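(* Let $f$ be a proper convex function on $\mathbb{R}^n$ and $g$ a proper convex function on $\mathbb{R}^m$, and let $x^\star\in\mathbb{R}^n$, $v^\star\in\mathbb{R}^m$. Assume that the tangent cones $\mathcal{T}_f(x^\star)$ and $\mathcal{T}_g(v^\star)$ are non-empty and closed, and that the subdifferentials $\partial f(x^\star)$ and $\partial g(v^\star)$ do not contain the origin. Let $$\mathscr{C}_p=\omega^2\left(\mathcal{T}_f(x^\star)\cap\mathbb{S}^{n-1}\right)+\omega^2\left(\mathcal{T}_g(v^\star)\cap\mathbb{S}^{m-1}\right)$$ and, for $\lambda>0$, $$\mathscr{C}_p(\lambda)=\min_{\alpha\le t\le\beta}\ 2\cdot\zeta\left(\frac{\sqrt{m}}{\lambda t}\partial f(x^\star)\right)+\eta^2\left(\frac{1}{t}\partial g(v^\star)\cap\mathbb{S}^{m-1}\right)-1,$$ where $\alpha=\min_{b\in\partial g(v^\star)}\|b\|_2$ and $\beta=\max_{b\in\partial g(v^\star)}\|b\|_2$. If $\lambda>0$ and $m\ge\mathscr{C}_p(\lambda)$, then $$m\ge\mathscr{C}_p-1.$$ On the other hand, if $m\ge\mathscr{C}_p$, then one can choose the tradeoff parameter as $$\lambda^\star=\arg\min_{\lambda>0}\mathscr{C}_p(\lambda)$$ such that $$m\ge\mathscr{C}_p(\lambda^\star)-5;$$ if in this case one further has $\omega(\mathcal{T}_f(x^\star)\cap\mathbb{S}^{n-1})\ge4$, then $m\ge\mathscr{C}_p(\lambda^\star)-1$.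
   Context: The tangent cone of a convex function $f$ at $x$ is $\mathcal{T}_f(x)=\{u: f(x+t u)\le f(x)\text{ for some }t>0\}$. The subdifferential of $f$ at $x\in\mathbb{R}^n$ is $\partial f(x)=\{u\in\mathbb{R}^n: f(x+d)-f(x)\ge\langle u,d\rangle\text{ for all }d\in\mathbb{R}^n\}$; it is non-empty, compact and convex when $x$ is in the interior of the domain of $f$. For $c\ge0$, $c\,\partial f(x)=\{c\,u:u\in\partial f(x)\}$, and $\frac1t\partial g(v^\star)\cap\mathbb{S}^{m-1}$ means $\left(\frac1t\partial g(v^\star)\right)\cap\mathbb{S}^{m-1}$. $\mathbb{S}^{d-1}$ is the $\ell_2$ unit sphere of $\mathbb{R}^d$. For $\mathcal{S}\subset\mathbb{R}^d$ and $g\sim N(0,I_d)$: the Gaussian width is $\omega(\mathcal{S})=\mathbb{E}\sup_{x\in\mathcal{S}}\langle g,x\rangle$ (and $\omega^2(\mathcal{S})=(\omega(\mathcal{S}))^2$); with $\operatorname{dist}(x,\mathcal{S})=\inf_{y\in\mathcal{S}}\|x-y\|_2$, the Gaussian distance is $\zeta(\mathcal{S})=\mathbb{E}\operatorname{dist}(g,\mathcal{S})$ and the Gaussian squared distance is $\eta^2(\mathcal{S})=\mathbb{E}\operatorname{dist}^2(g,\mathcal{S})$. The minimum over $t$ in the definition of $\mathscr{C}_p(\lambda)$ is of the whole expression $2\zeta(\cdot)+\eta^2(\cdot)-1$.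
   Formalization: The argmin over λ>0 need not exist (f, g affine), so the bounds are proved for every minimizer and for the infimum over λ>0; existence of λ* is proved only when ∂f(x* ) is compact and not a single point, and ∂f(x* ) is assumed non-empty. *)

(* Defs.v *)
From HB Require Import structures.
From mathcomp Require Import all_boot all_order all_algebra.
From mathcomp Require Import all_classical all_reals all_analysis.

Set Implicit Arguments.
Unset Strict Implicit.
Unset Printing Implicit Defensive.

Import Order.TTheory GRing.Theory Num.Theory.
Import numFieldNormedType.Exports.

Local Open Scope classical_set_scope.
Local Open Scope ring_scope.

Section euclidean.
Context {R : realType} {d : nat}.
Implicit Types (x y u : 'rV[R]_d) (A : set 'rV[R]_d).

Definition dotv x y : R := \sum_(i < d) x ord0 i * y ord0 i.

(* The library norm on matrices is the sup norm. *)
Definition l2norm x : R := Num.sqrt (dotv x x).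

Definition l2sphere : set 'rV[R]_d := [set x | l2norm x = 1].

Definition scale_set (c : R) A : set 'rV[R]_d := [set c *: u | u in A].

End euclidean.

Section convex_analysis.
Context {R : realType} {d : nat}.
Implicit Types (f : 'rV[R]_d -> \bar R) (x : 'rV[R]_d).

Definition proper_fun f : Prop :=
  (forall x, f x != -oo%E) /\ (exists x, f x != +oo%E).

(* Since 0 * +oo = 0 in \bar R, the endpoints t = 0 and t = 1 are harmless. *)
Definition convex_efun f : Prop :=
  forall (x y : 'rV[R]_d) (t : R), 0 <= t <= 1 ->
    (f ((1 - t) *: x + t *: y)%R <= (1 - t)%:E * f x + t%:E * f y)%E.

Definition tangent_cone f x : set 'rV[R]_d :=
  [set u | exists2 t : R, 0 < t & (f (x + t *: u)%R <= f x)%E].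

(* For f x = +oo the difference is -oo, so the subdifferential of a function
   is empty outside of its domain. *)
Definition subdiff f x : set 'rV[R]_d :=
  [set u | forall h, ((dotv u h)%:E <= f (x + h)%R - f x)%E].

End convex_analysis.

Section gaussian.
Context {R : realType}.

Definition cons_pair (d : nat)
    (p : measurableTypeR R * d.-tuple (measurableTypeR R)) :
    d.+1.-tuple (measurableTypeR R) :=
  [tuple of p.1 :: p.2].

Lemma measurable_cons_pair d : measurable_fun setT (@cons_pair d).
Proof. exact: (measurable_cons measurable_fst measurable_snd). Qed.

HB.instance Definition _ d :=
  isMeasurableFun.Build _ _ _ _ (@cons_pair d) (@measurable_cons_pair d).

(* The d-fold product of N(0,1), that is N(0, I_d), on d-tuples: the library
   has the product sigma-algebra on tuples, but none on row vectors. *)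
Fixpoint std_gaussian (d : nat) : probability (d.-tuple (measurableTypeR R)) R :=
  match d with
  | 0 => \d_([tuple] : 0.-tuple (measurableTypeR R))
  | d'.+1 =>
      distribution (normal_prob (0 : R) 1 \x std_gaussian d')%E (@cons_pair d')
  end.

Definition vec_of_tuple (d : nat) (w : d.-tuple R) : 'rV[R]_d :=
  \row_i tnth w i.

Local Open Scope ereal_scope.

(* Suprema, infima and expectations are taken in \bar R, so that no value has
   to be made up for empty or unbounded sets. *)
Definition gaussian_width (d : nat) (S : set 'rV[R]_d) : \bar R :=
  \int[std_gaussian d]_w
    ereal_sup [set (dotv (vec_of_tuple w) x)%:E | x in S].

Definition dist_to (d : nat) (x : 'rV[R]_d) (S : set 'rV[R]_d) : \bar R :=
  ereal_inf [set (l2norm (x - y)%R)%:E | y in S].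

Definition gaussian_dist (d : nat) (S : set 'rV[R]_d) : \bar R :=
  \int[std_gaussian d]_w dist_to (vec_of_tuple w) S.

Definition gaussian_sqdist (d : nat) (S : set 'rV[R]_d) : \bar R :=
  \int[std_gaussian d]_w (dist_to (vec_of_tuple w) S) ^+ 2.

End gaussian.

Definition is_minimum {R : realType} (A : set R) (a : R) : Prop :=
  A a /\ lbound A a.

Definition is_maximum {R : realType} (A : set R) (b : R) : Prop :=
  A b /\ ubound A b.

Definition is_argmin {R : realType} (D : set R) (F : R -> \bar R) (a : R) :
    Prop :=
  D a /\ forall b, D b -> (F a <= F b)%E.

Section thresholds.
Context {R : realType} {n m : nat}.
Variables (f : 'rV[R]_n -> \bar R) (g : 'rV[R]_m -> \bar R).
Variables (x : 'rV[R]_n) (v : 'rV[R]_m).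
Local Open Scope ereal_scope.

Definition Cp : \bar R :=
  gaussian_width (tangent_cone f x `&` l2sphere) ^+ 2 +
  gaussian_width (tangent_cone g v `&` l2sphere) ^+ 2.

Definition Cp_objective (lambda t : R) : \bar R :=
  2%:E *
    gaussian_dist (scale_set (Num.sqrt m%:R / (lambda * t))%R (subdiff f x)) +
  gaussian_sqdist (scale_set t^-1%R (subdiff g v) `&` l2sphere) - 1.

(* alpha and beta are meant to be the least and the largest Euclidean norm of
   an element of subdiff g v. *)
Definition Cp_pen (alpha beta lambda : R) : \bar R :=
  ereal_inf [set Cp_objective lambda t | t in `[alpha, beta]].

End thresholds.

(* Main.v *)
(* Under the hypotheses each tangent cone T is the polar cone of the subdifferential D.
   For the lower bound, the supremum of <g, .> over the unit vectors of T is at most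
   dist(g, c D), so w_f <= zeta(c df), while the orthogonal decomposition of g along a
   cone and its polar gives w_g^2 + (E sup over a slice of cone(dg))^2 <= m.

   For the upper bound, lambda enters only through c = sqrt m / (lambda t), so c and t
   can be chosen separately. Let <P, g - P> be the gap of the projection P of g on c df.
   When it vanishes, dist(g, c df) is the supremum over T_f; in general the square root of
   the difference of the squares is Lipschitz, and remains so once given the sign of the
   gap. Choosing c such that this signed root has mean almost zero, the Gaussian Poincare
   inequality bounds the mean difference of the squares by 1. The slices of cone(dg) by the
   sphere are treated in the same way in t. The sharper bound divides the root by a
   weight, uses a fourth moment bound, and improves the Poincare bound for the support
   function of a spherical set by its second Hermite component.

   The Poincare inequality comes from the correlations of f(x) and f(r x + s y) with
   r^2 + s^2 = 1: c(r)^2 <= c(1) c(r^2) and a linear bound as r tends to 1. *)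
Require Import Defs.
From HB Require Import structures.
From mathcomp Require Import all_boot all_order all_algebra.
From mathcomp Require Import all_classical all_reals all_analysis.
From mathcomp Require Import measurable_realfun.
From mathcomp Require Import ring lra.
Set Implicit Arguments.
Unset Strict Implicit.
Unset Printing Implicit Defensive.
Import Order.TTheory GRing.Theory Num.Theory.
Import numFieldNormedType.Exports.
Local Open Scope classical_set_scope.
Local Open Scope ring_scope.

(** For unit [z], [|h - z|^2 = |h|^2 + 1 - 2 <z, h>], so the objective equals [2 F(c) + m - 2 B(t)],
    with [F] a mean distance and [B] the mean support function of a slice: the constants 5 and 1
    become [F - B <= 5/2] and [F - B <= 1/2]. The root of a defect is Lipschitz because a squared
    distance is an infimum and the squared positive part of a support function a supremum: freezing
    the optimizers of [h] bounds the defect at [g] by [(sqrt (defect h) + |g - h|)^2]. Its Poincare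
    bound involves the square of the mean, which is why a sign is needed. None of these functions is
    known to be differentiable. The Poincare inequality therefore asks only for quadratic upper
    bounds on increments: in an exchangeable Gaussian pair the positive part of an increment carries
    half of the energy. Moreau envelopes supply such bounds for Lipschitz functions. Only four
    moments are used, hence the growth classes [gro] and the limits by Fatou. In the sharper bound
    the margin is thin: at width 4 the last inequality holds by less than 1/500, thanks to the
    factor [1 - 1/(2m)]. *)

Section shift_invariant.
Context {R : realType}.
Local Open Scope ereal_scope.
Local Notation RR := (measurableTypeR R).

Lemma measurable_fun_lin2 d (T : measurableType d) (a b : R) (f g : T -> RR) :
  measurable_fun setT f -> measurable_fun setT g ->
  measurable_fun setT (fun x => (a * f x + b * g x)%R : RR).
Proof.
move=> mf mg; apply: (@measurable_funD _ _ R) => //;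
  by apply: (@measurable_funM _ _ R).
Qed.

Lemma measurable_fun_lin2_pair (a b c e : R) :
  measurable_fun setT (fun z : RR * RR =>
    ((a * z.1 + b * z.2)%R : RR, (c * z.1 + e * z.2)%R : RR)).
Proof.
by apply/measurable_fun_pair => /=; apply: measurable_fun_lin2.
Qed.

Variable mu : {sigma_finite_measure set RR -> \bar R}.
Hypothesis mu_shift : forall (t : R) (f : RR -> \bar R), measurable_fun setT f ->
  (forall x, 0 <= f x) -> \int[mu]_x f (x + t)%R = \int[mu]_x f x.

Lemma integral_shear1 (t : R) (K : RR * RR -> \bar R) :
  measurable_fun setT K -> (forall z, 0 <= K z) ->
  \int[mu]_x \int[mu]_y K ((x + t * y)%R, y) = \int[mu]_x \int[mu]_y K (x, y).
Proof.
move=> mK K0.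
have mK1 : measurable_fun setT (fun z : RR * RR => K ((z.1 + t * z.2)%R, z.2)).
  apply: (measurableT_comp mK).
  have := measurable_fun_lin2_pair 1 t 0 1.
  by under eq_fun do rewrite !mul1r mul0r add0r.
pose K1 := fun z : RR * RR => K ((z.1 + t * z.2)%R, z.2).
transitivity (\int[mu]_y \int[mu]_x K1 (x, y)).
  by apply: (@fubini_tonelli _ _ RR RR R mu mu K1) => // z; exact: K0.
transitivity (\int[mu]_y \int[mu]_x K (x, y)); last first.
  by apply/esym; apply: (@fubini_tonelli _ _ RR RR R mu mu K).
apply: eq_integral => y _.
apply: (@mu_shift (t * y)%R (fun x => K (x, y))) => //.
exact: measurableT_comp.
Qed.

Lemma integral_shear2 (t : R) (K : RR * RR -> \bar R) :
  measurable_fun setT K -> (forall z, 0 <= K z) ->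
  \int[mu]_x \int[mu]_y K (x, (y + t * x)%R) = \int[mu]_x \int[mu]_y K (x, y).
Proof.
move=> mK K0; apply: eq_integral => x _.
apply: (@mu_shift (t * x)%R (fun y => K (x, y))) => //.
exact: measurableT_comp.
Qed.

(** A plane rotation is a product of three shears of parameters [a], [- s] and [a], where [a] is the
    tangent of half the angle. Each shear moves one coordinate by a multiple of the other, so by
    Fubini it is a translation on every line. The denominator of [a] excludes the multiples of the
    half turn. *)
Lemma integral_shift_inv_rotation (c s : R) (K : RR * RR -> \bar R) :
  (c ^+ 2 + s ^+ 2 = 1)%R -> s != 0%R ->
  measurable_fun setT K -> (forall z, 0 <= K z) ->
  \int[mu]_x \int[mu]_y K ((c * x + s * y)%R, (- s * x + c * y)%R) =
  \int[mu]_x \int[mu]_y K (x, y).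
Proof.
move=> cs s0 mK K0; pose a := ((1 - c) / s)%R.
have as1 : (a * s = 1 - c)%R by rewrite /a divfK.
pose K1 := fun z : RR * RR => K ((z.1 + a * z.2)%R, z.2).
pose K2 := fun z : RR * RR => K1 (z.1, (z.2 + (- s) * z.1)%R).
have mK1 : measurable_fun setT K1.
  apply: (measurableT_comp mK).
  have := measurable_fun_lin2_pair 1 a 0 1.
  by under eq_fun do rewrite !mul1r mul0r add0r.
have mK2 : measurable_fun setT K2.
  apply: (measurableT_comp mK1).
  have := measurable_fun_lin2_pair 1 0 (- s) 1.
  by under eq_fun do rewrite !mul1r mul0r addr0 addrC.
transitivity (\int[mu]_x \int[mu]_y K2 ((x + a * y)%R, y)); last first.
  transitivity (\int[mu]_x \int[mu]_y K2 (x, y)).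
    by apply: integral_shear1 => // z; exact: K0.
  transitivity (\int[mu]_x \int[mu]_y K1 (x, y)).
    by apply: (@integral_shear2 (- s)%R K1) => // z; exact: K0.
  exact: integral_shear1.
apply: eq_integral => x _; apply: eq_integral => y _; rewrite /K2 /K1 /=.
have e2 : (s * s = 1 - c * c)%R by rewrite -!expr2 -cs; ring.
congr (K (_, _)); last first.
  have -> : (y + - s * (x + a * y) = y - s * x - (a * s) * y)%R by ring.
  by rewrite as1; ring.
apply/eqP; rewrite -(inj_eq (mulfI s0)); apply/eqP.
have -> : (s * (x + a * y + a * (y + - s * (x + a * y))) =
  s * x + (a * s) * (y + y) - (a * s) * (s * x) - (a * s) * (a * s) * y)%R by ring.
have -> : (s * (c * x + s * y) = c * s * x + (s * s) * y)%R by ring.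
by rewrite as1 e2; ring.
Qed.

End shift_invariant.

(** * Density of the standard normal law and its invariance under plane rotations *)

Section normal_law.
Context {R : realType}.
Local Open Scope ereal_scope.
Local Notation leb := (@lebesgue_measure R).
Local Notation N01 := (normal_prob (0 : R) 1).
Local Notation pdf := (normal_pdf (0 : R) 1).

(** Translations preserve the length of half-open intervals, and Lebesgue measure is determined by
    these lengths. *)
Lemma integral_lebesgue_shift (t : R) (f : measurableTypeR R -> \bar R) :
  measurable_fun setT f -> (forall x, 0 <= f x) ->
  \int[leb]_x f (x + t)%R = \int[leb]_x f x.
Proof.
move=> mf f0.
pose phi := (fun x : R => (x + t)%R) : measurableTypeR R -> measurableTypeR R.
have mphi : measurable_fun setT phi by exact: measurable_funD.
have -> : \int[leb]_x f (x + t)%R = \int[pushforward leb phi]_x f x.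
  by rewrite ge0_integral_pushforward.
apply: eq_measure_integral => /= A mA _; apply/esym.
pose mphi_mixin := isMeasurableFun.Build _ _ _ _ _ mphi.
pose mphi_pack : {mfun _ >-> _} := HB.pack phi mphi_mixin.
rewrite (@lebesgue_measure_unique R (pushforward leb mphi_pack))//.
move=> _ [[a b]] _ <-; rewrite /pushforward/=.
have E : phi @^-1` `]a, b] = `](a - t)%R, (b - t)%R]%classic.
  by apply/seteqP; split => x /=; rewrite !in_itv/= ltrBlDr lerBrDr.
transitivity (lebesgue_measure `](a - t)%R, (b - t)%R]%classic); last first.
  by congr (lebesgue_measure _); rewrite -E.
rewrite !lebesgue_measure_itv/= !lte_fin ltrD2r.
by case: ifP => // _; rewrite -!EFinD; congr EFin; ring.
Qed.

Local Notation RR := (measurableTypeR R).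

Import HBNNSimple.

(** [normal_prob] integrates the density over a set, so the claim is immediate for indicators only;
    simple functions and monotone convergence carry it to nonnegative measurable functions. *)
Lemma integral_normal_density (f : measurableTypeR R -> \bar R) :
  measurable_fun setT f -> (forall x, 0 <= f x) ->
  \int[N01]_x f x = \int[leb]_x (f x * (pdf x)%:E).
Proof.
move=> mf f0.
have mp : measurable_fun [set: measurableTypeR R] (EFin \o pdf).
  by apply/measurable_EFinP; exact: measurable_normal_pdf.
have p0 x : 0 <= (pdf x)%:E by rewrite lee_fin normal_pdf_ge0.
pose f_ := nnsfun_approx measurableT mf.
transitivity (limn (fun n => \int[N01]_x (f_ n x)%:E)).
  rewrite -monotone_convergence//.
  - apply: eq_integral => y _; apply/esym/cvg_lim => //.
    by apply: cvg_nnsfun_approx=> // *; apply: f0.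
  - by move=> n; apply/measurable_EFinP; exact: measurable_funP.
  - by move=> n y _; rewrite lee_fin.
  - by move=> y _ m n mn; rewrite lee_fin; exact/lefP/nd_nnsfun_approx.
transitivity (limn (fun n => \int[leb]_x ((f_ n x)%:E * (pdf x)%:E))); last first.
  rewrite -monotone_convergence//.
  - apply: eq_integral => y _; apply/cvg_lim => //.
    apply: cvgeZr => //; by apply: cvg_nnsfun_approx=> // *; apply: f0.
  - move=> n; apply: emeasurable_funM => //.
    by apply/measurable_EFinP; exact: measurable_funP.
  - by move=> n y _; rewrite mule_ge0// lee_fin.
  - move=> y _ m n mn; apply: lee_wpmul2r => //.
    by rewrite lee_fin; exact/lefP/nd_nnsfun_approx.
congr (limn _); apply/funext => n.
under eq_integral do rewrite fimfunE -fsumEFin//.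
rewrite ge0_integral_fsum//; last 2 first.
- by move=> y; apply/measurable_EFinP; apply: measurable_funM => //; exact: measurable_indic.
- by move=> y x _; rewrite nnfun_muleindic_ge0.
under [RHS]eq_integral => x _.
  rewrite fimfunE -fsumEFin// ge0_mule_fsuml; last by move=> *; rewrite nnfun_muleindic_ge0.
  over.

rewrite ge0_integral_fsum//; last 2 first.
- move=> y; apply: emeasurable_funM => //.
  by apply/measurable_EFinP; apply: measurable_funM => //; exact: measurable_indic.
- by move=> y x _; rewrite mule_ge0// nnfun_muleindic_ge0.
apply: eq_fsbigr => r rf; rewrite integralZl_indic_nnsfun//= integral_indic//= setIT.
under eq_integral do rewrite EFinM -muleA.
have r0 : (0 <= r)%R by move: rf; rewrite inE => -[x _ <-].
rewrite ge0_integralZl//; last 2 first.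
- by apply: emeasurable_funM => //; apply/measurable_EFinP.
- by move=> x _; rewrite mule_ge0// lee_fin.
congr (_ * _); rewrite /normal_prob [LHS]integral_mkcond.
apply: eq_integral => x _; rewrite patchE indicE.
by case: ifP => _; rewrite ?mul1e ?mul0e.
Qed.

Lemma integral_normal_density2 (H : RR * RR -> \bar R) :
  measurable_fun setT H -> (forall z, 0 <= H z) ->
  \int[N01]_x \int[N01]_y H (x, y) =
  \int[leb]_x \int[leb]_y (H (x, y) * (pdf x * pdf y)%:E).
Proof.
move=> mH H0.
have mF : measurable_fun setT (fun x => \int[N01]_y H (x, y)).
  exact: (@measurable_fun_fubini_tonelli_F _ _ _ _ _ N01 H).
have mp : measurable_fun [set: RR] (EFin \o pdf).
  by apply/measurable_EFinP; exact: measurable_normal_pdf.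
have p0 x : 0 <= (pdf x)%:E by rewrite lee_fin normal_pdf_ge0.
transitivity (\int[leb]_x ((\int[N01]_y H (x, y)) * (pdf x)%:E)).
  by apply: integral_normal_density => // x; exact: integral_ge0.
apply: eq_integral => x _.
have mHx : measurable_fun setT (fun y => H (x, y)) by exact: measurableT_comp.
transitivity ((\int[leb]_y (H (x, y) * (pdf y)%:E)) * (pdf x)%:E).
  by congr (_ * _); apply: integral_normal_density.
transitivity (\int[leb]_y (H (x, y) * (pdf y)%:E * (pdf x)%:E)).
  apply/esym; apply: (@ge0_integralZr _ RR R leb setT _ (fun y => H (x, y) * (pdf y)%:E)) => //.
  - exact: emeasurable_funM.
  - by move=> y _; rewrite mule_ge0.
by apply: eq_integral => y _; rewrite -muleA -EFinM [X in (_ * X%:E)%E]mulrC.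
Qed.

Lemma normal_pdf_rotation (c s x y : R) : (c ^+ 2 + s ^+ 2 = 1)%R ->
  (pdf (c * x + s * y) * pdf (- s * x + c * y) = pdf x * pdf y)%R.
Proof.
move=> cs; rewrite normal_pdfE ?oner_neq0// /normal_fun.
rewrite [LHS]mulrACA [RHS]mulrACA -!expRD; congr (_ * expR _)%R.
rewrite !subr0 -!mulrDl; congr (_ / _)%R.
have -> : (- (c * x + s * y) ^+ 2 + - (- s * x + c * y) ^+ 2 =
  - ((c ^+ 2 + s ^+ 2) * (x ^+ 2 + y ^+ 2)))%R by ring.
by rewrite cs; ring.
Qed.

(** The joint density depends on [x^2 + y^2] only, so it can be absorbed into the integrand before
    rotating with respect to Lebesgue measure. *)
Let normal_rotation_neq0 (c s : R) (H : RR * RR -> \bar R) :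
  (c ^+ 2 + s ^+ 2 = 1)%R -> s != 0%R ->
  measurable_fun setT H -> (forall z, 0 <= H z) ->
  \int[N01]_x \int[N01]_y H ((c * x + s * y)%R, (- s * x + c * y)%R) =
  \int[N01]_x \int[N01]_y H (x, y).
Proof.
move=> cs s0 mH H0.
pose K := fun z : RR * RR => H z * (pdf z.1 * pdf z.2)%:E.
have mK : measurable_fun setT K.
  apply: (@emeasurable_funM _ _ R _ H) => //.
  apply/measurable_EFinP; apply: (@measurable_funM _ _ R).
    by apply: (measurableT_comp (@measurable_normal_pdf R 0 1)).
  by apply: (measurableT_comp (@measurable_normal_pdf R 0 1)).
have K0 z : 0 <= K z by rewrite mule_ge0// lee_fin mulr_ge0// normal_pdf_ge0.
pose H' := fun z : RR * RR => H ((c * z.1 + s * z.2)%R, (- s * z.1 + c * z.2)%R).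
have mH' : measurable_fun setT H'.
  by apply: (measurableT_comp mH); exact: measurable_fun_lin2_pair.
transitivity (\int[leb]_x \int[leb]_y (H' (x, y) * (pdf x * pdf y)%:E)).
  by apply: integral_normal_density2 => // z; exact: H0.
transitivity (\int[leb]_x \int[leb]_y K (x, y)); last first.
  by apply/esym; exact: integral_normal_density2.
transitivity (\int[leb]_x \int[leb]_y K ((c * x + s * y)%R, (- s * x + c * y)%R)).
  by apply: eq_integral => x _; apply: eq_integral => y _; rewrite /K /H' /= normal_pdf_rotation.
exact: (integral_shift_inv_rotation integral_lebesgue_shift cs s0 mK K0).
Qed.

Lemma normal_rotation (c s : R) (H : RR * RR -> \bar R) :
  (c ^+ 2 + s ^+ 2 = 1)%R -> measurable_fun setT H -> (forall z, 0 <= H z) ->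
  \int[N01]_x \int[N01]_y H ((c * x + s * y)%R, (- s * x + c * y)%R) =
  \int[N01]_x \int[N01]_y H (x, y).
Proof.
move=> cs mH H0; have [s0|s0] := eqVneq s 0%R; last exact: normal_rotation_neq0.
have q : (0 ^+ 2 + 1 ^+ 2 = 1 :> R)%R by rewrite expr0n expr1n add0r.
(* a rotation by a multiple of the half turn is twice a quarter turn composed with it *)
have q' : (s ^+ 2 + (- c) ^+ 2 = 1)%R by rewrite sqrrN addrC.
have c0 : (- c)%R != 0%R.
  by apply/eqP => /eqP; rewrite oppr_eq0 => /eqP c0; move: cs; rewrite s0 c0 expr0n/= addr0 => /esym/eqP; rewrite oner_eq0.
pose H' := fun z : RR * RR => H ((0 * z.1 + 1 * z.2)%R, (- 1 * z.1 + 0 * z.2)%R).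
have mH' : measurable_fun setT H'.
  by apply: (measurableT_comp mH); exact: measurable_fun_lin2_pair.
transitivity (\int[N01]_x \int[N01]_y H' (x, y)); last first.
  exact: (normal_rotation_neq0 q (oner_neq0 _) mH H0).
transitivity (\int[N01]_x \int[N01]_y H' ((s * x + - c * y)%R, (- - c * x + s * y)%R)); last first.
  by apply: (normal_rotation_neq0 q' c0 mH') => z; exact: H0.
apply: eq_integral => x _; apply: eq_integral => y _ /=.
by rewrite /H' /=; congr (H (_, _)); ring.
Qed.

End normal_law.

(** * Euclidean geometry of row vectors and Lipschitz functions *)

Section euclidean_space.
Context {R : realType} {d : nat}.
Implicit Types (x y z u v : 'rV[R]_d) (a b : R).

Lemma dotvC x y : dotv x y = dotv y x.
Proof. by apply: eq_bigr => i _; rewrite mulrC. Qed.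

Lemma dotvDl x y z : dotv (x + y) z = dotv x z + dotv y z.
Proof. by rewrite -big_split; apply: eq_bigr => i _; rewrite mxE mulrDl. Qed.

Lemma dotvZl a x y : dotv (a *: x) y = a * dotv x y.
Proof. by rewrite /dotv big_distrr; apply: eq_bigr => i _; rewrite /= mxE mulrA. Qed.

Lemma dotvDr x y z : dotv z (x + y) = dotv z x + dotv z y.
Proof. by rewrite dotvC dotvDl !(dotvC z). Qed.

Lemma dotvZr a x y : dotv x (a *: y) = a * dotv x y.
Proof. by rewrite dotvC dotvZl dotvC. Qed.

Lemma dotvNl x y : dotv (- x) y = - dotv x y.
Proof. by rewrite -scaleN1r dotvZl mulN1r. Qed.

Lemma dotvNr x y : dotv x (- y) = - dotv x y.
Proof. by rewrite dotvC dotvNl dotvC. Qed.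

Lemma dotvBl x y z : dotv (x - y) z = dotv x z - dotv y z.
Proof. by rewrite dotvDl dotvNl. Qed.

Lemma dotvBr x y z : dotv z (x - y) = dotv z x - dotv z y.
Proof. by rewrite dotvDr dotvNr. Qed.

Lemma dot0v x : dotv 0 x = 0.
Proof. by rewrite -(scale0r 0) dotvZl mul0r. Qed.

Lemma dotv0 x : dotv x 0 = 0.
Proof. by rewrite dotvC dot0v. Qed.

Lemma dotvv_ge0 x : 0 <= dotv x x.
Proof. by apply: sumr_ge0 => i _; rewrite -expr2 sqr_ge0. Qed.

Lemma l2norm_ge0 x : 0 <= l2norm x. Proof. exact: sqrtr_ge0. Qed.

Lemma sqr_l2norm x : l2norm x ^+ 2 = dotv x x.
Proof. by rewrite sqr_sqrtr ?dotvv_ge0. Qed.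

Lemma coord_le_l2norm x i : `|x ord0 i| <= l2norm x.
Proof.
rewrite -sqrtr_sqr ler_wsqrtr// /dotv (bigD1 i)//= -expr2 lerDl.
by apply: sumr_ge0 => j _; rewrite -expr2 sqr_ge0.
Qed.

Lemma l2norm0 : l2norm (0 : 'rV[R]_d) = 0.
Proof. by rewrite /l2norm dotv0 sqrtr0. Qed.

Lemma l2norm_eq0 x : l2norm x = 0 -> x = 0.
Proof.
move=> x0; apply/rowP => i; rewrite mxE; apply/eqP; rewrite -normr_eq0.
by rewrite eq_le normr_ge0 andbT -x0 coord_le_l2norm.
Qed.

Lemma l2norm_gt0 x : x != 0 -> 0 < l2norm x.
Proof.
move=> x0; rewrite lt_neqAle l2norm_ge0 andbT eq_sym.
by apply/eqP => /l2norm_eq0/eqP; rewrite (negbTE x0).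
Qed.

Lemma l2normZ a x : l2norm (a *: x) = `|a| * l2norm x.
Proof. by rewrite /l2norm dotvZl dotvZr mulrA -expr2 sqrtrM ?sqr_ge0// sqrtr_sqr. Qed.

Lemma l2normN x : l2norm (- x) = l2norm x.
Proof. by rewrite -scaleN1r l2normZ normrN1 mul1r. Qed.

Lemma l2normB x y : l2norm (x - y) = l2norm (y - x).
Proof. by rewrite -opprB l2normN. Qed.

Lemma sqr_l2normD x y :
  l2norm (x + y) ^+ 2 = l2norm x ^+ 2 + dotv x y *+ 2 + l2norm y ^+ 2.
Proof. by rewrite !sqr_l2norm dotvDl !dotvDr (dotvC y x); ring. Qed.

Lemma sqr_l2normB x y :
  l2norm (x - y) ^+ 2 = l2norm x ^+ 2 - dotv x y *+ 2 + l2norm y ^+ 2.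
Proof. by rewrite !sqr_l2norm dotvBl !dotvBr (dotvC y x); ring. Qed.

Lemma cauchy_schwarz x y : dotv x y <= l2norm x * l2norm y.
Proof.
have [->|y0] := eqVneq y 0; first by rewrite dotv0 l2norm0 mulr0.
have ny := l2norm_gt0 y0.
have := sqr_ge0 (l2norm (l2norm y *: x - l2norm x *: y)).
rewrite sqr_l2normB !l2normZ !ger0_norm ?l2norm_ge0// dotvZl dotvZr.
have [->|x0] := eqVneq x 0; first by move=> _; rewrite dot0v l2norm0 mul0r.
have nx := l2norm_gt0 x0.
move: (l2norm x) (l2norm y) nx ny => p q p0 q0.
have -> : (q * p) ^+ 2 - q * (p * dotv x y) *+ 2 + (p * q) ^+ 2 =
   (p * q * 2) * (p * q - dotv x y) by ring.
by rewrite pmulr_rge0 ?subr_ge0// !mulr_gt0.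
Qed.

Lemma cauchy_schwarz_abs x y : `|dotv x y| <= l2norm x * l2norm y.
Proof.
rewrite ler_norml cauchy_schwarz andbT lerNl -dotvNl -(l2normN x).
exact: cauchy_schwarz.
Qed.

Lemma l2normD x y : l2norm (x + y) <= l2norm x + l2norm y.
Proof.
rewrite -ler_sqr ?nnegrE ?addr_ge0 ?l2norm_ge0// sqr_l2normD sqrrD.
by rewrite lerD2r lerD2l lerMn2r cauchy_schwarz.
Qed.

Lemma l2norm_lip x y : `|l2norm x - l2norm y| <= l2norm (x - y).
Proof.
rewrite ler_norml; apply/andP; split.
  by rewrite lerNl opprB lerBlDl l2normB -{1}(subrK x y) addrC; exact: l2normD.
by rewrite lerBlDl addrC -{1}(subrK y x); exact: l2normD.
Qed.

Lemma mxnorm_le_l2norm x : `|x| <= l2norm x.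
Proof.
rewrite -[`|x|]/(mx_norm x) mx_normrE; apply: bigmax_le; first exact: l2norm_ge0.
by move=> [i j] _; rewrite ord1; exact: coord_le_l2norm.
Qed.

(** The factor [d] instead of its square root is enough: the bound serves to compare the Euclidean
    topology with that of the sup norm. *)
Lemma l2norm_le_coord x r : 0 <= r -> (forall i, `|x ord0 i| <= r) ->
  l2norm x <= d%:R * r.
Proof.
move=> r0 xr; have [d0|d0] := posnP d.
  suff -> : x = 0 by rewrite l2norm0 mulr_ge0.
  by apply/rowP => i; move: (ltn_ord i); rewrite {2}d0.
rewrite -ler_sqr ?nnegrE ?l2norm_ge0 ?mulr_ge0// sqr_l2norm.
apply: (@le_trans _ _ (\sum_(i < d) r ^+ 2)).
  apply: ler_sum => i _; rewrite -expr2 -real_normK ?num_real//.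
  by rewrite ler_sqr ?nnegrE.
rewrite sumr_const card_ord -[_ *+ d]mulr_natl exprMn ler_wpM2r ?sqr_ge0//.
by rewrite -natrX ler_nat -{1}(expn1 d) leq_pexp2l.
Qed.

Definition lip (L : R) (f : 'rV[R]_d -> R) := forall x y, `|f x - f y| <= L * l2norm (x - y).

Lemma lip_continuous L f : lip L f -> continuous f.
Proof.
move=> fL x; apply/(@cvgrPdist_le _ R^o _ (nbhs x)) => e e0.
(* Adding 1 to both factors keeps [D] positive for a constant function and in dimension 0. *)
apply/nbhs_ballP; pose D := (`|L| + 1) * (d%:R + 1).
have D0 : 0 < D by rewrite mulr_gt0// ltr_wpDl.
exists (e / D) => /=; first exact: divr_gt0.
move=> y xy; apply: (le_trans (fL x y)).
have eD0 : 0 <= e / D by rewrite ltW// divr_gt0.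
have xyD : l2norm (x - y) <= d%:R * (e / D).
  apply: l2norm_le_coord => // i; rewrite !mxE ltW//. by case: xy => _ /(_ ord0 i).
apply: (@le_trans _ _ ((`|L| + 1) * ((d%:R + 1) * (e / D)))).
  apply: (@le_trans _ _ ((`|L| + 1) * l2norm (x - y))).
    apply: ler_wpM2r; first exact: l2norm_ge0.
    by rewrite (le_trans (ler_norm _))// lerDl.
  apply: ler_wpM2l; first by rewrite addr_ge0.
  by rewrite (le_trans xyD)// ler_wpM2r// lerDl.
have -> : (`|L| + 1) * ((d%:R + 1) * (e / D)) = D * (e / D) by rewrite /D; ring.
by rewrite [X in X <= _]mulrC divfK// gt_eqF.
Qed.

Lemma l2norm_continuous : continuous (@l2norm R d).
Proof. by apply: (@lip_continuous 1) => x y; rewrite mul1r; exact: l2norm_lip. Qed.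

Lemma dotv_continuous x : continuous (dotv x).
Proof.
apply: (@lip_continuous (l2norm x)) => y z.
by rewrite -dotvBr; exact: cauchy_schwarz_abs.
Qed.

Lemma l2ball_bounded (A : set 'rV[R]_d) (M : R) :
  (forall x, A x -> l2norm x <= M) -> bounded_set A.
Proof.
move=> AM; exists M; split; first exact: num_real.
move=> r Mr x /AM xM.
apply: (le_trans (mxnorm_le_l2norm x)).
by rewrite (le_trans xM)// ltW.
Qed.

Lemma l2_closed_compact (A : set 'rV[R]_d) (M : R) :
  (forall x, A x -> l2norm x <= M) -> closed A -> compact A.
Proof. by move=> /l2ball_bounded bA cA; exact: bounded_closed_compact. Qed.

Lemma closed_le_fun (f g : 'rV[R]_d -> R) :
  continuous f -> continuous g -> closed [set x | f x <= g x].
Proof.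
move=> cf cg.
have -> : [set x | f x <= g x] = (fun x => g x - f x) @^-1` [set r | 0 <= r].
  by apply/seteqP; split => x /=; rewrite subr_ge0.
apply: preimage_closed; last exact: closed_ge.
by move=> x _; apply: (@cvgB _ R^o _ (nbhs x) _ g f); [exact: cg|exact: cf].
Qed.

(** Compactness is needed only below the level [f x0], where the last hypothesis bounds the norm; a
    minimum over that part of [A] is a minimum over [A]. *)
Lemma closed_min_attained (A : set 'rV[R]_d) (f : 'rV[R]_d -> R) (M : R) x0 :
  closed A -> A x0 -> continuous f ->
  (forall x, A x -> f x <= f x0 -> l2norm x <= M) ->
  exists2 y, A y & forall x, A x -> f y <= f x.
Proof.
move=> cA Ax0 cf fM; pose B := A `&` [set x | f x <= f x0].
have cB : compact B.
  apply: (@l2_closed_compact _ M); first by move=> x [Ax fx]; exact: fM.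
  by apply: closedI => //; apply: closed_le_fun => //; exact: cst_continuous.
have B0 : B !=set0 by exists x0; split => //=.
have [y] := EVT_min_rV B0 cB (continuous_subspaceT cf).
rewrite inE => -[Ay fy] ymin.
exists y => // x Ax; have [fx|/ltW fx] := leP (f x) (f x0).
  by apply: ymin; rewrite inE.
exact: le_trans fy fx.
Qed.

Lemma compact_max_attained (A : set 'rV[R]_d) (f : 'rV[R]_d -> R) :
  compact A -> A !=set0 -> continuous f ->
  exists2 y, A y & forall x, A x -> f x <= f y.
Proof.
move=> cA A0 cf.
have [y Ay ymax] := EVT_max_rV A0 cA (continuous_subspaceT cf).
exists y; first by move: Ay; rewrite inE.
by move=> x Ax; apply: ymax; rewrite inE.
Qed.

Lemma l2sphere_closed : closed (@l2sphere R d).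
Proof.
have -> : @l2sphere R d = [set x | l2norm x <= 1] `&` [set x | 1 <= l2norm x].
  apply/seteqP; split => x /=; rewrite /l2sphere /=; first by move=> ->.
  by move=> [x1 x2]; apply/eqP; rewrite eq_le x1 x2.
by apply: closedI; apply: closed_le_fun => //; (exact: l2norm_continuous || exact: cst_continuous).
Qed.

End euclidean_space.

(** * Rotation invariance and linear forms of the Gaussian vector *)

Section gaussian_vectors.
Context {R : realType}.
Local Open Scope ereal_scope.
Local Notation RR := (measurableTypeR R).
Local Notation N01 := (normal_prob (0 : R) 1).
Local Notation G := (@std_gaussian R).

Lemma integral_probability_cst d (T : measurableType d) (P : probability T R) (r : \bar R) :
  \int[P]_x r = r.
Proof.
by have := @integral_cst _ T R P setT measurableT r; rewrite /cst/= => ->; rewrite [P _]probability_setT mule1.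
Qed.

Lemma ge0_integral_gaussS d (F : d.+1.-tuple RR -> \bar R) :
  measurable_fun setT F -> (forall w, 0 <= F w) ->
  \int[G d.+1]_w F w = \int[N01]_a \int[G d]_w F (cons_pair (a, w)).
Proof.
move=> mF F0; rewrite /= ge0_integral_distribution//.
rewrite (fubini_tonelli1 (m1 := N01) (m2 := G d) (F \o @cons_pair R d))//.
- exact: (measurableT_comp mF (@measurable_cons_pair R d)).
- by move=> x; exact: F0.
Qed.

Definition lin2_tuple d (a b : R) (x y : d.-tuple RR) : d.-tuple RR :=
  [tuple (a * tnth x i + b * tnth y i)%R | i < d].

Lemma measurable_lin2_tuple d d' (T : measurableType d') a b (f g : T -> d.-tuple RR) :
  measurable_fun setT f -> measurable_fun setT g ->
  measurable_fun setT (fun z => lin2_tuple a b (f z) (g z)).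
Proof.
move=> mf mg; apply/measurable_fun_tnthP => i.
rewrite (_ : _ \o _ = fun z => (a * tnth (f z) i + b * tnth (g z) i)%R); last first.
  by apply/funext => z /=; rewrite tnth_mktuple.
by apply: measurable_fun_lin2; apply: (measurableT_comp (measurable_tnth i)).
Qed.

Lemma lin2_tuple_cons d a b u v (x y : d.-tuple RR) :
  lin2_tuple a b (cons_pair (u, x)) (cons_pair (v, y)) =
  cons_pair ((a * u + b * v)%R, lin2_tuple a b x y).
Proof.
apply: eq_from_tnth => i; rewrite tnth_mktuple.
have [j ->|->] := unliftP ord0 i; last by rewrite !tnth0.
by rewrite !tnthS tnth_mktuple.
Qed.

(** Induction on the dimension: the first coordinates of the two vectors rotate by the plane case,
    the remaining ones by the induction hypothesis with the first ones fixed. Fubini brings the two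
    first coordinates to the outside. *)
Lemma gauss_rotation d (c s : R) (H : d.-tuple RR * d.-tuple RR -> \bar R) :
  (c ^+ 2 + s ^+ 2 = 1)%R -> measurable_fun setT H -> (forall z, 0 <= H z) ->
  \int[G d]_x \int[G d]_y H (lin2_tuple c s x y, lin2_tuple (- s) c x y) =
  \int[G d]_x \int[G d]_y H (x, y).
Proof.
move=> cs; elim: d H => [|d IH] H mH H0.
  by apply: eq_integral => x _; apply: eq_integral => y _; congr (H (_, _)); apply: eq_from_tnth => -[].
have expand (K : d.+1.-tuple RR * d.+1.-tuple RR -> \bar R) :
    measurable_fun setT K -> (forall z, 0 <= K z) ->
    \int[G d.+1]_x \int[G d.+1]_y K (x, y) =
    \int[N01]_a \int[N01]_b \int[G d]_x \int[G d]_y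
      K (cons_pair (a, x), cons_pair (b, y)).
  move=> mK K0.
  have mKF : measurable_fun setT (fun x => \int[G d.+1]_y K (x, y)).
    exact: (measurable_fun_fubini_tonelli_F (m2 := G d.+1) K).
  rewrite ge0_integral_gaussS//; last by move=> x; exact: integral_ge0.
  apply: eq_integral => a _.
  transitivity (\int[G d]_x \int[N01]_b \int[G d]_y K (cons_pair (a, x), cons_pair (b, y))).
    apply: eq_integral => x _.
    apply: (@ge0_integral_gaussS d (fun y => K (cons_pair (a, x), y))) => //.
    exact: measurableT_comp.
  pose L := fun z : d.-tuple RR * RR => \int[G d]_y K (cons_pair (a, z.1), cons_pair (z.2, y)).
  apply: (@fubini_tonelli _ _ _ _ _ (G d) N01 L); first last.
    by move=> z; exact: integral_ge0.
  pose L' := fun z : (d.-tuple RR * RR) * d.-tuple RR => K (cons_pair (a, z.1.1), cons_pair (z.1.2, z.2)).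
  apply: (measurable_fun_fubini_tonelli_F (m2 := G d) L'); last by move=> z; exact: K0.
  apply: (measurableT_comp mK); apply/measurable_fun_pair => /=.
    apply: (measurableT_comp (@measurable_cons_pair R d)).
    apply/measurable_fun_pair => //=.
    by apply: (measurableT_comp (@measurable_fst _ _ _ _)).
  apply: (measurableT_comp (@measurable_cons_pair R d)).
  apply/measurable_fun_pair => //=.
  by apply: (measurableT_comp (@measurable_snd _ _ _ _)).
have mrot : measurable_fun setT
    (fun z : d.+1.-tuple RR * d.+1.-tuple RR => (lin2_tuple c s z.1 z.2, lin2_tuple (- s) c z.1 z.2)).
  by apply/measurable_fun_pair => /=; apply: measurable_lin2_tuple.
pose Hr := fun z => H (lin2_tuple c s z.1 z.2, lin2_tuple (- s) c z.1 z.2).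
have mHr : measurable_fun setT Hr by exact: (measurableT_comp mH mrot).
transitivity (\int[N01]_a \int[N01]_b \int[G d]_x \int[G d]_y
      Hr (cons_pair (a, x), cons_pair (b, y))).
  by apply: (expand Hr mHr) => z; exact: H0.
transitivity (\int[N01]_a \int[N01]_b \int[G d]_x \int[G d]_y
      H (cons_pair (a, x), cons_pair (b, y))); last first.
  by apply/esym; exact: (expand H mH H0).
pose M := fun z : RR * RR => \int[G d]_x \int[G d]_y H (cons_pair (z.1, x), cons_pair (z.2, y)).
have mcons (a b : RR) : measurable_fun setT (fun w : d.-tuple RR * d.-tuple RR =>
    (cons_pair (a, w.1), cons_pair (b, w.2))).
  apply/measurable_fun_pair => /=.
    by apply: (measurableT_comp (@measurable_cons_pair R d)); apply/measurable_fun_pair.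
  by apply: (measurableT_comp (@measurable_cons_pair R d)); apply/measurable_fun_pair.
transitivity (\int[N01]_a \int[N01]_b M ((c * a + s * b)%R, (- s * a + c * b)%R)).
  apply: eq_integral => a _; apply: eq_integral => b _; rewrite /M/=.
  pose H' := fun w : d.-tuple RR * d.-tuple RR =>
    H (cons_pair ((c * a + s * b)%R, w.1), cons_pair ((- s * a + c * b)%R, w.2)).
  transitivity (\int[G d]_x \int[G d]_y H' (x, y)); last by [].
  rewrite -(IH H'); last 2 first.
  - exact: (measurableT_comp mH (mcons _ _)).
  - by move=> z; exact: H0.
  by apply: eq_integral => x _; apply: eq_integral => y _; rewrite /Hr /H' /= !lin2_tuple_cons.
apply: (@normal_rotation R c s M) => //; last by move=> z; do 2 (apply: integral_ge0 => ? _).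
pose M1 := fun z : (RR * RR) * d.-tuple RR => \int[G d]_y H (cons_pair (z.1.1, z.2), cons_pair (z.1.2, y)).
apply: (measurable_fun_fubini_tonelli_F (m2 := G d) M1); last by move=> z; exact: integral_ge0.
pose M2 := fun z : ((RR * RR) * d.-tuple RR) * d.-tuple RR => H (cons_pair (z.1.1.1, z.1.2), cons_pair (z.1.1.2, z.2)).
apply: (measurable_fun_fubini_tonelli_F (m2 := G d) M2); last by move=> z; exact: H0.
apply: (measurableT_comp mH); apply/measurable_fun_pair => /=.
  apply: (measurableT_comp (@measurable_cons_pair R d)).
  apply/measurable_fun_pair => /=.
    apply: (measurableT_comp (@measurable_fst _ _ RR RR)).
    apply: (measurableT_comp (@measurable_fst _ _ (RR * RR)%type (d.-tuple RR))).
    exact: measurable_fst.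
  apply: (measurableT_comp (@measurable_snd _ _ (RR * RR)%type (d.-tuple RR))).
  exact: measurable_fst.
apply: (measurableT_comp (@measurable_cons_pair R d)).
apply/measurable_fun_pair => //=.
apply: (measurableT_comp (@measurable_snd _ _ RR RR)).
apply: (measurableT_comp (@measurable_fst _ _ (RR * RR)%type (d.-tuple RR))).
exact: measurable_fst.
Qed.

(** By induction the tail of the form has the law of [r t]; the rotation of cosine [a ord0 / n] and
    sine [r / n] then turns [a ord0 u + r t] into [n] times a single normal variable. If [n = 0]
    both sides are constant. *)
Lemma gauss_lin d (a : 'I_d -> R) (F : RR -> \bar R) :
  measurable_fun setT F -> (forall t, 0 <= F t) ->
  \int[G d]_w F (\sum_(i < d) a i * tnth w i)%R =
  \int[N01]_t F (Num.sqrt (\sum_(i < d) a i ^+ 2) * t)%R.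
Proof.
elim: d a F => [|d IH] a F mF F0.
  under eq_integral do rewrite big_ord0.
  rewrite big_ord0 sqrtr0; under [RHS]eq_integral do rewrite mul0r.
  by rewrite !integral_probability_cst.
have msum : measurable_fun setT (fun w : d.-tuple RR => (\sum_(i < d) a (lift ord0 i) * tnth w i)%R : RR).
  apply: (@measurable_sum _ _ R) => i.
  by apply: (@measurable_funM _ _ R) => //; exact: measurable_tnth.
have msum1 : measurable_fun setT (fun w : d.+1.-tuple RR => (\sum_(i < d.+1) a i * tnth w i)%R : RR).
  apply: (@measurable_sum _ _ R) => i.
  by apply: (@measurable_funM _ _ R) => //; exact: measurable_tnth.
rewrite ge0_integral_gaussS//; last exact: measurableT_comp.
pose r := Num.sqrt (\sum_(i < d) a (lift ord0 i) ^+ 2)%R.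
transitivity (\int[N01]_u \int[N01]_t F (a ord0 * u + r * t)%R).
  apply: eq_integral => u _.
  transitivity (\int[G d]_w F (a ord0 * u + \sum_(i < d) a (lift ord0 i) * tnth w i)%R).
    apply: eq_integral => w _; congr F; rewrite big_ord_recl tnth0; congr (_ + _)%R.
    by apply: eq_bigr => i _; rewrite tnthS.
  pose F' := fun t : RR => F (a ord0 * u + t)%R.
  apply: (IH (fun i => a (lift ord0 i)) F'); last by move=> t; exact: F0.
  by apply: (measurableT_comp mF); exact: (@measurable_funD _ _ R).
pose n := Num.sqrt (\sum_(i < d.+1) a i ^+ 2)%R; rewrite -/n.
have n2 : (n ^+ 2 = a ord0 ^+ 2 + r ^+ 2)%R.
  rewrite /n /r !sqr_sqrtr; last 2 first.
  - by apply: sumr_ge0 => i _; exact: sqr_ge0.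
  - by apply: sumr_ge0 => i _; exact: sqr_ge0.
  by rewrite big_ord_recl.
have [n0|n0] := eqVneq n 0%R.
  move: n2; rewrite n0 expr0n/= => /esym/eqP.
  rewrite paddr_eq0 ?sqr_ge0// !sqrf_eq0 => /andP[/eqP a0 /eqP r0]. rewrite a0 r0.
  under eq_integral => u _.
    under eq_integral => t _ do rewrite !mul0r addr0.
    rewrite integral_probability_cst.
  over.
  by under [RHS]eq_integral do rewrite mul0r.
pose H := fun z : RR * RR => F (n * z.1)%R.
have mH : measurable_fun setT H.
  by apply: (measurableT_comp mF); apply: (@measurable_funM _ _ R).
have cs : ((a ord0 / n) ^+ 2 + (r / n) ^+ 2 = 1)%R.
  by rewrite !expr_div_n -mulrDl -n2 divff// sqrf_eq0.
transitivity (\int[N01]_u \int[N01]_t H (u, t)); last first.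
  by apply: eq_integral => u _; rewrite /H/= integral_probability_cst.
transitivity (\int[N01]_u \int[N01]_t
    H ((a ord0 / n * u + r / n * t)%R, (- (r / n) * u + a ord0 / n * t)%R)); last first.
  by apply: (normal_rotation cs mH) => z; exact: F0.
apply: eq_integral => u _; apply: eq_integral => t _; rewrite /H/=; congr F.
by field.
Qed.

End gaussian_vectors.

(** * Moments of the standard normal law *)

Section normal_moments.
Context {R : realType}.
Local Notation RR := (measurableTypeR R).
Local Notation N01 := (normal_prob (0 : R) 1).

Lemma measurable_exp_sqr (h : R) :
  measurable_fun setT (fun t : RR => (expR (- (h * t ^+ 2 / 2)))%:E).
Proof.
apply/measurable_EFinP; apply: (measurableT_comp (@measurable_expR R)).
apply: (@measurable_funN _ _ R); apply: (@measurable_funM _ _ R) => //.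
apply: (@measurable_funM _ _ R) => //; exact: (@measurable_funX _ _ R).
Qed.

(** The product with the density is [s] times the normal density of standard deviation
    [s = (1 + h)^(-1/2)]. A negative [h] gives the finiteness of the fourth moment, small positive
    [h] the variance. *)
Lemma normal_exp_sqr (h : R) : -1 < h ->
  (\int[N01]_t (expR (- (h * t ^+ 2 / 2)))%:E = (Num.sqrt (1 + h))^-1%:E)%E.
Proof.
move=> h1; have h0 : 0 < 1 + h by rewrite -ltrBlDl sub0r.
pose s := (Num.sqrt (1 + h))^-1.
have s0 : 0 < s by rewrite invr_gt0 sqrtr_gt0.
have s2 : s ^+ 2 = (1 + h)^-1 by rewrite exprVn sqr_sqrtr// ltW.
have mE := measurable_exp_sqr h.
have E t : (expR (- (h * t ^+ 2 / 2)) * normal_pdf 0 1 t =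
    s * normal_pdf 0 s t)%R.
  rewrite !normal_pdfE ?oner_neq0 ?gt_eqF// /normal_fun !subr0 mulrCA.
  rewrite -expRD [RHS]mulrA; congr (_ * expR _)%R.
    rewrite /normal_peak expr1n mul1r -mulrnAr [in RHS]sqrtrM ?sqr_ge0//.
    by rewrite sqrtr_sqr ger0_norm ?ltW// invfM mulrA divff ?mul1r// gt_eqF.
  rewrite -mulr_natr s2 expr1n; field.
  by rewrite gt_eqF.
transitivity (\int[@lebesgue_measure R]_t ((expR (- (h * t ^+ 2 / 2)))%:E * (normal_pdf 0 1 t)%:E))%E.
  by apply: integral_normal_density => // x; rewrite lee_fin expR_ge0.
transitivity (\int[@lebesgue_measure R]_t (s%:E * (normal_pdf 0 s t)%:E))%E.
  by apply: eq_integral => t _; rewrite -!EFinM E.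
rewrite ge0_integralZl//=.
- by rewrite integral_normal_pdf mule1.
- by apply/measurable_EFinP; exact: measurable_normal_pdf.
- by move=> x _; rewrite lee_fin normal_pdf_ge0.
- by rewrite lee_fin ltW.
Qed.

Lemma exprX4_le_expR (t : R) : t ^+ 4 <= 32 * expR (t ^+ 2 / 4).
Proof.
have := @expR_ge1Dxn R (t ^+ 2 / 4) 1; rewrite divr_ge0 ?sqr_ge0// => /(_ isT).
rewrite /= (_ : 2`!%:R = 2)//.
have -> : (t ^+ 2 / 4) ^+ 2 / 2 = t ^+ 4 / 32 by field.
by move=> h; rewrite mulrC -ler_pdivrMr// (le_trans _ h)// lerDr.
Qed.

Lemma measurable_sqr_X (k : nat) : measurable_fun setT (fun t : RR => (t ^+ k)%:E).
Proof. by apply/measurable_EFinP; exact: (@measurable_funX _ _ R). Qed.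

Lemma normal_moment4_fin : (\int[N01]_t (t ^+ 4)%:E < +oo)%E.
Proof.
have mE := measurable_exp_sqr (- (1 / 2)).
apply: (@le_lt_trans _ _ (\int[N01]_t (32%:E * (expR (- (- (1 / 2) * t ^+ 2 / 2)))%:E)))%E.
  apply: ge0_le_integral => //.
  - by move=> t _; rewrite lee_fin (exprM t 2 2) sqr_ge0.
  - exact: measurable_sqr_X.
  - by apply: emeasurable_funM => //.
  - move=> t _; rewrite -EFinM lee_fin (le_trans (exprX4_le_expR t))//.
    have -> : (- (- (1 / 2) * t ^+ 2 / 2)) = t ^+ 2 / 4 by field.
    by [].
rewrite ge0_integralZl//.
have h1 : -1 < - (1 / 2) :> R by lra.
by rewrite (normal_exp_sqr h1) -EFinM ltry.
Qed.

(** A half turn of the plane, applied to a function of the first coordinate. *)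
Lemma normal_integral_opp (F : RR -> \bar R) :
  measurable_fun setT F -> (forall t, 0 <= F t)%E ->
  (\int[N01]_t F (- t)%R = \int[N01]_t F t)%E.
Proof.
move=> mF F0; pose H := fun z : RR * RR => F z.1.
have mH : measurable_fun setT H by exact: measurableT_comp.
have cs : (-1) ^+ 2 + 0 ^+ 2 = 1 :> R by rewrite sqrrN expr1n expr0n addr0.
have := normal_rotation cs mH (fun z => F0 z.1).
rewrite /H/= => E.
transitivity (\int[N01]_x \int[N01]_y F (- x)%R)%E.
  by apply: eq_integral => x _; rewrite integral_probability_cst.
transitivity (\int[N01]_x \int[N01]_y F x)%E; last first.
  by apply: eq_integral => x _; rewrite integral_probability_cst.
rewrite -E; apply: eq_integral => x _; apply: eq_integral => y _.
by congr F; ring.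
Qed.

End normal_moments.

Section normal_variance.
Context {R : realType}.
Local Notation RR := (measurableTypeR R).
Local Notation N01 := (normal_prob (0 : R) 1).

Lemma integrable_dominated d (T : measurableType d) (mu : {measure set T -> \bar R})
    (f g : T -> R) :
  measurable_fun setT (fun x => (f x)%:E) -> mu.-integrable setT (fun x => (g x)%:E) ->
  (forall x, `|f x| <= g x) -> mu.-integrable setT (fun x => (f x)%:E).
Proof.
move=> mf ig fg; apply: le_integrable ig => // x _ /=.
by rewrite lee_fin (le_trans (fg x))// ler_norm.
Qed.

Section integrable_EFin.
Context d (T : measurableType d) (mu : {measure set T -> \bar R}).
Implicit Types f g : T -> R.

Lemma integrable_EFinD f g : mu.-integrable setT (fun x => (f x)%:E) ->
  mu.-integrable setT (fun x => (g x)%:E) ->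
  mu.-integrable setT (fun x => (f x + g x)%:E).
Proof.
move=> i1 i2; have := integrableD measurableT i1 i2.
by apply: eq_integrable => // x _ /=; rewrite EFinD.
Qed.

Lemma integrable_EFinZ (k : R) f : mu.-integrable setT (fun x => (f x)%:E) ->
  mu.-integrable setT (fun x => (k * f x)%:E).
Proof.
move=> i1; have := integrableZl measurableT k i1.
by apply: eq_integrable => // x _ /=; rewrite EFinM.
Qed.

Lemma integrable_EFinB f g : mu.-integrable setT (fun x => (f x)%:E) ->
  mu.-integrable setT (fun x => (g x)%:E) ->
  mu.-integrable setT (fun x => (f x - g x)%:E).
Proof.
move=> i1 i2; have := integrableB measurableT i1 i2.
by apply: eq_integrable => // x _ /=; rewrite EFinB.
Qed.

End integrable_EFin.

Lemma integrable_probability_cst d (T : measurableType d) (P : probability T R) (r : R) :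
  P.-integrable setT (fun=> r%:E).
Proof. exact: (@finite_measure_integrable_cst _ _ _ P). Qed.

Lemma Rintegral_probability_cst d (T : measurableType d) (P : probability T R) (r : R) :
  (\int[P]_x r)%R = r.
Proof. by rewrite /Rintegral integral_probability_cst. Qed.

Lemma normal_integrable_X4 : N01.-integrable setT (fun t : RR => (t ^+ 4)%:E).
Proof.
apply/integrableP; split; first exact: measurable_sqr_X.
rewrite (_ : (fun _ => _) = (fun t : RR => (t ^+ 4)%:E)); first exact: normal_moment4_fin.
by apply/funext => t /=; rewrite ger0_norm// (exprM t 2 2) sqr_ge0.
Qed.

Lemma normal_integrable_X (k : nat) : (k <= 4)%N ->
  N01.-integrable setT (fun t : RR => (t ^+ k)%:E).
Proof.
move=> k4; apply: (@integrable_dominated _ RR N01 (fun t => t ^+ k) (fun t => 1 + t ^+ 4)).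
- exact: measurable_sqr_X.
- under eq_fun do rewrite EFinD.
  apply: integrableD => //; first exact: integrable_probability_cst.
  exact: normal_integrable_X4.
- move=> t; rewrite normrX.
  have t4 : 0 <= t ^+ 4 by rewrite (exprM t 2 2) sqr_ge0.
  have [t1|/ltW t1] := leP `|t| 1.
    by rewrite (le_trans (exprn_ile1 _ _ t1))// lerDl.
  apply: (@le_trans _ _ (`|t| ^+ 4)); first exact: ler_weXn2l.
  by rewrite -normrX ger0_norm// lerDr.
Qed.

Let mom (k : nat) : R := (\int[N01]_t (t ^+ k))%R.

Let exp_sqr_int (h : R) : 0 < h ->
  N01.-integrable setT (fun t : RR => (expR (- (h * t ^+ 2 / 2)))%:E).
Proof.
move=> h0; apply: (@integrable_dominated _ RR N01 (fun t => expR (- (h * t ^+ 2 / 2))) (fun=> 1)).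
- exact: measurable_exp_sqr.
- exact: integrable_probability_cst.
- move=> t; rewrite ger0_norm ?expR_ge0// -expR0 ler_expR oppr_le0.
  by rewrite divr_ge0// mulr_ge0 ?sqr_ge0// ltW.
Qed.

Let exp_sqr_val (h : R) : 0 < h ->
  (\int[N01]_t (expR (- (h * t ^+ 2 / 2))))%R = (Num.sqrt (1 + h))^-1.
Proof.
by move=> h0; rewrite /Rintegral normal_exp_sqr// (lt_trans _ h0)// ltrN10.
Qed.

Let sqrZ_int (h : R) : N01.-integrable setT (EFin \o (fun t : RR => h / 2 * t ^+ 2)).
Proof.
exact: (integrable_EFinZ _ (normal_integrable_X (isT : (2 <= 4)%N))).
Qed.

Let mom_lb (h : R) : 0 < h -> 1 - h / 2 * mom 2 <= (Num.sqrt (1 + h))^-1.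
Proof.
move=> h0; rewrite -exp_sqr_val//.
have i2 := sqrZ_int h.
have -> : 1 - h / 2 * mom 2 = (\int[N01]_t (1 - h / 2 * t ^+ 2))%R.
  rewrite RintegralB//; last exact: integrable_probability_cst.
  rewrite RintegralZl//; last exact: normal_integrable_X.
  by rewrite Rintegral_probability_cst.
apply: le_Rintegral => //.
- by apply: integrable_EFinB => //; exact: integrable_probability_cst.
- exact: exp_sqr_int.
- by move=> t _; rewrite mulrAC; exact: expR_ge1Dx.
Qed.

(** In the product with [(1 + u / 2)^2], a lower bound of [expR u], the coefficient 3/4 is the one
    for which the terms of order one and two cancel; what remains beyond 1 is nonnegative. *)
Let expRN_le (u : R) : 0 <= u -> expR (- u) <= 1 - u + 3 / 4 * u ^+ 2.
Proof.
move=> u0; rewrite expRN -[X in X <= _]mul1r ler_pdivrMr ?expR_gt0//.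
have e : expR u = expR (u / 2) ^+ 2 by rewrite expr2 -expRD; congr expR; field.
have h1 : 1 + u / 2 <= expR (u / 2) by exact: expR_ge1Dx.
have h2 : (1 + u / 2) ^+ 2 <= expR u.
  by rewrite e ler_sqr ?nnegrE ?expR_ge0// addr_ge0// divr_ge0.
have q0 : 0 <= 1 - u + 3 / 4 * u ^+ 2 by nra.
apply: (le_trans _ (ler_wpM2l q0 h2)).
rewrite -subr_ge0.
have -> : (1 - u + 3 / 4 * u ^+ 2) * (1 + u / 2) ^+ 2 - 1 = u ^+ 3 / 2 + 3 / 16 * u ^+ 4.
  by field.
by rewrite addr_ge0// ?divr_ge0 ?mulr_ge0 ?exprn_ge0.
Qed.

Let mom_ub (h : R) : 0 < h ->
  (Num.sqrt (1 + h))^-1 <= 1 - h / 2 * mom 2 + 3 / 16 * h ^+ 2 * mom 4.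
Proof.
move=> h0; rewrite -exp_sqr_val//.
have i2 := sqrZ_int h.
have i12 : N01.-integrable setT (EFin \o (fun t : RR => 1 - h / 2 * t ^+ 2)).
  by apply: integrable_EFinB => //; exact: integrable_probability_cst.
have i4 : N01.-integrable setT (EFin \o (fun t : RR => 3 / 16 * h ^+ 2 * t ^+ 4)).
  exact: (integrable_EFinZ _ (normal_integrable_X (isT : (4 <= 4)%N))).
have -> : 1 - h / 2 * mom 2 + 3 / 16 * h ^+ 2 * mom 4 =
    (\int[N01]_t (1 - h / 2 * t ^+ 2 + 3 / 16 * h ^+ 2 * t ^+ 4))%R.
  rewrite RintegralD// RintegralB//; last exact: integrable_probability_cst.
  rewrite !RintegralZl//; try exact: normal_integrable_X.
  by rewrite Rintegral_probability_cst.
apply: le_Rintegral => //.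
- exact: exp_sqr_int.
- exact: integrable_EFinD.
- move=> t _; have u0 : 0 <= h * t ^+ 2 / 2.
    by rewrite divr_ge0// mulr_ge0 ?sqr_ge0// ltW.
  apply: (le_trans (expRN_le u0)).
  by rewrite le_eqVlt; apply/orP; left; apply/eqP; field.
Qed.

(** The mean of [expR (- (h t^2 / 2))] is [(1 + h)^(-1/2)]. It is squeezed between [1 - h/2 mom 2]
    and the same plus a term of order [h^2]; comparing the first-order terms as [h] tends to 0 gives
    [mom 2 = 1]. *)
Lemma normal_variance : (\int[N01]_t (t ^+ 2)%:E = 1%E)%E.
Proof.
have fin2 : (\int[N01]_t (t ^+ 2)%:E \is a fin_num)%E.
  exact: (integrable_fin_num _ (normal_integrable_X (isT : (2 <= 4)%N))).
rewrite -(fineK fin2) -[fine _]/(mom 2); congr EFin.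
have m20 : 0 <= mom 2 by apply: Rintegral_ge0 => t _; exact: sqr_ge0.
have m40 : 0 <= mom 4.
  by apply: Rintegral_ge0 => t _; rewrite (exprM t 2 2) sqr_ge0.
have key e : 0 < e -> e <= 1 -> 2 <= (2 + 4 * e) * mom 2 /\ mom 2 <= 1 + 9 * mom 4 * e.
  (* This choice makes the square root of [1 + h] equal to [1 + e], so that only polynomial
     inequalities remain. *)
  move=> e0 e1; pose h := (1 + e) ^+ 2 - 1.
  have h0 : 0 < h by rewrite /h; nra.
  have r : Num.sqrt (1 + h) = 1 + e.
    by rewrite /h addrC subrK sqrtr_sqr ger0_norm// addr_ge0// ltW.
  have e1' : 1 + e != 0 by rewrite gt_eqF// ltr_pwDl// ltW.
  have := mom_lb h0; have := mom_ub h0; rewrite r.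
  have hE : h = e * (2 + e) by rewrite /h; ring.
  pose i := (1 + e)^-1.
  have i0 : 0 < i by rewrite invr_gt0 ltr_pwDl// ltW.
  have ie : i * (1 + e) = 1 by rewrite /i mulVf.
  have i1 : i <= 1 by nra.
  rewrite -/i hE; move: (mom 2) (mom 4) m20 m40 => a b a0 b0 ub lb.
  have ei : e * i = 1 - i by rewrite -ie; ring.
  have lb' : i <= (2 + e) / 2 * a by rewrite -(ler_pM2l e0) ei; lra.
  have ub' : (2 + e) / 2 * a <= i + 3 / 16 * (2 + e) ^+ 2 * e * b.
    by rewrite -(ler_pM2l e0) mulrDr ei; lra.
  split.
    have : (1 + e) * i <= (1 + e) * ((2 + e) / 2 * a) by rewrite ler_pM2l// ltr_pwDl// ltW.
    rewrite mulrC ie => h1; have : (1 + e) * ((2 + e) / 2 * a) <= (1 + 2 * e) * a by nra.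
    by nra.
  have : a <= (2 + e) / 2 * a by nra.
  have : (2 + e) ^+ 2 <= 9 by nra.
  have : 0 <= e * b by rewrite mulr_ge0// ltW.
  by nra.
apply/eqP; rewrite eq_le; apply/andP; split; last first.
  rewrite leNgt; apply/negP => lt1.
  have e0 : 0 < (1 - mom 2) / 4 by lra.
  have e1 : (1 - mom 2) / 4 <= 1 by lra.
  have [+ _] := key _ e0 e1; nra.
apply/ler_addgt0Pr => e e0.
pose e' := Num.min 1 (e / (9 * mom 4 + 1)).
have d0 : 0 < 9 * mom 4 + 1 by nra.
have e'0 : 0 < e' by rewrite lt_min ltr01 divr_gt0.
have e'1 : e' <= 1 by rewrite ge_min lexx.
have [_ h] := key _ e'0 e'1.
apply: (le_trans h); rewrite lerD2l.
have : e' <= e / (9 * mom 4 + 1) by rewrite ge_min lexx orbT.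
rewrite ler_pdivlMr//; nra.
Qed.

End normal_variance.

(** * Gaussian expectation of functions of polynomial growth *)

Section gaussian_expectation.
Context {R : realType} {d : nat}.
Local Notation RR := (measurableTypeR R).
Local Notation N01 := (normal_prob (0 : R) 1).
Local Notation G := (@std_gaussian R d).
Local Notation V := 'rV[R]_d.
Implicit Types (F : V -> R) (H : V -> V -> R) (x y : V).

Definition gmeas F := measurable_fun setT (fun w : d.-tuple RR => (F (vec_of_tuple w) : RR)).

Definition gmeas2 H :=
  measurable_fun setT (fun z : d.-tuple RR * d.-tuple RR =>
    (H (vec_of_tuple z.1) (vec_of_tuple z.2) : RR)).

(** Rational centres and radii [1 / (k + 1)] index countably many boxes. Those contained in [U]
    cover it, and each is cut out by finitely many conditions on coordinates; for the other indices
    [B] is empty. *)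
Lemma open_gmeasurable (U : set V) : open U ->
  measurable [set w : d.-tuple RR | U (vec_of_tuple w)].
Proof.
move=> oU; pose q (p : 'rV[rat]_d) : V := map_mx ratr p.
pose B (pk : 'rV[rat]_d * nat) : set (d.-tuple RR) :=
  [set w | (forall y, (forall i, `|q pk.1 ord0 i - y ord0 i| < pk.2.+1%:R^-1) -> U y) /\
     forall i, `|q pk.1 ord0 i - tnth w i| < pk.2.+1%:R^-1].
have -> : [set w : d.-tuple RR | U (vec_of_tuple w)] = \bigcup_pk B pk.
  apply/seteqP; split => [w /= Uw|w [pk _ [h1 h2]]]; last first.
    by apply: h1 => i; rewrite [vec_of_tuple w _ _]mxE; exact: h2.
  have /nbhs_ballP[e /= e0 he] := oU _ Uw.
  have [k ke] : exists k : nat, k.+1%:R^-1 < e / 2.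
    have e20 : 0 < e / 2 by rewrite divr_gt0.
    by have [k] := ltr_add_invr e20; rewrite add0r => hk; exists k.
  have k0 : 0 < k.+1%:R^-1 :> R by rewrite invr_gt0.
  have rat_near (i : 'I_d) : exists r : rat, `|ratr r - tnth w i| < k.+1%:R^-1.
    have : tnth w i - k.+1%:R^-1 < tnth w i + k.+1%:R^-1 by rewrite ltrD2l gtrN.
    move=> /rat_in_itvoo[r]; rewrite in_itv/= => /andP[r1 r2]; exists r.
    by rewrite ltr_distl r1 r2.
  have /choice[p hp] := rat_near.
  exists (\row_i p i, k) => //; split => [y hy|i]; last by rewrite !mxE; exact: hp.
  apply: he; split=> // a i; rewrite (ord1 a) mxE.
  rewrite /ball/= (_ : tnth w i - y ord0 i = - (ratr (p i) - tnth w i) + (ratr (p i) - y ord0 i)); last by ring.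
  apply: (le_lt_trans (ler_normD _ _)); rewrite normrN.
  have := hy i; rewrite /q !mxE => hy'.
  by rewrite (lt_trans (ltrD (hp i) hy'))// [ltRHS](splitr e) ltrD.
apply: countable_bigcupT_measurable => [|[p k]]; first exact: countableP.
pose P := forall y : V, (forall i, `|q p ord0 i - y ord0 i| < k.+1%:R^-1) -> U y.
have [hP|hP] := pselect P; last first.
  by rewrite (_ : B _ = set0)//; apply/seteqP; split => // w [].
rewrite (_ : B _ = \bigcap_(i in [set: 'I_d]) [set w : d.-tuple RR | `|q p ord0 i - tnth w i| < k.+1%:R^-1]); last first.
  by apply/seteqP; split => [w [_ h] i _|w h]; [exact: h|split => // i; exact: h].
apply: fin_bigcap_measurable => // i _.
rewrite (_ : [set _ | _] = (fun w : d.-tuple RR => tnth w i) @^-1`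
    `](q p ord0 i - k.+1%:R^-1), (q p ord0 i + k.+1%:R^-1)[).
  rewrite -[X in measurable X]setTI.
  by apply: (@measurable_tnth _ RR d i) => //; exact: measurable_itv.
by apply/seteqP; split => w /=; rewrite in_itv/= -ltr_distl distrC.
Qed.

Lemma continuous_gmeas F : continuous F -> gmeas F.
Proof.
move=> cF; apply: (measurability _ (RGenOInfty.measurableE R)) => //.
move=> _ [_ [a ->] <-]; rewrite setTI.
rewrite (_ : _ @^-1` _ = [set w : d.-tuple RR | [set x | a < F x] (vec_of_tuple w)]); last first.
  by apply/seteqP; split => w /=; rewrite in_itv/= andbT.
apply: open_gmeasurable.
rewrite (_ : [set x | a < F x] = F @^-1` [set r | a < r])//.
by apply: open_comp => [x _|]; [exact: cF|exact: open_gt].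
Qed.

Lemma lip_gmeas L F : lip L F -> gmeas F.
Proof. by move=> /lip_continuous; exact: continuous_gmeas. Qed.

Lemma vec_of_lin2 a b (x y : d.-tuple RR) :
  vec_of_tuple (lin2_tuple a b x y) = a *: vec_of_tuple x + b *: vec_of_tuple y.
Proof. by apply/rowP => i; rewrite !mxE tnth_mktuple. Qed.

Lemma gmeas2_lin a b F : gmeas F -> gmeas2 (fun x y => F (a *: x + b *: y)).
Proof.
move=> mF; rewrite /gmeas2; under eq_fun do rewrite -vec_of_lin2.
by apply: (measurableT_comp mF); apply: measurable_lin2_tuple.
Qed.

(** Measurability and growth of degree [k] travel together: degrees add under products, and a degree
    of at most 4 gives integrability because the fourth moment is finite. Integrability of a
    concrete integrand is thus reduced to counting degrees. *)
Definition gro k F := gmeas F /\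
  exists2 C, 0 <= C & forall x, `|F x| <= C * (1 + l2norm x) ^+ k.

Definition gro2 k H := gmeas2 H /\
  exists2 C, 0 <= C & forall x y, `|H x y| <= C * (1 + l2norm x + l2norm y) ^+ k.

Let n1 x : 1 <= 1 + l2norm x. Proof. by rewrite lerDl l2norm_ge0. Qed.
Let n2 x y : 1 <= 1 + l2norm x + l2norm y.
Proof. by rewrite -addrA lerDl addr_ge0 ?l2norm_ge0. Qed.

Lemma groW k l F : (k <= l)%N -> gro k F -> gro l F.
Proof.
move=> kl [mF [C C0 FC]]; split => //; exists C => // x.
by rewrite (le_trans (FC x))// ler_wpM2l// ler_weXn2l.
Qed.

Lemma gro_cst k c : gro k (fun=> c).
Proof.
apply: (@groW 0) => //; split; first exact: measurable_cst.
by exists `|c| => // x; rewrite expr0 mulr1.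
Qed.

Lemma groD k F1 F2 : gro k F1 -> gro k F2 -> gro k (fun x => F1 x + F2 x).
Proof.
move=> [m1 [C1 C10 h1]] [m2 [C2 C20 h2]]; split; first exact: (@measurable_funD _ _ R).
exists (C1 + C2); first exact: addr_ge0.
by move=> x; rewrite (le_trans (ler_normD _ _))// mulrDl lerD.
Qed.

Lemma groM k l F1 F2 : gro k F1 -> gro l F2 -> gro (k + l) (fun x => F1 x * F2 x).
Proof.
move=> [m1 [C1 C10 h1]] [m2 [C2 C20 h2]]; split; first exact: (@measurable_funM _ _ R).
exists (C1 * C2); first exact: mulr_ge0.
by move=> x; rewrite normrM exprD mulrACA ler_pM.
Qed.

Lemma groZ k a F : gro k F -> gro k (fun x => a * F x).
Proof. by move=> hF; have := groM (gro_cst 0 a) hF. Qed.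

Lemma groB k F1 F2 : gro k F1 -> gro k F2 -> gro k (fun x => F1 x - F2 x).
Proof.
move=> h1 h2; have := groD h1 (groZ (-1) h2).
by under eq_fun do rewrite mulN1r.
Qed.

Lemma lip_gro L F : lip L F -> gro 1 F.
Proof.
move=> FL; split; first exact: lip_gmeas FL.
exists (`|F 0| + `|L|); first exact: addr_ge0.
move=> x; rewrite expr1 mulrDl !mulrDr !mulr1.
have := FL x 0; rewrite subr0 => FL0.
have : `|F x| <= `|F x - F 0| + `|F 0| by rewrite -{1}(subrK (F 0) (F x)) ler_normD.
have : L * l2norm x <= `|L| * l2norm x by rewrite ler_wpM2r ?l2norm_ge0// ler_norm.
have := l2norm_ge0 x; have := normr_ge0 (F 0); have := normr_ge0 L; nra.
Qed.

Lemma l2norm_lip1 : lip 1 (@l2norm R d).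
Proof. by move=> x y; rewrite mul1r l2norm_lip. Qed.

Lemma gro_l2norm : gro 1 (@l2norm R d).
Proof. exact: lip_gro l2norm_lip1. Qed.

Lemma groX k n F : gro k F -> gro (k * n) (fun x => F x ^+ n).
Proof.
move=> hF; elim: n => [|n IH]; first by rewrite muln0; under eq_fun do rewrite expr0; exact: gro_cst.
by rewrite mulnS; under eq_fun do rewrite exprS; exact: groM.
Qed.

Lemma gro_max k F1 F2 : gro k F1 -> gro k F2 -> gro k (fun x => Num.max (F1 x) (F2 x)).
Proof.
move=> [m1 [C1 C10 h1]] [m2 [C2 C20 h2]]; split; first exact: (@measurable_maxr _ _ R).
exists (C1 + C2); first exact: addr_ge0.
move=> x; rewrite mulrDl; have p0 : 0 <= (1 + l2norm x) ^+ k by rewrite exprn_ge0// (le_trans _ (n1 x)).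
rewrite /Num.max; case: ifP => _.
  by rewrite (le_trans (h2 x))// lerDr mulr_ge0.
by rewrite (le_trans (h1 x))// lerDl mulr_ge0.
Qed.

Lemma gro2W k l H : (k <= l)%N -> gro2 k H -> gro2 l H.
Proof.
move=> kl [mF [C C0 FC]]; split => //; exists C => // x y.
by rewrite (le_trans (FC x y))// ler_wpM2l// ler_weXn2l.
Qed.

Lemma gro2D k (F1 F2 : V -> V -> R) : gro2 k F1 -> gro2 k F2 -> gro2 k (fun x y => F1 x y + F2 x y).
Proof.
move=> [m1 [C1 C10 h1]] [m2 [C2 C20 h2]]; split; first exact: (@measurable_funD _ _ R).
exists (C1 + C2); first exact: addr_ge0.
by move=> x y; rewrite (le_trans (ler_normD _ _))// mulrDl lerD.
Qed.

Lemma gro2M k l (F1 F2 : V -> V -> R) : gro2 k F1 -> gro2 l F2 -> gro2 (k + l) (fun x y => F1 x y * F2 x y).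
Proof.
move=> [m1 [C1 C10 h1]] [m2 [C2 C20 h2]]; split; first exact: (@measurable_funM _ _ R).
exists (C1 * C2); first exact: mulr_ge0.
by move=> x y; rewrite normrM exprD mulrACA ler_pM.
Qed.

Lemma gro2_lin k a b F : gro k F -> gro2 k (fun x y => F (a *: x + b *: y)).
Proof.
move=> [mF [C C0 FC]]; split; first exact: gmeas2_lin.
pose M := 1 + `|a| + `|b|.
exists (C * M ^+ k); first by rewrite mulr_ge0// exprn_ge0// !addr_ge0.
move=> x y; rewrite (le_trans (FC _))// -mulrA ler_wpM2l// -exprMn.
rewrite lerXn2r ?nnegrE ?addr_ge0 ?mulr_ge0 ?l2norm_ge0 ?addr_ge0 ?l2norm_ge0//.
have := l2normD (a *: x) (b *: y); rewrite !l2normZ /M.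
have := l2norm_ge0 x; have := l2norm_ge0 y; have := normr_ge0 a; have := normr_ge0 b.
move: (l2norm (_ + _)) (l2norm x) (l2norm y) `|a| `|b| => p q r s t; nra.
Qed.

Lemma gro2_fst k F : gro k F -> gro2 k (fun x _ => F x).
Proof.
move=> hF; have := gro2_lin 1 0 hF.
rewrite (_ : (fun _ _ => _) = (fun x _ => F x))//.
by apply/funext => x; apply/funext => y; rewrite scale1r scale0r addr0.
Qed.

Lemma gro2_snd k F : gro k F -> gro2 k (fun _ y => F y).
Proof.
move=> hF; have := gro2_lin 0 1 hF.
rewrite (_ : (fun _ _ => _) = (fun _ y => F y))//.
by apply/funext => x; apply/funext => y; rewrite scale1r scale0r add0r.
Qed.

Lemma gro2_cst k c : gro2 k (fun _ _ => c).
Proof. exact: (gro2_fst (gro_cst k c)). Qed.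

Lemma gro2Z k a H : gro2 k H -> gro2 k (fun x y => a * H x y).
Proof. by move=> hF; have := gro2M (gro2_cst 0 a) hF. Qed.

Lemma gro2B k (F1 F2 : V -> V -> R) : gro2 k F1 -> gro2 k F2 -> gro2 k (fun x y => F1 x y - F2 x y).
Proof.
move=> h1 h2; have := gro2D h1 (gro2Z (-1) h2).
rewrite (_ : (fun x y => F1 x y + -1 * F2 x y) = (fun x y => F1 x y - F2 x y))//.
by apply/funext => x; apply/funext => y; rewrite mulN1r.
Qed.

Lemma gro2_sqr k H : gro2 k H -> gro2 (k + k) (fun x y => H x y ^+ 2).
Proof.
move=> h; have := gro2M h h.
rewrite (_ : (fun x y => H x y * H x y) = (fun x y => H x y ^+ 2))//.
Qed.

Lemma gro2_max0 k H : gro2 k H -> gro2 k (fun x y => Num.max 0 (H x y)).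
Proof.
move=> [m1 [C1 C10 h1]]; split.
  by apply: (@measurable_maxr _ _ R) => //; exact: measurable_cst.
exists C1 => // x y.
rewrite /Num.max; case: ifP => // _; rewrite normr0 mulr_ge0// exprn_ge0//.
exact: le_trans (n2 x y).
Qed.

Lemma gro_section k H x : gro2 k H -> gro k (H x).
Proof.
move=> [mH [C C0 HC]]; split.
  pose xs : d.-tuple RR := [tuple x ord0 i | i < d].
  have -> : H x = H (vec_of_tuple xs) by congr H; apply/rowP => i; rewrite mxE tnth_mktuple.
  have mp : measurable_fun setT (fun w : d.-tuple RR => (xs, w)) by apply/measurable_fun_pair.
  exact: (measurableT_comp mH mp).
exists (C * (1 + l2norm x) ^+ k); first by rewrite mulr_ge0// exprn_ge0// (le_trans _ (n1 x)).
move=> y; rewrite (le_trans (HC x y))// -mulrA ler_wpM2l// -exprMn lerXn2r ?nnegrE//.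
- exact: le_trans (n2 x y).
- by rewrite mulr_ge0// (le_trans _ (n1 _)).
- by have := l2norm_ge0 x; have := l2norm_ge0 y; nra.
Qed.

End gaussian_expectation.

Section gaussian_expectation_ops.
Context {R : realType} {d : nat}.
Local Notation RR := (measurableTypeR R).
Local Notation N01 := (normal_prob (0 : R) 1).
Local Notation G := (@std_gaussian R d).
Local Notation V := 'rV[R]_d.
Local Notation vec := (@vec_of_tuple R d).
Implicit Types (F : V -> R) (H : V -> V -> R) (x y : V).

Definition Ex F : R := (\int[G]_w F (vec w))%R.

Definition Ex2 H : R := (\int[(G \x G)%E]_z H (vec z.1) (vec z.2))%R.

Lemma integral_gauss_dotv (a : V) (F : RR -> \bar R) :
  measurable_fun setT F -> (forall t, 0 <= F t)%E ->
  (\int[G]_w F (dotv a (vec w)) = \int[N01]_t F (l2norm a * t)%R)%E.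
Proof.
move=> mF F0; have := gauss_lin (fun i => a ord0 i) mF F0.
have -> : Num.sqrt (\sum_(i < d) a ord0 i ^+ 2) = l2norm a.
  by congr Num.sqrt; apply: eq_bigr => i _; rewrite expr2.
move=> <-; apply: eq_integral => w _; congr F.
by apply: eq_bigr => i _; rewrite mxE.
Qed.

(** Expand the square of the sum into a double sum and bound each [x_i^2 x_j^2] by the mean of the
    two fourth powers. *)
Lemma l2norm4_le x : l2norm x ^+ 4 <= d%:R * \sum_(i < d) x ord0 i ^+ 4.
Proof.
rewrite (exprM _ 2 2) sqr_l2norm expr2 /dotv mulr_suml.
rewrite mulr_natl -[d in _ *+ d]card_ord -sumr_const.
have -> : \sum_(i in 'I_d) \sum_(j < d) x ord0 j ^+ 4 =
  \sum_(i < d) \sum_(j < d) (x ord0 i ^+ 4 + x ord0 j ^+ 4) / 2.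
  under [RHS]eq_bigr do rewrite -mulr_suml big_split /= sumr_const card_ord.
  rewrite -mulr_suml big_split /= sumrMnl [X in _ = (_ + X) / _]sumr_const card_ord.
  by rewrite sumr_const card_ord; field.
apply: ler_sum => i _; rewrite mulr_sumr; apply: ler_sum => j _.
have : 0 <= (x ord0 i ^+ 2 - x ord0 j ^+ 2) ^+ 2 by exact: sqr_ge0.
rewrite -!expr2 (exprM (x ord0 i) 2 2) (exprM (x ord0 j) 2 2).
move: (x ord0 i ^+ 2) (x ord0 j ^+ 2) => p q; nra.
Qed.

Lemma integrable_coord4 (i : 'I_d) :
  G.-integrable setT (fun w : d.-tuple RR => (tnth w i ^+ 4)%:E).
Proof.
have m4 : measurable_fun setT (fun w : d.-tuple RR => (tnth w i ^+ 4)%:E).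
  by apply/measurable_EFinP; apply: (@measurable_funX _ _ R); exact: measurable_tnth.
apply/integrableP; split => //.
have := @integral_gauss_dotv (delta_mx ord0 i) (fun t => (t ^+ 4)%:E) (@measurable_sqr_X R 4).
have x4 (t : R) : 0 <= t ^+ 4 by rewrite (exprM t 2 2) sqr_ge0.
move=> /(_ (fun t => x4 t)) E.
rewrite (_ : (\int[_]_x _)%E = (\int[N01]_t ((l2norm (delta_mx ord0 i : V) * t) ^+ 4)%:E)%E).
  have -> : l2norm (delta_mx ord0 i : V) = 1.
    rewrite /l2norm /dotv (bigD1 i)//= big1 ?addr0; last first.
      by move=> j ji; rewrite !mxE (negbTE ji) andbF mul0r.
    by rewrite !mxE !eqxx mul1r sqrtr1.
  under eq_integral do rewrite mul1r.
  exact: normal_moment4_fin.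
rewrite -E; apply: eq_integral => w _; rewrite /= ger0_norm//; congr ((_ ^+ 4)%:E).
rewrite /dotv (bigD1 i)//= big1 ?addr0; last first.
  by move=> j ji; rewrite !mxE (negbTE ji) andbF mul0r.
by rewrite !mxE !eqxx mul1r.
Qed.

Lemma integrable_l2norm4 : G.-integrable setT (fun w : d.-tuple RR => ((1 + l2norm (vec w)) ^+ 4)%:E).
Proof.
apply: (@integrable_dominated R _ (d.-tuple RR) G (fun w => (1 + l2norm (vec w)) ^+ 4)
  (fun w => 8 + 8 * d%:R * \sum_(i < d) tnth w i ^+ 4)).
- apply/measurable_EFinP.
  have [m _] := groX 4 (groD (gro_cst 1 1) (@gro_l2norm R d)).
  exact: m.
- apply: integrable_EFinD; first exact: integrable_probability_cst.
  apply: integrable_EFinZ; under eq_fun do rewrite -sumEFin.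
  by apply: integrable_sum => // i _; exact: integrable_coord4.
move=> w; have n0 := l2norm_ge0 (vec w).
rewrite ger0_norm ?exprn_ge0 ?addr_ge0//.
have h := l2norm4_le (vec w).
rewrite (_ : \sum_(i < d) vec w ord0 i ^+ 4 = \sum_(i < d) tnth w i ^+ 4) in h; last first.
  by apply: eq_bigr => i _; rewrite mxE.
rewrite -mulrA; apply: (@le_trans _ _ (8 + 8 * l2norm (vec w) ^+ 4)); last by lra.
move: (l2norm (vec w)) n0 => n n0.
(* 8 is the constant given by convexity of the fourth power at the midpoint of 1 and [n]; the
   difference has a double root at [n = 1]. *)
rewrite -subr_ge0.
have -> : 8 + 8 * n ^+ 4 - (1 + n) ^+ 4 =
  (n - 1) ^+ 2 * (7 * n ^+ 2 + 10 * n + 7) by ring.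
by rewrite mulr_ge0 ?sqr_ge0// !addr_ge0 ?mulr_ge0 ?sqr_ge0.
Qed.

Lemma gro_int k F : (k <= 4)%N -> gro k F -> G.-integrable setT (fun w => (F (vec w))%:E).
Proof.
move=> k4 /(groW k4) [mF [C C0 FC]].
apply: (@integrable_dominated R _ (d.-tuple RR) G (fun w => F (vec w))
  (fun w => C * (1 + l2norm (vec w)) ^+ 4)).
- exact/measurable_EFinP.
- exact/integrable_EFinZ/integrable_l2norm4.
- by move=> w; exact: FC.
Qed.

Lemma Ex_cst c : Ex (fun=> c) = c.
Proof. exact: Rintegral_probability_cst. Qed.

Lemma ExD F1 F2 : gro 4 F1 -> gro 4 F2 -> Ex (fun x => F1 x + F2 x) = Ex F1 + Ex F2.
Proof. by move=> /gro_int h1 /gro_int h2; apply: RintegralD => //; [exact: h1|exact: h2]. Qed.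

Lemma ExB F1 F2 : gro 4 F1 -> gro 4 F2 -> Ex (fun x => F1 x - F2 x) = Ex F1 - Ex F2.
Proof. by move=> /gro_int h1 /gro_int h2; apply: RintegralB => //; [exact: h1|exact: h2]. Qed.

Lemma ExZ a F : gro 4 F -> Ex (fun x => a * F x) = a * Ex F.
Proof. by move=> /gro_int h1; apply: RintegralZl => //; exact: h1. Qed.

Lemma le_Ex F1 F2 : gro 4 F1 -> gro 4 F2 -> (forall x, F1 x <= F2 x) -> Ex F1 <= Ex F2.
Proof.
by move=> /gro_int h1 /gro_int h2 h; apply: le_Rintegral => //; [exact: h1|exact: h2].
Qed.

Lemma Ex_ge0 F : (forall x, 0 <= F x) -> 0 <= Ex F.
Proof. by move=> F0; apply: Rintegral_ge0. Qed.

Lemma eq_Ex F1 F2 : F1 =1 F2 -> Ex F1 = Ex F2.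
Proof. by move=> h; congr Ex; apply/funext. Qed.

Lemma Ex_EFin F : gro 4 F -> (\int[G]_w (F (vec w))%:E)%E = (Ex F)%:E.
Proof.
by move=> /gro_int h; rewrite /Ex /Rintegral fineK//; exact: integrable_fin_num (h (leqnn _)).
Qed.

Lemma gro_dotv (a : V) : gro 1 (dotv a).
Proof.
apply: (@lip_gro _ _ (l2norm a)) => x y.
by rewrite -dotvBr; exact: cauchy_schwarz_abs.
Qed.

Lemma Ex_dotv_sqr (a : V) : Ex (fun x => dotv a x ^+ 2) = l2norm a ^+ 2.
Proof.
have m2 := @measurable_sqr_X R 2.
have := integral_gauss_dotv a m2 (fun t => (sqr_ge0 t : (0 <= (t ^+ 2)%:E)%E)).
rewrite /Ex /Rintegral => ->; under eq_integral do rewrite exprMn EFinM.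
rewrite ge0_integralZl//.
- by rewrite normal_variance mule1.
- by move=> t _; rewrite lee_fin sqr_ge0.
- by rewrite lee_fin sqr_ge0.
Qed.

Lemma measurable_max0_sqr : measurable_fun setT (fun t : RR => (Num.max 0 t ^+ 2)%:E).
Proof.
apply/measurable_EFinP; apply: (@measurable_funX _ _ R).
by apply: (@measurable_maxr _ _ R).
Qed.

(** By symmetry, since [t^2] is the sum of the squares of its positive and negative parts. Half of
    the variance is what a one-sided energy estimate sees. *)
Lemma normal_half_variance : (\int[N01]_t ((Num.max 0 t ^+ 2)%R)%:E = ((1 / 2)%R)%:E)%E.
Proof.
have mp := measurable_max0_sqr.
have p0 (t : R) : (0%:E <= ((Num.max 0 t ^+ 2)%R)%:E)%E by rewrite lee_fin sqr_ge0.
have e1 := normal_integral_opp mp p0.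
have mn : measurable_fun setT (fun t : RR => (Num.max 0 (- t) ^+ 2)%:E).
  apply/measurable_EFinP; apply: (@measurable_funX _ _ R).
  apply: (@measurable_maxr _ _ R) => //; exact: (@measurable_funN _ _ R).
have := normal_variance (R := R).
have -> : (\int[N01]_t (t ^+ 2)%:E = \int[N01]_t (((Num.max 0 t ^+ 2)%R)%:E + ((Num.max 0 (- t) ^+ 2)%R)%:E))%E.
  apply: eq_integral => t _; rewrite -EFinD; congr EFin.
  have [t0|/ltW t0] := leP 0 t.
    by rewrite (max_idPl _) ?oppr_le0// expr0n addr0.
  by rewrite (max_idPr _) ?oppr_ge0// expr0n add0r sqrrN.
rewrite ge0_integralD//.
rewrite e1; case: (\int[N01]_t _)%E => //= r; rewrite -EFinD => -[h].
by congr EFin; lra.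
Qed.

Lemma Ex_dotv_max0_sqr (a : V) : Ex (fun x => Num.max 0 (dotv a x) ^+ 2) = l2norm a ^+ 2 / 2.
Proof.
have p0 (t : R) : (0%:E <= ((Num.max 0 t ^+ 2)%R)%:E)%E by rewrite lee_fin sqr_ge0.
have := integral_gauss_dotv a measurable_max0_sqr p0.
rewrite /Ex /Rintegral => ->.
under eq_integral => t _.
  rewrite -{1}(mulr0 (l2norm a)) -maxr_pMr ?l2norm_ge0// exprMn EFinM.
  over.
rewrite ge0_integralZl//.
- by rewrite normal_half_variance -EFinM /= mul1r.
- exact: measurable_max0_sqr.
- by rewrite lee_fin sqr_ge0.
Qed.

Lemma Ex_sqr_l2norm : Ex (fun x => l2norm x ^+ 2) = d%:R.
Proof.
transitivity (Ex (fun x => \sum_(i < d) (dotv (delta_mx ord0 i) x) ^+ 2)).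
  apply: eq_Ex => x; rewrite sqr_l2norm; apply: eq_bigr => i _.
  rewrite -expr2; congr (_ ^+ 2); rewrite /dotv (bigD1 i)//= big1 ?addr0; last first.
    by move=> j ji; rewrite !mxE (negbTE ji) andbF mul0r.
  by rewrite !mxE !eqxx mul1r.
have key (s : seq 'I_d) : gro 4 (fun x => \sum_(i <- s) (dotv (delta_mx ord0 i) x) ^+ 2) /\
    Ex (fun x => \sum_(i <- s) (dotv (delta_mx ord0 i) x) ^+ 2) = (size s)%:R.
  elim: s => [|i s [IH1 IH2]].
    by under eq_fun do rewrite big_nil; split; [exact: gro_cst|rewrite Ex_cst].
  have g : gro 4 (fun x => dotv (delta_mx ord0 i) x ^+ 2).
    by apply: groW (groX 2 (gro_dotv _)).
  under eq_fun do rewrite big_cons; split; first exact: groD.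
  rewrite ExD// IH2 Ex_dotv_sqr /= -natr1 addrC; congr (_ + _).
  rewrite sqr_l2norm /dotv (bigD1 i)//= big1 ?addr0; last first.
    by move=> j ji; rewrite !mxE (negbTE ji) andbF mul0r.
  by rewrite !mxE !eqxx mul1r.
have [_] := key (index_enum 'I_d).
by rewrite /index_enum -enumT size_enum_ord.
Qed.

Let q4 x : R := (1 + l2norm x) ^+ 4.

(** [1 + |x| + |y|] is at most [(1 + |x|) (1 + |y|)], so the double integral is dominated by a
    product of two finite fourth moments. *)
Lemma gro2_int k H : (k <= 4)%N -> gro2 k H ->
  (G \x G)%E.-integrable setT (fun z => (H (vec z.1) (vec z.2))%:E).
Proof.
move=> k4 /(gro2W k4) [mH [C C0 HC]].
have gq : gro 4 q4 := groX 4 (groD (gro_cst 1 1) gro_l2norm).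
have q0 x : 0 <= q4 x by rewrite exprn_ge0// addr_ge0// l2norm_ge0.
have mH' : measurable_fun setT (fun z : d.-tuple RR * d.-tuple RR => (H (vec z.1) (vec z.2))%:E).
  exact/measurable_EFinP.
apply: ((@integrable12ltyP _ _ _ _ _ G G _ mH').2).
have qi : (\int[G]_w (q4 (vec w))%:E)%E = (Ex q4)%:E by rewrite Ex_EFin.
have mq : measurable_fun setT (fun w => (q4 (vec w))%:E) by apply/measurable_EFinP; case: gq.
have inner (x : d.-tuple RR) : (\int[G]_y (C%:E * (q4 (vec x))%:E * (q4 (vec y))%:E) =
    ((C * Ex q4 * q4 (vec x))%R)%:E)%E.
  rewrite ge0_integralZl//.
  - by rewrite qi -!EFinM; congr EFin; ring.
  - by move=> y _; rewrite lee_fin.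
  - by rewrite mule_ge0// lee_fin.
apply: (@le_lt_trans _ _ (\int[G]_x \int[G]_y (C%:E * (q4 (vec x))%:E * (q4 (vec y))%:E)))%E.
  apply: ge0_le_integral => //.
  - by move=> x _; exact: integral_ge0.
  - apply: (measurable_fun_fubini_tonelli_F (m2 := G) (fun z => `|(H (vec z.1) (vec z.2))%:E|)%E) => //.
    exact: measurableT_comp.
  - under eq_fun do rewrite inner.
    by apply/measurable_EFinP; have [] := groZ (C * Ex q4) gq.
  move=> x _; apply: ge0_le_integral => //.
  - apply: measurableT_comp => //.
    apply/measurable_EFinP; have [m _] := gro_section (vec x) (conj mH (ex_intro2 _ _ C C0 HC) : gro2 4 H).
    exact: m.
  - exact: emeasurable_funM.
  move=> y _ /=; rewrite -!EFinM lee_fin (le_trans (HC _ _))// -mulrA ler_wpM2l//.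
  rewrite -exprMn lerXn2r ?nnegrE//.
  - by rewrite !addr_ge0// l2norm_ge0.
  - by rewrite mulr_ge0// addr_ge0// l2norm_ge0.
  - by have := l2norm_ge0 (vec x); have := l2norm_ge0 (vec y); nra.
under eq_integral do rewrite inner.
by rewrite (Ex_EFin (groZ _ gq)) ltry.
Qed.

End gaussian_expectation_ops.

(** * Independent pairs of Gaussian vectors and exchangeability *)

Section gaussian_pairs.
Context {R : realType} {d : nat}.
Local Notation RR := (measurableTypeR R).
Local Notation G := (@std_gaussian R d).
Local Notation V := 'rV[R]_d.
Local Notation vec := (@vec_of_tuple R d).
Implicit Types (F : V -> R) (H : V -> V -> R) (x y : V).

Lemma Ex2D (H1 H2 : V -> V -> R) : gro2 4 H1 -> gro2 4 H2 ->
  Ex2 (fun x y => H1 x y + H2 x y) = Ex2 H1 + Ex2 H2.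
Proof.
move=> /(gro2_int (leqnn _)) h1 /(gro2_int (leqnn _)) h2.
by apply: (@RintegralD _ _ R (G \x G)%E).
Qed.

Lemma Ex2B (H1 H2 : V -> V -> R) : gro2 4 H1 -> gro2 4 H2 ->
  Ex2 (fun x y => H1 x y - H2 x y) = Ex2 H1 - Ex2 H2.
Proof.
move=> /(gro2_int (leqnn _)) h1 /(gro2_int (leqnn _)) h2.
by apply: (@RintegralB _ _ R (G \x G)%E).
Qed.

Lemma Ex2Z a H : gro2 4 H -> Ex2 (fun x y => a * H x y) = a * Ex2 H.
Proof.
by move=> /(gro2_int (leqnn _)) h; apply: (@RintegralZl _ _ R (G \x G)%E) => //; exact: h.
Qed.

Lemma Ex2_ge0 H : (forall x y, 0 <= H x y) -> 0 <= Ex2 H.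
Proof. by move=> H0; apply: Rintegral_ge0. Qed.

Lemma eq_Ex2 (H1 H2 : V -> V -> R) : (forall x y, H1 x y = H2 x y) -> Ex2 H1 = Ex2 H2.
Proof. by move=> h; congr Ex2; apply/funext => x; apply/funext => y. Qed.

Lemma Ex2_iter k H : (k <= 4)%N -> gro2 k H ->
  gro k (fun x => Ex (H x)) /\ Ex2 H = Ex (fun x => Ex (H x)).
Proof.
move=> k4 gH; have iH := gro2_int k4 gH.
have inner x : (\int[G]_y (H x (vec y))%:E)%E = (Ex (H x))%:E.
  exact: Ex_EFin (groW k4 (gro_section x gH)).
have mI : measurable_fun setT (fun w : d.-tuple RR => (Ex (H (vec w)))%:E).
  have := @measurable_fubini_F _ _ _ _ _ G G _ iH.
  rewrite /fubini_F (_ : (fun _ => _) = (fun w : d.-tuple RR => (Ex (H (vec w)))%:E))//.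
  by apply/funext => w; rewrite -inner.
split; last first.
  rewrite /Ex2 {1}/Rintegral -(@integral12_prod_meas1 _ _ _ _ _ G G _ iH) /fubini_F.
  by congr fine; apply: eq_integral => w _; rewrite -inner.
split; first exact/measurable_EFinP.
case: gH => mH [C C0 HC].
pose q (y : V) : R := (1 + l2norm y) ^+ k.
have gq : gro 4 q.
  by apply: (@groW _ _ k) => //; have := groX k (groD (gro_cst 1 1) (@gro_l2norm R d)); rewrite mul1n.
have Hq x y : `|H x y| <= C * (1 + l2norm x) ^+ k * q y.
  rewrite (le_trans (HC x y))// -mulrA ler_wpM2l// -exprMn lerXn2r ?nnegrE//.
  - by rewrite !addr_ge0// l2norm_ge0.
  - by rewrite mulr_ge0// addr_ge0// l2norm_ge0.
  - by have := l2norm_ge0 x; have := l2norm_ge0 y; nra.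
have gHx x : gro 4 (H x).
  by apply: (groW k4); apply: gro_section; split => //; exists C.
exists (C * Ex q).
  rewrite mulr_ge0//; apply: Ex_ge0 => x.
  by rewrite exprn_ge0// addr_ge0// l2norm_ge0.
move=> x; rewrite mulrAC -ExZ//; rewrite ler_norml -mulN1r.
have gZ : gro 4 (fun y => C * (1 + l2norm x) ^+ k * q y) by exact: groZ.
rewrite -ExZ//; apply/andP; split; apply: le_Ex => //; try exact: groZ.
  by move=> y; have := Hq x y; rewrite ler_norml mulN1r => /andP[].
by move=> y; have := Hq x y; rewrite ler_norml => /andP[].
Qed.

Lemma Ex2E H : gro2 4 H -> Ex2 H = Ex (fun x => Ex (H x)).
Proof. by move=> h; have [] := Ex2_iter (leqnn 4) h. Qed.

Lemma le_Ex2 (H1 H2 : V -> V -> R) : gro2 4 H1 -> gro2 4 H2 ->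
  (forall x y, H1 x y <= H2 x y) -> Ex2 H1 <= Ex2 H2.
Proof.
move=> g1 g2 h; rewrite (Ex2E g1) (Ex2E g2); apply: le_Ex.
- by have [] := Ex2_iter (leqnn 4) g1.
- by have [] := Ex2_iter (leqnn 4) g2.
- by move=> x; apply: le_Ex => //; exact: gro_section.
Qed.

Lemma Ex2_fst F : gro 4 F -> Ex2 (fun x _ => F x) = Ex F.
Proof. by move=> h; rewrite Ex2E; [apply: eq_Ex => x; rewrite Ex_cst|exact: gro2_fst]. Qed.

Lemma Ex2_snd F : gro 4 F -> Ex2 (fun _ y => F y) = Ex F.
Proof. by move=> h; rewrite Ex2E; [rewrite Ex_cst|exact: gro2_snd]. Qed.

Lemma gro2_comp k a b a' b' H : gro2 k H ->
  gro2 k (fun x y => H (a *: x + b *: y) (a' *: x + b' *: y)).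
Proof.
move=> [mH [C C0 HC]]; split.
  rewrite /gmeas2; under eq_fun do rewrite -!vec_of_lin2.
  apply: (measurableT_comp mH (g := fun z => (lin2_tuple a b z.1 z.2, lin2_tuple a' b' z.1 z.2))).
  by apply/measurable_fun_pair => /=; apply: measurable_lin2_tuple.
pose M := 1 + `|a| + `|b| + `|a'| + `|b'|.
exists (C * M ^+ k); first by rewrite mulr_ge0// exprn_ge0// !addr_ge0.
move=> x y; rewrite (le_trans (HC _ _))// -mulrA ler_wpM2l// -exprMn.
rewrite lerXn2r ?nnegrE ?addr_ge0 ?mulr_ge0 ?addr_ge0 ?l2norm_ge0//.
have := l2normD (a *: x) (b *: y); have := l2normD (a' *: x) (b' *: y).
rewrite !l2normZ /M; have := l2norm_ge0 x; have := l2norm_ge0 y.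
have := normr_ge0 a; have := normr_ge0 b; have := normr_ge0 a'; have := normr_ge0 b'.
move: (l2norm (a *: _ + _)) (l2norm (a' *: _ + _)) (l2norm x) (l2norm y) `|a| `|b| `|a'| `|b'|.
by move=> p p' q r s t s' t'; nra.
Qed.

Lemma integral_rotation (c s : R) (K : d.-tuple RR * d.-tuple RR -> \bar R) :
  c ^+ 2 + s ^+ 2 = 1 -> measurable_fun setT K ->
  (\int[(G \x G)]_z K (lin2_tuple c s z.1 z.2, lin2_tuple (- s) c z.1 z.2) =
   \int[(G \x G)]_z K z)%E.
Proof.
move=> cs mK.
pose rot := fun z : d.-tuple RR * d.-tuple RR => (lin2_tuple c s z.1 z.2, lin2_tuple (- s) c z.1 z.2).
have mrot : measurable_fun setT rot.
  by apply/measurable_fun_pair => /=; apply: measurable_lin2_tuple.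
have pos (L : d.-tuple RR * d.-tuple RR -> \bar R) : measurable_fun setT L ->
    (forall z, 0 <= L z)%E -> (\int[(G \x G)]_z (L \o rot) z = \int[(G \x G)]_z L z)%E.
  move=> mL L0.
  have L0' z : (0 <= (L \o rot) z)%E by exact: L0.
  transitivity (\int[G]_x fubini_F G (L \o rot) x)%E.
    by apply: (@fubini_tonelli1 _ _ _ _ _ G G (L \o rot)) => //; exact: measurableT_comp.
  transitivity (\int[G]_x fubini_F G L x)%E; last first.
    by symmetry; apply: (@fubini_tonelli1 _ _ _ _ _ G G L).
  exact: (gauss_rotation cs mL L0).
rewrite [RHS]integralE [LHS]integralE; congr (_ - _)%E.
  rewrite -(pos (K^\+)%E (measurable_funepos mK) (fun z => funepos_ge0 K z)).
  by apply: eq_integral => z _; rewrite /= !funeposE.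
rewrite -(pos (K^\-)%E (measurable_funeneg mK) (fun z => funeneg_ge0 K z)).
by apply: eq_integral => z _; rewrite /= !funenegE.
Qed.

Lemma Ex2_rotation c s H : c ^+ 2 + s ^+ 2 = 1 -> gmeas2 H ->
  Ex2 (fun x y => H (c *: x + s *: y) (- s *: x + c *: y)) = Ex2 H.
Proof.
move=> cs mH; rewrite /Ex2 /Rintegral; congr fine.
rewrite -(@integral_rotation c s (fun z => (H (vec z.1) (vec z.2))%:E))//.
  by apply: eq_integral => z _; rewrite /= !vec_of_lin2.
exact/measurable_EFinP.
Qed.

Lemma Ex_lin2 a b F : a ^+ 2 + b ^+ 2 = 1 -> gro 4 F ->
  Ex2 (fun x y => F (a *: x + b *: y)) = Ex F.
Proof.
move=> ab gF; rewrite -[RHS]Ex2_fst//.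
by rewrite -(Ex2_rotation ab (H := fun x _ => F x))//; case: (gro2_fst gF).
Qed.

Lemma Ex_opp F : gro 4 F -> Ex (fun x => F (- x)) = Ex F.
Proof.
move=> gF; have ab : (-1) ^+ 2 + 0 ^+ 2 = 1 :> R by rewrite sqrrN expr1n expr0n addr0.
rewrite -(Ex_lin2 ab gF) Ex2E; last exact: gro2_lin.
apply: eq_Ex => x; rewrite (_ : (fun y => _) = (fun=> F (- x))) ?Ex_cst//.
by apply/funext => y; rewrite scaleN1r scale0r addr0.
Qed.

Lemma gro_opp k F : gro k F -> gro k (fun x => F (- x)).
Proof.
move=> gF; have := gro_section 0 (gro2_lin 0 (-1) gF).
rewrite (_ : (fun y => F (0 *: 0 + -1 *: y)) = (fun x => F (- x)))//.
by apply/funext => x; rewrite scale0r add0r scaleN1r.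
Qed.

Lemma gro_affine k F a x0 : gro k F -> gro k (fun x => F (a *: x + x0)).
Proof.
move=> gF; have := gro_section x0 (gro2_lin 1 a gF).
rewrite (_ : (fun y => F (1 *: x0 + a *: y)) = (fun x => F (a *: x + x0)))//.
by apply/funext => x; rewrite scale1r addrC.
Qed.

Lemma Ex2_reflection c s H : c ^+ 2 + s ^+ 2 = 1 -> gro2 4 H ->
  Ex2 (fun x y => H (c *: x + s *: y) (s *: x - c *: y)) = Ex2 H.
Proof.
move=> cs gH; pose H' x y := H x (- y).
have gH' : gro2 4 H'.
  have := gro2_comp 1 0 0 (-1) gH.
  rewrite (_ : (fun x y => H _ _) = H')//.
  apply/funext => x; apply/funext => y.
  by rewrite /H' scale1r !scale0r addr0 add0r scaleN1r.
transitivity (Ex2 H').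
  rewrite -(Ex2_rotation cs (H := H')); last by case: gH'.
  apply: eq_Ex2 => x y; rewrite /H' opprD !scaleNr opprK.
  by congr H; rewrite addrC.
rewrite !Ex2E//; apply: eq_Ex => x; apply: Ex_opp.
exact: gro_section.
Qed.

(** The reflection [(x, y) -> (c x + s y, s x - c y)] preserves the law of the pair and is an
    involution, so it swaps [x] and [c x + s y]. *)
Lemma Ex2_exchange c s H : c ^+ 2 + s ^+ 2 = 1 -> gro2 4 H ->
  Ex2 (fun x y => H x (c *: x + s *: y)) = Ex2 (fun x y => H (c *: x + s *: y) x).
Proof.
move=> cs gH; pose H' x y := H x (c *: x + s *: y).
have gH' : gro2 4 H'.
  have := gro2_comp 1 0 c s gH.
  rewrite (_ : (fun x y => H _ _) = H')//.
  by apply/funext => x; apply/funext => y; rewrite /H' scale1r scale0r addr0.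
rewrite -[LHS](Ex2_reflection cs gH'); apply: eq_Ex2 => x y; rewrite /H'.
congr H; apply/rowP => i; rewrite !mxE.
by transitivity ((c ^+ 2 + s ^+ 2) * x ord0 i); [ring|rewrite cs mul1r].
Qed.

End gaussian_pairs.

Opaque Ex Ex2.

(** * Ornstein-Uhlenbeck operators and the decay of correlations *)

Section mehler.
Context {R : realType} {d : nat}.
Local Notation RR := (measurableTypeR R).
Local Notation V := 'rV[R]_d.
Implicit Types (f g H : V -> R) (x y v : V).

Lemma Ex_cauchy_schwarz f g : gro 2 f -> gro 2 g ->
  Ex (fun x => f x * g x) ^+ 2 <= Ex (fun x => f x ^+ 2) * Ex (fun x => g x ^+ 2).
Proof.
move=> gf gg; set b := Ex _; set a := Ex (fun x => f x ^+ 2); set c := Ex _.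
have ga : gro 4 (fun x => f x ^+ 2) by exact: (groX 2 gf).
have gc : gro 4 (fun x => g x ^+ 2) by exact: (groX 2 gg).
have gb : gro 4 (fun x => f x * g x) by exact: (groM gf gg).
have P t : 0 <= a - 2 * t * b + t ^+ 2 * c.
  rewrite -!ExZ// -ExB//; last exact: groZ.
  rewrite -ExD//; [|by apply: groB => //; exact: groZ|exact: groZ].
  apply: Ex_ge0 => x.
  rewrite (_ : _ + _ = (f x - t * g x) ^+ 2) ?sqr_ge0//; ring.
have c0 : 0 <= c by apply: Ex_ge0 => x; exact: sqr_ge0.
have [cz|cnz] := eqVneq c 0.
  have [->|b0] := eqVneq b 0; first by rewrite cz mulr0 expr0n.
  (* With [c = 0] the quadratic is affine in [t], and at this point it takes the value -1. *)
  have := P ((a + 1) / (2 * b)); rewrite cz mulr0 addr0.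
  rewrite (_ : 2 * ((a + 1) / (2 * b)) * b = a + 1); last by field.
  lra.
have cp : 0 < c by rewrite lt_neqAle eq_sym cnz.
have := P (b / c); rewrite -(pmulr_rge0 _ cp).
rewrite (_ : c * _ = a * c - b ^+ 2); last by field.
by rewrite subr_ge0.
Qed.

(** The Ornstein-Uhlenbeck semigroup with [r] the exponential of minus the time: [r = 1] is the
    identity and [r = 0] the expectation. *)
Definition mehler (r : R) f x := Ex (fun y => f (r *: x + Num.sqrt (1 - r ^+ 2) *: y)).

Lemma sqr_mehler_weights (r : R) : 0 <= r <= 1 -> r ^+ 2 + Num.sqrt (1 - r ^+ 2) ^+ 2 = 1.
Proof.
move=> r01; rewrite sqr_sqrtr; first by rewrite addrC subrK.
by rewrite subr_ge0 expr_le1//; case/andP: r01.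
Qed.

Lemma gro_mehler k r f : (k <= 4)%N -> gro k f -> gro k (mehler r f).
Proof. by move=> k4 gf; have [] := Ex2_iter k4 (gro2_lin r (Num.sqrt (1 - r ^+ 2)) gf). Qed.

Lemma Ex_mehler_mul r f g : gro 2 f -> gro 2 g ->
  Ex (fun x => f x * mehler r g x) =
  Ex2 (fun x y => f x * g (r *: x + Num.sqrt (1 - r ^+ 2) *: y)).
Proof.
move=> gf gg; rewrite Ex2E; last exact: (gro2M (gro2_fst gf) (gro2_lin _ _ gg)).
apply: eq_Ex => x; rewrite ExZ//; apply: (@groW _ _ 2) => //.
exact: (gro_section x (gro2_lin _ _ gg)).
Qed.

Lemma mehler_sym r f g : 0 <= r <= 1 -> gro 2 f -> gro 2 g ->
  Ex (fun x => f x * mehler r g x) = Ex (fun x => g x * mehler r f x).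
Proof.
move=> r01 gf gg; rewrite !Ex_mehler_mul//.
have gH : gro2 4 (fun x y => f x * g y).
  exact: (gro2M (gro2_fst gf) (gro2_snd gg)).
rewrite (Ex2_exchange (sqr_mehler_weights r01) gH).
by apply: eq_Ex2 => x y; rewrite mulrC.
Qed.

(** The two independent noises have variances [r^2 (1 - r^2)] and [1 - r^2], which add up to
    [1 - r^4]; a rotation merges them into one. For [t = 0] both noises vanish. *)
Lemma mehler_mehler r f x : 0 <= r <= 1 -> gro 2 f ->
  mehler r (mehler r f) x = mehler (r ^+ 2) f x.
Proof.
move=> r01 gf; have r2 : r ^+ 2 <= 1 by rewrite expr_le1//; case/andP: r01.
have s2 : Num.sqrt (1 - r ^+ 2) ^+ 2 = 1 - r ^+ 2 by rewrite sqr_sqrtr ?subr_ge0.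
rewrite /mehler; set s := Num.sqrt (1 - r ^+ 2) in s2 *.
have r4 : r ^+ 2 ^+ 2 <= 1 by rewrite expr_le1// sqr_ge0.
have t2 : Num.sqrt (1 - r ^+ 2 ^+ 2) ^+ 2 = 1 - r ^+ 2 ^+ 2 by rewrite sqr_sqrtr ?subr_ge0.
set t := Num.sqrt _ in t2 *.
have [t0|tn0] := eqVneq t 0.
  have s0 : s = 0.
    apply/eqP; rewrite -sqrf_eq0 s2; move: t2; rewrite t0 expr0n/= => /esym/eqP.
    by move: r2; have := sqr_ge0 r; set q := r ^+ 2 => q0 q1 /eqP h; apply/eqP; nra.
  rewrite s0 t0; apply: eq_Ex => y; rewrite !scale0r !addr0.
  rewrite (_ : (fun=> _) = (fun=> f (r ^+ 2 *: x))) ?Ex_cst//.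
  by apply/funext => z; rewrite scale0r addr0 scalerA -expr2.
pose F z := f (t *: z + r ^+ 2 *: x).
have gF : gro 4 F by apply: (@groW _ _ 2) => //; exact: gro_affine.
transitivity (Ex F); last by apply: eq_Ex => y; rewrite /F addrC.
have ab : (r * s / t) ^+ 2 + (s / t) ^+ 2 = 1.
  rewrite !exprMn exprVn s2 t2 -mulrDl -[X in _ + X]mul1r -mulrDl.
  rewrite (_ : (r ^+ 2 + 1) * (1 - r ^+ 2) = 1 - r ^+ 2 ^+ 2); last by ring.
  by rewrite divff// -t2 sqrf_eq0.
rewrite -(Ex_lin2 ab gF) Ex2E; last exact: gro2_lin.
apply: eq_Ex => y; apply: eq_Ex => z; rewrite /F; congr f.
by apply/rowP => i; rewrite !mxE; field.
Qed.

(* Semigroup property and symmetry turn the square norm of [mehler r f] into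
   the correlation at r^2. *)
Lemma mehler_doubling r f : 0 <= r <= 1 -> gro 2 f ->
  Ex (fun x => f x * mehler r f x) ^+ 2 <=
  Ex (fun x => f x ^+ 2) * Ex (fun x => f x * mehler (r ^+ 2) f x).
Proof.
move=> r01 gf; have gm : gro 2 (mehler r f) by exact: gro_mehler.
have E : Ex (fun x => mehler r f x ^+ 2) = Ex (fun x => f x * mehler (r ^+ 2) f x).
  transitivity (Ex (fun x => mehler r f x * mehler r f x)).
    by apply: eq_Ex => x; exact: expr2.
  transitivity (Ex (fun x => f x * mehler r (mehler r f) x)).
    exact: mehler_sym.
  by apply: eq_Ex => x; congr (_ * _); exact: mehler_mehler.
exact: (eq_ind _ (fun z => _ <= _ * z) (Ex_cauchy_schwarz gf gm) _ E).
Qed.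

(** By the Bernoulli inequality, powers of a [q > 1] grow at least linearly in the exponent. *)
Lemma pow2_bounded_le1 (q C : R) : 0 <= q -> (forall k, q ^+ (2 ^ k) <= C) -> q <= 1.
Proof.
move=> q0 qC; rewrite leNgt; apply/negP => q1.
pose h := q - 1; have h0 : 0 < h by rewrite subr_gt0.
have B n : 1 + n%:R * h <= q ^+ n.
  elim: n => [|n IH]; first by rewrite mul0r addr0 expr0.
  rewrite exprS (_ : q = 1 + h) in IH *; last by rewrite addrC subrK.
  have n0 : 0 <= n%:R :> R by [].
  rewrite (le_trans _ (ler_wpM2l _ IH))//; last by rewrite addr_ge0// ltW.
  by rewrite -natr1; nra.
have [N HN] : exists N : nat, C < N%:R * h.
  exists (Num.truncn (`|C| / h)).+1; rewrite -ltr_pdivrMr//.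
  apply: le_lt_trans (truncnS_gt _); rewrite ler_pM2r ?invr_gt0//; exact: ler_norm.
have := le_trans (B (2 ^ N)%N) (qC N); apply/negP; rewrite -ltNge.
apply: (lt_le_trans HN); rewrite -[N%:R * h]add0r lerD//.
by apply: ler_wpM2r; [exact: ltW|rewrite ler_nat; apply: ltnW; exact: ltn_expl].
Qed.

Lemma gebelein_step (A v u w : R) N : 0 <= A -> 0 < v ->
  A ^+ N * v <= v ^+ N * u -> u ^+ 2 <= v * w -> A ^+ (N * 2) * v <= v ^+ (N * 2) * w.
Proof.
move=> A0 v0 h1 h2; rewrite !exprM.
have a0 : 0 <= A ^+ N by exact: exprn_ge0.
have b0 : 0 < v ^+ N by exact: exprn_gt0.
move: (A ^+ N) (v ^+ N) a0 b0 h1 => a b a0 b0 h1.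
rewrite -(ler_pM2r v0); apply: (@le_trans _ _ ((a * v) ^+ 2)); first by rewrite exprMn; lra.
apply: (@le_trans _ _ ((b * u) ^+ 2)).
  by rewrite ler_sqr ?nnegrE//; [rewrite mulr_ge0// ltW|rewrite (le_trans _ h1)// mulr_ge0// ltW].
rewrite exprMn (_ : b ^+ 2 * w * v = b ^+ 2 * (v * w)); last by ring.
by rewrite ler_wpM2l// sqr_ge0.
Qed.

(** With [c(r)] the correlation, iterated doubling gives [c(r)^N v <= v^N c(r^N)] for [N = 2^k], and
    the linear bound turns this into [(c(r) / (r v))^N <= C / v]. A number with bounded powers is at
    most 1, so an arbitrary constant [C] improves to [v]. This stands in for the Hermite
    expansion. *)
Lemma gebelein f C : gro 2 f ->
  (forall r, 0 <= r <= 1 -> Ex (fun x => f x * mehler r f x) <= C * r) ->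
  forall r, 0 <= r <= 1 ->
    Ex (fun x => f x * mehler r f x) <= r * Ex (fun x => f x ^+ 2).
Proof.
move=> gf fC r r01; pose c r := Ex (fun x => f x * mehler r f x).
set v := Ex (fun x => f x ^+ 2).
have v0 : 0 <= v by apply: Ex_ge0 => x; exact: sqr_ge0.
have [r0 r1] := andP r01; rewrite -/(c r).
have [c0|cp] := leP (c r) 0; first by rewrite (le_trans c0)// mulr_ge0.
have rp : 0 < r.
  rewrite lt_neqAle r0 andbT eq_sym; apply/eqP => rz.
  by have := fC r r01; rewrite -/(c r) rz mulr0 leNgt; rewrite rz in cp; rewrite cp.
have vp : 0 < v.
  rewrite lt_neqAle v0 andbT eq_sym; apply/eqP => vz.
  have := mehler_doubling r01 gf; rewrite -/(c r) -/v vz mul0r leNgt.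
  by rewrite exprn_gt0.
have rk k : 0 <= r ^+ k <= 1 by rewrite exprn_ge0// exprn_ile1.
have K k : (c r) ^+ (2 ^ k) * v <= v ^+ (2 ^ k) * c (r ^+ (2 ^ k)) /\ 0 < c (r ^+ (2 ^ k)).
  elim: k => [|k].
    by rewrite expn0 !expr1 mulrC; split; [exact: lexx|exact: cp].
  have -> : (2 ^ k.+1 = 2 ^ k * 2)%N by exact: expnSr.
  move: (2 ^ k)%N => N [IH IH0].
  have D : c (r ^+ N) ^+ 2 <= v * c (r ^+ (N * 2)).
    by rewrite exprM; exact: mehler_doubling (rk N) gf.
  split; first exact: gebelein_step (ltW cp) vp IH D.
  rewrite -(pmulr_rgt0 _ vp); apply: lt_le_trans D; exact: exprn_gt0.
have [_ c1] := K 0%N; pose q := c r / (r * v).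
have rv : 0 < r * v by exact: mulr_gt0.
suff q1 : q <= 1 by rewrite -[X in _ <= X]mul1r -ler_pdivrMr.
apply: (@pow2_bounded_le1 _ (C / v)); first by apply: divr_ge0; exact: ltW.
move=> k; have [Kk K0] := K k; have E := fC _ (rk (2 ^ k)%N).
move: Kk K0 E; rewrite -/(c _) /q; move: (2 ^ k)%N => N Kk K0 E.
rewrite expr_div_n exprMn ler_pdivrMr; last by apply: mulr_gt0; exact: exprn_gt0.
rewrite -(ler_pM2r vp); apply: (le_trans Kk).
apply: (@le_trans _ _ (v ^+ N * (C * r ^+ N))).
  by apply: ler_wpM2l E; apply: exprn_ge0.
rewrite le_eqVlt; apply/orP; left; apply/eqP; field.
by rewrite gt_eqF.
Qed.

End mehler.

(** * The Gaussian Poincare inequality under one-sided quadratic bounds *)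

Section poincare.
Context {R : realType} {d : nat}.
Local Notation RR := (measurableTypeR R).
Local Notation V := 'rV[R]_d.
Implicit Types (f g H : V -> R) (x y v : V).

Lemma gro_norm k f : gro k f -> gro k (fun x => `|f x|).
Proof.
move=> [mf [C C0 fC]]; split; last by exists C => // x; rewrite normr_id.
exact: (measurableT_comp (@normr_measurable R setT) mf).
Qed.

(** For centred [f] the product of [f x] and [f (s y)] has mean 0. Subtracting it leaves an
    increment of [f] between points at distance [r |x|], whence the factor [r]. *)
Lemma correlation_linear_bound f L : gro 2 f -> Ex f = 0 ->
  (forall x y, `|f x - f y| <= L * (1 + l2norm x + l2norm y) * l2norm (x - y)) ->
  exists C, forall r, 0 <= r <= 1 -> Ex (fun x => f x * mehler r f x) <= C * r.
Proof.
move=> gf f0 fL.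
pose B x y := `|f x| * (`|L| * (l2norm x * (1 + l2norm x + 2 * l2norm y))).
have gB : gro2 4 B.
  apply: (@gro2M _ _ 2 2); first exact: gro2_fst (gro_norm gf).
  apply: gro2Z; apply: (@gro2M _ _ 1 1); first exact: gro2_fst (@gro_l2norm R d).
  apply: gro2D; last exact: gro2Z (gro2_snd (@gro_l2norm R d)).
  by apply: gro2D; [exact: gro2_cst|exact: gro2_fst (@gro_l2norm R d)].
exists (Ex2 B) => r /[dup] r01 /andP[r0 r1]; rewrite Ex_mehler_mul//.
set s := Num.sqrt _.
have s0 : 0 <= s by exact: sqrtr_ge0.
have s1 : s <= 1.
  rewrite -ler_sqr ?nnegrE// expr1n sqr_sqrtr; last by rewrite subr_ge0 expr_le1.
  by rewrite gerBl sqr_ge0.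
have g1 : gro2 4 (fun x y => f x * f (r *: x + s *: y)).
  exact: (gro2M (gro2_fst gf) (gro2_lin _ _ gf)).
have g2 : gro2 4 (fun x y => f x * f (0 *: x + s *: y)).
  exact: (gro2M (gro2_fst gf) (gro2_lin _ _ gf)).
have z : Ex2 (fun x y => f x * f (0 *: x + s *: y)) = 0.
  rewrite Ex2E//.
  transitivity (Ex (fun x => Ex (fun y => f (s *: y)) * f x)); last first.
    by rewrite ExZ ?f0 ?mulr0//; exact: groW gf.
  apply: eq_Ex => x; rewrite mulrC -ExZ; last first.
    by apply: (@groW _ _ 2) => //; have := gro_affine s 0 gf; under eq_fun do rewrite addr0.
  by apply: eq_Ex => y; rewrite scale0r add0r.
rewrite -[X in X <= _]subr0 -z -Ex2B// mulrC -Ex2Z//.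
apply: le_Ex2; [exact: gro2B|exact: gro2Z|] => x y.
rewrite -mulrBr scale0r add0r.
apply: (le_trans (ler_norm _)); rewrite normrM /B mulrCA ler_wpM2l//.
apply: (le_trans (fL _ _)); rewrite addrK l2normZ (ger0_norm r0).
have := l2normD (r *: x) (s *: y); rewrite !l2normZ (ger0_norm r0) (ger0_norm s0).
move: (l2norm_ge0 (r *: x + s *: y)) (l2norm_ge0 x) (l2norm_ge0 y).
move: (l2norm (_ + _)) (l2norm x) (l2norm y) => p a b p0 a0 b0 ab.
have -> : r * (`|L| * (a * (1 + a + 2 * b))) = `|L| * (1 + a + 2 * b) * (r * a) by ring.
apply: ler_wpM2r; first exact: mulr_ge0.
have e0 : 0 <= 1 + p + s * b by rewrite !addr_ge0// mulr_ge0.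
apply: (@le_trans _ _ (`|L| * (1 + p + s * b))); first by rewrite ler_wpM2r// ler_norm.
by rewrite ler_wpM2l//; nra.
Qed.

(** The left side is half the mean square of the increment over the pair [(x, r x + s y)]. The pair
    is exchangeable, so positive and negative increments contribute equally. Keeping the positive
    part is what lets an upper bound on increments suffice. *)
Lemma mehler_sqr_diff r f : 0 <= r <= 1 -> gro 2 f ->
  Ex (fun x => f x ^+ 2) - Ex (fun x => f x * mehler r f x) =
  Ex2 (fun x y => Num.max 0 (f (r *: x + Num.sqrt (1 - r ^+ 2) *: y) - f x) ^+ 2).
Proof.
move=> r01 gf; rewrite Ex_mehler_mul//; set s := Num.sqrt _.
have rs := sqr_mehler_weights r01.
pose F x z := Num.max 0 (f z - f x) ^+ 2.
have gF : gro2 4 F.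
  apply: (@gro2_sqr _ _ 2); apply: gro2_max0.
  by apply: gro2B; [exact: gro2_snd|exact: gro2_fst].
have lin k (H : V -> V -> R) : gro2 k H -> gro2 k (fun x y => H x (r *: x + s *: y)).
  move=> gH; have := gro2_comp 1 0 r s gH.
  rewrite (_ : (fun x y => H _ _) = (fun x y => H x (r *: x + s *: y)))//.
  by apply/funext => x; apply/funext => y; rewrite scale1r scale0r addr0.
have gF2 : gro2 4 (fun x y => F (r *: x + s *: y) x).
  apply: (lin _ (fun x z => F z x)); apply: (@gro2_sqr _ _ 2); apply: gro2_max0.
  by apply: gro2B; [exact: gro2_fst|exact: gro2_snd].
have E1 : Ex2 (fun x y => F x (r *: x + s *: y)) = Ex2 (fun x y => F (r *: x + s *: y) x).
  exact: Ex2_exchange.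
have gf2 : gro 4 (fun x => f x ^+ 2) by exact: (groX 2 gf).
have gp : gro2 4 (fun x y => f x * f (r *: x + s *: y)).
  exact: (gro2M (gro2_fst gf) (gro2_lin _ _ gf)).
have E2 : Ex2 (fun x y => F x (r *: x + s *: y) + F (r *: x + s *: y) x) =
   Ex2 (fun x y => f x ^+ 2 + f (r *: x + s *: y) ^+ 2 - 2 * (f x * f (r *: x + s *: y))).
  apply: eq_Ex2 => x y; rewrite /F; move: (f x) (f _) => a b.
  rewrite /Num.max; case: ifPn; case: ifPn; rewrite -?leNgt ?subr_gt0 ?subr_le0 => h1 h2; try ring.
    by exfalso; lra.
  by have -> : a = b; [lra|ring].
have gb : gro2 4 (fun x y => f x ^+ 2 + f (r *: x + s *: y) ^+ 2).
  by apply: gro2D; [exact: gro2_fst|exact: (@gro2_lin _ _ 4 r s _ gf2)].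
rewrite Ex2D// in E2; last exact: lin.
rewrite -E1 Ex2B// in E2; last exact: gro2Z.
rewrite Ex2D// in E2; [|exact: gro2_fst|exact: (@gro2_lin _ _ 4 r s _ gf2)].
rewrite Ex2Z// Ex2_fst// in E2.
rewrite (_ : Ex2 (fun x y => f (r *: x + s *: y) ^+ 2) = Ex (fun x => f x ^+ 2)) in E2; last first.
  exact: (@Ex_lin2 _ _ r s (fun x => f x ^+ 2)).
move: E2; rewrite /F; lra.
Qed.

(** To first order the positive part of the increment is at most [s] times that of [dotv a y], whose
    mean square is [|a|^2 / 2], while [s^2 <= 2 (1 - r)]: this yields [(1 - r) Ex H]. The remaining
    terms are of size [1 - r] before squaring and are collected in [B]. *)
Lemma mehler_energy f H K : gro 2 f -> gro 2 H -> 0 <= K ->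
  (forall x, exists2 a, l2norm a ^+ 2 <= H x &
     forall v, f (x + v) <= f x + dotv a v + K * l2norm v ^+ 2) ->
  exists C, forall r, 0 <= r < 1 ->
    Ex (fun x => f x ^+ 2) - Ex (fun x => f x * mehler r f x) <=
    (1 - r) * (Ex H + C * Num.sqrt (1 - r)).
Proof.
move=> gf gH K0 fa.
have gH4 : gro 4 H by exact: groW gH.
pose B x y := H x + (1 + 2 * K) * l2norm x ^+ 2 + 4 * K * l2norm y ^+ 2.
have gn2 : gro 2 (fun x => l2norm x ^+ 2 : R) by exact: (groX 2 (@gro_l2norm R d)).
have gB : gro2 2 B.
  apply: gro2D; last exact/gro2Z/gro2_snd.
  apply: gro2D; first exact: gro2_fst.
  exact/gro2Z/gro2_fst.
have gB2 : gro2 4 (fun x y => B x y ^+ 2) by exact: (@gro2_sqr _ _ 2).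
exists (Ex H + 2 * Ex2 (fun x y => B x y ^+ 2)) => r /andP[r0 r1].
have r01 : 0 <= r <= 1 by rewrite r0 ltW.
rewrite mehler_sqr_diff//; set s := Num.sqrt (1 - r ^+ 2); set e := Num.sqrt (1 - r).
have dr : 0 < 1 - r by rewrite subr_gt0.
have e0 : 0 < e by rewrite sqrtr_gt0.
have e2 : e ^+ 2 = 1 - r by rewrite sqr_sqrtr// ltW.
have s0 : 0 <= s by exact: sqrtr_ge0.
have s2 : s ^+ 2 = 1 - r ^+ 2 by have := sqr_mehler_weights r01; rewrite -/s; lra.
have s2le : s ^+ 2 <= 2 * (1 - r) by rewrite s2; nra.
have e1 : e <= 1 by rewrite -ler_sqr ?nnegrE ?(ltW e0)// e2 expr1n gerBl.
pose F x y := Num.max 0 (f (r *: x + s *: y) - f x) ^+ 2.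
have gF : gro2 4 F.
  apply: (@gro2_sqr _ _ 2); apply: gro2_max0.
  by apply: gro2B; [exact: gro2_lin|exact: gro2_fst].
have gBx x : gro 4 (fun y => B x y ^+ 2) := gro_section x gB2.
have gEB : gro 4 (fun x => Ex (fun y => B x y ^+ 2)) by have [] := Ex2_iter (leqnn 4) gB2.
have gEF : gro 4 (fun x => Ex (F x)) by have [] := Ex2_iter (leqnn 4) gF.
have gR : gro 4 (fun x => (1 + e) * (1 - r) * H x + 2 * (1 - r) * e * Ex (fun y => B x y ^+ 2)).
  by apply: groD; exact: groZ.
have key x : Ex (F x) <=
    (1 + e) * (1 - r) * H x + 2 * (1 - r) * e * Ex (fun y => B x y ^+ 2).
  have [a aH fv] := fa x.
  have H0 : 0 <= H x by rewrite (le_trans _ aH)// sqr_ge0.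
  have ga : gro 4 (fun y => Num.max 0 (dotv a y) ^+ 2).
    apply: (@groW _ _ 2) => //; apply: (@groX _ _ 1 2).
    by apply: gro_max; [exact: gro_cst|exact: gro_dotv].
  have pw y : F x y <= (1 + e) * s ^+ 2 * Num.max 0 (dotv a y) ^+ 2
                      + 2 * (1 - r) * e * B x y ^+ 2.
    have D : f (r *: x + s *: y) - f x <= s * dotv a y + (1 - r) * B x y.
      have := fv ((r - 1) *: x + s *: y).
      rewrite addrA -{1}[x]scale1r -scalerDl addrCA subrr addr0.
      rewrite dotvDr !dotvZr => h.
      rewrite lerBlDl; apply: (le_trans h); rewrite -!addrA lerD2l.
      have n2 : l2norm ((r - 1) *: x + s *: y) ^+ 2 <=
          2 * ((1 - r) ^+ 2 * l2norm x ^+ 2) + 2 * (s ^+ 2 * l2norm y ^+ 2).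
        have := sqr_ge0 (l2norm ((r - 1) *: x - s *: y)).
        rewrite sqr_l2normB sqr_l2normD !l2normZ !exprMn !real_normK ?num_real//.
        by rewrite -(sqrrN (r - 1)) opprB; lra.
      have ax : - dotv a x <= H x + l2norm x ^+ 2.
        have := sqr_ge0 (l2norm (a + x)); rewrite sqr_l2normD.
        have := sqr_ge0 (l2norm a); have := sqr_ge0 (l2norm x); move: aH; lra.
      have := sqr_ge0 (l2norm x); have := sqr_ge0 (l2norm y).
      rewrite /B; move: (l2norm x ^+ 2) (l2norm y ^+ 2) (dotv a x) n2 ax => X Y ax n2 hax Y0 X0.
      have KX : 0 <= K * X by rewrite mulr_ge0.
      have KY : 0 <= K * Y by rewrite mulr_ge0.
      have := ler_wpM2l K0 n2; move: (K * l2norm _ ^+ 2) => q hq.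
      have : K * (2 * ((1 - r) ^+ 2 * X) + 2 * (s ^+ 2 * Y)) <= 2 * (1 - r) * (K * X) + 4 * (1 - r) * (K * Y).
        rewrite (_ : K * _ = 2 * (1 - r) ^+ 2 * (K * X) + 2 * s ^+ 2 * (K * Y)); last by ring.
        apply: lerD; apply: ler_wpM2r => //; nra.
      have := ler_wpM2l (ltW dr) hax; move: hq; nra.
    have B0 : 0 <= B x y.
      rewrite /B !addr_ge0// mulr_ge0 ?sqr_ge0// ?addr_ge0// mulr_ge0//.
    have p0 : 0 <= Num.max 0 (dotv a y) by rewrite le_max lexx.
    have pa : dotv a y <= Num.max 0 (dotv a y) by rewrite le_max lexx orbT.
    have mD : Num.max 0 (f (r *: x + s *: y) - f x) <= s * Num.max 0 (dotv a y) + (1 - r) * B x y.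
      rewrite ge_max addr_ge0 ?mulr_ge0 ?(ltW dr)//= (le_trans D)// lerD2r.
      exact: ler_wpM2l.
    have m0 : 0 <= Num.max 0 (f (r *: x + s *: y) - f x) by rewrite le_max lexx.
    rewrite /F; move: (Num.max 0 (f _ - f x)) (Num.max 0 (dotv a y)) (B x y) mD m0 p0 B0 => M p b mD m0 p0 b0.
    apply: (@le_trans _ _ ((s * p + (1 - r) * b) ^+ 2)).
      by rewrite ler_sqr ?nnegrE// addr_ge0 ?mulr_ge0 ?(ltW dr).
    rewrite -e2.
    (* (p + q)^2 <= (1 + e) p^2 + (1 + 1/e) q^2 *)
    have h : 2 * (s * p) * (e * b) <= (s * p) ^+ 2 + (e * b) ^+ 2.
      by have := sqr_ge0 (s * p - e * b); lra.
    have := ler_wpM2l (ltW e0) h.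
    have : e ^+ 4 * b ^+ 2 <= e ^+ 3 * b ^+ 2.
      by rewrite ler_wpM2r ?sqr_ge0// exprS ler_piMl// exprn_ge0// ltW.
    rewrite (_ : e * (2 * (s * p) * (e * b)) = 2 * (s * p) * (e ^+ 2 * b)); last by ring.
    rewrite (_ : e * ((s * p) ^+ 2 + (e * b) ^+ 2) = e * s ^+ 2 * p ^+ 2 + e ^+ 3 * b ^+ 2); last by ring.
    rewrite (_ : (s * p + e ^+ 2 * b) ^+ 2 = s ^+ 2 * p ^+ 2 + 2 * (s * p) * (e ^+ 2 * b) + e ^+ 4 * b ^+ 2); last by ring.
    rewrite (_ : 2 * e ^+ 2 * e * b ^+ 2 = 2 * (e ^+ 3 * b ^+ 2)); last by ring.
    move: (e ^+ 3 * b ^+ 2) (e ^+ 4 * b ^+ 2) => u w; lra.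
  have := le_Ex (gro_section x gF) _ pw; rewrite ExD; [|exact: groZ|exact: groZ].
  rewrite !ExZ// Ex_dotv_max0_sqr => /(_ _)/le_trans; apply.
    by apply: groD; exact: groZ.
  rewrite lerD2r (_ : _ * (l2norm a ^+ 2 / 2) = (1 + e) / 2 * (s ^+ 2 * l2norm a ^+ 2)); last by ring.
  rewrite (_ : _ * H x = (1 + e) / 2 * (2 * (1 - r) * H x)); last by field.
  rewrite ler_wpM2l ?divr_ge0 ?addr_ge0 ?(ltW e0)//.
  by apply: ler_pM => //; exact: sqr_ge0.
rewrite Ex2E//; apply: (le_trans (le_Ex gEF gR key)).
rewrite ExD; [|exact: groZ|exact: groZ]; rewrite !ExZ// -Ex2E//.
by rewrite le_eqVlt; apply/orP; left; apply/eqP; ring.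
Qed.

(** An elementary form of the limit [r -> 1]: the inequality is tested at [r = 1 - e^2], where the
    square root is [e]. *)
Lemma le_sqrt_limit (A B C : R) :
  (forall r, 0 <= r < 1 -> A <= B + C * Num.sqrt (1 - r)) -> A <= B.
Proof.
move=> h; rewrite leNgt; apply/negP => AB.
pose e := Num.min 1 ((A - B) / (2 * (`|C| + 1))).
have C1 : 0 < `|C| + 1 by rewrite ltr_wpDl.
have e0 : 0 < e by rewrite lt_min ltr01 divr_gt0 ?subr_gt0// mulr_gt0.
have e1 : e <= 1 by rewrite ge_min lexx.
have := h (1 - e ^+ 2); rewrite subr_ge0 expr_le1 ?(ltW e0)// e1 gtrBl exprn_gt0//.
rewrite opprB addrCA subrr addr0 sqrtr_sqr (ger0_norm (ltW e0)) => /(_ isT).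
have : e * (`|C| + 1) <= (A - B) / 2.
  rewrite -ler_pdivlMr// (_ : (A - B) / 2 / _ = (A - B) / (2 * (`|C| + 1))) ?ge_min ?lexx ?orbT//.
  by field; rewrite gt_eqF.
have : C * e <= `|C| * e by rewrite ler_wpM2r ?(ltW e0)// ler_norm.
lra.
Qed.

(** For the centred function [g], the correlation bound shows that the energy at [r] is at least
    [(1 - r) Ex g^2], and the short-time estimate that it is at most
    [(1 - r) (Ex H + C2 sqrt (1 - r))]. Divide by [1 - r] and let [r] tend to 1. *)
Lemma poincare f H K L : gro 2 f -> gro 2 H -> 0 <= K ->
  (forall x y, `|f x - f y| <= L * (1 + l2norm x + l2norm y) * l2norm (x - y)) ->
  (forall x, exists2 a, l2norm a ^+ 2 <= H x &
     forall v, f (x + v) <= f x + dotv a v + K * l2norm v ^+ 2) ->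
  Ex (fun x => f x ^+ 2) - Ex f ^+ 2 <= Ex H.
Proof.
move=> gf gH K0 fL fa; pose g x := f x - Ex f.
have gf4 : gro 4 f by exact: groW gf.
have gg : gro 2 g by apply: groB => //; exact: gro_cst.
have g0 : Ex g = 0 by rewrite /g ExB ?Ex_cst ?subrr//; exact: gro_cst.
have gL x y : `|g x - g y| <= L * (1 + l2norm x + l2norm y) * l2norm (x - y).
  by rewrite /g opprB addrA subrK.
have ga x : exists2 a, l2norm a ^+ 2 <= H x &
     forall v, g (x + v) <= g x + dotv a v + K * l2norm v ^+ 2.
  by have [a aH fv] := fa x; exists a => // v; have := fv v; rewrite /g; lra.
have [C1 c1] := correlation_linear_bound gg g0 gL.
have [C2 c2] := mehler_energy gg gH K0 ga.
have gsq : gro 4 (fun x => g x ^+ 2) by exact: (groX 2 gg).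
have -> : Ex (fun x => f x ^+ 2) - Ex f ^+ 2 = Ex (fun x => g x ^+ 2).
  have gf2 : gro 4 (fun x => f x ^+ 2) by exact: (groX 2 gf).
  transitivity (Ex (fun x => f x ^+ 2 - 2 * Ex f * f x + Ex f ^+ 2)).
    rewrite ExD; [|by apply: groB => //; exact: groZ|exact: gro_cst].
    by rewrite ExB//; [rewrite ExZ// Ex_cst; ring|exact: groZ].
  by apply: eq_Ex => x; rewrite /g; ring.
apply: (@le_sqrt_limit _ _ C2) => r /[dup] r01 /andP[r0 r1].
have := gebelein gg c1 (r := r); rewrite r0 (ltW r1) => /(_ isT).
have := c2 r r01 => h1 h2.
have dr : 0 < 1 - r by rewrite subr_gt0.
rewrite -(ler_pM2l dr); lra.
Qed.

End poincare.

Section continuous_real.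
Context {R : realType} {T : topologicalType}.
Implicit Types f g : T -> R.

Lemma continuous_addR f g : continuous f -> continuous g -> continuous (fun x => f x + g x).
Proof. by move=> cf cg x; apply: (@cvgD _ R^o _ (nbhs x) _ f g); [exact: cf|exact: cg]. Qed.

Lemma continuous_subR f g : continuous f -> continuous g -> continuous (fun x => f x - g x).
Proof. by move=> cf cg x; apply: (@cvgB _ R^o _ (nbhs x) _ f g); [exact: cf|exact: cg]. Qed.

Lemma continuous_mulR f g : continuous f -> continuous g -> continuous (fun x => f x * g x).
Proof. by move=> cf cg x; apply: (@continuousM R T f g x); [exact: cf|exact: cg]. Qed.

Lemma continuous_cstR (c : R) : continuous (fun _ : T => c).
Proof. by move=> x; exact: cvg_cst. Qed.
End continuous_real.

(** * Poincare inequality for Lipschitz functions *)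

Section concentration.
Context {R : realType} {d : nat}.
Local Notation RR := (measurableTypeR R).
Local Notation G := (@std_gaussian R d).
Local Notation vec := (@vec_of_tuple R d).
Local Notation V := 'rV[R]_d.
Implicit Types (f g H W : V -> R) (x y v z : V).

(** The pointwise hypothesis says that [F] lies below the lower limit of the [F_ k]; with the slack
    [e] no real sequence has to converge. *)
Lemma fatou_Ex (F_ : nat -> V -> R) F B :
  (forall k, gro 4 (F_ k)) -> (forall k x, 0 <= F_ k x) -> gro 4 F -> (forall x, 0 <= F x) ->
  (forall x e, 0 < e -> exists N, forall k, (N <= k)%N -> F x <= F_ k x + e) ->
  (forall k, Ex (F_ k) <= B) -> Ex F <= B.
Proof.
move=> gF_ F_0 gF F0 FF_ FB; rewrite -lee_fin -Ex_EFin//.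
have mF_ k : measurable_fun setT (fun w : d.-tuple RR => (F_ k (vec w))%:E).
  by apply/measurable_EFinP; case: (gF_ k).
have F_0' k (w : d.-tuple RR) : setT w -> (0 <= (F_ k (vec w))%:E)%E by rewrite lee_fin.
have fat := @fatou _ (d.-tuple RR) R G setT measurableT _ mF_ F_0'.
have mL : measurable_fun setT (fun w : d.-tuple RR => limn_einf (fun k => (F_ k (vec w))%:E)).
  apply: (measurableT_comp (@oppe_measurable R setT)
    (g := fun w : d.-tuple RR => limn_esup (fun k => - (F_ k (vec w))%:E)%E)).
  apply: (@measurable_fun_limn_esup _ (d.-tuple RR) R setT (fun k w => - (F_ k (vec w))%:E)%E) => k.
  exact: (measurableT_comp (@oppe_measurable R setT)).
have FL (w : d.-tuple RR) : ((F (vec w))%:E <= limn_einf (fun k => (F_ k (vec w))%:E))%E.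
  apply/lee_addgt0Pr => e e0; have [N HN] := FF_ (vec w) e e0.
  rewrite limn_einf_lim.
  have : ((F (vec w) - e)%:E <= limn (einfs (fun k => (F_ k (vec w))%:E)))%E.
    apply: lime_ge; first exact: is_cvg_einfs.
    exists N => // n /= Nn; apply: le_ereal_inf_tmp => _ [k /= nk <-].
    by rewrite lee_fin lerBlDr; apply: HN; exact: leq_trans nk.
  by rewrite -leeBlDr// EFinB.
have mF : measurable_fun setT (fun w : d.-tuple RR => (F (vec w))%:E).
  by apply/measurable_EFinP; case: gF.
have le1 : (\int[G]_w (F (vec w))%:E <= \int[G]_w limn_einf (fun k => (F_ k (vec w))%:E))%E.
  apply: ge0_le_integral => //.
  by move=> w _; rewrite lee_fin.
apply: (le_trans le1); apply: (le_trans fat).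
rewrite limn_einf_lim; apply: lime_le; first exact: is_cvg_einfs.
exists 0%N => // n /= _; apply: (@le_trans _ _ (Ex (F_ n))%:E); last by rewrite lee_fin.
by apply: ereal_inf_lbound; exists n => //=; exact: Ex_EFin.
Qed.

(** [poincare] wants a linear term and a quadratic remainder, while [f] has only a bound [Gr] on its
    slope. The Moreau envelope [fe] of parameter [e] has such an expansion from above, differs from
    [f] by a multiple of [e], and its gradient is bounded by [Gr] up to a multiple of [e]. *)
Lemma poincare_weighted f Gr L K K' : lip L f -> 0 <= L -> lip K' Gr -> 0 <= K' ->
  (forall x, 0 <= Gr x) -> 0 <= K ->
  (forall y v, f (y + v) <= f y + Gr y * l2norm v + K * l2norm v ^+ 2) ->
  Ex (fun x => f x ^+ 2) - Ex f ^+ 2 <= Ex (fun x => Gr x ^+ 2).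
Proof.
move=> fL L0 GK K'0 G0 K0 fG.
have gf : gro 1 f := lip_gro fL.
have gG : gro 1 Gr := lip_gro GK.
have gG2 : gro 4 (fun x => Gr x ^+ 2) by apply: (@groW _ _ 2) => //; exact: (groX 2 gG).
have gf2 : gro 4 (fun x => f x ^+ 2) by apply: (@groW _ _ 2) => //; exact: (groX 2 gf).
pose c := 2 * L ^+ 2; have c0 : 0 <= c by rewrite mulr_ge0// sqr_ge0.
pose C := 4 * K' * L * Ex Gr + 4 * K' ^+ 2 * L ^+ 2 +
          2 * c * Ex (fun x => `|f x|) + c * (2 * `|Ex f| + c).
(* The parameter of the envelope is tied to [r], so that errors of order [e] are those which the
   limit lemma removes; [C] adds them up. *)
apply: (@le_sqrt_limit _ _ _ C) => r /andP[r0 r1]; set e := Num.sqrt (1 - r).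
have e0 : 0 < e by rewrite sqrtr_gt0 subr_gt0.
have e1 : e <= 1.
  rewrite -ler_sqr ?nnegrE ?(ltW e0)// expr1n sqr_sqrtr ?gerBl//.
  by rewrite subr_ge0 ltW.
have e0' := ltW e0.
have /choice[prox proxP] x : exists y, forall z,
    f y + l2norm (x - y) ^+ 2 / (2 * e) <= f z + l2norm (x - z) ^+ 2 / (2 * e).
  have cf : continuous (fun y => f y + l2norm (x - y) ^+ 2 / (2 * e)).
    have cn : continuous (fun y => l2norm (x - y) : R).
      apply: (@lip_continuous _ _ 1) => u v; rewrite mul1r.
      apply: (le_trans (l2norm_lip _ _)).
      rewrite (_ : x - u - (x - v) = v - u) 1?l2normB//.
      by apply/rowP => i; rewrite !mxE; ring.
    apply: continuous_addR; first exact: lip_continuous fL.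
    apply: continuous_mulR; last exact: continuous_cstR.
    by under eq_fun do rewrite expr2; exact: continuous_mulR.
  have [|y _ ymin] := @closed_min_attained _ _ setT _ (l2norm x + 2 * e * L) x closedT I cf;
    last by exists y => z; exact: ymin.
  move=> y _; rewrite subrr l2norm0 expr0n mul0r addr0 => h.
  have xy : l2norm (x - y) <= 2 * e * L.
    have := fL x y; rewrite ler_norml => /andP[_ h2].
    have e2 : 0 < 2 * e by rewrite mulr_gt0.
    have : l2norm (x - y) ^+ 2 <= (2 * e * L) * l2norm (x - y).
      rewrite -mulrA mulrC -ler_pdivrMr//; lra.
    have := l2norm_ge0 (x - y); rewrite le_eqVlt => /orP[/eqP <- _|p].
      by rewrite !mulr_ge0.
    by rewrite expr2 ler_pM2r.
  rewrite -[y](subKr x) (le_trans (l2normD _ _))// l2normN lerD2l//.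
pose fe x := f (prox x) + l2norm (x - prox x) ^+ 2 / (2 * e).
have pe x : l2norm (x - prox x) <= 2 * e * L.
  have := proxP x x; rewrite subrr l2norm0 expr0n mul0r addr0 => h.
  have := fL x (prox x); rewrite ler_norml => /andP[_ h2].
  have e2 : 0 < 2 * e by rewrite mulr_gt0.
  have : l2norm (x - prox x) ^+ 2 <= (2 * e * L) * l2norm (x - prox x).
    rewrite -mulrA mulrC -ler_pdivrMr//; lra.
  have := l2norm_ge0 (x - prox x); rewrite le_eqVlt => /orP[/eqP <- _|p].
    by rewrite !mulr_ge0.
  by rewrite expr2 ler_pM2r.
have fe1 x : fe x <= f x.
  by have := proxP x x; rewrite subrr l2norm0 expr0n mul0r addr0.
have fe2 x : f x - fe x <= c * e.
  have := fL x (prox x); rewrite ler_norml => /andP[_ h2].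
  have : 0 <= l2norm (x - prox x) ^+ 2 / (2 * e) by rewrite divr_ge0 ?sqr_ge0// mulr_ge0.
  have := ler_wpM2l L0 (pe x); rewrite /fe /c; move: h2; nra.
have feL1 x x' : fe x' - fe x <= L * l2norm (x' - x).
  have := proxP x' (prox x + (x' - x)).
  rewrite (_ : x' - (prox x + (x' - x)) = x - prox x); last by apply/rowP => i; rewrite !mxE; ring.
  have := fL (prox x + (x' - x)) (prox x); rewrite addrAC subrr add0r ler_norml => /andP[_].
  rewrite /fe; lra.
have feL : lip L fe.
  move=> x x'; rewrite ler_norml feL1 andbT lerNl opprB l2normB; exact: feL1.
have gfe : gro 1 fe := lip_gro feL.
(* The minimizer [prox x] for [x] is used as a competitor at [x + v]. *)
have fev x v : fe (x + v) <= fe x + dotv (e^-1 *: (x - prox x)) v + (2 * e)^-1 * l2norm v ^+ 2.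
  apply: (le_trans (proxP (x + v) (prox x))).
  rewrite addrAC sqr_l2normD dotvZl /fe -!addrA lerD2l le_eqVlt; apply/orP; left; apply/eqP.
  by field; rewrite gt_eqF.
(* Moving from [prox x] in the direction [a] cannot lower the penalized value; dividing by the step
   and letting it tend to 0 gives [|a| <= Gr (prox x)]. As [prox x] is within [2 e L] of [x], the
   Lipschitz bound on [Gr] finishes. *)
have ae x : l2norm (e^-1 *: (x - prox x)) <= Gr x + 2 * K' * L * e.
  apply: (@le_trans _ _ (Gr (prox x))); last first.
    have := GK x (prox x); rewrite ler_norml => /andP[h _].
    have := ler_wpM2l K'0 (pe x); lra.
  set a := e^-1 *: _; set y := prox x.
  have xa : x - y = e *: a by rewrite scalerA divff ?gt_eqF// scale1r.
  clearbody a; have [a0|ap] := leP (l2norm a) 0; first exact: le_trans (G0 _).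
  apply: (@le_sqrt_limit _ _ _ ((K + (2 * e)^-1) * l2norm a)) => q /andP[q0 q1].
  set t := Num.sqrt _; have t0 : 0 < t by rewrite sqrtr_gt0 subr_gt0.
  have := fG y (t *: a); have := proxP x (y + t *: a).
  rewrite opprD addrA -/y xa -scalerBl !l2normZ !exprMn !real_normK ?num_real//.
  rewrite (ger0_norm (ltW t0)).
  move: (f y) (f (y + _)) (Gr y) => A B g h1 h2.
  rewrite -(ler_pM2l (mulr_gt0 t0 ap)).
  have : g * (t * l2norm a) + K * (t ^+ 2 * l2norm a ^+ 2) >=
     t * l2norm a ^+ 2 - t ^+ 2 * l2norm a ^+ 2 / (2 * e).
    have -> : t * l2norm a ^+ 2 - t ^+ 2 * l2norm a ^+ 2 / (2 * e) =
       e ^+ 2 * l2norm a ^+ 2 / (2 * e) - (e - t) ^+ 2 * l2norm a ^+ 2 / (2 * e).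
      by field; rewrite gt_eqF.
    lra.
  move=> h3; apply: (@le_trans _ _ (t * l2norm a ^+ 2)); first by rewrite le_eqVlt; apply/orP; left; apply/eqP; ring.
  rewrite (_ : _ * (_ + _) = g * (t * l2norm a) + K * (t ^+ 2 * l2norm a ^+ 2) + t ^+ 2 * l2norm a ^+ 2 / (2 * e)).
    by move: h3; lra.
  by field; rewrite gt_eqF.
pose H x := Gr x ^+ 2 + (4 * K' * L * e) * Gr x + (2 * K' * L * e) ^+ 2.
have gH : gro 2 H.
  apply: groD; last exact: gro_cst.
  apply: groD; first exact: (groX 2 gG).
  by apply: groZ; exact: groW gG.
have P : Ex (fun x => fe x ^+ 2) - Ex fe ^+ 2 <= Ex H.
  apply: (@poincare _ _ _ _ (2 * e)^-1 L) => //.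
  - exact: groW gfe.
  - by rewrite invr_ge0 mulr_ge0.
  - move=> x y; apply: (le_trans (feL x y)); rewrite ler_wpM2r ?l2norm_ge0//.
    rewrite ler_peMr// -addrA lerDl addr_ge0 ?l2norm_ge0//.
  - move=> x; exists (e^-1 *: (x - prox x)) => //.
    have := ae x; rewrite -ler_sqr ?nnegrE ?l2norm_ge0//; last first.
      by rewrite addr_ge0// !mulr_ge0.
    by move/le_trans; apply; rewrite /H le_eqVlt; apply/orP; left; apply/eqP; ring.
have EH : Ex H = Ex (fun x => Gr x ^+ 2) + (4 * K' * L * e) * Ex Gr + (2 * K' * L * e) ^+ 2.
  rewrite /H ExD; [|apply: groD => //|exact: gro_cst]; last by apply: groZ; exact: groW gG.
  rewrite ExD//; last by apply: groZ; exact: groW gG.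
  by rewrite ExZ ?Ex_cst//; exact: groW gG.
have gf4 : gro 4 f by exact: groW gf.
have gfe4 : gro 4 fe by exact: groW gfe.
have ga : gro 4 (fun x => `|f x|) by exact: gro_norm.
have gfe2 : gro 4 (fun x => fe x ^+ 2) by apply: (@groW _ _ 2) => //; exact: (groX 2 gfe).
have sq : Ex (fun x => f x ^+ 2) <= Ex (fun x => fe x ^+ 2) + 2 * c * e * Ex (fun x => `|f x|).
  rewrite -ExZ// -ExD//; last exact: groZ.
  apply: le_Ex => //; first by apply: groD => //; exact: groZ.
  move=> x; have h1 := fe1 x; have h2 := fe2 x; have := ler_norm (f x).
  have := normr_ge0 (f x); move: (f x) (fe x) `|f x| h1 h2 => a b n h1 h2 n0 an.
  have : (a - b) * (2 * a - (a - b)) <= (a - b) * (2 * n).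
    by apply: ler_wpM2l; lra.
  have : (a - b) * (2 * n) <= c * e * (2 * n) by apply: ler_wpM2r => //; lra.
  lra.
have mn1 : Ex fe <= Ex f by exact: le_Ex.
have mn2 : Ex f - Ex fe <= c * e.
  rewrite -ExB// -(@Ex_cst R d (c * e)); apply: le_Ex => //; first exact: groB.
  exact: gro_cst.
have mn3 : Ex fe ^+ 2 <= Ex f ^+ 2 + c * e * (2 * `|Ex f| + c).
  have := ler_norm (- Ex f); rewrite normrN; have := normr_ge0 (Ex f).
  move: (Ex f) (Ex fe) `|Ex f| mn1 mn2 => a b n h1 h2 n0 an.
  have ce : c * e <= c by rewrite ler_piMr.
  have : (a - b) * (- (2 * a) + (a - b)) <= (a - b) * (2 * n + c).
    by apply: ler_wpM2l; lra.
  have : (a - b) * (2 * n + c) <= c * e * (2 * n + c) by apply: ler_wpM2r => //; lra.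
  lra.
have e2e : 4 * K' ^+ 2 * L ^+ 2 * e ^+ 2 <= 4 * K' ^+ 2 * L ^+ 2 * e.
  apply: ler_wpM2l; first by rewrite !mulr_ge0// sqr_ge0.
  by rewrite expr2 ler_piMl.
have -> : C * e = 4 * K' * L * e * Ex Gr + 4 * K' ^+ 2 * L ^+ 2 * e + 2 * c * e * Ex (fun x => `|f x|)
   + c * e * (2 * `|Ex f| + c) by rewrite /C; ring.
move: P; rewrite EH (_ : (2 * K' * L * e) ^+ 2 = 4 * K' ^+ 2 * L ^+ 2 * e ^+ 2); last by ring.
move: sq mn3 e2e; lra.
Qed.

Lemma poincare_lip f L : lip L f -> 0 <= L ->
  Ex (fun x => f x ^+ 2) - Ex f ^+ 2 <= L ^+ 2.
Proof.
move=> fL L0; rewrite -[X in _ <= X](@Ex_cst R d).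
apply: (@poincare_weighted f (fun=> L) L 0 0) => //.
  by move=> x y; rewrite subrr normr0 mul0r.
move=> y v; rewrite mul0r addr0 -lerBlDl.
by have := fL (y + v) y; rewrite addrAC subrr add0r; apply: le_trans; exact: ler_norm.
Qed.

End concentration.

(** * Fourth moments and the second Hermite component *)

Section moments.
Context {R : realType} {d : nat}.
Local Notation V := 'rV[R]_d.
Implicit Types (f g H u W : V -> R) (x y v z : V).

Lemma lip_sqr_le u : lip 1 u -> Ex u = 0 -> Ex (fun x => u x ^+ 2) <= 1.
Proof. by move=> u1 u0; have := poincare_lip u1 ler01; rewrite u0 !expr2 mulr0 subr0 mulr1. Qed.

(** Poincare for [u^2], whose slope is [2 |u|], gives [Ex u^4 <= 4 Ex u^2 + (Ex u^2)^2 <= 5].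
    Truncation at [k^2] makes the square Lipschitz, and Fatou removes the truncation. *)
Lemma fourth_moment u : lip 1 u -> Ex u = 0 -> Ex (fun x => u x ^+ 4) <= 5.
Proof.
move=> u1 u0.
have gu : gro 1 u := lip_gro u1.
have gu2 : gro 2 (fun x => u x ^+ 2) by exact: (groX 2 gu).
have gu4 : gro 4 (fun x => u x ^+ 2) by exact: groW gu2.
pose f (k : nat) x := Num.min (u x ^+ 2) (k%:R ^+ 2).
have fl k : lip (2 * k%:R) (f k).
  have k0 : 0 <= k%:R :> R by [].
  have one x y : f k x - f k y <= 2 * k%:R * l2norm (x - y).
    have uxy := u1 x y; rewrite mul1r in uxy.
    have := ler_norm (u x - u y); have := ler_norm (u y - u x); rewrite distrC => a1 a2.
    move: (l2norm_ge0 (x - y)) (le_trans a1 uxy) (le_trans a2 uxy).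
    rewrite /f; move: (u x) (u y) (l2norm _) => a b n n0 h1 h2.
    have [bk|kb] := leP (b ^+ 2) (k%:R ^+ 2).
      have bk' : `|b| <= k%:R by rewrite -ler_sqr ?nnegrE// real_normK ?num_real.
      move: bk'; rewrite ler_norml => /andP[b1 b2].
      have [ak|ka] := leP (a ^+ 2) (k%:R ^+ 2).
        have ak' : `|a| <= k%:R by rewrite -ler_sqr ?nnegrE// real_normK ?num_real.
        move: ak'; rewrite ler_norml => /andP[c1 c2].
        rewrite subr_sqr; have [ab|ab] := leP 0 (a + b).
          by apply: (@le_trans _ _ (n * (a + b))); [rewrite ler_wpM2r//; lra|nra].
        by nra.
      have ka' : k%:R < `|a| by rewrite -ltr_sqr ?nnegrE// real_normK ?num_real.
      rewrite subr_sqr; move: ka'; rewrite lter_normr => /orP[ka'|ka'].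
        have : k%:R - b <= n by lra.
        by move=> ?; apply: (@le_trans _ _ (n * (k%:R + b))); [rewrite ler_wpM2r//; lra|nra].
      have : k%:R + b <= n by lra.
      by move=> ?; apply: (@le_trans _ _ ((k%:R - b) * n)); [rewrite ler_wpM2l//; lra|nra].
    have [ak|ka] := leP (a ^+ 2) (k%:R ^+ 2).
      by apply: (@le_trans _ _ 0); [rewrite subr_le0|rewrite !mulr_ge0].
    by rewrite subrr !mulr_ge0.
  move=> x y; rewrite ler_norml one andbT lerNl opprB l2normB; exact: one.
have f0 k x : 0 <= f k x by rewrite /f le_min !sqr_ge0.
apply: (@fatou_Ex _ _ (fun k x => f k x ^+ 2)).
- by move=> k; apply: (@groW _ _ 2) => //; exact: (groX 2 (lip_gro (fl k))).
- by move=> k x; exact: sqr_ge0.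
- exact: (groX 4 gu).
- by move=> x; rewrite (exprM _ 2 2) sqr_ge0.
- move=> x e e0; exists (Num.truncn (`|u x|)).+1 => k kN.
  have uk : `|u x| <= k%:R.
    apply: (le_trans (ltW (truncnS_gt _))); by rewrite ler_nat.
  have : u x ^+ 2 <= k%:R ^+ 2.
    by rewrite -[u x ^+ 2]real_normK ?num_real// ler_sqr ?nnegrE.
  by rewrite /f => /min_idPl ->; rewrite -exprM lerDl ltW.
move=> k.
have P : Ex (fun x => f k x ^+ 2) - Ex (f k) ^+ 2 <= Ex (fun x => (2 * `|u x|) ^+ 2).
  apply: (@poincare_weighted _ _ _ _ (2 * k%:R) 1 2) => //.
  - move=> x y; rewrite -mulrBr normrM ger0_norm// ler_wpM2l//.
    apply: (le_trans (ler_dist_dist _ _)); by have := u1 x y; rewrite mul1r.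
  - move=> y v; rewrite mul1r.
    have h := u1 (y + v) y; rewrite addrAC subrr add0r mul1r in h.
    have : u (y + v) ^+ 2 <= u y ^+ 2 + 2 * `|u y| * l2norm v + l2norm v ^+ 2.
      have : `|u (y + v)| <= `|u y| + l2norm v.
        rewrite -[u (y + v)](subrK (u y)) (le_trans (ler_normD _ _))// addrC lerD2l//.
      rewrite -ler_sqr ?nnegrE ?addr_ge0 ?l2norm_ge0// real_normK ?num_real// => /le_trans; apply.
      rewrite sqrrD real_normK ?num_real// le_eqVlt; apply/orP; left; apply/eqP; ring.
    have p0 : 0 <= 2 * `|u y| * l2norm v + l2norm v ^+ 2.
      by rewrite addr_ge0 ?sqr_ge0// !mulr_ge0// l2norm_ge0.
    rewrite /f -!addrA => h2.
    have [yk|ky] := leP (u y ^+ 2) (k%:R ^+ 2).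
      by rewrite ge_min h2.
    by rewrite ge_min lerDl p0 orbT.
have E1 : Ex (fun x => (2 * `|u x|) ^+ 2) = 4 * Ex (fun x => u x ^+ 2).
  rewrite -ExZ//; apply: eq_Ex => x; rewrite exprMn real_normK ?num_real//; ring.
have E2 : Ex (fun x => u x ^+ 2) <= 1 := lip_sqr_le u1 u0.
have E3 : Ex (f k) <= 1.
  apply: le_trans E2; apply: le_Ex => //; first exact: groW (lip_gro (fl k)).
  by move=> x; rewrite /f ge_min lexx.
have E4 : Ex (f k) ^+ 2 <= 1.
  by rewrite expr_le1//; apply: Ex_ge0 => x; exact: f0.
lra.
Qed.

Lemma Ex_dotv z : Ex (dotv z) = 0.
Proof.
have gz : gro 4 (dotv z) by exact: groW (@gro_dotv R d z).
have := Ex_opp gz.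
rewrite (_ : Ex (fun x => dotv z (- x)) = - Ex (dotv z)); first lra.
rewrite -mulN1r -ExZ//; apply: eq_Ex => x; rewrite dotvNr; ring.
Qed.

(** The reflection at 45 degrees turns [|x|^2 - |y|^2] into [2 <x, y>], of mean square [4 d]; for
    independent [x] and [y] the mean square of the former is twice the variance of [|x|^2]. *)
Lemma Ex_l2norm4 : Ex (fun x : V => l2norm x ^+ 4) = d%:R ^+ 2 + 2 * d%:R.
Proof.
pose q x : R := l2norm x ^+ 2.
have gq : gro 2 q by exact: (groX 2 (@gro_l2norm R d)).
have gq4 : gro 4 q by exact: groW gq.
have gqq : gro 4 (fun x => q x ^+ 2) by exact: (groX 2 gq).
pose H x y := (q x - q y) ^+ 2.
have gH : gro2 4 H by apply: (@gro2_sqr _ _ 2); apply: gro2B; [exact: gro2_fst|exact: gro2_snd].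
pose c : R := Num.sqrt (1 / 2).
have c2 : c ^+ 2 = 1 / 2 by rewrite sqr_sqrtr.
have cc : c ^+ 2 + c ^+ 2 = 1 by lra.
have E1 := Ex2_reflection cc gH.
have E2 : Ex2 H = 2 * Ex (fun x => q x ^+ 2) - 2 * d%:R ^+ 2.
  transitivity (Ex2 (fun x y => q x ^+ 2 + q y ^+ 2 - 2 * (q x * q y))).
    by apply: eq_Ex2 => x y; rewrite /H; ring.
  have gp : gro2 4 (fun x y => q x * q y) by exact: (gro2M (gro2_fst gq) (gro2_snd gq)).
  rewrite Ex2B; [|by apply: gro2D; [exact: gro2_fst|exact: gro2_snd]|exact: gro2Z].
  rewrite Ex2D; [|exact: gro2_fst|exact: gro2_snd].
  rewrite Ex2_fst// Ex2_snd// Ex2Z// (Ex2E gp).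
  rewrite (_ : Ex (fun x => Ex (fun y => q x * q y)) = d%:R ^+ 2); first ring.
  transitivity (Ex (fun x => d%:R * q x)); last by rewrite ExZ// /q Ex_sqr_l2norm expr2.
  by apply: eq_Ex => x; rewrite ExZ// /q Ex_sqr_l2norm mulrC.
have E3 : Ex2 (fun x y => H (c *: x + c *: y) (c *: x - c *: y)) = 4 * d%:R.
  have gd : gro2 4 (fun x y => H (c *: x + c *: y) (c *: x - c *: y)).
    have := gro2_comp c c c (- c) gH.
    by rewrite (_ : (fun x y => H _ (_ + - c *: y)) = (fun x y => H (c *: x + c *: y) (c *: x - c *: y)))//;
      apply/funext => x; apply/funext => y; rewrite scaleNr.
  rewrite (Ex2E gd); transitivity (Ex (fun x => 4 * q x)); last by rewrite ExZ// /q Ex_sqr_l2norm.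
  apply: eq_Ex => x.
  have gdx : gro 4 (fun y => dotv x y ^+ 2).
    by apply: (@groW _ _ 2) => //; exact: (groX 2 (@gro_dotv R d x)).
  rewrite -/(q x) /q -Ex_dotv_sqr -ExZ//; apply: eq_Ex => y.
  rewrite /H /q -!scalerDr -scalerBr !l2normZ !exprMn real_normK ?num_real// c2.
  by rewrite sqr_l2normD sqr_l2normB; field.
transitivity (Ex (fun x => q x ^+ 2)); last by move: E1; rewrite E3 E2; lra.
by apply: eq_Ex => x; rewrite /q -exprM.
Qed.

(** [|x|^2 - d] is an eigenfunction of eigenvalue [r^2]: it is the sum of the second Hermite
    polynomials of the coordinates. *)
Lemma mehler_sqr_l2norm r x : 0 <= r <= 1 ->
  mehler r (fun x => l2norm x ^+ 2) x = r ^+ 2 * l2norm x ^+ 2 + (1 - r ^+ 2) * d%:R.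
Proof.
move=> r01; rewrite /mehler; set s := Num.sqrt _.
have s2 : s ^+ 2 = 1 - r ^+ 2 by have := sqr_mehler_weights r01; rewrite -/s; lra.
have gd : gro 4 (fun y => dotv x y) by exact: groW (@gro_dotv R d x).
have gn : gro 4 (fun y => l2norm y ^+ 2 : R).
  by apply: (@groW _ _ 2) => //; exact: (groX 2 (@gro_l2norm R d)).
transitivity (Ex (fun y => r ^+ 2 * l2norm x ^+ 2 + (2 * r * s) * dotv x y + s ^+ 2 * l2norm y ^+ 2)).
  apply: eq_Ex => y; rewrite sqr_l2normD !l2normZ !exprMn !real_normK ?num_real//.
  rewrite dotvZl dotvZr; ring.
rewrite ExD; [|by apply: groD; [exact: gro_cst|exact: groZ]|exact: groZ].
rewrite ExD; [|exact: gro_cst|exact: groZ].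
by rewrite Ex_cst !ExZ// Ex_dotv Ex_sqr_l2norm s2 mulr0 addr0.
Qed.

(* The second Hermite component of W improves the Poincare bound: it is tested
   against [k |x|^2], and letting [k] tend to -oo in the short-time estimate
   bounds the covariance of W with |x|^2. *)
Lemma width_variance W : (0 < d)%N -> lip 1 W ->
  (forall x, exists2 z, l2norm z = 1 & dotv z x = W x /\ forall y, dotv z y <= W y) ->
  0 <= Ex W /\ Ex (fun x => W x ^+ 2) <= Ex W ^+ 2 + 1 - Ex W ^+ 2 / (2 * d%:R).
Proof.
move=> d0 Wl Wz.
have gW : gro 1 W := lip_gro Wl.
have gW4 : gro 4 W by exact: groW gW.
have gW2 : gro 2 W by exact: groW gW.
have gWW : gro 4 (fun x => W x ^+ 2) by apply: (@groW _ _ 2) => //; exact: (groX 2 gW).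
have w0 : 0 <= Ex W.
  have [z _ [_ zW]] := Wz 0; rewrite -(Ex_dotv z); apply: le_Ex => //.
  exact: groW (@gro_dotv R d z).
split => //; set w := Ex W in w0 *.
pose q x : R := l2norm x ^+ 2.
have gq : gro 2 q by exact: (groX 2 (@gro_l2norm R d)).
have gq4 : gro 4 q by exact: groW gq.
have gqq : gro 4 (fun x => q x * q x) by exact: (groM gq gq).
have gWq : gro 4 (fun x => W x * q x) by exact: (groM gW2 gq).
have Eq : Ex q = d%:R by exact: Ex_sqr_l2norm.
have Eqq : Ex (fun x => q x * q x) = d%:R ^+ 2 + 2 * d%:R.
  by rewrite -Ex_l2norm4; apply: eq_Ex => x; rewrite /q -exprD.
set V2 := Ex (fun x => W x ^+ 2).
set cov := Ex (fun x => W x * q x) - w * d%:R.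
pose F k x := k * q x - W x.
pose H k x := 1 - 4 * k * W x + 4 * k ^+ 2 * q x.
have gF k : gro 2 (F k) by apply: groB => //; exact: groZ.
have gH k : gro 2 (H k).
  apply: groD; last exact: groZ.
  by apply: groB; [exact: gro_cst|exact: groZ].
have EH k : Ex (H k) = 1 - 4 * k * w + 4 * k ^+ 2 * d%:R.
  rewrite /H ExD; [|by apply: groB; [exact: gro_cst|exact: groZ]|exact: groZ].
  rewrite ExB; [|exact: gro_cst|exact: groZ].
  by rewrite Ex_cst !ExZ// Eq.
have EF k : Ex (F k) = k * d%:R - w.
  by rewrite /F ExB//; [rewrite ExZ// Eq|exact: groZ].
have EFF k : Ex (fun x => F k x ^+ 2) = k ^+ 2 * (d%:R ^+ 2 + 2 * d%:R) - 2 * k * (cov + w * d%:R) + V2.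
  transitivity (Ex (fun x => k ^+ 2 * (q x * q x) - 2 * k * (W x * q x) + W x ^+ 2)).
    by apply: eq_Ex => x; rewrite /F; ring.
  rewrite ExD//; last by apply: groB; exact: groZ.
  rewrite ExB; [|exact: groZ|exact: groZ].
  by rewrite !ExZ// Eqq /cov subrK.
have Fa k x : exists2 a, l2norm a ^+ 2 <= H k x &
     forall v, F k (x + v) <= F k x + dotv a v + `|k| * l2norm v ^+ 2.
  have [z z1 [zx zy]] := Wz x.
  exists ((2 * k) *: x - z).
    rewrite sqr_l2normB l2normZ exprMn real_normK ?num_real// z1 dotvZl (dotvC x z) zx /H /q.
    rewrite le_eqVlt; apply/orP; left; apply/eqP; ring.
  move=> v; rewrite /F /q dotvBl dotvZl sqr_l2normD.
  have := zy (x + v); rewrite dotvDr zx.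
  have : k * l2norm v ^+ 2 <= `|k| * l2norm v ^+ 2 by rewrite ler_wpM2r ?sqr_ge0// ler_norm.
  lra.
have FL k x y : `|F k x - F k y| <= (1 + `|k|) * (1 + l2norm x + l2norm y) * l2norm (x - y).
  have h1 := Wl x y; rewrite mul1r in h1.
  have h2 : `|q x - q y| <= (l2norm x + l2norm y) * l2norm (x - y).
    rewrite /q subr_sqr normrM mulrC (ger0_norm (addr_ge0 (l2norm_ge0 _) (l2norm_ge0 _))).
    by rewrite ler_wpM2l ?addr_ge0 ?l2norm_ge0//; exact: l2norm_lip.
  have : `|F k x - F k y| <= `|k| * `|q x - q y| + `|W x - W y|.
    rewrite -normrM /F (_ : _ - _ = k * (q x - q y) - (W x - W y)); last by ring.
    exact: ler_normB.
  have := ler_wpM2l (normr_ge0 k) h2; have := l2norm_ge0 x; have := l2norm_ge0 y.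
  have := l2norm_ge0 (x - y); have := normr_ge0 k; move: h1.
  move: `|F k x - _| `|q x - _| `|W x - _| `|k| (l2norm (x - y)) (l2norm x) (l2norm y).
  move=> p1 p2 p3 kk n a b h1 k0 n0 b0 a0 h h3.
  have : 0 <= kk * n by exact: mulr_ge0.
  have : 0 <= (a + b) * n by rewrite mulr_ge0// addr_ge0.
  lra.
have A k : V2 - w ^+ 2 <= 1 - 4 * k * w + 2 * k * cov + 2 * k ^+ 2 * d%:R.
  have := poincare (gF k) (gH k) (normr_ge0 k) (FL k) (Fa k).
  rewrite EFF EF EH; lra.
(* The energy is divided by [1 - r] and [r] tends to 1. The terms with [|x|^2] have eigenvalue [r^2]
   and leave the factor [1 + r]; the contribution of [W] alone is nonnegative and is dropped. *)
have B k : 4 * k ^+ 2 * d%:R - 4 * k * cov <= 1 - 4 * k * w + 4 * k ^+ 2 * d%:R.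
  have [C hC] := mehler_energy (gF k) (gH k) (normr_ge0 k) (Fa k).
  set D := 2 * k ^+ 2 * d%:R - 2 * k * cov.
  apply: (@le_sqrt_limit _ _ _ (C + `|D|)) => r /[dup] r01' /andP[r0 r1].
  have r01 : 0 <= r <= 1 by rewrite r0 ltW.
  have := hC r r01'; rewrite EH EFF.
  have gmW : gro 2 (mehler r W) by exact: gro_mehler.
  have -> : Ex (fun x => F k x * mehler r (F k) x) =
     Ex (fun x => W x * mehler r W x) - 2 * k * (r ^+ 2 * (cov + w * d%:R) + (1 - r ^+ 2) * d%:R * w)
     + k ^+ 2 * (r ^+ 2 * (d%:R ^+ 2 + 2 * d%:R) + (1 - r ^+ 2) * d%:R * d%:R).
    have mF x : mehler r (F k) x = k * mehler r q x - mehler r W x.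
      rewrite /mehler /F ExB.
      - rewrite ExZ//; exact: (gro_section x (gro2_lin _ _ gq4)).
      - apply: groZ; exact: (gro_section x (gro2_lin _ _ gq4)).
      - exact: (gro_section x (gro2_lin _ _ gW4)).
    have gmq : gro 2 (mehler r q) by exact: gro_mehler.
    have g1 : gro 4 (fun x => W x * mehler r W x) by exact: (groM gW2 gmW).
    have g2 : gro 4 (fun x => W x * mehler r q x) by exact: (groM gW2 gmq).
    have g3 : gro 4 (fun x => q x * mehler r W x) by exact: (groM gq gmW).
    have g4 : gro 4 (fun x => q x * mehler r q x) by exact: (groM gq gmq).
    transitivity (Ex (fun x => W x * mehler r W x - k * (W x * mehler r q x)
       - k * (q x * mehler r W x) + k ^+ 2 * (q x * mehler r q x))).
      by apply: eq_Ex => x; rewrite mF /F; ring.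
    rewrite ExD; [|by apply: groB; [apply: groB => //|]; exact: groZ|exact: groZ].
    rewrite ExB; [|by apply: groB => //; exact: groZ|exact: groZ].
    rewrite ExB//; last exact: groZ.
    rewrite !ExZ//.
    have -> : Ex (fun x => q x * mehler r W x) = Ex (fun x => W x * mehler r q x).
      exact: mehler_sym.
    have -> : Ex (fun x => W x * mehler r q x) = r ^+ 2 * (cov + w * d%:R) + (1 - r ^+ 2) * d%:R * w.
      transitivity (Ex (fun x => r ^+ 2 * (W x * q x) + (1 - r ^+ 2) * d%:R * W x)).
        by apply: eq_Ex => x; rewrite (mehler_sqr_l2norm x r01) /q; ring.
      rewrite ExD; [|exact: groZ|exact: groZ].
      by rewrite !ExZ// /cov subrK.
    have -> : Ex (fun x => q x * mehler r q x) = r ^+ 2 * (d%:R ^+ 2 + 2 * d%:R) + (1 - r ^+ 2) * d%:R * d%:R.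
      transitivity (Ex (fun x => r ^+ 2 * (q x * q x) + (1 - r ^+ 2) * d%:R * q x)).
        by apply: eq_Ex => x; rewrite (mehler_sqr_l2norm x r01) /q; ring.
      rewrite ExD; [|exact: groZ|exact: groZ].
      by rewrite !ExZ// Eqq Eq.
    ring.
  have WW : Ex (fun x => W x * mehler r W x) <= V2.
    rewrite -subr_ge0 mehler_sqr_diff//; apply: Ex2_ge0 => x y; exact: sqr_ge0.
  set mW := Ex _ in WW *; move=> h.
  have dr : 0 < 1 - r by rewrite subr_gt0.
  set s := Num.sqrt (1 - r) in h *.
  have s0 : 0 <= s by exact: sqrtr_ge0.
  have s2 : s ^+ 2 = 1 - r by rewrite sqr_sqrtr// ltW.
  have s1 : s <= 1 by rewrite -ler_sqr ?nnegrE// s2 expr1n gerBl.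
  have : (1 + r) * D <= 1 - 4 * k * w + 4 * k ^+ 2 * d%:R + C * s.
    rewrite -(ler_pM2l dr); apply: le_trans h; rewrite /D; move: WW; lra.
  have : (1 - r) * D <= `|D| * s.
    rewrite -s2; apply: (@le_trans _ _ (s ^+ 2 * `|D|)).
      by rewrite ler_wpM2l ?sqr_ge0// ler_norm.
    by rewrite expr2 -mulrA [`|D| * s]mulrC ler_piMl// mulr_ge0.
  have -> : 4 * k ^+ 2 * d%:R - 4 * k * cov = 2 * D by rewrite /D; ring.
  lra.
(* [B] says that [4 k (w - cov) <= 1] for every [k]; for [cov > w] the chosen negative [k] would
   turn this into [2 <= 1]. *)
have cw : cov <= w.
  rewrite leNgt; apply/negP => h; pose t := cov - w; have t0 : 0 < t by rewrite subr_gt0.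
  have := B (- (1 / (2 * t))).
  have : 4 * (1 / (2 * t)) * t = 2 by field; rewrite gt_eqF.
  rewrite /t; lra.
have dp : 0 < d%:R :> R by rewrite ltr0n.
(* This [k] minimizes [1 - 2 k w + 2 k^2 d], the right side of [A] once [cov] is replaced by [w]. *)
pose k := w / (2 * d%:R); have k0 : 0 <= k by rewrite divr_ge0// mulr_ge0.
have kd : k * d%:R = w / 2 by rewrite /k; field; rewrite gt_eqF.
have := A k; have := ler_wpM2l k0 cw.
have -> : 2 * k ^+ 2 * d%:R = k * w by rewrite (_ : 2 * k ^+ 2 * d%:R = 2 * k * (k * d%:R)); [rewrite kd; lra|ring].
have -> : w ^+ 2 / (2 * d%:R) = k * w by rewrite /k; ring.
lra.
Qed.

End moments.

(** * Projections on closed convex sets and cones *)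

Section projection.
Context {R : realType} {d : nat}.
Local Notation V := 'rV[R]_d.
Implicit Types (C D : set V) (g h p q u x y z : V).

Definition cvx C := forall x y (t : R), 0 <= t <= 1 -> C x -> C y -> C ((1 - t) *: x + t *: y).

Definition polar D : set V := [set z | forall u, D u -> dotv u z <= 0].

Definition is_proj C g p := C p /\ forall q, C q -> dotv (g - p) (q - p) <= 0.

(** The value 0 is a default that plays no part for nonempty closed convex [C], where a projection
    exists. *)
Definition cproj C g : V := xget 0 [set p | is_proj C g p].

(** A nearest point [p] is compared with the points [p + t (q - p)] of the segment to [q]; letting
    [t] tend to 0 turns minimality into the variational inequality. *)
Lemma proj_exists C g : closed C -> cvx C -> C !=set0 -> exists p, is_proj C g p.
Proof.
move=> cC vC [x0 Cx0].
have cf : continuous (fun y => l2norm (g - y) : R).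
  apply: (@lip_continuous _ _ 1) => u v; rewrite mul1r.
  apply: (le_trans (l2norm_lip _ _)).
  rewrite (_ : g - u - (g - v) = v - u) 1?l2normB//.
  by apply/rowP => i; rewrite !mxE; ring.
have [|p Cp pmin] := @closed_min_attained _ _ C _ (l2norm g + l2norm (g - x0)) x0 cC Cx0 cf.
  move=> y _ h; rewrite -[y](subKr g) (le_trans (l2normD _ _))// l2normN lerD2l//.
exists p; split => // q Cq.
apply: (@le_sqrt_limit _ _ _ (l2norm (q - p) ^+ 2)) => r /andP[r0 r1].
rewrite add0r; set t := Num.sqrt _.
have t0 : 0 < t by rewrite sqrtr_gt0 subr_gt0.
have t1 : t <= 1.
  rewrite -ler_sqr ?nnegrE ?(ltW t0)// expr1n sqr_sqrtr ?gerBl//.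
  by rewrite subr_ge0 ltW.
have := pmin _ (vC p q t _ Cp Cq); rewrite t1 (ltW t0) => /(_ isT).
rewrite -ler_sqr ?nnegrE ?l2norm_ge0//.
have -> : g - ((1 - t) *: p + t *: q) = (g - p) - t *: (q - p).
  by apply/rowP => i; rewrite !mxE; ring.
rewrite (sqr_l2normB (g - p)) dotvZr l2normZ exprMn real_normK ?num_real// => h.
rewrite -(ler_pM2l t0); have := sqr_ge0 (l2norm (q - p)); nra.
Qed.

Section closed_convex.
Variables (C : set V) (cC : closed C) (vC : cvx C) (C0 : C !=set0).

Lemma projP g : is_proj C g (cproj C g).
Proof. by rewrite /cproj; case: xgetP => [p -> //|/(_ _) h]; have [p /h] := proj_exists g cC vC C0. Qed.

Lemma proj_in g : C (cproj C g). Proof. by case: (projP g). Qed.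

Lemma proj_var g q : C q -> dotv (g - cproj C g) (q - cproj C g) <= 0.
Proof. by case: (projP g) => _; exact. Qed.

Lemma proj_nonexpansive g h : l2norm (cproj C g - cproj C h) <= l2norm (g - h).
Proof.
have h1 := proj_var g (proj_in h); have h2 := proj_var h (proj_in g).
set p := cproj C g in h1 h2 *; set q := cproj C h in h1 h2 *.
have := cauchy_schwarz (g - h) (p - q).
have : l2norm (p - q) ^+ 2 <= dotv (g - h) (p - q).
  move: h1 h2; rewrite sqr_l2norm !dotvBl !dotvBr (dotvC q p); lra.
have := l2norm_ge0 (p - q); rewrite le_eqVlt => /orP[/eqP <-|a h3 h4]; first by rewrite l2norm_ge0.
by rewrite -(ler_pM2r a) -expr2; exact: le_trans h4.
Qed.

Lemma proj_min g q : C q -> l2norm (g - cproj C g) <= l2norm (g - q).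
Proof.
move=> Cq; have h := proj_var g Cq; set p := cproj C g in h *.
rewrite -ler_sqr ?nnegrE ?l2norm_ge0//.
have -> : g - q = (g - p) - (q - p) by apply/rowP => i; rewrite !mxE; ring.
by rewrite (sqr_l2normB (g - p)); have := sqr_ge0 (l2norm (q - p)); lra.
Qed.

Hypothesis coneC : forall (s : R) x, 0 <= s -> C x -> C (s *: x).

Lemma proj_cone g : dotv (g - cproj C g) (cproj C g) = 0 /\
  forall q, C q -> dotv (g - cproj C g) q <= 0.
Proof.
have Cp := proj_in g; have var := @proj_var g; set p := cproj C g in Cp var *.
(* The variational inequality at [0] and at [2 p], both in the cone, gives the two signs. *)
have e0 : dotv (g - p) p = 0.
  have := var _ (coneC (ler0n R 0) Cp); rewrite mulr0n scale0r sub0r dotvNr.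
  have := var _ (coneC (ler0n R 2) Cp).
  rewrite (_ : 2%:R *: p - p = p); last by rewrite scaler_nat mulr2n addrK.
  lra.
by split => // q /var; rewrite dotvBr e0 subr0.
Qed.

End closed_convex.

End projection.

(** * The tangent cone as polar of the subdifferential *)

Section subdifferential.
Context {R : realType} {d : nat}.
Local Notation V := 'rV[R]_d.
Variables (f : V -> \bar R) (x : V).
Hypotheses (f_proper : proper_fun f) (f_convex : convex_efun f).
Local Notation D := (subdiff f x).
Local Notation T := (tangent_cone f x).

Lemma subdiff_closed : closed D.
Proof.
have -> : D = \bigcap_(h in setT) [set u | ((dotv u h)%:E <= f (x + h)%R - f x)%E].
  by apply/seteqP; split => u /= hu; [move=> h _; exact: hu|move=> h; exact: hu].
apply: closed_bigI => h _.
case: (f (x + h) - f x)%E => [r| |].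
- have -> : [set u : V | ((dotv u h)%:E <= r%:E)%E] = [set u | dotv h u <= r].
    by apply/seteqP; split => u /=; rewrite lee_fin dotvC.
  by apply: closed_le_fun; [exact: dotv_continuous|exact: continuous_cstR].
- rewrite (_ : [set u | _] = setT); first exact: closedT.
  by apply/seteqP; split => u //= _; exact: leey.
- rewrite (_ : [set u | _] = set0); first exact: closed0.
  by apply/seteqP; split => u //=; rewrite leNgt ltNyr.
Qed.

Lemma subdiff_cvx : cvx D.
Proof.
move=> u w t /andP[t0 t1] Du Dw h.
(* The increment of [f] may be infinite; bounding it below by the larger of two reals avoids a
   convex combination of extended inequalities. *)
apply: (@le_trans _ _ (maxe (dotv u h)%:E (dotv w h)%:E)); last first.
  by rewrite ge_max; apply/andP; split; [exact: Du|exact: Dw].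
rewrite -EFin_max lee_fin dotvDl !dotvZl.
have : dotv u h <= Num.max (dotv u h) (dotv w h) by rewrite le_max lexx.
have : dotv w h <= Num.max (dotv u h) (dotv w h) by rewrite le_max lexx orbT.
move: (Num.max _ _) => M h1 h2.
have : (1 - t) * dotv u h <= (1 - t) * M by rewrite ler_wpM2l// subr_ge0.
have : t * dotv w h <= t * M by rewrite ler_wpM2l.
lra.
Qed.

Hypothesis D0 : D !=set0.

Lemma subdiff_fin : exists r, f x = r%:E.
Proof.
have [u /(_ 0)] := D0; rewrite addr0 dotv0.
have [/(_ x)] := f_proper.
case: (f x) => [r _ _ _| |]//; by exists r.
Qed.

Lemma tangent_cone_polar : T `<=` polar D.
Proof.
move=> z [t t0 ft] u Du; have [r fx] := subdiff_fin.
have := Du (t *: z); rewrite dotvZr; move: ft; rewrite fx.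
case: (f _) => [s| |]//.
by rewrite lee_fin -EFinB lee_fin => h1 h2; rewrite -(pmulr_rle0 _ t0); lra.
Qed.

Lemma tangent_coneZ (s : R) z : 0 <= s -> T z -> T (s *: z).
Proof.
rewrite le_eqVlt => /orP[/eqP <- _|s0 [t t0 ft]].
  by exists 1 => //; rewrite scale0r scaler0 addr0.
by exists (t / s); [exact: divr_gt0|rewrite scalerA divfK ?gt_eqF].
Qed.

Lemma tangent_coneD z w : T z -> T w -> T (z + w).
Proof.
move=> [t t0 ft] [s s0 fs]; have [r fx] := subdiff_fin.
have ts : 0 < t + s by exact: addr_gt0.
(* With this step the point is the convex combination of [x + t z] and [x + s w] of weights
   [s / (t + s)] and [t / (t + s)]. *)
exists (t * s / (t + s)); first by rewrite divr_gt0// mulr_gt0.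
have l01 : 0 <= t / (t + s) <= 1.
  by rewrite divr_ge0 ?(ltW t0) ?(ltW ts)//= ler_pdivrMr// mul1r lerDl ltW.
have := f_convex (x + t *: z) (x + s *: w) l01.
have -> : (1 - t / (t + s)) *: (x + t *: z) + (t / (t + s)) *: (x + s *: w) =
   x + (t * s / (t + s)) *: (z + w).
  by apply/rowP => i; rewrite !mxE; field; rewrite gt_eqF.
move/le_trans; apply; move: ft fs; rewrite fx.
case: (f (x + t *: z)) (f_proper.1 (x + t *: z)) => [a _ ha| |]//.
case: (f (x + s *: w)) (f_proper.1 (x + s *: w)) => [b _ hb| |]//.
rewrite -!EFinM -EFinD lee_fin; rewrite !lee_fin in ha hb.
case/andP: l01 => l0 l1; move: (t / (t + s)) l0 l1 => l l0 l1.
have : (1 - l) * a <= (1 - l) * r by rewrite ler_wpM2l// subr_ge0.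
have : l * b <= l * r by rewrite ler_wpM2l.
lra.
Qed.

Lemma tangent_cone_cvx : cvx T.
Proof.
move=> y z t /andP[t0 t1] Ty Tz; apply: tangent_coneD; apply: tangent_coneZ => //.
by rewrite subr_ge0.
Qed.

Lemma tangent_cone0 : T 0.
Proof. by exists 1 => //; rewrite scaler0 addr0. Qed.

Hypotheses (cT : closed T) (D_origin : ~ D 0).

(* A vector z outside T is separated from T by [a], the residual of the
   projection. Scaling [a] by the infimum of the slopes of f over the half-space
   dot(a, h) > 0 gives a subgradient that is positive on z. *)
Lemma polar_tangent_cone : polar D `<=` T.
Proof.
move=> z pz; have [r fx] := subdiff_fin.
have T0 : T !=set0 by exists 0; exact: tangent_cone0.
apply: contrapT => nTz.
have [e0 aT] := proj_cone cT tangent_cone_cvx T0 tangent_coneZ z.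
have Tp := proj_in cT tangent_cone_cvx T0 z.
set p := cproj T z in e0 aT Tp; set a := z - p in e0 aT.
have a0 : a != 0 by apply/eqP => /eqP; rewrite subr_eq0 => /eqP zp; apply: nTz; rewrite zp.
have az : dotv a z = l2norm a ^+ 2.
  by rewrite -{1}[z](subrK p) -/a dotvDr e0 addr0 sqr_l2norm.
have az0 : 0 < dotv a z by rewrite az exprn_gt0// l2norm_gt0.
have pos h : 0 < dotv a h -> (r%:E < f (x + h)%R)%E.
  move=> ah; rewrite ltNge; apply/negP => fh.
  have : T h by exists 1 => //; rewrite scale1r fx.
  by move/aT; rewrite leNgt ah.
have fgt h : f (x + h) != -oo%E := f_proper.1 (x + h).
(* If [f] is infinite on the whole open half-space, adding a nonnegative multiple of [a] to a
   subgradient gives a subgradient, and a large multiple contradicts [pz]. *)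
have [[h0 [ah0 fh0]]|no] := pselect (exists h, 0 < dotv a h /\ (f (x + h)%R < +oo)%E); last first.
  have [u0 Du0] := D0.
  have Ds (s : R) : 0 <= s -> D (u0 + s *: a).
    move=> s0 h; have [ah|ah] := ltP 0 (dotv a h).
      have -> : f (x + h) = +oo%E.
        apply/eqP; rewrite -leye_eq leNgt; apply/negP => fh; apply: no; by exists h.
      by rewrite fx/= leey.
    apply: le_trans (Du0 h); rewrite lee_fin dotvDl dotvZl gerDl.
    by rewrite mulr_ge0_le0.
  have := pz _ (Ds ((`|dotv u0 z| + 1) / dotv a z) _).
  rewrite divr_ge0 ?addr_ge0 ?(ltW az0)// => /(_ isT).
  rewrite dotvDl dotvZl divfK ?gt_eqF//.
  have := ler_norm (- dotv u0 z); rewrite normrN; lra.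
have toR h : (f (x + h)%R < +oo)%E -> exists b, f (x + h) = b%:E.
  by case: (f (x + h)) (fgt h) => [b _ _| |]//; exists b.
pose slopes := [set s | exists h b, [/\ 0 < dotv a h, f (x + h) = b%:E & s = (b - r) / dotv a h]].
have sl0 : lbound slopes 0.
  move=> _ [h [b [ah fh ->]]]; apply: divr_ge0; last exact: ltW.
  by have := pos h ah; rewrite fh lte_fin subr_ge0; exact: ltW.
have [b0 fb0] := toR _ fh0.
have hi : has_inf slopes.
  by split; [exists ((b0 - r) / dotv a h0), h0, b0|exists 0].
pose s := inf slopes.
have s0 : 0 <= s by apply: lb_le_inf => //; case: hi.
have sle h b : 0 < dotv a h -> f (x + h) = b%:E -> s * dotv a h <= b - r.
  move=> ah fh; rewrite -ler_pdivlMr//; apply: ge_inf; first by case: hi.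
  by exists h, b.
have Dsa : D (s *: a).
  move=> h; rewrite dotvZl fx; have [fhoo|] := eqVneq (f (x + h)) +oo%E; first by rewrite fhoo leey.
  rewrite -ltey => /toR[b fb]; rewrite fb -EFinB lee_fin.
  have [ah|ah] := ltP 0 (dotv a h); first exact: sle.
  (* the slope at any admissible point bounds f at h from below *)
  have slope k c : 0 < dotv a k -> f (x + k) = c%:E ->
      dotv a h * ((c - r) / dotv a k) <= b - r.
    move=> ak fk; have cr : r < c by have := pos k ak; rewrite fk lte_fin.
    rewrite leNgt; apply/negP => lt1.
    pose e := dotv a h * ((c - r) / dotv a k) - (b - r).
    have e0' : 0 < e by rewrite subr_gt0.
    (* [h + l0 k] lies on the hyperplane. The extra [e / (c - r)] pushes it into the open
       half-space, where [f] exceeds [r], and is exactly the amount for which convexity bounds the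
       value there by [r]. *)
    pose l0 := - dotv a h / dotv a k.
    have l00 : 0 <= l0 by rewrite divr_ge0 ?oppr_ge0 ?(ltW ak).
    pose l := l0 + e / (c - r).
    have ll0 : l0 < l by rewrite ltrDl divr_gt0// subr_gt0.
    have lp : 0 < l by exact: le_lt_trans ll0.
    have l1 : 0 < 1 + l by rewrite addr_gt0.
    have t01 : 0 <= l / (1 + l) <= 1.
      by rewrite divr_ge0 ?(ltW lp) ?(ltW l1)//= ler_pdivrMr// mul1r lerDr.
    have := f_convex (x + h) (x + k) t01.
    have -> : (1 - l / (1 + l)) *: (x + h) + (l / (1 + l)) *: (x + k) =
       x + (1 + l)^-1 *: (h + l *: k).
      by apply/rowP => i; rewrite !mxE; field; rewrite gt_eqF.
    rewrite fb fk -!EFinM -EFinD.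
    have ac : 0 < dotv a ((1 + l)^-1 *: (h + l *: k)).
      rewrite dotvZr mulr_gt0 ?invr_gt0// dotvDr dotvZr.
      have : l0 * dotv a k = - dotv a h by rewrite /l0 divfK ?gt_eqF.
      have : l0 * dotv a k < l * dotv a k by rewrite ltr_pM2r.
      lra.
    move=> h1; have := lt_le_trans (pos _ ac) h1; rewrite lte_fin => h2.
    have : r * (1 + l) < b + l * c.
      have -> : b + l * c = ((1 - l / (1 + l)) * b + l / (1 + l) * c) * (1 + l).
        by field; rewrite gt_eqF.
      by rewrite ltr_pM2r.
    have : l * (c - r) = - (b - r).
      have cr0 : c - r != 0 by rewrite gt_eqF// subr_gt0.
      by rewrite /l /e /l0; field; rewrite cr0 gt_eqF.
    lra.
  have [ah0'|ahn] := eqVneq (dotv a h) 0.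
    by rewrite ah0' mulr0; have := slope _ _ ah0 fb0; rewrite ah0' mul0r.
  have ahlt : dotv a h < 0 by rewrite lt_neqAle ahn.
  rewrite -ler_ndivrMr//; apply: lb_le_inf; first by case: hi.
  move=> _ [k [c [ak fk ->]]]; rewrite ler_ndivrMr// mulrC.
  exact: slope.
(* Otherwise [s *: a] would be the origin, which is not a subgradient. A positive [s] makes this
   subgradient positive on [z], against [pz]. *)
have sp : 0 < s.
  rewrite lt_neqAle s0 andbT; apply/eqP => sz; apply: D_origin.
  by move: Dsa; rewrite -sz scale0r.
have := pz _ Dsa; rewrite dotvZl leNgt; apply/negP; rewrite negbK.
exact: mulr_gt0.
Qed.

Lemma tangent_coneE : T = polar D.
Proof. by apply/seteqP; split; [exact: tangent_cone_polar|exact: polar_tangent_cone]. Qed.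

End subdifferential.

(** * Support functions, and closed sets that cover a segment *)

Section support.
Context {R : realType} {d : nat}.
Local Notation V := 'rV[R]_d.
Implicit Types (K D : set V) (g h x y z : V).

Definition sup_dot K x : R := sup [set dotv z x | z in K].

Lemma sup_dotP K x : compact K -> K !=set0 ->
  (exists2 z, K z & dotv z x = sup_dot K x) /\ forall z, K z -> dotv z x <= sup_dot K x.
Proof.
move=> cK K0; have [z Kz zmax] := compact_max_attained cK K0 (@dotv_continuous R d x).
have E : sup_dot K x = dotv z x.
  apply/eqP; rewrite eq_le; apply/andP; split.
    apply: ge_sup; first by exists (dotv z x), z.
    by move=> _ [y Ky <-]; rewrite dotvC (dotvC z); exact: zmax.
  apply: ub_le_sup; last by exists z.
  by exists (dotv z x) => _ [y Ky <-]; rewrite dotvC (dotvC z); exact: zmax.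
split; first by exists z.
by move=> y Ky; rewrite E dotvC (dotvC z); exact: zmax.
Qed.

Lemma sup_dot_lip K : compact K -> K !=set0 -> K `<=` l2sphere -> lip 1 (sup_dot K).
Proof.
move=> cK K0 KS; have one x y : sup_dot K x - sup_dot K y <= l2norm (x - y).
  have [[z Kz zx] _] := sup_dotP x cK K0; have [_ /(_ z Kz) zy] := sup_dotP y cK K0.
  rewrite -zx; apply: (@le_trans _ _ (dotv z (x - y))); first by rewrite dotvBr; lra.
  by rewrite (le_trans (cauchy_schwarz _ _))// (KS _ Kz) mul1r.
move=> x y; rewrite mul1r ler_norml one andbT lerNl opprB l2normB; exact: one.
Qed.

Lemma ereal_sup_dot K x : compact K -> K !=set0 ->
  ereal_sup [set (dotv x z)%:E | z in K] = (sup_dot K x)%:E.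
Proof.
move=> cK K0; have [[z Kz zx] zmax] := sup_dotP x cK K0.
apply/eqP; rewrite eq_le; apply/andP; split.
  by apply: ge_ereal_sup => _ [y Ky <-]; rewrite lee_fin dotvC; exact: zmax.
by apply: ereal_sup_ubound; exists z => //; rewrite dotvC zx.
Qed.

Lemma polar_closed D : closed (polar D).
Proof.
have -> : polar D = \bigcap_(u in D) [set z | dotv u z <= 0].
  by apply/seteqP; split => z /= h u Du; exact: h.
apply: closed_bigI => u _.
by apply: closed_le_fun; [exact: dotv_continuous|exact: continuous_cstR].
Qed.

Lemma polar_sphere_compact D : compact (polar D `&` l2sphere).
Proof.
apply: (@l2_closed_compact _ _ _ 1); first by move=> x [_ ->].
by apply: closedI; [exact: polar_closed|exact: l2sphere_closed].
Qed.

(** Connectedness of the unit interval: the supremum of the points of [A] in it belongs to both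
    sets. *)
Lemma closed_cover_meet (A B : set R) : closed A -> closed B ->
  (forall s, 0 <= s <= 1 -> A s \/ B s) -> A 0 -> B 1 ->
  exists s, [/\ 0 <= s <= 1, A s & B s].
Proof.
move=> cA cB AB A0 B1; pose E := [set s | 0 <= s <= 1 /\ A s].
have hs : has_sup E.
  by split; [exists 0; split => //; rewrite lexx ler01|exists 1 => s [/andP[]]].
have E0 : E 0 by split => //; rewrite lexx ler01.
pose s := sup E.
have s0 : 0 <= s by apply: ub_le_sup => //; case: hs.
have s1 : s <= 1 by apply: ge_sup; [exists 0|move=> t [/andP[]]].
have nb (C : set R) : closed C -> ~ C s -> exists2 e, 0 < e & forall t, `|s - t| < e -> ~ C t.
  move=> cC nC; have : nbhs s (~` C) by apply: open_nbhs_nbhs; split => //; exact: closed_openC.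
  by move=> /nbhs_ballP[e /= e0 h]; exists e => // t st; exact: h.
have As : A s.
  apply: contrapT => /(nb _ cA)[e e0 h].
  have [t Et st] := sup_adherent e0 hs.
  have ts : t <= s by apply: ub_le_sup => //; case: hs.
  by apply: (h t); [rewrite ger0_norm ?subr_ge0//; move: st; rewrite -/s; lra|case: Et].
exists s; split => //; first by rewrite s0.
apply: contrapT => /[dup] nBs /(nb _ cB)[e e0 h].
have sl1 : s < 1 by rewrite lt_neqAle s1 andbT; apply/eqP => se; apply: nBs; rewrite se.
pose t := s + Num.min (e / 2) (1 - s).
have mp : 0 < Num.min (e / 2) (1 - s) by rewrite lt_min divr_gt0//= subr_gt0.
have me : Num.min (e / 2) (1 - s) < e.
  by rewrite gt_min ltr_pdivrMr// mulr_natr mulr2n ltrDl e0.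
have t1 : t <= 1 by rewrite /t addrC -lerBrDr ge_min lexx orbT.
have t01 : 0 <= t <= 1 by rewrite t1 andbT /t addr_ge0// ltW.
have Et : E t.
  split => //; have [//|Bt] := AB t t01; exfalso; apply: (h t) => //.
  by rewrite distrC /t addrAC subrr add0r gtr0_norm.
have : t <= s by apply: ub_le_sup => //; case: hs.
by rewrite /t gerDl leNgt mp.
Qed.

(** The additivity of lengths is what matters: slope bounds used on the two sides of the crossing
    point add up to one over the whole segment. *)
Lemma segment_meet (A B : set V) g h : closed A -> closed B ->
  (forall x, A x \/ B x) -> A g -> B h ->
  exists k, [/\ A k, B k & l2norm (g - k) + l2norm (k - h) = l2norm (g - h)].
Proof.
move=> cA cB AB Ag Bh; pose p (s : R) := g + s *: (h - g).
have cp : continuous p.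
  move=> s; apply: (@cvgD _ V _ (nbhs s) _ (fun=> g) (fun s => s *: (h - g))); first exact: cvg_cst.
  exact: (@scalel_continuous _ V).
have cl (C : set V) : closed C -> closed [set s | C (p s)].
  by move=> cC; apply: preimage_closed => // s _; exact: cp.
have [||s [/andP[s0 s1] As Bs]] := closed_cover_meet (cl _ cA) (cl _ cB) (fun s _ => AB (p s)).
- by rewrite /= /p scale0r addr0.
- by rewrite /= /p scale1r addrC subrK.
exists (p s); split => //.
have -> : g - p s = s *: (g - h) by apply/rowP => i; rewrite !mxE; ring.
have -> : p s - h = (1 - s) *: (g - h) by apply/rowP => i; rewrite !mxE; ring.
by rewrite !l2normZ !ger0_norm ?subr_ge0// -mulrDl addrC subrK mul1r.
Qed.

End support.

(** * Giving a sign to a nonnegative Lipschitz function *)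

Section signed_function.
Context {R : realType} {d : nat}.
Local Notation V := 'rV[R]_d.
Variables (A B : set V) (q Gr : V -> R) (K : R).
Hypotheses (cA : closed A) (cB : closed B) (AB : forall x, A x \/ B x).
Hypotheses (q_ge0 : forall x, 0 <= q x) (qAB : forall x, A x -> B x -> q x = 0).
Hypotheses (Gr_ge0 : forall x, 0 <= Gr x) (Gr_le1 : forall x, Gr x <= 1).
Hypotheses (K0 : 0 <= K) (GrK : lip K Gr).
Hypothesis (qG : forall g h, q g <= q h + Gr h * l2norm (g - h)).

Definition signed x := if `[< A x >] then q x else - q x.

Lemma signedA x : A x -> signed x = q x.
Proof. by move=> Ax; rewrite /signed asboolT. Qed.

Lemma signedB x : B x -> signed x = - q x.
Proof.
move=> Bx; rewrite /signed; case: asboolP => // Ax.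
by rewrite qAB// oppr0.
Qed.

(** Across a change of sign both values are measured from the crossing point [k], where [q]
    vanishes, with the slope at [k]; passing to the slope at [h] costs the quadratic term, as [Gr]
    is Lipschitz. *)
Lemma signed_slope g h : signed g - signed h <= Gr h * l2norm (g - h) + K * l2norm (g - h) ^+ 2.
Proof.
have n0 := l2norm_ge0 (g - h).
have r0 : 0 <= Gr h * l2norm (g - h) + K * l2norm (g - h) ^+ 2.
  by rewrite addr_ge0 ?mulr_ge0// sqr_ge0.
have Kn : 0 <= K * l2norm (g - h) ^+ 2 by rewrite mulr_ge0// sqr_ge0.
have [Ag|Bg] := AB g; have [Ah|Bh] := AB h.
- by rewrite !signedA//; have := qG g h; lra.
- rewrite (signedA Ag) (signedB Bh) opprK.
  have [k [Ak Bk e]] := segment_meet cA cB AB Ag Bh.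
  have h1 := qG g k; have h2 := qG h k; rewrite (qAB Ak Bk) add0r in h1 h2.
  have := GrK k h; rewrite ler_norml => /andP[_ h3].
  have kh : l2norm (k - h) <= l2norm (g - h) by rewrite -e lerDr l2norm_ge0.
  have : Gr k <= Gr h + K * l2norm (g - h) by have := ler_wpM2l K0 kh; lra.
  rewrite (l2normB h k) in h2; move=> h4.
  apply: (@le_trans _ _ (Gr k * l2norm (g - h))); first by rewrite -e; lra.
  by have := ler_wpM2r n0 h4; rewrite expr2; lra.
- rewrite (signedB Bg) (signedA Ah) -opprD; have := q_ge0 g; have := q_ge0 h; lra.
- rewrite (signedB Bg) (signedB Bh) opprK.
  have h1 := qG h g; rewrite (l2normB h g) in h1.
  have := GrK g h; rewrite ler_norml => /andP[_ h3].
  have := @ler_wpM2r _ _ n0 (Gr g) (Gr h + K * l2norm (g - h)).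
  by rewrite mulrDl expr2 => /(_ _)/wrap[]; lra.
Qed.

Lemma signed_lip : lip 1 signed.
Proof.
have one g h : signed g - signed h <= l2norm (g - h).
  have n0 := l2norm_ge0 (g - h).
  have q1 x y : q x <= q y + l2norm (x - y).
    apply: (le_trans (qG x y)); rewrite lerD2l ler_piMl ?l2norm_ge0//.
  have [Ag|Bg] := AB g; have [Ah|Bh] := AB h.
  - by rewrite !signedA//; have := q1 g h; lra.
  - rewrite (signedA Ag) (signedB Bh) opprK.
    have [k [Ak Bk <-]] := segment_meet cA cB AB Ag Bh.
    have := q1 g k; have := q1 h k; rewrite (qAB Ak Bk) (l2normB h k); lra.
  - rewrite (signedB Bg) (signedA Ah) -opprD; have := q_ge0 g; have := q_ge0 h; lra.
  - rewrite (signedB Bg) (signedB Bh) opprK; have := q1 h g; rewrite (l2normB h g); lra.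
move=> x y; rewrite mul1r ler_norml one andbT lerNl opprB l2normB; exact: one.
Qed.

Lemma signed_sqr x : signed x ^+ 2 = q x ^+ 2.
Proof. by rewrite /signed; case: ifP => // _; rewrite sqrrN. Qed.

(** Poincare for the signed function, which has the same square as [q] but whose mean can be made
    small. *)
Lemma signed_variance :
  Ex (fun x => q x ^+ 2) <= Ex (fun x => Gr x ^+ 2) + Ex signed ^+ 2.
Proof.
have -> : Ex (fun x => q x ^+ 2) = Ex (fun x => signed x ^+ 2).
  by apply: eq_Ex => x; rewrite signed_sqr.
rewrite -lerBlDr.
apply: (poincare_weighted signed_lip ler01 GrK K0 Gr_ge0 K0) => y v.
by have := signed_slope (y + v) y; rewrite addrAC subrr add0r; lra.
Qed.

End signed_function.

(** * Distance to a scaled convex set against the support function of its polar *)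

Section cone_distance.
Context {R : realType} {d : nat}.
Local Notation V := 'rV[R]_d.
Variable D : set V.
Hypotheses (cD : closed D) (vD : cvx D) (D0 : D !=set0) (D_origin : ~ D 0).
Implicit Types (g h u v y z : V) (c : R).

Definition polar_sup g : R := sup_dot (polar D `&` l2sphere) g.
Definition polar_sup_pos g := Num.max 0 (polar_sup g).
Definition sproj c g := c *: cproj D (c^-1 *: g).
Definition sdist c g : R := l2norm (g - sproj c g).
Definition sgap c g := dotv (sproj c g) (g - sproj c g).
Definition defect c g := sdist c g ^+ 2 - polar_sup_pos g ^+ 2.

Local Notation X := polar_sup.
Local Notation Xp := polar_sup_pos.
Local Notation P := sproj.
Local Notation J := sdist.
Local Notation S := sgap.
Local Notation N := defect.

(** The least-norm element [p] of [D] satisfies [<u, p> >= |p|^2] on [D], so its normalized opposite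
    is in the polar. *)
Lemma polar_sphere_neq0 : polar D `&` l2sphere !=set0.
Proof.
have Dp := proj_in cD vD D0 0; have var := @proj_var _ _ D cD vD D0 0.
set p := cproj D 0 in Dp var.
have p0 : p != 0 by apply/eqP => p0; apply: D_origin; rewrite -p0.
have np : 0 < l2norm p by exact: l2norm_gt0.
exists (- (l2norm p)^-1 *: p); split.
  move=> u Du; rewrite dotvZr mulNr oppr_le0 mulr_ge0 ?invr_ge0 ?(ltW np)//.
  have := var u Du; rewrite sub0r dotvNl dotvBr (dotvC u p).
  by have := dotvv_ge0 p; lra.
by rewrite /l2sphere/= l2normZ normrN normfV (gtr0_norm np) mulVf ?gt_eqF.
Qed.

Let cTS := @polar_sphere_compact R d D.
Let TS0 := polar_sphere_neq0.

Lemma polar_supP g : (exists2 z, polar D z /\ l2norm z = 1 & dotv z g = X g) /\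
  forall z, polar D z -> l2norm z = 1 -> dotv z g <= X g.
Proof.
have [h1 h2] := sup_dotP g cTS TS0; split; first exact: h1.
by move=> z pz z1; apply: h2.
Qed.

Lemma polar_sup_lip : lip 1 X.
Proof. by apply: sup_dot_lip => // z []. Qed.

Lemma polar_sup_pos_ge0 g : 0 <= Xp g. Proof. by rewrite /Xp le_max lexx. Qed.

Lemma polar_sup_le_pos g : X g <= Xp g. Proof. by rewrite /Xp le_max lexx orbT. Qed.

Lemma polar_sup_pos_lip : lip 1 Xp.
Proof.
have one x y : Xp x - Xp y <= l2norm (x - y).
  have := polar_sup_lip x y; rewrite mul1r => /(le_trans (ler_norm _)) h.
  have := polar_sup_pos_ge0 y; have := polar_sup_le_pos y; have := l2norm_ge0 (x - y).
  by move=> n0 h1 h2; rewrite lerBlDr {1}/Xp ge_max; apply/andP; split; lra.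
move=> x y; rewrite mul1r ler_norml one andbT lerNl opprB l2normB; exact: one.
Qed.

(** The squared positive part of a real [t] is the supremum of [2 s t - s^2] over [s >= 0]. This
    presents [polar_sup_pos g ^+ 2] as a supremum of affine functions of [g], so that a choice made
    at one point gives a lower bound at any other. *)
Lemma polar_sup_pos_sqr_ge g y (s : R) : polar D y -> l2norm y = 1 -> 0 <= s ->
  2 * s * dotv g y - s ^+ 2 <= Xp g ^+ 2.
Proof.
move=> py y1 s0; have [_ /(_ y py y1)] := polar_supP g.
rewrite dotvC; have := polar_sup_le_pos g; move: (Xp g) (X g) (dotv g y) => a b t h1 h2.
have := sqr_ge0 (a - s); have : s * t <= s * a by rewrite ler_wpM2l//; lra.
nra.
Qed.

Lemma polar_sup_pos_witness g : exists2 y, polar D y /\ l2norm y = 1 & Xp g * dotv g y = Xp g ^+ 2.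
Proof.
have [[y py yg] _] := polar_supP g; exists y => //; rewrite dotvC yg.
by rewrite /Xp /Num.max; case: ifP => _; [rewrite expr2|rewrite mul0r expr0n].
Qed.

Section fixed_scale.
Variable c : R.
Hypothesis c0 : 0 < c.

Lemma sproj_in g : exists2 u, D u & P c g = c *: u.
Proof. by exists (cproj D (c^-1 *: g)) => //; exact: proj_in. Qed.

Lemma sproj_var g u : D u -> dotv (g - P c g) (c *: u - P c g) <= 0.
Proof.
move=> Du; have := proj_var cD vD D0 (c^-1 *: g) Du; rewrite /P; set p := cproj _ _.
have -> : g - c *: p = c *: (c^-1 *: g - p).
  by rewrite scalerBr scalerA divff ?gt_eqF// scale1r.
rewrite -scalerBr dotvZl dotvZr => h.
by rewrite !mulr_ge0_le0// ltW.
Qed.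

Lemma sdist_min g u : D u -> J c g <= l2norm (g - c *: u).
Proof.
move=> Du; have h := sproj_var g Du; rewrite /J.
rewrite -ler_sqr ?nnegrE ?l2norm_ge0//.
have -> : g - c *: u = (g - P c g) - (c *: u - P c g) by apply/rowP => i; rewrite !mxE; ring.
by rewrite (sqr_l2normB (g - P c g)); have := sqr_ge0 (l2norm (c *: u - P c g)); lra.
Qed.

Lemma sproj_nonexpansive g h : l2norm (P c g - P c h) <= l2norm (g - h).
Proof.
rewrite /P -scalerBr l2normZ (gtr0_norm c0).
have := proj_nonexpansive cD vD D0 (c^-1 *: g) (c^-1 *: h).
rewrite -scalerBr l2normZ gtr0_norm ?invr_gt0// => h1.
by rewrite -ler_pdivlMl.
Qed.

Lemma sdist_le g h : J c g <= l2norm (g - P c h).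
Proof. by have [u Du ->] := sproj_in h; exact: sdist_min. Qed.

Lemma sdist_ge0 g : 0 <= J c g. Proof. exact: l2norm_ge0. Qed.

Lemma sdist_lip : lip 1 (J c).
Proof.
have one x y : J c x - J c y <= l2norm (x - y).
  rewrite lerBlDr (le_trans (sdist_le x y))//.
  have -> : x - P c y = (x - y) + (y - P c y) by rewrite addrA subrK.
  exact: l2normD.
move=> x y; rewrite mul1r ler_norml one andbT lerNl opprB l2normB; exact: one.
Qed.

Lemma sproj_polar g z : polar D z -> dotv (P c g) z <= 0.
Proof.
by move=> pz; have [u Du ->] := sproj_in g; rewrite dotvZl pmulr_rle0//; exact: pz.
Qed.

Lemma polar_sup_le_sdist g : X g <= J c g.
Proof.
have [[z [pz z1] <-] _] := polar_supP g.
have := cauchy_schwarz z (g - P c g); rewrite z1 mul1r dotvBr (dotvC z (P c g)).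
by have := sproj_polar g pz; rewrite /J; lra.
Qed.

Lemma polar_sup_pos_le_sdist g : Xp g <= J c g.
Proof. by rewrite /Xp ge_max sdist_ge0 polar_sup_le_sdist. Qed.

Lemma defect_ge0 g : 0 <= N c g.
Proof.
by rewrite /N subr_ge0 ler_sqr ?nnegrE ?polar_sup_pos_le_sdist ?polar_sup_pos_ge0 ?sdist_ge0.
Qed.

(** The projection of [h] bounds the distance at [g] from above, the maximizer [y] of [h] bounds the
    supremum at [g] from below. With [k = (h - P h) - s y] this reads
    [N g <= N h + 2 <k, g - h> + |g - h|^2], and [|k|^2 <= N h] because [P h] pairs nonpositively
    with [y]. *)
Lemma defect_one_sided g h :
  N c g <= (Num.sqrt (N c h) + l2norm (g - h)) ^+ 2.
Proof.
have [y [py y1] yh] := polar_sup_pos_witness h.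
have s0 := polar_sup_pos_ge0 h.
have h1 := polar_sup_pos_sqr_ge g py y1 s0.
have h2 : J c g ^+ 2 <= l2norm ((h - P c h) + (g - h)) ^+ 2.
  rewrite ler_sqr ?nnegrE ?l2norm_ge0// (_ : _ + _ = g - P c h); first exact: sdist_le.
  by apply/rowP => i; rewrite !mxE; ring.
set s := Xp h in yh s0 h1; set k := (h - P c h) - s *: y.
have h3 : l2norm k ^+ 2 <= N c h.
  rewrite /k sqr_l2normB l2normZ (ger0_norm s0) y1 mulr1 dotvZr dotvBl /N -/(J c h) -/s.
  move: (sproj_polar h py) s0 yh; clear; move: s (dotv h y) (dotv (P c h) y) (J c h).
  by move=> s t p j h1 h2 h3; have : s * p <= 0 by [rewrite mulr_ge0_le0]; rewrite mulr2n; nra.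
have h4 : l2norm k <= Num.sqrt (N c h).
  by rewrite -[l2norm k]ger0_norm ?l2norm_ge0// -sqrtr_sqr ler_wsqrtr.
have h5 := cauchy_schwarz k (g - h).
have h6 : l2norm k * l2norm (g - h) <= Num.sqrt (N c h) * l2norm (g - h).
  by rewrite ler_wpM2r ?l2norm_ge0.
rewrite sqr_l2normD in h2.
rewrite sqrrD sqr_sqrtr ?defect_ge0// /N -/s.
have e1 : dotv k (g - h) = dotv (h - P c h) (g - h) - s * (dotv g y - dotv h y).
  by rewrite /k dotvBl dotvZl (dotvC y) dotvBl.
rewrite e1 in h5; move: h1 h2 h5 h6 yh; rewrite -/(J c h); clear.
move: (J c g) (J c h) (Xp g) (l2norm (g - h)) (Num.sqrt _ * _) (l2norm k * _)
  (dotv (h - P c h) _) (dotv g y) (dotv h y); clear; move: s; clear => *; lra.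
Qed.

Lemma sqrt_defect_slope g h : Num.sqrt (N c g) <= Num.sqrt (N c h) + l2norm (g - h).
Proof.
rewrite -[X in _ <= X]ger0_norm ?addr_ge0 ?sqrtr_ge0 ?l2norm_ge0// -sqrtr_sqr.
exact/ler_wsqrtr/defect_one_sided.
Qed.

(** The same freezing for the difference itself instead of that of squares. The unit vectors [zJ],
    from the residual, and [y] satisfy [|zJ - y|^2 <= 2 - 2 X h / J c h], and the second-order term
    of the distance has the coefficient [1 / (2 J c h)]: both bring the slope [1 / sqrt (J c h)]. *)
Lemma excess_one_sided g h : 0 < J c h ->
  2 * (J c g - Xp g) <=
  (Num.sqrt (2 * (J c h - Xp h)) + l2norm (g - h) / Num.sqrt (J c h)) ^+ 2.
Proof.
move=> Jp; set j := Num.sqrt (J c h).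
have j0 : 0 < j by rewrite sqrtr_gt0.
have j2 : j ^+ 2 = J c h by rewrite sqr_sqrtr ?ltW.
have n0 := l2norm_ge0 (g - h).
have phi0 : 0 <= 2 * (J c h - Xp h) by rewrite mulr_ge0// subr_ge0 polar_sup_pos_le_sdist.
set f := Num.sqrt (2 * (J c h - Xp h)).
have f0 : 0 <= f by exact: sqrtr_ge0.
have f2 : f ^+ 2 = 2 * (J c h - Xp h) by rewrite sqr_sqrtr.
(* A negative supremum means [Xp h = 0]; the root at [h] is then at least [j], and the Lipschitz
   bound of the distance is enough. *)
have [Xneg|Xpos] := ltP (X h) 0.
  have Xp0 : Xp h = 0 by rewrite /Xp; apply/max_idPl; exact: ltW.
  have h1 := sdist_lip g h; rewrite mul1r in h1.
  have h2 := le_trans (ler_norm _) h1.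
  have fj : j <= f.
    rewrite -ler_sqr ?nnegrE ?(ltW j0)// f2 j2 Xp0 subr0.
    by rewrite ler_peMl ?(ltW Jp)// ler1n.
  have : l2norm (g - h) <= f * (l2norm (g - h) / j).
    by rewrite mulrCA ler_peMr// ler_pdivlMr// mul1r.
  have := sqr_ge0 (l2norm (g - h) / j); rewrite sqrrD f2 Xp0.
  have := polar_sup_pos_ge0 g; move: h2; clear.
  by move: (Xp g) (J c g) (J c h) (l2norm (g - h)) (l2norm (g - h) / j) => *; lra.
have [y [py y1] yh] := (polar_supP h).1.
have XpX : Xp h = X h by apply/max_idPr.
pose zJ := (J c h)^-1 *: (h - P c h).
have zJ1 : l2norm zJ = 1 by rewrite l2normZ gtr0_norm ?invr_gt0// mulVf ?gt_eqF.
have hJ : h - P c h = J c h *: zJ by rewrite scalerA divff ?gt_eqF// scale1r.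
have h1 : J c g <= J c h + dotv zJ (g - h) + l2norm (g - h) ^+ 2 / (2 * J c h).
  have a1 : J c g ^+ 2 <= l2norm ((h - P c h) + (g - h)) ^+ 2.
    rewrite ler_sqr ?nnegrE ?l2norm_ge0// (_ : _ + _ = g - P c h); first exact: sdist_le.
    by apply/rowP => i; rewrite !mxE; ring.
  rewrite sqr_l2normD -/(J c h) hJ dotvZl in a1.
  have sq := sqr_ge0 (J c g - J c h).
  set t := dotv zJ _ in a1 *; set n := l2norm (g - h) in n0 a1 *.
  rewrite -(ler_pM2l Jp) !mulrDr.
  rewrite (_ : J c h * (n ^+ 2 / (2 * J c h)) = n ^+ 2 / 2); last by field; rewrite gt_eqF.
  by move: a1 sq; clear; move: (J c h) (J c g) => p q; nra.
have h2 : X h + dotv y (g - h) <= Xp g.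
  have := (polar_supP g).2 y py y1; have := polar_sup_le_pos g.
  by rewrite dotvBr yh; clear; move: (X h) (X g) (Xp g) (dotv y g) => *; lra.
have h3 : l2norm (zJ - y) ^+ 2 <= (f / j) ^+ 2.
  rewrite sqr_l2normB zJ1 y1 expr1n exprMn exprVn f2 j2.
  have : X h / J c h <= dotv zJ y.
    rewrite /zJ dotvZl mulrC ler_pM2l ?invr_gt0// dotvBl (dotvC h) yh.
    by rewrite lerBrDr gerDl; exact: sproj_polar.
  rewrite XpX (_ : 2 * (J c h - X h) / J c h = 2 - 2 * (X h / J c h)); last by field; rewrite gt_eqF.
  by clear; move: (X h / J c h) (dotv zJ y) => *; lra.
have h4 : dotv (zJ - y) (g - h) <= f / j * l2norm (g - h).
  apply: (le_trans (cauchy_schwarz _ _)); apply: ler_wpM2r => //.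
  rewrite -ler_sqr ?nnegrE ?l2norm_ge0// divr_ge0// ltW//.
rewrite dotvBl in h4.
rewrite sqrrD f2 (_ : (l2norm (g - h) / j) ^+ 2 = 2 * (l2norm (g - h) ^+ 2 / (2 * J c h))); last first.
  by rewrite exprMn exprVn j2; field; rewrite gt_eqF.
rewrite XpX (_ : f * (l2norm (g - h) / j) = f / j * l2norm (g - h)); last by ring.
move: h1 h2 h4; clear.
move: (J c g) (X h) (Xp g) (dotv y _) (dotv zJ _) (f / j * _) (J c h) (_ / (2 * _)) => *; lra.
Qed.

(* Below the scale set to the polar cone: on [sgap <= 0] the residual lies in
   the polar cone. *)
Lemma excess_le_of_sgap g u : D u -> S c g <= 0 ->
  J c g * (J c g - Xp g) <= - S c g /\ - S c g <= J c g * (c * l2norm u).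
Proof.
move=> Du Sle; split; last first.
  have := sproj_var g Du; rewrite dotvBr (dotvC (g - _) (P c g)) -/(S c g) => h.
  have := cauchy_schwarz (- (g - P c g)) (c *: u).
  rewrite l2normN dotvNl l2normZ (gtr0_norm c0) -/(J c g); lra.
have pg : polar D (g - P c g).
  move=> w Dw; have := sproj_var g Dw; rewrite dotvBr (dotvC _ (P c g)) -/(S c g) dotvZr.
  rewrite dotvC => h; rewrite -(pmulr_rle0 _ c0); lra.
have := sdist_ge0 g; rewrite le_eqVlt => /orP[/eqP <-|Jp]; first by rewrite mul0r oppr_ge0.
have := (polar_supP g).2 ((J c g)^-1 *: (g - P c g)).
rewrite l2normZ gtr0_norm ?invr_gt0// mulVf ?gt_eqF// => /(_ _ erefl)/wrap[].
  by move=> w Dw; rewrite dotvZr pmulr_rle0 ?invr_gt0//; exact: pg.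
have -> : dotv ((J c g)^-1 *: (g - P c g)) g = J c g + S c g / J c g.
  rewrite dotvZl -[X in dotv _ X](subrK (P c g)) dotvDr -sqr_l2norm -/(J c g).
  by rewrite (dotvC _ (P c g)) -/(S c g); field; rewrite gt_eqF.
have := polar_sup_le_pos g => h1 h2.
have : J c g * (J c g + S c g / J c g) <= J c g * Xp g by rewrite ler_pM2l//; lra.
rewrite mulrDr (mulrC _ (S c g / _)) divfK ?gt_eqF//; lra.
Qed.

Lemma excess_le g u : D u -> S c g <= 0 -> J c g - Xp g <= c * l2norm u.
Proof.
move=> Du Sle; have [h1 h2] := excess_le_of_sgap Du Sle.
have := sdist_ge0 g; rewrite le_eqVlt => /orP[/eqP j0|Jp].
  rewrite -j0 sub0r (@le_trans _ _ 0) ?oppr_le0 ?polar_sup_pos_ge0//.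
  by rewrite mulr_ge0 ?l2norm_ge0// ltW.
by rewrite -(ler_pM2l Jp); lra.
Qed.

Lemma defect_eq0 g : S c g = 0 -> N c g = 0.
Proof.
move=> S0; have [u Du] := D0; have Sle : S c g <= 0 by rewrite S0.
have [h1 _] := excess_le_of_sgap Du Sle; rewrite S0 oppr0 in h1.
have h2 := polar_sup_pos_le_sdist g; have h3 := polar_sup_pos_ge0 g.
apply/eqP; rewrite eq_le defect_ge0 andbT /N subr_sqr.
have : 0 <= Xp g * (J c g - Xp g) by rewrite mulr_ge0// subr_ge0.
have : 0 <= (J c g - Xp g) ^+ 2 by exact: sqr_ge0.
have : J c g <= 0 \/ 0 < J c g by have [|] := leP (J c g) 0; [left|right].
case=> [jl|jp]; first by have -> : J c g = 0; [|have -> : Xp g = 0]; lra.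
have : J c g - Xp g <= 0 by rewrite -(pmulr_rle0 _ jp).
move=> h4; have -> : J c g = Xp g by lra.
by rewrite subrr mul0r.
Qed.

Lemma sgap_continuous : continuous (S c).
Proof.
have E : S c = (fun g => (l2norm g ^+ 2 - l2norm (P c g) ^+ 2 - J c g ^+ 2) / 2).
  apply/funext => g; have e := sqr_l2normD (g - P c g) (P c g).
  rewrite subrK -/(J c g) dotvC -/(S c g) in e; rewrite e.
  by move: (S c g) (J c g) (l2norm _) => *; field.
have sq (f : V -> R) L : lip L f -> continuous (fun g => f g ^+ 2).
  move=> fL; under eq_fun do rewrite expr2.
  by apply: continuous_mulR; exact: lip_continuous fL.
have Pl : lip 1 (fun g => l2norm (P c g) : R).
  move=> g h; rewrite mul1r (le_trans (l2norm_lip _ _))//; exact: sproj_nonexpansive.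
rewrite E; apply: continuous_mulR; last exact: continuous_cstR.
apply: continuous_subR; last exact: sq sdist_lip.
by apply: continuous_subR; [exact: sq (@l2norm_lip1 R d)|exact: sq Pl].
Qed.

End fixed_scale.

End cone_distance.

(** * Scalar inequalities *)

Section real_lemmas.
Context {R : realType}.
Implicit Types (a b c s t u z mu : R).

(** A quartic in the deviation [u = z - mu] that dominates [1 / (2 max(1, z)) + max(0, 2 z (1 - z))]
    for [z >= 0] and [mu >= 4.08]. There is no cubic term because its mean is not controlled: only
    [Ex u = 0], [Ex u^2 <= 1] and [Ex u^4 <= 5] are at hand. *)
Definition majorant u : R := 156 / 1250 - 311 / (100 * 100) * u
  + 19 / (100 * 100) * u ^+ 2 + 27 / 5000 * u ^+ 4.

(* The quintic [z * majorant u - 1/2], [z = u + 4.08], is nearly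
   [20/3721 (z - 2/5) (z^2 - 199/25 z + 61/4)^2]. *)
Lemma majorant_ge_inv u : 1 <= u + 408 / 100 -> (2 * (u + 408 / 100))^-1 <= majorant u.
Proof.
move=> h; have z0 : 0 < u + 408 / 100 by lra.
rewrite -[_^-1]mul1r ler_pdivrMr; last by rewrite mulr_gt0.
have T : 0 <= (u + 408 / 100 - 2 / 5) *
  ((u + 408 / 100) ^+ 2 - 199 / 25 * (u + 408 / 100) + 61 / 4) ^+ 2.
  by apply: mulr_ge0; [lra|exact: sqr_ge0].
have z0' := ltW z0.
have A : 0 <= (u + 408 / 100) * (u + 1) ^+ 2 by rewrite mulr_ge0// sqr_ge0.
have B : 0 <= (u + 408 / 100) * u ^+ 2 by rewrite mulr_ge0// sqr_ge0.
have C : 0 <= (u + 408 / 100) * u ^+ 4 by rewrite mulr_ge0// (exprM u 2 2) sqr_ge0.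
by rewrite /majorant; move: T A B C z0'; clear => *; lra.
Qed.

Lemma majorant_ge1 u : u + 408 / 100 <= 1 / 2 -> 1 <= majorant u.
Proof.
move=> h; have u2 : 12 <= u ^+ 2 by nra.
have u4 : 144 <= u ^+ 4 by rewrite (exprM _ 2 2); nra.
by rewrite /majorant; lra.
Qed.

Lemma majorant_ge_quad u : 1 / 2 <= u + 408 / 100 -> u + 408 / 100 <= 1 ->
  1 / 2 + 2 * (u + 408 / 100) * (1 - (u + 408 / 100)) <= majorant u.
Proof.
move=> h1 h2; have u4 : 2 * (1138 / 100) * u ^+ 2 - (1138 / 100) ^+ 2 <= u ^+ 4.
  by have := sqr_ge0 (u ^+ 2 - 1138 / 100); rewrite (exprM u 2 2); lra.
rewrite /majorant; have := sqr_ge0 (u + 336 / 100); move: (u ^+ 4) u4 h1 h2; clear => *; lra.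
Qed.

Lemma majorant_ge mu z : 408 / 100 <= mu -> 0 <= z ->
  (2 * Num.max 1 z)^-1 + Num.max 0 (2 * z * (1 - z)) <= majorant (z - mu).
Proof.
move=> hmu z0; set u := z - mu; have uz : u + 408 / 100 <= z by rewrite /u; lra.
have low : u + 408 / 100 <= 1 -> 1 / 2 <= majorant u.
  move=> h; have [h1|h1] := leP (u + 408 / 100) (1 / 2).
    by have := majorant_ge1 h1; lra.
  apply: le_trans (majorant_ge_quad (ltW h1) h); rewrite lerDl; apply: mulr_ge0; lra.
have [z1|z1] := leP 1 z.
  have -> : Num.max 0 (2 * z * (1 - z)) = 0.
    by apply/max_idPl; rewrite mulr_ge0_le0//; [rewrite mulr_ge0|rewrite subr_le0].
  rewrite addr0; have [h|h] := leP 1 (u + 408 / 100).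
    apply: le_trans (majorant_ge_inv h).
    by rewrite lef_pV2 ?posrE; [rewrite ler_pM2l| |]; lra.
  apply: le_trans (low (ltW h)).
  by rewrite mul1r lef_pV2 ?posrE; lra.
rewrite mulr1 (_ : Num.max 0 (2 * z * (1 - z)) = 2 * z * (1 - z)); last first.
  by apply/max_idPr; rewrite !mulr_ge0// subr_ge0 ltW.
have [h1|h1] := leP (u + 408 / 100) (1 / 2).
  by apply: le_trans (majorant_ge1 h1); have := sqr_ge0 (2 * z - 1); lra.
apply: le_trans (majorant_ge_quad (ltW h1) _); last by lra.
move: (u + 408 / 100) uz h1 => y yz h1; nra.
Qed.

Lemma inv_sqrt_diff a b : 1 <= a -> 1 <= b -> `|(Num.sqrt a)^-1 - (Num.sqrt b)^-1| <= `|a - b|.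
Proof.
move=> a1 b1.
have one p q : 1 <= p -> 1 <= q -> (Num.sqrt p)^-1 - (Num.sqrt q)^-1 <= `|p - q|.
  move=> p1 q1; have [pq|qp] := leP p q; last first.
    apply: (@le_trans _ _ 0) => //; rewrite subr_le0 lef_pV2 ?posrE ?sqrtr_gt0; try lra.
    exact/ler_wsqrtr/ltW.
  have sp : 1 <= Num.sqrt p by rewrite -[X in X <= _]sqrtr1 ler_wsqrtr.
  have sq : Num.sqrt p <= Num.sqrt q by exact: ler_wsqrtr.
  rewrite -[X in `|X - _|]sqr_sqrtr ?(le_trans ler01)//.
  rewrite -[X in `|_ - X|]sqr_sqrtr ?(le_trans ler01)//.
  move: (Num.sqrt p) (Num.sqrt q) sp sq => x y x1 xy.
  rewrite distrC ger0_norm; last by rewrite subr_ge0 ler_sqr ?nnegrE; lra.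
  rewrite subr_sqr (_ : x^-1 - y^-1 = (y - x) / (x * y)); last by field; rewrite !gt_eqF//; lra.
  rewrite ler_wpM2l ?subr_ge0// invf_ple ?posrE; [|nra|lra].
  apply: (@le_trans _ _ 1); last by nra.
  by rewrite invf_le1; lra.
by rewrite ler_norml one// andbT lerNl opprB distrC one.
Qed.

Lemma abs_sum_le a b c : 0 <= a -> 0 <= b -> a <= c -> b <= c -> `|a + b| <= 2 * c.
Proof. by move=> a0 b0 ac bc; rewrite (ger0_norm (addr_ge0 a0 b0)); lra. Qed.

(** Here [j >= 3 k / 4] and [x <= k / 4], and [k >= 6] makes the quadratic growth of the defect beat
    four times a weight that is at most [j]. *)
Lemma large_scale_bound (k n j x w : R) : 6 <= k -> n <= k / 4 -> k - n <= j ->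
  0 <= x -> x <= n -> w <= Num.max 1 j -> 2 ^+ 2 * w <= j ^+ 2 - x ^+ 2.
Proof.
move=> k6 nk kj x0 xn; have j4 : 4 <= j by lra.
rewrite (max_idPr _); last by lra.
move=> wj; have : x ^+ 2 <= (k / 4) ^+ 2 by rewrite ler_sqr ?nnegrE; lra.
have : (3 * (k / 4)) * (3 * (k / 4) - 4) <= j * (j - 4) by apply: ler_pM; lra.
nra.
Qed.

(* [165 / 10^5] bounds the maximum of [(s - 4) / s^4], attained at [s = 16/3]. *)
Lemma neg_part_le u : - u - 4 <= 165 / (1000 * 100) * u ^+ 4.
Proof.
have h1 : 2 * (256 / 9) * u ^+ 2 - (256 / 9) ^+ 2 <= u ^+ 4.
  by have := sqr_ge0 (u ^+ 2 - 256 / 9); rewrite (exprM u 2 2); lra.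
have h2 := sqr_ge0 (u + 1875 / 352).
lra.
Qed.

(** Above level 1 the quotient gives back the excess. Below it the weight is 1 and the loss
    [(j - x) (1 - z)] is at most [2 z (1 - z)], because [j - x <= j + x]. *)
Lemma excess_split (j x : R) : x <= j -> 0 <= x ->
  j - x <= 1 / 2 * (2 * (j - x) * ((j + x) / 2) / Num.max 1 ((j + x) / 2)) +
    Num.max 0 (2 * ((j + x) / 2) * (1 - (j + x) / 2)).
Proof.
move=> xj x0; have [z [Ez z0]] : exists z, z = (j + x) / 2 /\ 0 <= z.
  by exists ((j + x) / 2); split => //; lra.
rewrite -Ez; have jz : j - x <= 2 * z by lra.
have [z1|z1] := leP 1 z.
  rewrite mulfK ?gt_eqF//; last by lra.
  have : 0 <= Num.max 0 (2 * z * (1 - z)) by rewrite le_max lexx.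
  lra.
have : 2 * z * (1 - z) <= Num.max 0 (2 * z * (1 - z)) by rewrite le_max lexx orbT.
rewrite divr1; move: (Num.max _ _) => m; nra.
Qed.

Lemma midpoint_le a b : b <= a -> (a + b) / 2 <= a.
Proof. lra. Qed.

Lemma midpoint_diff_le a b s t c : `|a - b| <= c -> `|s - t| <= c -> `|(a + s) / 2 - (b + t) / 2| <= c.
Proof. by rewrite !ler_norml => /andP[? ?] /andP[? ?]; apply/andP; split; lra. Qed.

Lemma max1_diff_le a b : `|Num.max 1 a - Num.max 1 b| <= `|a - b|.
Proof.
have one s t : Num.max 1 s - Num.max 1 t <= `|s - t|.
  have := ler_norm (s - t); have := normr_ge0 (s - t).
  by case: (leP 1 s) => ?; case: (leP 1 t) => ?; move: `|_| => *; lra.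
by rewrite ler_norml one andbT lerNl opprB distrC one.
Qed.

Lemma ratio_diff_le a b s t : 1 <= s -> 1 <= t -> 0 <= b ->
  `|a / s - b / t| <= `|a - b| + b * `|s - t|.
Proof.
move=> s1 t1 b0; have s0 : 0 < s by lra.
have t0 : 0 < t by lra.
have st : 0 < s * t by exact: mulr_gt0.
have -> : a / s - b / t = (a - b) / s - b * (s - t) / (s * t).
  by field; rewrite !gt_eqF.
apply: (le_trans (ler_normB _ _)); rewrite !normrM !normfV (ger0_norm b0) (gtr0_norm s0) (gtr0_norm st).
apply: lerD.
  by rewrite ler_pdivrMr// ler_peMr.
rewrite ler_pdivrMr// ler_peMr ?mulr_ge0//.
by apply: (le_trans s1); rewrite ler_peMr// ltW.
Qed.

Lemma ratio_modulus (j j' x s t a L B n : R) : 1 <= n -> 0 <= L -> 0 <= B -> 0 <= a ->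
  `|j - j'| <= a * (L * n) -> 0 <= j -> j <= B * n -> 0 <= j' -> j' <= B * n ->
  0 <= j' ^+ 2 - x ^+ 2 -> 1 <= s -> 1 <= t -> `|s - t| <= a * (L * n) ->
  `|(j ^+ 2 - x ^+ 2) / s - (j' ^+ 2 - x ^+ 2) / t| <= (2 * L * B + B ^+ 2 * L) * a * n ^+ 4.
Proof.
move=> n1 L0 B0 a0 jj j0 jB j0' jB' N0 s1 t1 st.
have n0 : 0 <= n by lra.
apply: (le_trans (ratio_diff_le _ s1 t1 N0)).
have h1 : `|j ^+ 2 - x ^+ 2 - (j' ^+ 2 - x ^+ 2)| <= 2 * L * B * a * n ^+ 2.
  rewrite (_ : _ - _ = (j - j') * (j + j')); last by ring.
  rewrite normrM (ger0_norm (addr_ge0 j0 j0')).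
  rewrite (_ : 2 * L * B * a * n ^+ 2 = (a * (L * n)) * (B * n + B * n)); last by ring.
  by apply: ler_pM => //; [exact: addr_ge0|exact: lerD].
have h2 : j' ^+ 2 - x ^+ 2 <= B ^+ 2 * n ^+ 2.
  apply: (@le_trans _ _ (j' ^+ 2)); first by rewrite gerBl sqr_ge0.
  by rewrite -exprMn ler_sqr ?nnegrE// mulr_ge0.
have h3 : (j' ^+ 2 - x ^+ 2) * `|s - t| <= B ^+ 2 * L * a * n ^+ 3.
  rewrite (_ : B ^+ 2 * L * a * n ^+ 3 = (B ^+ 2 * n ^+ 2) * (a * (L * n))); last by ring.
  exact: ler_pM.
have h4 : 2 * L * B * a * n ^+ 2 <= 2 * L * B * a * n ^+ 4.
  by apply: ler_wpM2l; [rewrite !mulr_ge0|rewrite ler_weXn2l].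
have h5 : B ^+ 2 * L * a * n ^+ 3 <= B ^+ 2 * L * a * n ^+ 4.
  by apply: ler_wpM2l; [rewrite !mulr_ge0// sqr_ge0|rewrite ler_weXn2l].
apply: (le_trans (lerD h1 h3)); apply: (le_trans (lerD h4 h5)).
by rewrite le_eqVlt; apply/orP; left; apply/eqP; ring.
Qed.

Lemma half_sqr_diff (j j' p p' w r L B n : R) : 0 <= r -> 0 <= L ->
  `|j - j'| <= r * L -> `|p - p'| <= r * L -> 0 <= j -> 0 <= j' -> j <= B -> j' <= B ->
  0 <= p -> 0 <= p' -> p <= B + n -> p' <= B + n ->
  `|(w - p ^+ 2 - j ^+ 2) / 2 - (w - p' ^+ 2 - j' ^+ 2) / 2| <=
  r * (L * (B + B) + L * (B + B + (n + n)) + 1).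
Proof.
move=> r0 L0 jj pp j0 j0' jB jB' p0 p0' pB pB'.
have h1 : `|j ^+ 2 - j' ^+ 2| <= r * L * (B + B).
  by rewrite subr_sqr normrM (ger0_norm (addr_ge0 j0 j0')); apply: ler_pM => //; [exact: addr_ge0|exact: lerD].
have h2 : `|p ^+ 2 - p' ^+ 2| <= r * L * (B + n + (B + n)).
  by rewrite subr_sqr normrM (ger0_norm (addr_ge0 p0 p0')); apply: ler_pM => //; [exact: addr_ge0|exact: lerD].
move: h1 h2; rewrite !ler_norml => /andP[? ?] /andP[? ?].
have B0 : 0 <= B by lra.
have ? : 0 <= r * L * (B + B) by rewrite !mulr_ge0// addr_ge0.
have ? : 0 <= r * L * (B + n + (B + n)) by rewrite !mulr_ge0//; lra.
by apply/andP; split; lra.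
Qed.

Lemma small_scale_bound (c p n j x : R) : 0 <= c -> c <= 1 -> 0 <= p -> 0 <= n ->
  j - x <= c * p -> j <= n + c * p -> x <= j -> 0 <= x ->
  j ^+ 2 - x ^+ 2 <= c * (2 * (1 + p)) ^+ 2 * (1 + n) ^+ 2.
Proof.
move=> c0 c1 p0 n0 jx jn xj x0.
have cp : c * p <= p by rewrite ler_piMl.
have h1 : (j - x) * (j + x) <= c * p * (2 * (n + p)).
  by apply: ler_pM; lra.
apply: (@le_trans _ _ (c * p * (2 * (n + p)))); first by rewrite subr_sqr.
have np : n + p <= (1 + p) * (1 + n) by nra.
have pp : p * 2 <= 2 * (1 + p) * (2 * (1 + n)) by nra.
rewrite (_ : c * p * (2 * (n + p)) = c * ((p * 2) * (n + p))); last by ring.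
rewrite (_ : c * (2 * (1 + p)) ^+ 2 * (1 + n) ^+ 2 =
  c * ((2 * (1 + p) * (2 * (1 + n))) * ((1 + p) * (1 + n)))); last by ring.
apply: ler_wpM2l => //; apply: ler_pM => //; [exact: mulr_ge0|exact: addr_ge0].
Qed.

Lemma sqrt_diff_le a b c : 0 <= a -> 0 <= b -> 0 <= c -> `|a ^+ 2 - b ^+ 2| <= c ^+ 2 -> `|a - b| <= c.
Proof.
move=> a0 b0 c0 h; rewrite -ler_sqr ?nnegrE// (le_trans _ h)// subr_sqr normrM expr2.
by rewrite ler_wpM2l// (ger0_norm (addr_ge0 a0 b0)) ler_norml; lra.
Qed.

Lemma unif_continuousR (F : R -> R) :
  (forall e : R, 0 < e -> exists2 r, 0 < r & forall s t, `|s - t| < r -> `|F s - F t| <= e) ->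
  continuous F.
Proof.
move=> h s; apply/(@cvgrPdist_le _ R^o _ (nbhs s)) => e e0.
have [r r0 hr] := h e e0; apply/nbhs_ballP; exists r => //= t st; exact: hr.
Qed.

(** Intermediate values for a function controlled on [[a, b]] only: composition with the clamped
    parametrization [k] makes it continuous on the line, and the closed cover argument applies to
    the sets of either sign. *)
Lemma unif_root (F : R -> R) a b : a <= b ->
  (forall e : R, 0 < e -> exists2 r, 0 < r &
     forall s t, a <= s <= b -> a <= t <= b -> `|s - t| < r -> `|F s - F t| <= e) ->
  0 <= F a -> F b <= 0 -> exists2 s, a <= s <= b & F s = 0.
Proof.
move=> ab hF Fa Fb; pose k s := Num.min b (Num.max a (a + s * (b - a))).
have kab s : a <= k s <= b.
  by rewrite /k le_min ab le_max lexx ge_min lexx.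
have klip s t : `|k s - k t| <= (b - a) * `|s - t|.
  have ba : 0 <= b - a by rewrite subr_ge0.
  have one p q : k p - k q <= (b - a) * `|p - q|.
    have : p * (b - a) - q * (b - a) <= (b - a) * `|p - q|.
      by rewrite -mulrBl mulrC ler_wpM2l// ler_norm.
    have : 0 <= (b - a) * `|p - q| by rewrite mulr_ge0.
    rewrite /k; move: (_ * `|_|) (p * _) (q * _) ab => w x y; clear => ab w0 xy.
    by case: (leP a (a + x)) => ?; case: (leP a (a + y)) => ?; case: (leP b (a + x)) => ?;
      case: (leP b (a + y)) => ?; case: (leP b a) => ?; lra.
  by rewrite ler_norml one andbT lerNl opprB distrC one.
have k0 : k 0 = a.
  by rewrite /k mul0r addr0 maxxx; apply/min_idPr.
have k1 : k 1 = b.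
  by rewrite /k mul1r addrC subrK (max_idPr ab) minxx.
have cF : continuous (F \o k).
  apply: unif_continuousR => e e0; have [r r0 hr] := hF e e0.
  have ba1 : 0 < b - a + 1 by lra.
  exists (r / (b - a + 1)); first exact: divr_gt0.
  move=> s t st; apply: hr => //; apply: (le_lt_trans (klip s t)).
  rewrite ltr_pdivlMr// in st; apply: le_lt_trans st; rewrite mulrC ler_wpM2l//; lra.
have cA : closed [set s | 0 <= (F \o k) s].
  by apply: (@preimage_closed _ _ (F \o k) [set r | 0 <= r]) => [s _|]; [exact: cF|exact: closed_ge].
have cB : closed [set s | (F \o k) s <= 0].
  by apply: (@preimage_closed _ _ (F \o k) [set r | r <= 0]) => [s _|]; [exact: cF|exact: closed_le].
have [|||s [_ h1 h2]] := closed_cover_meet cA cB.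
- by move=> s _ /=; have [|/ltW] := leP 0 (F (k s)); [left|right].
- by rewrite /= k0.
- by rewrite /= k1.
by exists (k s) => //; apply/eqP; rewrite eq_le h1 h2.
Qed.

End real_lemmas.

(** * The weighted root of the defect and its dependence on the scale *)

Section balance.
Context {R : realType} {d : nat}.
Local Notation V := 'rV[R]_d.
Variable D : set V.
Hypotheses (cD : closed D) (vD : cvx D) (D0 : D !=set0) (D_origin : ~ D 0).
Implicit Types (g h u v y z : V) (c : R) (b : bool).

Local Notation X := (polar_sup D).
Local Notation Xp := (polar_sup_pos D).
Local Notation P := (sproj D).
Local Notation J := (sdist D).
Local Notation S := (sgap D).
Local Notation N := (defect D).
Local Notation p0 := (cproj D 0).

Definition level c g := (J c g + Xp g) / 2.
(** The defect is [2 (J - Xp) Z]. For [b = true], dividing it by [Z] leaves twice the plain excess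
    and a slope of order [Z^(-1/2)], so that Poincare yields the mean of [1 / Z] instead of 1. The
    floor 1 keeps the slope Lipschitz where the level is small. For [b = false] there is no
    weight. *)
Definition weight b c g := if b then Num.max 1 (level c g) else 1.
Definition root_defect b c g := Num.sqrt (N c g / weight b c g).
Definition slope b c g := (Num.sqrt (weight b c g))^-1.
Definition signed_defect b c := signed [set g | 0 <= S c g] (root_defect b c).

Local Notation Z := level.
Local Notation M := weight.
Local Notation q := root_defect.
Local Notation Gr := slope.
Local Notation xi := signed_defect.

Lemma weight_ge1 b c g : 1 <= M b c g.
Proof. by rewrite /M; case: b => //; rewrite le_max lexx. Qed.

Let M0 b c g : 0 < M b c g. Proof. exact: lt_le_trans ltr01 (weight_ge1 b c g). Qed.

Lemma root_defect_ge0 b c g : 0 <= q b c g. Proof. exact: sqrtr_ge0. Qed.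

Lemma slope_ge0 b c g : 0 <= Gr b c g. Proof. by rewrite invr_ge0 sqrtr_ge0. Qed.

Lemma slope_le1 b c g : Gr b c g <= 1.
Proof.
rewrite invf_le1 ?sqrtr_gt0//.
by rewrite -[X in X <= _]sqrtr1 ler_wsqrtr// weight_ge1.
Qed.

Lemma slope_sqr b c g : Gr b c g ^+ 2 = (M b c g)^-1.
Proof. by rewrite exprVn sqr_sqrtr// ltW. Qed.

Lemma root_defect_sqr b c g : 0 < c -> q b c g ^+ 2 = N c g / M b c g.
Proof. by move=> c0; rewrite sqr_sqrtr// divr_ge0 ?defect_ge0// ltW. Qed.

Lemma root_defect_le b c g : 0 < c -> q b c g <= Num.sqrt (N c g).
Proof.
move=> c0; apply: ler_wsqrtr; rewrite ler_pdivrMr// ler_peMr ?weight_ge1//.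
exact: defect_ge0.
Qed.

Lemma defect_excess c g : N c g = 2 * (J c g - Xp g) * Z c g.
Proof. by rewrite /N /Z; field. Qed.

Lemma level_ge0 c g : 0 <= Z c g.
Proof. by rewrite divr_ge0// addr_ge0 ?sdist_ge0 ?polar_sup_pos_ge0. Qed.

Lemma level_lip c : 0 < c -> lip 1 (Z c).
Proof.
move=> c0 g h; have h1 := sdist_lip cD vD D0 c0 g h.
have h2 := polar_sup_pos_lip cD vD D0 D_origin g h; rewrite !mul1r in h1 h2 *.
exact: midpoint_diff_le.
Qed.

Lemma slope_lip b c : 0 < c -> lip 1 (Gr b c).
Proof.
move=> c0 g h; rewrite mul1r; apply: (le_trans (inv_sqrt_diff (weight_ge1 b c g) (weight_ge1 b c h))).
rewrite /M; case: b; last by rewrite subrr normr0 l2norm_ge0.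
have := level_lip c0 g h; rewrite mul1r; apply: le_trans; exact: max1_diff_le.
Qed.

(** Where the weight is 1 at [h], a larger weight at [g] only lowers the root there, and the
    unweighted bound applies. Elsewhere the root at [h] is that of [2 (J - Xp)], whose slope
    [J^(-1/2)] is at most [Z^(-1/2)], as [Z] is the midpoint of [Xp <= J]. *)
Lemma root_defect_slope b c g h : 0 < c -> q b c g <= q b c h + Gr b c h * l2norm (g - h).
Proof.
move=> c0; have [M1|M1] := eqVneq (M b c h) 1.
  have -> : q b c h = Num.sqrt (N c h) by rewrite /q M1 divr1.
  have -> : Gr b c h = 1 by rewrite /Gr M1 sqrtr1 invr1.
  rewrite mul1r; apply: le_trans (root_defect_le b g c0) _.
  exact: sqrt_defect_slope.
have {M1}[bT Zh] : b = true /\ 1 < Z c h.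
  move: M1; rewrite /M; case: b => //; last by rewrite eqxx.
  by case: (leP 1 (Z c h)) => [|_]; [rewrite le_eqVlt => /orP[/eqP <-|]; rewrite ?eqxx|rewrite eqxx].
have MZ : M b c h = Z c h by rewrite /M bT; apply/max_idPr; exact: ltW.
have Zp : 0 < Z c h by exact: lt_trans ltr01 Zh.
have ZJ : Z c h <= J c h.
  exact/midpoint_le/polar_sup_pos_le_sdist.
have Jp : 0 < J c h by exact: lt_le_trans ZJ.
have ex g' : 0 <= J c g' - Xp g' by rewrite subr_ge0 polar_sup_pos_le_sdist.
have -> : q b c h = Num.sqrt (2 * (J c h - Xp h)).
  by rewrite /q MZ defect_excess mulfK ?gt_eqF.
apply: (@le_trans _ _ (Num.sqrt (2 * (J c g - Xp g)))).
  apply: ler_wsqrtr; rewrite defect_excess ler_pdivrMr// ler_wpM2l ?mulr_ge0 ?ex//.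
  by rewrite /M bT le_max lexx orbT.
have n0 := l2norm_ge0 (g - h).
apply: (@le_trans _ _ (Num.sqrt (2 * (J c h - Xp h)) + l2norm (g - h) / Num.sqrt (J c h))).
  rewrite -[X in _ <= X]ger0_norm; last by rewrite addr_ge0 ?divr_ge0 ?sqrtr_ge0.
  by rewrite -sqrtr_sqr; apply: ler_wsqrtr; exact: excess_one_sided.
rewrite lerD2l mulrC ler_wpM2r// /Gr MZ.
by rewrite lef_pV2 ?posrE; [apply: ler_wsqrtr|rewrite sqrtr_gt0|rewrite sqrtr_gt0].
Qed.

Section fixed.
Variables (b : bool) (c : R).
Hypothesis c0 : 0 < c.

Lemma sgap_closed : closed [set g | 0 <= S c g] /\ closed [set g | S c g <= 0].
Proof.
have cS := sgap_continuous cD vD D0 c0.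
by split; apply: closed_le_fun => //; exact: continuous_cstR.
Qed.

Lemma sgap_cover g : [set g | 0 <= S c g] g \/ [set g | S c g <= 0] g.
Proof. by have [|/ltW] := leP 0 (S c g); [left|right]. Qed.

Lemma root_defect_eq0 g : 0 <= S c g -> S c g <= 0 -> q b c g = 0.
Proof.
move=> h1 h2; rewrite /q (defect_eq0 cD vD D0 D_origin c0) ?mul0r ?sqrtr0//.
by apply/eqP; rewrite eq_le h1 h2.
Qed.

Lemma signed_defect_lip : lip 1 (xi b c).
Proof.
have [h1 h2] := sgap_closed.
apply: (signed_lip h1 h2 sgap_cover (root_defect_ge0 b c) root_defect_eq0 (slope_le1 b c)).
by move=> g h; exact: root_defect_slope.
Qed.

Lemma root_defect_variance :
  Ex (fun g => q b c g ^+ 2) <= Ex (fun g => Gr b c g ^+ 2) + Ex (xi b c) ^+ 2.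
Proof.
have [h1 h2] := sgap_closed.
apply: (signed_variance h1 h2 sgap_cover (root_defect_ge0 b c) root_defect_eq0 (slope_ge0 b c)
  (slope_le1 b c) ler01 (slope_lip b c0)).
by move=> g h; exact: root_defect_slope.
Qed.

End fixed.

Lemma cproj_le h : l2norm (cproj D h) <= l2norm p0 + l2norm h.
Proof.
have := proj_nonexpansive cD vD D0 h 0; rewrite subr0 => /(fun x => x) e.
by rewrite -[cproj D h](subrK p0) addrC (le_trans (l2normD _ _))// lerD2l.
Qed.

Definition scale_rate (lo : R) := l2norm p0 + 2 / lo.

Lemma scale_rate_ge0 lo : 0 < lo -> 0 <= scale_rate lo.
Proof. by move=> lo0; rewrite addr_ge0 ?l2norm_ge0// divr_ge0// ltW. Qed.

(** The difference splits into [(c - c') p] and [c' (p - p')]; the second term is controlled by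
    nonexpansiveness at the two rescaled points, and [lo] keeps the inverse scales bounded. *)
Lemma sproj_scale lo c c' g : 0 < lo -> lo <= c -> lo <= c' ->
  l2norm (P c g - P c' g) <= `|c - c'| * (scale_rate lo * (1 + l2norm g)).
Proof.
move=> lo0 lc lc'; have c0 := lt_le_trans lo0 lc; have c0' := lt_le_trans lo0 lc'.
have n0 := l2norm_ge0 g; have pn := l2norm_ge0 p0.
set p := cproj D (c^-1 *: g); set p' := cproj D (c'^-1 *: g).
have -> : P c g - P c' g = (c - c') *: p + c' *: (p - p').
  by rewrite /P -/p -/p'; apply/rowP => i; rewrite !mxE; ring.
apply: (le_trans (l2normD _ _)); rewrite !l2normZ (gtr0_norm c0').
have h1 : l2norm p <= l2norm p0 + l2norm g / lo.
  apply: (le_trans (cproj_le _)); rewrite lerD2l l2normZ gtr0_norm ?invr_gt0// mulrC.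
  by rewrite ler_wpM2l// lef_pV2.
have h2 : c' * l2norm (p - p') <= `|c - c'| * (l2norm g / lo).
  have := proj_nonexpansive cD vD D0 (c^-1 *: g) (c'^-1 *: g).
  rewrite -scalerBl l2normZ -/p -/p' => /(ler_wpM2l (ltW c0'))/le_trans; apply.
  rewrite mulrA -{1}[c']gtr0_norm// -normrM.
  have -> : c' * (c^-1 - c'^-1) = - ((c - c') / c) by field; rewrite !gt_eqF.
  rewrite normrN normrM (gtr0_norm (_ : 0 < c^-1)) ?invr_gt0//.
  by rewrite -mulrA ler_wpM2l// mulrC ler_wpM2l// lef_pV2.
apply: (le_trans (lerD (ler_wpM2l (normr_ge0 _) h1) h2)).
rewrite -mulrDr ler_wpM2l// /scale_rate.
have k0 : 0 <= lo^-1 by rewrite invr_ge0 ltW.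
by move: (l2norm p0) (l2norm g) (lo^-1) n0 pn k0 => x y z y0 x0 z0; nra.
Qed.

Lemma sdist_scale lo c c' g : 0 < lo -> lo <= c -> lo <= c' ->
  `|J c g - J c' g| <= `|c - c'| * (scale_rate lo * (1 + l2norm g)).
Proof.
move=> lo0 lc lc'; apply: (le_trans (l2norm_lip _ _)).
rewrite (_ : g - P c g - (g - P c' g) = P c' g - P c g); last first.
  by apply/rowP => i; rewrite !mxE; ring.
by rewrite distrC; exact: sproj_scale.
Qed.

Definition scale_bound (hi : R) := 1 + hi * l2norm p0.

Lemma sdist_bound hi c g : 0 < c -> c <= hi -> J c g <= scale_bound hi * (1 + l2norm g).
Proof.
move=> c0 chi; apply: (le_trans (sdist_min cD vD D0 c0 g (proj_in cD vD D0 0))).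
apply: (le_trans (l2normD _ _)); rewrite l2normN l2normZ (gtr0_norm c0) /scale_bound.
have n0 := l2norm_ge0 g; have pn := l2norm_ge0 p0.
have : c * l2norm p0 <= hi * l2norm p0 by rewrite ler_wpM2r.
have : 0 <= hi * l2norm p0 by rewrite mulr_ge0// (le_trans (ltW c0)).
move: (c * _) (hi * _) (l2norm g) n0 => x y z z0 y0 xy; nra.
Qed.

Lemma sgap_eq c g : S c g = (l2norm g ^+ 2 - l2norm (P c g) ^+ 2 - J c g ^+ 2) / 2.
Proof.
have e := sqr_l2normD (g - P c g) (P c g).
rewrite subrK -/(J c g) dotvC -/(S c g) in e; rewrite e.
by move: (S c g) (J c g) (l2norm _) => *; field.
Qed.

(** The square is Lipschitz in the scale; for the root this gives a modulus of order 1/2, enough for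
    the continuity of its mean. *)
Lemma root_defect_scale b lo hi : 0 < lo -> lo <= hi -> exists2 K, 0 <= K &
  forall c c' g, lo <= c <= hi -> lo <= c' <= hi ->
    `|q b c g ^+ 2 - q b c' g ^+ 2| <= K * `|c - c'| * (1 + l2norm g) ^+ 4.
Proof.
move=> lo0 lohi.
have L0 : 0 <= scale_rate lo by exact: scale_rate_ge0.
have B0 : 0 <= scale_bound hi.
  by rewrite addr_ge0// mulr_ge0 ?l2norm_ge0// (le_trans (ltW lo0)).
have [L EL] : {L | L = scale_rate lo} by exists (scale_rate lo).
have [B EB] : {B | B = scale_bound hi} by exists (scale_bound hi).
rewrite -EL in L0; rewrite -EB in B0.
exists (2 * L * B + B ^+ 2 * L); first by rewrite addr_ge0 ?mulr_ge0// sqr_ge0.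
move=> c c' g /andP[lc ch] /andP[lc' ch'].
have c0 := lt_le_trans lo0 lc; have c0' := lt_le_trans lo0 lc'.
have -> : q b c g ^+ 2 - q b c' g ^+ 2 = N c g / M b c g - N c' g / M b c' g.
  by congr (_ - _); exact: root_defect_sqr.
have n1 : 1 <= 1 + l2norm g by rewrite lerDl l2norm_ge0.
have j1 := sdist_bound g c0 ch; have j2 := sdist_bound g c0' ch'.
have jj := sdist_scale g lo0 lc lc'.
rewrite -EL in jj; rewrite -EB in j1 j2.
have jp := sdist_ge0 D c g; have jp' := sdist_ge0 D c' g.
have M1 := weight_ge1 b c g; have M1' := weight_ge1 b c' g.
have N'0 := defect_ge0 cD vD D0 D_origin c0' g.
have MM : `|M b c g - M b c' g| <= `|c - c'| * (L * (1 + l2norm g)).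
  have r0 : 0 <= `|c - c'| * (L * (1 + l2norm g)).
    by rewrite !mulr_ge0// (le_trans ler01).
  rewrite /M; case: b {M1 M1'}; last by rewrite subrr normr0.
  apply: (le_trans (max1_diff_le _ _)).
  by apply: midpoint_diff_le jj _; rewrite subrr normr0.
exact: (ratio_modulus n1 L0 B0 (normr_ge0 _) jj jp j1 jp' j2 N'0 M1 M1' MM).
Qed.

End balance.

(** * Continuity in the scale of the mean of the signed root *)

Section balanced_scale.
Context {R : realType} {d : nat}.
Local Notation V := 'rV[R]_d.
Variable D : set V.
Hypotheses (cD : closed D) (vD : cvx D) (D0 : D !=set0) (D_origin : ~ D 0).
Implicit Types (g h u v y z : V) (c : R) (b : bool).

Local Notation X := (polar_sup D).
Local Notation Xp := (polar_sup_pos D).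
Local Notation P := (sproj D).
Local Notation J := (sdist D).
Local Notation S := (sgap D).
Local Notation N := (defect D).
Local Notation p0 := (cproj D 0).
Local Notation Z := (level D).
Local Notation M := (weight D).
Local Notation q := (root_defect D).
Local Notation Gr := (slope D).
Local Notation xi := (signed_defect D).

Lemma signed_defect_pos b c g : 0 <= S c g -> xi b c g = q b c g.
Proof. by move=> h; rewrite /signed_defect signedA. Qed.

Lemma signed_defect_neg b c g : 0 < c -> S c g <= 0 -> xi b c g = - q b c g.
Proof.
move=> c0 h; apply: (@signedB _ _ _ [set g | S c g <= 0]) => // x h1 h2.
exact: root_defect_eq0.
Qed.

Lemma gro_sdist c : 0 < c -> gro 1 (J c).
Proof. by move=> c0; apply: lip_gro; exact: (sdist_lip cD vD D0 c0). Qed.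

Lemma gro_signed_defect b c : 0 < c -> gro 1 (xi b c).
Proof. by move=> c0; apply: lip_gro; exact: (signed_defect_lip cD vD D0 D_origin b c0). Qed.

Lemma sgap_root lo g c c' : 0 < lo -> lo <= c -> c <= c' ->
  (0 <= S c g /\ S c' g <= 0) \/ (S c g <= 0 /\ 0 <= S c' g) ->
  exists2 s, c <= s <= c' & S s g = 0.
Proof.
move=> lo0 lc cc'; have c0 := lt_le_trans lo0 lc.
have [L [EL L0]] : exists L, L = scale_rate D lo * (1 + l2norm g) /\ 0 <= L.
  exists (scale_rate D lo * (1 + l2norm g)); split => //.
  by rewrite mulr_ge0 ?scale_rate_ge0// addr_ge0// l2norm_ge0.
have [B [EB B0]] : exists B, B = scale_bound D c' * (1 + l2norm g) /\ 0 <= B.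
  exists (scale_bound D c' * (1 + l2norm g)); split => //.
  rewrite mulr_ge0 ?addr_ge0 ?l2norm_ge0// mulr_ge0 ?l2norm_ge0//.
  exact: le_trans (ltW c0) cc'.
have U (e : R) : 0 < e -> exists2 r, 0 < r & forall s t, c <= s <= c' -> c <= t <= c' ->
    `|s - t| < r -> `|S s g - S t g| <= e.
  move=> e0; pose C := L * (B + B) + L * (B + B + (l2norm g + l2norm g)).
  have C1 : 0 < C + 1.
    by rewrite ltr_wpDl// /C addr_ge0// mulr_ge0// !addr_ge0// l2norm_ge0.
  exists (e / (C + 1)); first exact: divr_gt0.
  move=> s t /andP[cs sc] /andP[ct tc]; rewrite ltr_pdivlMr// => st.
  have ls := le_trans lc cs; have lt := le_trans lc ct.
  have s0 := lt_le_trans lo0 ls; have t0 := lt_le_trans lo0 lt.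
  have h1 := sdist_scale cD vD D0 g lo0 ls lt; rewrite -EL in h1.
  have h2 := sproj_scale cD vD D0 g lo0 ls lt; rewrite -EL in h2.
  have j1 := sdist_bound cD vD D0 g s0 sc; rewrite -EB in j1.
  have j2 := sdist_bound cD vD D0 g t0 tc; rewrite -EB in j2.
  have h3 := le_trans (l2norm_lip _ _) h2.
  have pb r : J r g <= B -> l2norm (P r g) <= B + l2norm g.
    move=> jb; rewrite -[P r g](subKr g) (le_trans (l2normD _ _))// l2normN addrC lerD2r//.
  rewrite !sgap_eq; apply: le_trans (ltW st).
  have T := half_sqr_diff (l2norm g ^+ 2) (normr_ge0 (s - t)) L0 h1 h3 (sdist_ge0 _ _ _) (sdist_ge0 _ _ _) j1 j2
    (l2norm_ge0 _) (l2norm_ge0 _) (pb _ j1) (pb _ j2).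
  exact: T.
move=> [[h1 h2]|[h1 h2]].
  by apply: (unif_root cc' U).
have [|||s cs e] := @unif_root _ (fun s => - S s g) c c' cc'.
- move=> e e0; have [r r0 hr] := U e e0; exists r => // s t cs ct st.
  by rewrite opprK addrC distrC; exact: hr.
- by rewrite oppr_ge0.
- by rewrite oppr_le0.
by exists s => //; apply/eqP; rewrite -oppr_eq0 e.
Qed.

(** If the gap keeps its sign, the modulus of the square gives that of the root. If the sign
    changes, the gap vanishes at a scale in between, where the root is 0, so both values are small;
    hence the factor 2. *)
Lemma signed_defect_scale b lo hi : 0 < lo -> lo <= hi -> exists2 K, 0 <= K &
  forall c c' g, lo <= c <= hi -> lo <= c' <= hi ->
    `|xi b c g - xi b c' g| <= 2 * Num.sqrt (K * `|c - c'|) * (1 + l2norm g) ^+ 2.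
Proof.
move=> lo0 lohi; have [K K0 HK] := root_defect_scale cD vD D0 D_origin b lo0 lohi.
exists K => //.
have main c c' g : lo <= c <= hi -> lo <= c' <= hi -> c <= c' ->
    `|xi b c g - xi b c' g| <= 2 * Num.sqrt (K * `|c - c'|) * (1 + l2norm g) ^+ 2.
  move=> ch ch' cc'; have [lc ch1] := andP ch; have [lc' ch1'] := andP ch'.
  have c0 := lt_le_trans lo0 lc; have c0' := lt_le_trans lo0 lc'.
  have [n [En n1]] : exists n, n = 1 + l2norm g /\ 1 <= n.
    by exists (1 + l2norm g); split => //; rewrite lerDl l2norm_ge0.
  have n0 : 0 <= n by exact: le_trans ler01 n1.
  rewrite -En -mulrA; set h := Num.sqrt _ * n ^+ 2.
  have h0 : 0 <= h by rewrite mulr_ge0 ?sqrtr_ge0// sqr_ge0.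
  have h2 s t : lo <= s <= hi -> lo <= t <= hi -> `|s - t| <= `|c - c'| ->
      `|q b s g ^+ 2 - q b t g ^+ 2| <= h ^+ 2.
    move=> sh th st; apply: (le_trans (HK s t g sh th)); rewrite -En.
    rewrite exprMn sqr_sqrtr ?mulr_ge0// -exprM ler_wpM2r ?exprn_ge0//.
    by rewrite ler_wpM2l.
  have sd s t : lo <= s <= hi -> lo <= t <= hi -> `|s - t| <= `|c - c'| ->
      `|q b s g - q b t g| <= h.
    by move=> sh th st; apply: sqrt_diff_le => //; [exact: root_defect_ge0|exact: root_defect_ge0|exact: h2].
  have hh : h <= 2 * h by rewrite ler_peMl// ler1n.
  have opp : (0 <= S c g /\ S c' g <= 0) \/ (S c g <= 0 /\ 0 <= S c' g) ->
      q b c g <= h /\ q b c' g <= h.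
    move=> /(sgap_root lo0 lc cc')[s /andP[cs sc] Ss].
    have sh : lo <= s <= hi by rewrite (le_trans lc cs) (le_trans sc ch1').
    have qs : q b s g = 0.
      apply: (root_defect_eq0 cD vD D0 D_origin b); rewrite ?Ss//.
      exact: lt_le_trans c0 cs.
    have qle t : lo <= t <= hi -> `|t - s| <= `|c - c'| -> q b t g <= h.
      by move=> th ts; have := sd t s th sh ts; rewrite qs subr0; apply: le_trans; exact: ler_norm.
    rewrite (ler0_norm (_ : c - c' <= 0)) ?subr_le0// opprB in qle.
    split; apply: qle => //.
      by rewrite ler0_norm ?subr_le0// opprB lerD2r.
    by rewrite ger0_norm ?subr_ge0// lerD2l lerN2.
  have q0 s := root_defect_ge0 D b s g.
  have [s1|/ltW s1] := leP 0 (S c g); have [s2|/ltW s2] := leP 0 (S c' g).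
  - rewrite (signed_defect_pos b s1) (signed_defect_pos b s2).
    by apply: le_trans hh; exact: sd.
  - rewrite (signed_defect_pos b s1) (signed_defect_neg b c0' s2) opprK.
    have [r1 r2] := opp (or_introl (conj s1 s2)).
    exact: abs_sum_le (q0 c) (q0 c') r1 r2.
  - rewrite (signed_defect_neg b c0 s1) (signed_defect_pos b s2) -opprD normrN.
    have [r1 r2] := opp (or_intror (conj s1 s2)).
    exact: abs_sum_le (q0 c) (q0 c') r1 r2.
  rewrite (signed_defect_neg b c0 s1) (signed_defect_neg b c0' s2) opprK addrC distrC.
  by apply: le_trans hh; exact: sd.
move=> c c' g ch ch'; have [cc'|/ltW cc'] := leP c c'; first exact: main.
by rewrite distrC (distrC c c'); exact: main.
Qed.

Lemma Ex_signed_defect_unif b lo hi : 0 < lo -> lo <= hi ->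
  forall e : R, 0 < e -> exists2 r, 0 < r & forall c c', lo <= c <= hi -> lo <= c' <= hi ->
    `|c - c'| < r -> `|Ex (xi b c) - Ex (xi b c')| <= e.
Proof.
move=> lo0 lohi e e0; have [K K0 HK] := signed_defect_scale b lo0 lohi.
have gn : gro 4 (fun g : V => (1 + l2norm g) ^+ 2 : R).
  apply: (@groW _ _ 2) => //; apply: (@groX _ _ 1 2).
  by apply: groD; [exact: gro_cst|exact: gro_l2norm].
set m := Ex (fun g : V => (1 + l2norm g) ^+ 2 : R).
have m0 : 0 <= m by apply: Ex_ge0 => g; exact: sqr_ge0.
have m1 : 0 < m + 1 by rewrite ltr_wpDl.
have K1 : 0 < K + 1 by rewrite ltr_wpDl.
exists ((e / (2 * (m + 1))) ^+ 2 / (K + 1)).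
  by rewrite divr_gt0// exprn_gt0// divr_gt0// mulr_gt0.
move=> c c' ch ch' cc'; have [c0 c0'] : 0 < c /\ 0 < c'.
  by case/andP: ch ch' => lc _ /andP[lc' _]; split; exact: lt_le_trans lo0 _.
have g1 : gro 4 (xi b c) by exact: groW (gro_signed_defect b c0).
have g2 : gro 4 (xi b c') by exact: groW (gro_signed_defect b c0').
set k := 2 * Num.sqrt (K * `|c - c'|).
have k0 : 0 <= k by rewrite mulr_ge0// sqrtr_ge0.
have gk : gro 4 (fun g : V => k * (1 + l2norm g) ^+ 2) by exact: groZ.
have km : `|Ex (xi b c) - Ex (xi b c')| <= k * m.
  rewrite -ExB// -ExZ// ler_norml; apply/andP; split.
    rewrite -mulN1r -ExZ//; apply: le_Ex; [exact: groZ|exact: groB|] => g.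
    by have := HK c c' g ch ch'; rewrite ler_norml mulN1r => /andP[].
  apply: le_Ex; [exact: groB|exact: gk|] => g.
  by have := HK c c' g ch ch'; rewrite ler_norml => /andP[].
apply: (le_trans km).
have e2 : 0 <= e / (2 * (m + 1)) by rewrite divr_ge0 ?(ltW e0)// mulr_ge0// ltW.
have : Num.sqrt (K * `|c - c'|) <= e / (2 * (m + 1)).
  rewrite -[X in _ <= X]ger0_norm// -(sqrtr_sqr (e / (2 * (m + 1)))); apply: ler_wsqrtr.
  rewrite ltr_pdivlMr// in cc'; apply: le_trans (ltW cc').
  by rewrite mulrC ler_wpM2l// lerDl.
move=> h; apply: (@le_trans _ _ (2 * (e / (2 * (m + 1))) * m)).
  by rewrite ler_wpM2r// /k ler_wpM2l.
rewrite (_ : _ * m = e * (m / (m + 1))); last by field; rewrite gt_eqF.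
by rewrite ler_piMr ?(ltW e0)// ler_pdivrMr// mul1r lerDl.
Qed.

(** A negative value occurs only where the gap is negative, and there [J - Xp] is at most [c |p0|]:
    the defect is of order [c] and the root of order [sqrt c]. *)
Lemma Ex_signed_defect_small b c : 0 < c -> c <= 1 ->
  - (Num.sqrt c * (2 * (1 + l2norm p0)) * Ex (fun g : V => 1 + l2norm g)) <= Ex (xi b c).
Proof.
move=> c0 c1; have gn : gro 4 (fun g : V => 1 + l2norm g : R).
  by apply: (@groW _ _ 1) => //; apply: groD; [exact: gro_cst|exact: gro_l2norm].
set k := _ * (2 * _); have s0 : 0 <= Num.sqrt c by exact: sqrtr_ge0.
have pn := l2norm_ge0 p0.
have k0 : 0 <= k by rewrite mulr_ge0// mulr_ge0// addr_ge0.
rewrite -mulNr -ExZ//; apply: le_Ex; [exact: groZ|exact: groW (gro_signed_defect b c0)|] => g.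
have n0 := l2norm_ge0 g; rewrite mulNr.
have [s1|/ltW s1] := leP 0 (S c g).
  rewrite signed_defect_pos// (@le_trans _ _ 0) ?root_defect_ge0// oppr_le0.
  by rewrite mulr_ge0// addr_ge0.
rewrite signed_defect_neg// lerN2.
have Dp := proj_in cD vD D0 0.
have ex := excess_le cD vD D0 D_origin c0 Dp s1.
have jb := sdist_min cD vD D0 c0 g Dp.
have := le_trans jb (l2normD _ _); rewrite l2normN l2normZ (gtr0_norm c0) => {}jb.
have xp := polar_sup_pos_le_sdist cD vD D0 D_origin c0 g.
have xp0 := polar_sup_pos_ge0 D g.
apply: (le_trans (root_defect_le cD vD D0 D_origin b g c0)).
rewrite -[X in _ <= X]ger0_norm ?mulr_ge0// ?addr_ge0//.
rewrite -sqrtr_sqr; apply: ler_wsqrtr.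
rewrite exprMn /k exprMn sqr_sqrtr ?(ltW c0)//.
exact: small_scale_bound (ltW c0) c1 pn n0 ex jb xp xp0.
Qed.

End balanced_scale.

(** * Upper bounds on the mean distance at a well-chosen scale *)

Section mean_distance.
Context {R : realType} {d : nat}.
Local Notation V := 'rV[R]_d.
Variable D : set V.
Hypotheses (cD : closed D) (vD : cvx D) (D0 : D !=set0) (D_origin : ~ D 0).
Implicit Types (g h u v y z : V) (c : R) (b : bool).

Local Notation X := (polar_sup D).
Local Notation Xp := (polar_sup_pos D).
Local Notation P := (sproj D).
Local Notation J := (sdist D).
Local Notation S := (sgap D).
Local Notation N := (defect D).
Local Notation p0 := (cproj D 0).
Local Notation Z := (level D).
Local Notation M := (weight D).
Local Notation q := (root_defect D).
Local Notation Gr := (slope D).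
Local Notation xi := (signed_defect D).

Lemma polar_sup_pos_le_norm g : Xp g <= l2norm g.
Proof.
rewrite /polar_sup_pos ge_max l2norm_ge0/=.
have [[z [pz z1] <-] _] := polar_supP cD vD D0 D_origin g.
by rewrite (le_trans (cauchy_schwarz _ _))// z1 mul1r.
Qed.

Lemma min_norm_gt0 : 0 < l2norm p0.
Proof.
apply: l2norm_gt0; apply/eqP => e; apply: D_origin; rewrite -e.
exact: (proj_in cD vD D0).
Qed.

Lemma sproj_norm_ge c g : 0 < c -> c * l2norm p0 <= l2norm (P c g).
Proof.
move=> c0; have [u Du ->] := sproj_in cD vD D0 c g.
rewrite l2normZ (gtr0_norm c0) ler_pM2l//.
have := proj_min cD vD D0 0 Du; by rewrite !sub0r !l2normN.
Qed.

Lemma weight_le_max b c g : 0 < c -> M b c g <= Num.max 1 (J c g).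
Proof.
move=> c0; rewrite /weight; case: b; last by rewrite le_max lexx.
rewrite ge_max le_max lexx/= le_max; apply/orP; right.
exact/midpoint_le/(polar_sup_pos_le_sdist cD vD D0 D_origin c0).
Qed.

(** For [|g|] up to a quarter of [c |p0|] the gap is nonpositive and the root at least 2. For larger
    [|g|] the signed root is at most [2 |g|], which is absorbed by the factor
    [(4 |g| / (c |p0|))^2 >= 1]; the resulting term has a small mean for large [c]. *)
Lemma signed_defect_large b c g : 0 < c -> 6 <= c * l2norm p0 ->
  xi b c g <= (2 + 2 * l2norm g) * (4 * l2norm g / (c * l2norm p0)) ^+ 2 - 2.
Proof.
move=> c0 c6; have n0 := l2norm_ge0 g; have Pn := sproj_norm_ge g c0.
have [k [Ek k6]] : exists k, k = c * l2norm p0 /\ 6 <= k by exists (c * l2norm p0).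
rewrite -Ek in Pn *.
have kp : 0 < k by apply: lt_le_trans k6.
have SP : S c g <= l2norm (P c g) * (l2norm g - l2norm (P c g)).
  rewrite /S dotvBr -sqr_l2norm mulrBr expr2 lerD2r; exact: cauchy_schwarz.
have r0 : 0 <= (2 + 2 * l2norm g) * (4 * l2norm g / k) ^+ 2.
  by rewrite mulr_ge0 ?sqr_ge0// addr_ge0// mulr_ge0.
have [gk|kg] := leP (l2norm g) (k / 4).
  have Sneg : S c g <= 0.
    apply: (le_trans SP); rewrite mulr_ge0_le0 ?l2norm_ge0// subr_le0.
    by apply: (le_trans gk); apply: le_trans Pn; rewrite ler_pdivrMr// ler_peMr ?(ltW kp)// ler1n.
  rewrite (signed_defect_neg cD vD D0 D_origin b c0 Sneg).
  suff q2 : 2 <= q b c g by move: q2 r0; move: (q b c g) (_ * _ ^+ 2) => x y; lra.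
  have Jg : k - l2norm g <= J c g.
    have := l2normD (P c g - g) g; rewrite subrK l2normB -/(J c g); move: Pn.
    move: (l2norm _) (J c g) (l2norm _) => *; lra.
  have xg := polar_sup_pos_le_norm g; have x0 := polar_sup_pos_ge0 D g.
  have mj := weight_le_max b g c0; have m1 := weight_ge1 D b c g.
  have -> : (2 : R) = Num.sqrt (2 ^+ 2) by rewrite sqrtr_sqr ger0_norm.
  apply: ler_wsqrtr; rewrite ler_pdivlMr ?(lt_le_trans ltr01)//.
  exact: large_scale_bound k6 gk Jg x0 xg mj.
have big : 1 <= (4 * l2norm g / k) ^+ 2.
  rewrite -[X in X <= _](expr1n _ 2) ler_sqr ?nnegrE ?divr_ge0 ?mulr_ge0 ?(ltW kp)//.
  rewrite ler_pdivlMr// mul1r; move: kg; rewrite ltr_pdivrMr// mulrC; exact: ltW.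
have : xi b c g <= 2 * l2norm g.
  have [s1|/ltW s1] := leP 0 (S c g); last first.
    rewrite (signed_defect_neg cD vD D0 D_origin b c0 s1).
    by rewrite (@le_trans _ _ 0) ?mulr_ge0// oppr_le0 root_defect_ge0.
  rewrite signed_defect_pos//.
  have Pg : l2norm (P c g) <= l2norm g.
    have Pp : 0 < l2norm (P c g) by exact: lt_le_trans Pn.
    by have := le_trans s1 SP; rewrite pmulr_rge0// subr_ge0.
  apply: (le_trans (root_defect_le cD vD D0 D_origin b g c0)).
  apply: (@le_trans _ _ (J c g)).
    rewrite -[X in _ <= X](ger0_norm (sdist_ge0 D c g)) -(sqrtr_sqr (J c g)).
    by apply: ler_wsqrtr; rewrite /defect gerBl sqr_ge0.
  apply: (le_trans (l2normD _ _)); rewrite l2normN.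
  by move: Pg; move: (l2norm _) (l2norm _) => *; lra.
move=> h; apply: (le_trans h).
have : (2 + 2 * l2norm g) * 1 <= (2 + 2 * l2norm g) * (4 * l2norm g / k) ^+ 2.
  by apply: ler_wpM2l => //; rewrite addr_ge0// mulr_ge0.
by move: (l2norm g) (_ * (_ * _ / _) ^+ 2) => *; lra.
Qed.

Lemma Ex_signed_defect_neg b c1 : exists2 c, c1 <= c & 0 < c /\ Ex (xi b c) <= 0.
Proof.
have dp := min_norm_gt0; set de := l2norm p0 in dp.
pose F g : R := (2 + 2 * l2norm g) * l2norm g ^+ 2.
have gF : gro 4 F.
  apply: (@groW _ _ 3) => //; apply: (@groM _ _ 1 2); last exact: (groX 2 (@gro_l2norm R d)).
  by apply: groD; [exact: gro_cst|exact: groZ (@gro_l2norm R d)].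
have m0 : 0 <= Ex F.
  by apply: Ex_ge0 => g; rewrite /F mulr_ge0 ?sqr_ge0// addr_ge0// mulr_ge0 ?l2norm_ge0.
(* 6 is the threshold of the pointwise bound, [8 * Ex F] brings [16 Ex F / k^2] below 2, and the
   last term ensures [c1 <= c]. *)
pose k := 6 + 8 * Ex F + `|c1| * de; pose c := k / de.
have k6 : 6 <= k by rewrite /k -addrA lerDl addr_ge0 ?mulr_ge0// ltW.
have kp : 0 < k by apply: lt_le_trans k6.
have c0 : 0 < c by exact: divr_gt0.
have ck : c * de = k by rewrite /c divfK ?gt_eqF.
exists c.
  rewrite ler_pdivlMr// /k; have := ler_wpM2r (ltW dp) (ler_norm c1); lra.
split => //.
have h1 : Ex (xi b c) <= Ex (fun g => 16 / k ^+ 2 * F g - 2).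
  apply: le_Ex.
  - exact: groW (gro_signed_defect cD vD D0 D_origin b c0).
  - by apply: groB; [exact: groZ|exact: gro_cst].
  - move=> g; apply: (le_trans (signed_defect_large b g c0 _)); rewrite -/de ck//.
    rewrite /F le_eqVlt; apply/orP; left; apply/eqP; field; by rewrite gt_eqF.
apply: (le_trans h1); rewrite ExB; [|exact: groZ|exact: gro_cst].
rewrite ExZ// Ex_cst subr_le0.
have -> : 16 / k ^+ 2 * Ex F = (16 * Ex F) / k ^+ 2 by field; rewrite gt_eqF.
rewrite ler_pdivrMr ?exprn_gt0//.
have kk : k * 6 <= k * k by rewrite ler_wpM2l// ltW.
have k8 : 6 + 8 * Ex F <= k by rewrite /k lerDl mulr_ge0// ltW.
by rewrite expr2; move: kk k8 m0; move: (k * k) (Ex F) (k) => *; lra.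
Qed.

(** At a small scale the mean is at least [- e]. If it is also at most [e], this scale is taken;
    otherwise the mean is positive there and nonpositive at some large scale, and continuity gives a
    zero in between. *)
Lemma balanced_scale b (eta : R) : 0 < eta -> exists2 c, 0 < c & Ex (xi b c) ^+ 2 <= eta.
Proof.
move=> eta0; have gn : gro 4 (fun g : V => 1 + l2norm g : R).
  by apply: (@groW _ _ 1) => //; apply: groD; [exact: gro_cst|exact: gro_l2norm].
pose C := 2 * (1 + l2norm p0) * Ex (fun g : V => 1 + l2norm g).
have C0 : 0 <= C.
  rewrite !mulr_ge0 ?addr_ge0 ?l2norm_ge0//; apply: Ex_ge0 => g.
  by rewrite addr_ge0 ?l2norm_ge0.
have C1 : 0 < C + 1 by rewrite ltr_wpDl.
pose e := Num.sqrt eta; have e0 : 0 < e by rewrite sqrtr_gt0.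
pose r := Num.min 1 (e / (C + 1)).
have r0 : 0 < r by rewrite lt_min ltr01 divr_gt0.
have r1 : r <= 1 by rewrite ge_min lexx.
have rC : r * C <= e.
  apply: (@le_trans _ _ (e / (C + 1) * (C + 1))); last by rewrite divfK ?gt_eqF.
  by apply: ler_pM; rewrite ?(ltW r0)// ?lerDl// ge_min lexx orbT.
pose c := r ^+ 2; have c0 : 0 < c by exact: exprn_gt0.
have c1 : c <= 1 by rewrite expr_le1// ltW.
have lo : - e <= Ex (xi b c).
  apply: le_trans (Ex_signed_defect_small cD vD D0 D_origin b c0 c1).
  by rewrite lerN2 /c sqrtr_sqr (gtr0_norm r0) -mulrA.
have [hi|hi] := leP (Ex (xi b c)) e.
  exists c => //; rewrite -[X in _ <= X](sqr_sqrtr (ltW eta0)) -/e.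
  by rewrite -real_normK ?num_real// ler_sqr ?nnegrE ?(ltW e0)// ler_norml lo.
have [c2 cc2 [c20 neg]] := Ex_signed_defect_neg b c.
have U := Ex_signed_defect_unif cD vD D0 D_origin b c0 cc2.
have [s /andP[cs _] z] := unif_root cc2 U (le_trans (ltW e0) (ltW hi)) neg.
by exists s; [exact: lt_le_trans cs|rewrite z expr0n/= ltW].
Qed.

Let X1 : lip 1 X. Proof. exact: (polar_sup_lip cD vD D0 D_origin). Qed.
Let gX : gro 1 X. Proof. exact: lip_gro X1. Qed.
Let gX4 : gro 4 X. Proof. exact: groW gX. Qed.
Let gXp : gro 1 Xp. Proof. exact: lip_gro (polar_sup_pos_lip cD vD D0 D_origin). Qed.
Let gXp4 : gro 4 Xp. Proof. exact: groW gXp. Qed.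
Let gXp2 : gro 4 (fun g => Xp g ^+ 2).
Proof. by apply: (@groW _ _ 2) => //; exact: (groX 2 gXp). Qed.
Let gX2 : gro 4 (fun g => X g ^+ 2).
Proof. by apply: (@groW _ _ 2) => //; exact: (groX 2 gX). Qed.

Lemma Ex_sqr_le (F : V -> R) : gro 1 F -> Ex F ^+ 2 <= Ex (fun g => F g ^+ 2).
Proof.
move=> gF; have := Ex_cauchy_schwarz (groW (leqW (leqnn 1)) gF) (gro_cst 2 1).
rewrite Ex_cst expr1n; under eq_fun do rewrite mulr1; by rewrite mulr1.
Qed.

Lemma Ex_polar_sup_pos_sqr : Ex (fun g => Xp g ^+ 2) <= Ex (fun g => X g ^+ 2).
Proof.
apply: le_Ex => // g; rewrite /polar_sup_pos; case: (leP 0 (X g)) => // h.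
by rewrite expr0n sqr_ge0.
Qed.

Lemma Ex_polar_sup_sqr : Ex (fun g => X g ^+ 2) <= Ex X ^+ 2 + 1.
Proof. by have := poincare_lip X1 ler01; rewrite expr1n lerBlDl. Qed.

(** The unweighted root has slope 1, so the mean squares of the distance and of the positive support
    function differ by at most [1 + eta]; the variance of the support function adds the other 1. *)
Lemma mean_sdist_le (eta : R) : 0 < eta ->
  exists2 c, 0 < c & Ex (J c) ^+ 2 <= Ex X ^+ 2 + 2 + eta.
Proof.
move=> eta0; have [c c0 xc] := balanced_scale false eta0; exists c => //.
have gJ := gro_sdist cD vD D0 c0.
have gJ2 : gro 4 (fun g => J c g ^+ 2) by apply: (@groW _ _ 2) => //; exact: (groX 2 gJ).
have E1 : Ex (fun g => q false c g ^+ 2) = Ex (fun g => J c g ^+ 2) - Ex (fun g => Xp g ^+ 2).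
  rewrite -ExB//; apply: eq_Ex => g.
  by transitivity (N c g / 1); [exact: root_defect_sqr|rewrite divr1].
have E2 : Ex (fun g => Gr false c g ^+ 2) = 1.
  by rewrite -[RHS](@Ex_cst R d); apply: eq_Ex => g; rewrite slope_sqr invr1.
have := root_defect_variance cD vD D0 D_origin false c0; rewrite E1 E2.
have := Ex_polar_sup_pos_sqr; have := Ex_polar_sup_sqr; have := Ex_sqr_le gJ.
move: xc; move: (Ex (fun g => J c g ^+ 2)) (Ex (fun g => Xp g ^+ 2)) (Ex (fun g => X g ^+ 2))
  (Ex (xi _ _) ^+ 2) (Ex (J c) ^+ 2) (Ex X ^+ 2) => *; lra.
Qed.

(** Passing to the positive part costs [- X] where [X < 0]. With a mean of at least 4 this is at
    most [165 / 10^5] times the fourth power of the deviation, whose mean is at most 5. *)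
Lemma mean_polar_sup_neg : 4 <= Ex X -> Ex Xp <= Ex X + 825 / (1000 * 100).
Proof.
move=> w4; pose u g := X g - Ex X.
have u1 : lip 1 u by move=> g h; rewrite /u opprB addrA subrK; exact: X1.
have gu4 : gro 4 (fun g => u g ^+ 4) by exact: (groX 4 (lip_gro u1)).
have u0 : Ex u = 0 by rewrite /u ExB ?Ex_cst ?subrr//; exact: gro_cst.
have := fourth_moment u1 u0.
have : Ex Xp <= Ex (fun g => X g + 165 / (1000 * 100) * u g ^+ 4).
  apply: le_Ex => //; first by apply: groD => //; exact: groZ.
  move=> g; rewrite /polar_sup_pos ge_max; apply/andP; split.
    by have := neg_part_le (u g); rewrite /u; move: w4; lra.
  by rewrite lerDl; apply: mulr_ge0; [lra|rewrite (exprM _ 2 2); exact: sqr_ge0].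
rewrite ExD; [|exact: gX4|exact: groZ].
rewrite ExZ; last exact: gu4.
by move: (Ex X) (Ex Xp) (Ex _) => *; lra.
Qed.

(** [excess_split] bounds the mean of [J - Xp] by half the mean square of the weighted root plus a
    correction, and the variance bound replaces the former by half the mean of the squared slope.
    Both are functions of the level, dominated by the quartic [majorant]. *)
Lemma mean_sdist_sharp : 4 <= Ex X -> exists2 c, 0 < c & Ex (J c) <= Ex X + 163 / 1000.
Proof.
move=> w4; have e0 : 0 < 1 / 1000 :> R by lra.
have [c c0 xc] := balanced_scale true e0; exists c; first exact: c0.
rewrite leNgt; apply/negP => bad.
have gJ := groW (leqW (leqW (leqW (leqnn 1)))) (gro_sdist cD vD D0 c0).
pose mu := Ex (Z c).
have Z1 := level_lip cD vD D0 D_origin c0.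
have gZ : gro 4 (Z c) by exact: groW (lip_gro Z1).
have XXp : Ex X <= Ex Xp by apply: le_Ex => // g; exact: polar_sup_le_pos.
(* Arguing by contradiction raises the mean level from 4 to [4 + 163 / 2000], above the 4.08 that
   the majorant requires. *)
have mu4 : 408 / 100 <= mu.
  have -> : mu = (Ex (J c) + Ex Xp) / 2.
    rewrite mulrC -ExD// -ExZ; last exact: groD.
    by apply: eq_Ex => g; rewrite /level mulrC.
  by move: bad XXp w4; move: (Ex X) (Ex Xp) (Ex (J c)) => *; lra.
pose u g := Z c g - mu.
have u1 : lip 1 u by move=> g h; rewrite /u opprB addrA subrK; exact: Z1.
have gu : gro 1 u := lip_gro u1.
have gu1 : gro 4 u by exact: groW gu.
have gu2 : gro 4 (fun g => u g ^+ 2) by apply: (@groW _ _ 2) => //; exact: (groX 2 gu).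
have gu4 : gro 4 (fun g => u g ^+ 4) by exact: (groX 4 gu).
have u0 : Ex u = 0 by rewrite /u ExB ?Ex_cst ?subrr//; exact: gro_cst.
have m2 := lip_sqr_le u1 u0; have m4 := fourth_moment u1 u0.
have gq : gro 4 (fun g => q true c g ^+ 2).
  have := gro_signed_defect cD vD D0 D_origin true c0 => /(groX 2)/(groW (isT : (1 * 2 <= 4)%N)).
  by rewrite (_ : (fun g => q true c g ^+ 2) = (fun g => xi true c g ^+ 2))//;
    apply/funext => g; rewrite signed_sqr.
have gG : gro 4 (fun g => Gr true c g ^+ 2).
  by have := lip_gro (slope_lip cD vD D0 D_origin true c0) => /(groX 2)/(groW (isT : (1 * 2 <= 4)%N)).
have gm : gro 4 (fun g => Num.max 0 (2 * Z c g * (1 - Z c g))).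
  apply: gro_max; first exact: gro_cst.
  apply: (@groW _ _ 2) => //; apply: (@groM _ _ 1 1); first exact: groZ (lip_gro Z1).
  by apply: groB; [exact: gro_cst|exact: lip_gro Z1].
have var := root_defect_variance cD vD D0 D_origin true c0.
have h1 : Ex (J c) - Ex Xp <= 1 / 2 * Ex (fun g => q true c g ^+ 2)
    + Ex (fun g => Num.max 0 (2 * Z c g * (1 - Z c g))).
  rewrite -ExZ// -ExD//; last exact: groZ.
  rewrite -ExB//; apply: le_Ex; [exact: groB|by apply: groD => //; exact: groZ|] => g.
  have -> : q true c g ^+ 2 = N c g / M true c g by exact: root_defect_sqr.
  rewrite defect_excess /weight.
  have xj := polar_sup_pos_le_sdist cD vD D0 D_origin c0 g.
  have x0 := polar_sup_pos_ge0 D g.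
  exact: excess_split.
have h2 : 1 / 2 * Ex (fun g => Gr true c g ^+ 2) +
   Ex (fun g => Num.max 0 (2 * Z c g * (1 - Z c g))) <= Ex (fun g => majorant (u g)).
  rewrite -ExZ// -ExD//; last exact: groZ.
  have gmaj : gro 4 (fun g => majorant (u g)).
    rewrite /majorant; apply: groD; last exact: groZ.
    by apply: groD; [apply: groB; [exact: gro_cst|exact: groZ]|exact: groZ].
  apply: le_Ex => //; first by apply: groD => //; exact: groZ.
  move=> g; apply: le_trans (majorant_ge mu4 (level_ge0 D c g)).
  by rewrite slope_sqr /weight invfM mul1r.
(* In decimals, [0.1248 + 0.0019 + 5 * 0.0054]. *)
have h3 : Ex (fun g => majorant (u g)) <= 1537 / (100 * 100).
  rewrite /majorant ExD; [|by apply: groD; [apply: groB; [exact: gro_cst|exact: groZ]|exact: groZ]|exact: groZ].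
  rewrite ExD; [|by apply: groB; [exact: gro_cst|exact: groZ]|exact: groZ].
  rewrite ExB; [|exact: gro_cst|exact: groZ].
  rewrite Ex_cst !ExZ// u0; move: m2 m4.
  by move: (Ex (fun g => u g ^+ 2)) (Ex (fun g => u g ^+ 4)) => *; lra.
have h4 := mean_polar_sup_neg w4.
(* The majorant, the imperfect balance and the negative part add up to [0.1537 + 0.0005 + 0.00825],
   below 0.163. *)
move: xc bad var h1 h2 h3 h4.
move: (Ex (fun g => majorant _)) (Ex (fun g => Num.max _ _)) (Ex (fun g => Gr _ _ _ ^+ 2))
  (Ex (fun g => q _ _ _ ^+ 2)) (Ex (xi _ _) ^+ 2) (Ex X) (Ex Xp) (Ex (J c)) => *; lra.
Qed.

Lemma mean_polar_sup_le_sdist c : 0 < c -> Ex X <= Ex (J c).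
Proof.
move=> c0; apply: le_Ex => //; first exact: groW (gro_sdist cD vD D0 c0).
by move=> g; exact: (polar_sup_le_sdist cD vD D0 D_origin c0).
Qed.

End mean_distance.

(** * Cones generated by compact sets *)

Section cones.
Context {R : realType} {d : nat}.
Local Notation V := 'rV[R]_d.
Implicit Types (B D : set V) (g h p u v y z : V) (s t : R).

Definition cone B : set V := [set x | exists2 u, B u & exists2 s, 0 <= s & x = s *: u].

Lemma coneP B x : (forall u, B u -> 0 < l2norm u) ->
  cone B x <-> exists2 u, B u & l2norm u *: x = l2norm x *: u.
Proof.
move=> Bp; split=> [[u Bu [s s0 ->]]|[u Bu e]]; exists u => //.
  by rewrite l2normZ (ger0_norm s0) !scalerA mulrC.
exists (l2norm x / l2norm u); first by rewrite divr_ge0 ?l2norm_ge0.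
have u0 : l2norm u != 0 by rewrite gt_eqF// Bp.
by rewrite mulrC -scalerA -e scalerA mulVf// scale1r.
Qed.

(** [F x] is the least norm of [|u| x - |x| u] over [u] in [B]; it vanishes exactly when some [u] is
    on the ray of [x], since the minimum is attained. A Lipschitz description gives closedness of
    the cone and of its preimages under nonexpansive maps. *)
Lemma cone_gap B (b : R) : compact B -> B !=set0 -> (forall u, B u -> 0 < l2norm u <= b) ->
  exists2 F : V -> R, lip (2 * b) F & cone B = [set x | F x <= 0].
Proof.
move=> cB B0 Bb.
have kap x : exists u, B u /\ forall w, B w ->
    l2norm (l2norm u *: x - l2norm x *: u) <= l2norm (l2norm w *: x - l2norm x *: w).
  have cf : continuous (fun u => - l2norm (l2norm u *: x - l2norm x *: u) : R).
    apply: (@lip_continuous _ _ (l2norm x + l2norm x)) => u w.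
    rewrite opprK addrC -[X in _ <= _ * X]l2normN opprB.
    apply: (le_trans (l2norm_lip _ _)).
    rewrite (_ : _ - _ = (l2norm w - l2norm u) *: x - l2norm x *: (w - u)); last first.
      by apply/rowP => i; rewrite !mxE; ring.
    apply: (le_trans (l2normD _ _)); rewrite l2normN !l2normZ (ger0_norm (l2norm_ge0 x)).
    by rewrite mulrDl lerD2r mulrC ler_wpM2l ?l2norm_ge0// l2norm_lip.
  have [u Bu um] := compact_max_attained cB B0 cf.
  by exists u; split => // w /um; rewrite lerN2.
have /choice[k kP] := kap.
pose F x := l2norm (l2norm (k x) *: x - l2norm x *: k x).
exists F.
  have b0 : 0 <= 2 * b.
    by case: B0 => u /Bb/andP[u0 ub]; rewrite mulr_ge0// (le_trans (ltW u0)).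
  have one x y : F x - F y <= 2 * b * l2norm (x - y).
    have [By _] := kP y; have [_ /(_ _ By) h] := kP x.
    rewrite lerBlDl; apply: (le_trans h); rewrite /F; set u := k y in By *.
    rewrite (_ : l2norm u *: x - l2norm x *: u =
      (l2norm u *: y - l2norm y *: u) + (l2norm u *: (x - y) - (l2norm x - l2norm y) *: u)); last first.
      by apply/rowP => i; rewrite !mxE; ring.
    apply: (le_trans (l2normD _ _)); rewrite lerD2l.
    apply: (le_trans (l2normD _ _)); rewrite l2normN !l2normZ (ger0_norm (l2norm_ge0 u)).
    have /andP[u0 ub] := Bb _ By.
    apply: (@le_trans _ _ (l2norm u * l2norm (x - y) + l2norm u * l2norm (x - y))).
      by rewrite lerD2l mulrC ler_wpM2l ?(ltW u0)// l2norm_lip.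
    by rewrite -mulrDl ler_wpM2r ?l2norm_ge0// mulr_natl mulr2n lerD.
  by move=> x y; rewrite ler_norml one andbT lerNl opprB l2normB; exact: one.
have Bp u : B u -> 0 < l2norm u by case/Bb/andP.
apply/seteqP; split => x; rewrite (coneP x Bp) /=.
  move=> [u Bu e]; have [_ /(_ u Bu)] := kP x; rewrite e subrr l2norm0; exact.
move=> Fx; have [Bk _] := kP x; exists (k x) => //.
apply/eqP; rewrite -subr_eq0; apply/eqP/l2norm_eq0/eqP.
by rewrite eq_le l2norm_ge0 andbT.
Qed.

Lemma cone_cvx D : cvx D -> cvx (cone D).
Proof.
move=> vD x y t /andP[t0 t1] [u Du [s s0 ->]] [w Dw [r r0 ->]].
have t1' : 0 <= 1 - t by rewrite subr_ge0.
have a0 : 0 <= (1 - t) * s by rewrite mulr_ge0.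
have b0 : 0 <= t * r by rewrite mulr_ge0.
have := addr_ge0 a0 b0; rewrite le_eqVlt => /orP[/eqP e|ab].
  exists u => //; exists 0 => //.
  have ae : (1 - t) * s = 0 by apply/eqP; rewrite eq_le a0 andbT e lerDl.
  have be : t * r = 0 by apply/eqP; rewrite eq_le b0 andbT e lerDr.
  by rewrite !scalerA ae be !scale0r addr0.
set a := (1 - t) * s in a0 ab *; set b := t * r in b0 ab *.
exists ((1 - b / (a + b)) *: u + (b / (a + b)) *: w).
  apply: vD => //; rewrite divr_ge0 ?(ltW ab)//= ler_pdivrMr// mul1r lerDr//.
exists (a + b); first exact: ltW.
by rewrite !scalerA -/a -/b scalerDr !scalerA; congr (_ *: _ + _ *: _); field; rewrite gt_eqF.
Qed.

Lemma coneZ B s x : 0 <= s -> cone B x -> cone B (s *: x).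
Proof.
move=> s0 [u Bu [r r0 ->]]; exists u => //; exists (s * r); first exact: mulr_ge0.
by rewrite scalerA.
Qed.

Lemma sub_cone B u : B u -> cone B u.
Proof. by move=> Bu; exists u => //; exists 1 => //; rewrite scale1r. Qed.

End cones.

(** No continuity of [e] is assumed: at the supremum of the points where [e] is nonnegative, both
    signs occur arbitrarily near. *)
Lemma sign_change {R : realType} (e : R -> R) (a b : R) : a <= b -> 0 <= e a -> e b <= 0 ->
  exists2 t, a <= t <= b & forall r, 0 < r ->
    (exists2 s, a <= s <= b & `|s - t| < r /\ 0 <= e s) /\
    (exists2 s, a <= s <= b & `|s - t| < r /\ e s <= 0).
Proof.
move=> ab ea eb; pose E := [set s | a <= s <= b /\ 0 <= e s].
have Ea : E a by split => //; rewrite lexx.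
have hs : has_sup E by split; [exists a|exists b => s [/andP[]]].
pose t := sup E.
have at_ : a <= t by apply: ub_le_sup => //; case: hs.
have tb : t <= b by apply: ge_sup; [exists a|move=> s [/andP[]]].
exists t; first by rewrite at_.
move=> r r0; split.
  have [s Es st] := sup_adherent r0 hs; exists s; first by case: Es.
  have sT : s <= t by apply: ub_le_sup => //; case: hs.
  split; last by case: Es.
  by rewrite distrC ger0_norm ?subr_ge0//; move: st; rewrite -/t; lra.
have [tlt|tge] := ltP t b; last first.
  by exists b; rewrite ?ab ?lexx//; split => //; rewrite (_ : b = t) ?subrr ?normr0//; lra.
pose s := t + Num.min (r / 2) (b - t).
have m0 : 0 < Num.min (r / 2) (b - t) by rewrite lt_min divr_gt0//= subr_gt0.
have mr : Num.min (r / 2) (b - t) <= r / 2 by rewrite ge_min lexx.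
have mb : Num.min (r / 2) (b - t) <= b - t by rewrite ge_min lexx orbT.
have sab : a <= s <= b by rewrite /s; move: (Num.min _ _) m0 mb => *; apply/andP; split; lra.
exists s => //; split.
  by rewrite /s addrAC subrr add0r gtr0_norm//; move: (Num.min _ _) mr => *; lra.
rewrite leNgt; apply/negP => es.
have : s <= t by apply: ub_le_sup; [case: hs|split => //; exact: ltW].
by rewrite /s gerDl leNgt m0.
Qed.

(** * Spherical slices of the cone generated by the subdifferential of [g] *)

Section slices.
Context {R : realType} {d : nat}.
Local Notation V := 'rV[R]_d.
Variables (D : set V) (alpha beta : R) (ua ub : V).
Hypotheses (cD : closed D) (vD : cvx D) (D_origin : ~ D 0).
Hypotheses (Dua : D ua) (Dub : D ub) (uaE : l2norm ua = alpha) (ubE : l2norm ub = beta).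
Hypothesis (Dab : forall u, D u -> alpha <= l2norm u <= beta).
Implicit Types (g h p u v y z : V) (s t : R).

Local Notation X := (polar_sup D).
Local Notation Xp := (polar_sup_pos D).

Lemma alpha_gt0 : 0 < alpha.
Proof.
rewrite -uaE; apply: l2norm_gt0; apply/eqP => e; apply: D_origin; by rewrite -e.
Qed.

Lemma alpha_le_beta : alpha <= beta. Proof. by have := Dab Dua => /andP[]; lra. Qed.

Let D0 : D !=set0. Proof. by exists ua. Qed.

Lemma bounded_compact (A : set V) : closed A -> A `<=` D -> compact A.
Proof.
by move=> cA AD; apply: (@l2_closed_compact _ _ _ beta) => // x /AD/Dab/andP[].
Qed.

Definition slice t : set V := [set y | l2norm y = 1 /\ D (t *: y)].

Lemma slice_compact t : compact (slice t).
Proof.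
apply: (@l2_closed_compact _ _ _ 1); first by move=> x [-> _].
rewrite (_ : slice t = l2sphere `&` [set y | D (t *: y)]).
  apply: closedI; first exact: l2sphere_closed.
  by apply: preimage_closed => // y _; exact: (@scaler_continuous _ V).
by apply/seteqP; split.
Qed.

(** Along the segment from [ua] to [ub] the norm runs from [alpha] to [beta] and takes the value
    [t]; this point is then normalized. *)
Lemma slice_neq0 t : alpha <= t <= beta -> slice t !=set0.
Proof.
move=> /andP[at_ tb]; have t0 : 0 < t by apply: lt_le_trans alpha_gt0 _.
have [|||s /andP[s0 s1]] := @unif_root _ (fun s => t - l2norm ((1 - s) *: ua + s *: ub)) 0 1 ler01.
- move=> e e0; have n1 : 0 < l2norm (ua - ub) + 1 by rewrite ltr_wpDl// l2norm_ge0.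
  exists (e / (l2norm (ua - ub) + 1)); first exact: divr_gt0.
  move=> s r _ _ sr; rewrite opprB addrC addrA subrK.
  apply: (le_trans (l2norm_lip _ _)).
  rewrite (_ : _ - _ = (s - r) *: (ua - ub)); last by apply/rowP => i; rewrite !mxE; ring.
  rewrite l2normZ; rewrite ltr_pdivlMr// in sr; apply: le_trans (ltW sr).
  by rewrite ler_wpM2l// lerDl.
- by rewrite subr0 scale1r scale0r addr0 uaE subr_ge0.
- by rewrite subrr scale0r scale1r add0r ubE subr_le0.
move/eqP; rewrite subr_eq0 => /eqP e.
exists (t^-1 *: ((1 - s) *: ua + s *: ub)); split.
  by rewrite l2normZ gtr0_norm ?invr_gt0// -e mulVf ?gt_eqF.
by rewrite scalerA divff ?gt_eqF// scale1r; apply: vD => //; rewrite s0.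
Qed.

Local Notation C := (cone D).

Let Dp u : D u -> 0 < l2norm u.
Proof. by move=> /Dab/andP[h _]; exact: lt_le_trans alpha_gt0 h. Qed.

Lemma part_cone_gap (A : set V) : closed A -> A `<=` D -> A !=set0 ->
  exists2 F : V -> R, lip (2 * beta) F & cone A = [set x | F x <= 0].
Proof.
move=> cA AD A0; apply: cone_gap => //; first exact: bounded_compact.
by move=> u /AD Du; rewrite Dp//=; case/andP: (Dab Du).
Qed.

Lemma cone_closed : closed C.
Proof.
have [F Fl ->] := part_cone_gap cD (fun x (h : D x) => h) D0.
by apply: closed_le_fun; [exact: lip_continuous Fl|exact: continuous_cstR].
Qed.

Let C0 : C !=set0. Proof. by exists ua; exact: sub_cone. Qed.
Let vC : cvx C := cone_cvx vD.
Let ZC (s : R) x : 0 <= s -> C x -> C (s *: x) := @coneZ _ _ D s x.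

Definition pcone h := cproj C h.

Lemma pcone_in h : C (pcone h). Proof. exact: proj_in cone_closed vC C0 h. Qed.

Lemma pcone_orth h : dotv (h - pcone h) (pcone h) = 0.
Proof. exact: (proj_cone cone_closed vC C0 ZC h).1. Qed.

Lemma pcone_var h q : C q -> dotv (h - pcone h) q <= 0.
Proof. exact: (proj_cone cone_closed vC C0 ZC h).2. Qed.

Lemma pcone_polar h : polar D (h - pcone h).
Proof. by move=> u Du; rewrite dotvC; apply: pcone_var; exact: sub_cone. Qed.

Lemma polar_cone z p : polar D z -> C p -> dotv z p <= 0.
Proof.
by move=> pz [u Du [s s0 ->]]; rewrite dotvZr dotvC mulr_ge0_le0//; exact: pz.
Qed.

Lemma pcone_dot h : dotv h (pcone h) = l2norm (pcone h) ^+ 2.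
Proof.
have e := dotvDl (h - pcone h) (pcone h) (pcone h).
by rewrite subrK pcone_orth add0r -sqr_l2norm in e.
Qed.

Lemma sqr_norm_split h : l2norm h ^+ 2 = l2norm (h - pcone h) ^+ 2 + l2norm (pcone h) ^+ 2.
Proof.
have e := sqr_l2normD (h - pcone h) (pcone h).
by rewrite subrK pcone_orth mul0rn addr0 in e.
Qed.

(** In the Moreau decomposition the residual [h - pcone h] lies in the polar of [D], and pairing [h]
    with its direction gives its norm, which is therefore at most the supremum. *)
Lemma sqr_norm_le h : l2norm h ^+ 2 <= Xp h ^+ 2 + l2norm (pcone h) ^+ 2.
Proof.
rewrite sqr_norm_split lerD2r ler_sqr ?nnegrE ?l2norm_ge0 ?polar_sup_pos_ge0//.
have [->|n0] := eqVneq (h - pcone h) 0; first by rewrite l2norm0 polar_sup_pos_ge0.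
have np := l2norm_gt0 n0; set w := h - pcone h in n0 np *.
apply: le_trans (polar_sup_le_pos D h).
have pw : polar D ((l2norm w)^-1 *: w).
  by move=> u Du; rewrite dotvZr pmulr_rle0 ?invr_gt0//; exact: pcone_polar.
have n1 : l2norm ((l2norm w)^-1 *: w) = 1.
  by rewrite l2normZ gtr0_norm ?invr_gt0// mulVf ?gt_eqF.
apply: le_trans ((polar_supP cD vD D0 D_origin h).2 _ pw n1).
have -> : dotv ((l2norm w)^-1 *: w) h = (l2norm w)^-1 * l2norm w ^+ 2.
  rewrite dotvZl; congr (_ * _); rewrite sqr_l2norm.
  by rewrite -[X in dotv w X = _](subrK (pcone h)) dotvDr -/w pcone_orth addr0.
by rewrite expr2 mulrA mulVf ?gt_eqF// mul1r.
Qed.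

(** The residual of [h] pairs nonpositively with [pcone g], so subtracting it from [g] can only
    increase the pairing. The bound has the same use for slices as [sdist_le] has for distances. *)
Lemma pcone_contract g h : l2norm (pcone g) <= l2norm (pcone h + (g - h)).
Proof.
have := l2norm_ge0 (pcone g); rewrite le_eqVlt => /orP[/eqP <-|np]; first exact: l2norm_ge0.
rewrite -(ler_pM2r np) -expr2 -pcone_dot.
apply: le_trans (cauchy_schwarz _ _).
have -> : pcone h + (g - h) = g - (h - pcone h) by apply/rowP => i; rewrite !mxE; ring.
by rewrite dotvBl lerBrDr gerDl; exact: polar_cone (pcone_polar h) (pcone_in g).
Qed.

Lemma pcone_nonexpansive g h : l2norm (pcone g - pcone h) <= l2norm (g - h).
Proof. exact: (proj_nonexpansive cone_closed vC C0). Qed.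

Section fixed_slice.
Variable t : R.
Hypothesis tab : alpha <= t <= beta.

Let t0 : 0 < t. Proof. by case/andP: tab => h _; exact: lt_le_trans alpha_gt0 h. Qed.

Definition slice_sup h : R := sup_dot (slice t) h.
Definition slice_pos h := Num.max 0 (slice_sup h).
Definition slice_defect h := l2norm (pcone h) ^+ 2 - slice_pos h ^+ 2.

Local Notation W := slice_sup.
Local Notation Wp := slice_pos.
Local Notation N := slice_defect.

Lemma slice_supP h : (exists2 y, slice t y & dotv y h = W h) /\
  forall y, slice t y -> dotv y h <= W h.
Proof. exact: (sup_dotP h (@slice_compact t) (slice_neq0 tab)). Qed.

Lemma slice_sup_lip : lip 1 W.
Proof. by apply: sup_dot_lip; [exact: slice_compact|exact: slice_neq0|move=> y []]. Qed.

Lemma slice_pos_ge0 h : 0 <= Wp h. Proof. by rewrite /Wp le_max lexx. Qed.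

Lemma slice_sup_le_pos h : W h <= Wp h. Proof. by rewrite /Wp le_max lexx orbT. Qed.

Lemma slice_cone y : slice t y -> C y.
Proof.
move=> [_ Dy]; exists (t *: y) => //; exists t^-1; first by rewrite invr_ge0 ltW.
by rewrite scalerA mulVf ?gt_eqF// scale1r.
Qed.

Lemma slice_pos_lip : lip 1 Wp.
Proof.
have one x y : Wp x - Wp y <= l2norm (x - y).
  have := slice_sup_lip x y; rewrite mul1r => /(le_trans (ler_norm _)) h.
  have := slice_pos_ge0 y; have := slice_sup_le_pos y; have := l2norm_ge0 (x - y).
  by move=> n0 h1 h2; rewrite lerBlDr {1}/Wp ge_max; apply/andP; split; lra.
move=> x y; rewrite mul1r ler_norml one andbT lerNl opprB l2normB; exact: one.
Qed.

Lemma slice_dot_le h y : slice t y -> dotv y h <= dotv y (pcone h).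
Proof.
move=> Ky; have := pcone_var h (slice_cone Ky).
by rewrite dotvC dotvBr subr_le0.
Qed.

Lemma slice_pos_le h : Wp h <= l2norm (pcone h).
Proof.
rewrite /Wp ge_max l2norm_ge0/=; have [[y Ky <-] _] := slice_supP h.
apply: (le_trans (slice_dot_le h Ky)); apply: (le_trans (cauchy_schwarz _ _)).
by rewrite Ky.1 mul1r.
Qed.

Lemma slice_defect_ge0 h : 0 <= N h.
Proof. by rewrite subr_ge0 ler_sqr ?nnegrE ?slice_pos_ge0 ?l2norm_ge0// slice_pos_le. Qed.

Lemma slice_pos_sqr_ge g y s : slice t y -> 0 <= s -> 2 * s * dotv g y - s ^+ 2 <= Wp g ^+ 2.
Proof.
move=> Ky s0; have [_ /(_ y Ky)] := slice_supP g.
rewrite dotvC; have := slice_sup_le_pos g; move: (Wp g) (W g) (dotv g y) => a b r h1 h2.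
have := sqr_ge0 (a - s); have : s * r <= s * a by rewrite ler_wpM2l//; lra.
nra.
Qed.

Lemma slice_witness h : exists2 y, slice t y & Wp h * dotv h y = Wp h ^+ 2.
Proof.
have [[y Ky yh] _] := slice_supP h; exists y => //; rewrite dotvC yh.
by rewrite /Wp /Num.max; case: ifP => _; [rewrite expr2|rewrite mul0r expr0n].
Qed.

(** The freezing argument again: [pcone_contract] bounds the first square from above through
    [pcone h], and the maximizer of [h] bounds the slice supremum at [g] from below. *)
Lemma sqrt_slice_defect_slope g h : Num.sqrt (N g) <= Num.sqrt (N h) + l2norm (g - h).
Proof.
rewrite -[X in _ <= X]ger0_norm ?addr_ge0 ?sqrtr_ge0 ?l2norm_ge0//.
rewrite -[`|_ + _|]sqrtr_sqr; apply: ler_wsqrtr.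
have [y Ky yh] := slice_witness h; have s0 := slice_pos_ge0 h.
have h1 := slice_pos_sqr_ge g Ky s0.
have h2 : l2norm (pcone g) ^+ 2 <= l2norm (pcone h + (g - h)) ^+ 2.
  by rewrite ler_sqr ?nnegrE ?l2norm_ge0// pcone_contract.
have h0 := slice_dot_le h Ky.
set s := Wp h in yh s0 h1; set k := pcone h - s *: y.
have h3 : l2norm k ^+ 2 <= N h.
  rewrite /k sqr_l2normB l2normZ (ger0_norm s0) Ky.1 mulr1 dotvZr /N -/s.
  rewrite (dotvC y h) (dotvC y) in h0.
  have := ler_wpM2l s0 h0; rewrite yh; move: (s * dotv (pcone h) y) (l2norm _ ^+ 2) (s ^+ 2).
  by move=> a b c; lra.
have h4 : l2norm k <= Num.sqrt (N h).
  by rewrite -[l2norm k]ger0_norm ?l2norm_ge0// -sqrtr_sqr ler_wsqrtr.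
have h5 := cauchy_schwarz k (g - h).
have h6 : l2norm k * l2norm (g - h) <= Num.sqrt (N h) * l2norm (g - h).
  by rewrite ler_wpM2r ?l2norm_ge0.
rewrite sqr_l2normD in h2.
have r2 := sqr_sqrtr (slice_defect_ge0 h).
rewrite sqrrD r2; move: (Num.sqrt (N h)) h6 {h4 r2} => r h6; rewrite /N -/s.
have e1 : dotv k (g - h) = dotv (pcone h) (g - h) - s * (dotv g y - dotv h y).
  by rewrite /k dotvBl dotvZl (dotvC y) dotvBl.
rewrite e1 in h5; move: h1 h2 h5 h6 yh; clear e1; clearbody k; clear s0; clearbody s.
move: (l2norm (pcone g)) (l2norm (pcone h)) (Wp g) (l2norm (g - h)) (l2norm k * _)
  (dotv (pcone h) _) (dotv g y) (dotv h y) s => *; lra.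
Qed.

End fixed_slice.

Definition lo_part t : set V := D `&` [set u | l2norm u <= t].
Definition hi_part t : set V := D `&` [set u | t <= l2norm u].
(** [h] is in [lo_set t] when its projection vanishes or lies on a ray that meets [D] at a norm of
    at most [t]. [lo_set] and [hi_set] take the place of the two signs of the gap. *)
Definition lo_set t : set V := [set h | cone (lo_part t) (pcone h)].
Definition hi_set t : set V := [set h | cone (hi_part t) (pcone h)].

Lemma lo_part_sub t : lo_part t `<=` D. Proof. by move=> u []. Qed.

Lemma hi_part_sub t : hi_part t `<=` D. Proof. by move=> u []. Qed.

Lemma lo_part_closed t : closed (lo_part t).
Proof.
apply: closedI => //; apply: closed_le_fun; [exact: l2norm_continuous|exact: continuous_cstR].
Qed.

Lemma hi_part_closed t : closed (hi_part t).
Proof.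
apply: closedI => //; apply: closed_le_fun; [exact: continuous_cstR|exact: l2norm_continuous].
Qed.

Lemma preimage_cone_closed (A : set V) : closed A -> A `<=` D -> A !=set0 ->
  closed [set h | cone A (pcone h)].
Proof.
move=> cA AD A0; have [F Fl ->] := part_cone_gap cA AD A0.
have b0 : 0 <= 2 * beta by rewrite mulr_ge0// (le_trans (ltW alpha_gt0))// alpha_le_beta.
apply: closed_le_fun; last exact: continuous_cstR.
apply: (@lip_continuous _ _ (2 * beta)) => g h; apply: (le_trans (Fl _ _)).
by rewrite ler_wpM2l// pcone_nonexpansive.
Qed.

Lemma lo_set_closed t : alpha <= t <= beta -> closed (lo_set t).
Proof.
move=> /andP[h _]; apply: preimage_cone_closed; [exact: lo_part_closed|exact: lo_part_sub|].
by exists ua; split => //=; rewrite uaE.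
Qed.

Lemma hi_set_closed t : alpha <= t <= beta -> closed (hi_set t).
Proof.
move=> /andP[_ h]; apply: preimage_cone_closed; [exact: hi_part_closed|exact: hi_part_sub|].
by exists ub; split => //=; rewrite ubE.
Qed.

Lemma hi_lo_cover t h : hi_set t h \/ lo_set t h.
Proof.
have [u Du [s s0 e]] := pcone_in h.
by have [ut|tu] := leP t (l2norm u); [left|right]; exists u; try (by exists s); split => //=; exact: ltW.
Qed.

(** A ray that meets [D] at a norm above [t] and at one below it meets [D] at norm [t] by convexity;
    its direction is then in the slice and gives the value [|pcone h|]. *)
Lemma slice_defect_eq0 t h : alpha <= t <= beta -> hi_set t h -> lo_set t h ->
  slice_defect t h = 0.
Proof.
move=> tab [u [Du ut] [s s0 es]] [w [Dw wt] [r r0 er]].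
have t0 : 0 < t by case/andP: tab => /(lt_le_trans alpha_gt0).
have N0 := slice_defect_ge0 tab h; apply/eqP; rewrite eq_le N0 andbT subr_le0.
have [p0|p0] := eqVneq (pcone h) 0; first by rewrite p0 l2norm0 expr0n/= sqr_ge0.
have np := l2norm_gt0 p0; set p := pcone h in es er p0 np *.
rewrite ler_sqr ?nnegrE ?l2norm_ge0 ?slice_pos_ge0//.
have s1 : 0 < s.
  by rewrite lt_neqAle s0 andbT; apply/eqP => z; move: p0; rewrite es -z scale0r eqxx.
have r1 : 0 < r.
  by rewrite lt_neqAle r0 andbT; apply/eqP => z; move: p0; rewrite er -z scale0r eqxx.
pose y := (l2norm p)^-1 *: p.
have uy : u = l2norm u *: y.
  by rewrite /y es l2normZ (gtr0_norm s1) !scalerA; have nu := Dp Du;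
    rewrite (_ : _ * _ = 1) ?scale1r//; field; rewrite !gt_eqF.
have wy : w = l2norm w *: y.
  by rewrite /y er l2normZ (gtr0_norm r1) !scalerA; have nw := Dp Dw;
    rewrite (_ : _ * _ = 1) ?scale1r//; field; rewrite !gt_eqF.
have y1 : l2norm y = 1 by rewrite l2normZ gtr0_norm ?invr_gt0// mulVf ?gt_eqF.
have Ky : slice t y.
  split => //; have [e|ne] := eqVneq (l2norm u) (l2norm w).
    by have -> : t = l2norm u; [apply/eqP; rewrite eq_le ut e wt|rewrite -uy].
  have lt_wu : l2norm w < l2norm u by rewrite lt_neqAle eq_sym ne (le_trans wt ut).
  have duw : 0 < l2norm u - l2norm w by rewrite subr_gt0.
  pose l := (t - l2norm w) / (l2norm u - l2norm w).
  have l01 : 0 <= l <= 1.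
    by rewrite divr_ge0 ?subr_ge0 ?(ltW lt_wu)//= ler_pdivrMr// mul1r lerD2r.
  have -> : t *: y = (1 - l) *: w + l *: u.
    have e : t = (1 - l) * l2norm w + l * l2norm u by rewrite /l; field; rewrite gt_eqF.
    by rewrite [in LHS]e (scalerDl y) -(scalerA _ _ y) -(scalerA l _ y) -uy -wy.
  exact: vD.
apply: le_trans (slice_sup_le_pos t h).
apply: le_trans ((slice_supP tab h).2 _ Ky).
by rewrite dotvC /y dotvZr pcone_dot -/p expr2 mulrA mulVf ?gt_eqF// mul1r.
Qed.

Definition signed_slice t := signed (hi_set t) (fun h => Num.sqrt (slice_defect t h)).

Lemma signed_slice_lip t : alpha <= t <= beta -> lip 1 (signed_slice t).
Proof.
move=> tab; apply: (@signed_lip _ _ (hi_set t) (lo_set t) _ (fun=> 1)).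
- exact: hi_set_closed.
- exact: lo_set_closed.
- exact: hi_lo_cover.
- by move=> h; exact: sqrtr_ge0.
- by move=> h h1 h2; rewrite (slice_defect_eq0 tab h1 h2) sqrtr0.
- by move=> h; exact: lexx.
- by move=> g h; rewrite mul1r; exact: sqrt_slice_defect_slope.
Qed.

Lemma signed_slice_hi t h : hi_set t h -> signed_slice t h = Num.sqrt (slice_defect t h).
Proof. exact: signedA. Qed.

Lemma signed_slice_lo t h : alpha <= t <= beta -> lo_set t h ->
  signed_slice t h = - Num.sqrt (slice_defect t h).
Proof.
move=> tab; apply: (@signedB _ _ _ (lo_set t)) => // x h1 h2.
by rewrite (slice_defect_eq0 tab h1 h2) sqrtr0.
Qed.

(** A failure at [t] would produce an element of [D] of norm [t] with [c |u| <= <h, u>]. The set [Q]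
    of such [u] is compact and has no element of norm [t0], so the norms in [Q] stay at a positive
    distance from [t0]. *)
Lemma slice_sup_usc h t0 (e : R) : alpha <= t0 <= beta -> 0 < e ->
  exists2 r, 0 < r & forall t, alpha <= t <= beta -> `|t - t0| < r ->
    slice_sup t h <= slice_sup t0 h + e.
Proof.
move=> tab0 e0; set c := slice_sup t0 h + e.
pose Q : set V := D `&` [set u | c * l2norm u <= dotv h u].
have clQ : closed Q.
  apply: closedI => //; apply: closed_le_fun; last exact: dotv_continuous.
  by apply: continuous_mulR; [exact: continuous_cstR|exact: l2norm_continuous].
have notQ t : alpha <= t <= beta -> (forall y, slice t y -> ~ Q (t *: y)) -> slice_sup t h <= c.
  move=> tab nQ; have t1 : 0 < t by case/andP: tab => /(lt_le_trans alpha_gt0).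
  have [[y Ky <-] _] := slice_supP tab h.
  rewrite leNgt; apply/negP => lt1; apply: (nQ y Ky); split; first by case: Ky.
  by rewrite /= dotvZr l2normZ (gtr0_norm t1) Ky.1 mulr1 mulrC ler_pM2l// dotvC ltW.
have [Q0|Q0] := pselect (Q !=set0); last first.
  by exists 1 => // t tab _; apply: notQ => // y _ Qy; apply: Q0; exists (t *: y).
have cf : continuous (fun u : V => - `|l2norm u - t0| : R).
  apply: (@lip_continuous _ _ 1) => u w; rewrite mul1r opprK addrC distrC.
  rewrite distrC; apply: (le_trans (ler_dist_dist _ _)).
  by rewrite opprB addrA subrK l2normB; exact: l2norm_lip.
have [u Qu um] := compact_max_attained (bounded_compact clQ (fun x (h : Q x) => h.1)) Q0 cf.
exists `|l2norm u - t0|.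
  rewrite normr_gt0 subr_eq0; apply/eqP => ut; case: Qu => Du /=; rewrite ut.
  have t1 : 0 < t0 by case/andP: tab0 => /(lt_le_trans alpha_gt0).
  have Ky : slice t0 (t0^-1 *: u).
    split; first by rewrite l2normZ gtr0_norm ?invr_gt0// ut mulVf ?gt_eqF.
    by rewrite scalerA divff ?gt_eqF// scale1r.
  have := (slice_supP tab0 h).2 _ Ky; rewrite dotvC dotvZr => h1.
  rewrite -ler_pdivlMr// mulrC => h3.
  by have := le_trans h3 h1; rewrite /c gerDl leNgt e0.
move=> t tab tt0; apply: notQ => // y Ky Qy.
have t1 : 0 < t by case/andP: tab => /(lt_le_trans alpha_gt0).
have := um _ Qy; rewrite lerN2 l2normZ Ky.1 mulr1 (gtr0_norm t1) => h1.
by have := le_lt_trans h1 tt0; rewrite ltxx.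
Qed.

Lemma slice_pos_usc h t0 (e : R) : alpha <= t0 <= beta -> 0 < e ->
  exists2 r, 0 < r & forall t, alpha <= t <= beta -> `|t - t0| < r ->
    slice_pos t h <= slice_pos t0 h + e.
Proof.
move=> tab0 e0; have [r r0 hr] := slice_sup_usc h tab0 e0.
exists r => // t tab tt0; rewrite {1}/slice_pos ge_max addr_ge0 ?slice_pos_ge0 ?(ltW e0)//=.
by apply: (le_trans (hr t tab tt0)); rewrite lerD2r slice_sup_le_pos.
Qed.

Let ray p : set V := D `&` [set u | l2norm u *: p = l2norm p *: u].

Lemma ray_compact p : compact (ray p).
Proof.
apply: bounded_compact; last by move=> u [].
apply: closedI => //.
rewrite (_ : [set u | _] = [set u | l2norm (l2norm u *: p - l2norm p *: u) <= 0]).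
  apply: closed_le_fun; last exact: continuous_cstR.
  apply: (@lip_continuous _ _ (l2norm p + l2norm p)) => u w.
  apply: (le_trans (l2norm_lip _ _)).
  rewrite (_ : _ - _ = (l2norm u - l2norm w) *: p - l2norm p *: (u - w)); last first.
    by apply/rowP => i; rewrite !mxE; ring.
  apply: (le_trans (l2normD _ _)); rewrite l2normN !l2normZ (ger0_norm (l2norm_ge0 p)).
  by rewrite mulrDl lerD2r mulrC ler_wpM2l ?l2norm_ge0// l2norm_lip.
apply/seteqP; split => u /=; first by move=> ->; rewrite subrr l2norm0.
move=> h; apply/eqP; rewrite -subr_eq0; apply/eqP/l2norm_eq0/eqP.
by rewrite eq_le l2norm_ge0 andbT.
Qed.

Lemma ray_neq0 h : ray (pcone h) !=set0.
Proof. by have /(coneP _ Dp)[u Du e] := pcone_in h; exists u. Qed.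

(** The least norm of an element of [D] on the ray of the projection exceeds [t0]; as long as [t] is
    below it, [h] stays outside of [lo_set t]. *)
Lemma lo_set_stable t0 h : ~ lo_set t0 h ->
  exists2 r, 0 < r & forall t, `|t - t0| < r -> ~ lo_set t h.
Proof.
move=> nlo; have cn : continuous (fun u : V => - l2norm u : R).
  apply: (@lip_continuous _ _ 1) => u w; rewrite mul1r opprK addrC l2normB.
  exact: l2norm_lip.
have [u [Du eu] um] := compact_max_attained (@ray_compact (pcone h)) (ray_neq0 h) cn.
have lop t x : lo_part t x -> 0 < l2norm x by move=> [/Dp].
have ut : t0 < l2norm u.
  rewrite ltNge; apply/negP => ut; apply: nlo.
  by apply/(coneP _ (lop t0)); exists u.
exists (l2norm u - t0); first by rewrite subr_gt0.
move=> t tt0 /(coneP _ (lop t))[w [Dw wt] ew].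
have := um w (conj Dw ew); rewrite lerN2 => h1.
have := le_trans h1 wt; move: (le_lt_trans (ler_norm _) tt0); rewrite ltrD2r ltNge.
by move=> /negP.
Qed.

Lemma hi_set_stable t0 h : ~ hi_set t0 h ->
  exists2 r, 0 < r & forall t, `|t - t0| < r -> ~ hi_set t h.
Proof.
move=> nhi.
have [u [Du eu] um] := compact_max_attained (@ray_compact (pcone h)) (ray_neq0 h)
  (@l2norm_continuous R d).
have hip t x : hi_part t x -> 0 < l2norm x by move=> [/Dp].
have ut : l2norm u < t0.
  rewrite ltNge; apply/negP => ut; apply: nhi.
  by apply/(coneP _ (hip t0)); exists u.
exists (t0 - l2norm u); first by rewrite subr_gt0.
move=> t; rewrite distrC => tt0 /(coneP _ (hip t))[w [Dw wt] ew].
have h1 := um w (conj Dw ew).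
have := le_trans wt h1; move: (le_lt_trans (ler_norm _) tt0); rewrite ltrD2l ltrN2 ltNge.
by move=> /negP.
Qed.

Lemma slice_defect_lsc h t0 (e : R) : alpha <= t0 <= beta -> 0 < e ->
  exists2 r, 0 < r & forall t, alpha <= t <= beta -> `|t - t0| < r ->
    slice_defect t0 h <= slice_defect t h + e.
Proof.
move=> tab e0; set w := slice_pos t0 h.
have w0 : 0 <= w by exact: slice_pos_ge0.
pose e' := Num.min 1 (e / (2 * w + 1)).
have w1 : 0 < 2 * w + 1 by rewrite ltr_wpDl// mulr_ge0.
have e'0 : 0 < e' by rewrite lt_min ltr01 divr_gt0.
have e'1 : e' <= 1 by rewrite ge_min lexx.
have e'w : e' * (2 * w + 1) <= e by rewrite -ler_pdivlMr// ge_min lexx orbT.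
have [r r0 hr] := slice_pos_usc h tab e'0.
exists r => // t tab' tt0; have := hr t tab' tt0; rewrite -/w.
have := slice_pos_ge0 t h; rewrite /slice_defect -/w; move: (slice_pos t h) => z z0 zw.
have : z ^+ 2 <= (w + e') ^+ 2 by rewrite ler_sqr ?nnegrE ?addr_ge0// ltW.
have : e' * e' <= e' by rewrite ler_piMl// ltW.
rewrite sqrrD; move: (l2norm _ ^+ 2) e' e'w {e'0 e'1 hr zw} => q x h1; lra.
Qed.

(** If the defect at [t0] is positive, [h] is outside of one of the two sets at [t0], hence also at
    nearby parameters. The roots at [t] and [s] then have the same sign, so their convex combination
    does not cancel. *)
Lemma signed_slice_stable h t0 (e : R) : alpha <= t0 <= beta -> 0 < e ->
  exists2 r, 0 < r & forall t s (l : R), alpha <= t <= beta -> alpha <= s <= beta ->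
    `|t - t0| < r -> `|s - t0| < r -> 0 <= l <= 1 ->
    slice_defect t0 h <= (l * signed_slice t h + (1 - l) * signed_slice s h) ^+ 2 + e.
Proof.
move=> tab e0; have [N0|Np] := leP (slice_defect t0 h) 0.
  by exists 1 => // *; apply: (le_trans N0); rewrite addr_ge0 ?sqr_ge0// ltW.
have [r r0 hr] := slice_defect_lsc h tab e0.
have comb (a b l n : R) : 0 <= a -> 0 <= b -> n <= a + e -> n <= b + e -> 0 <= l <= 1 ->
    n <= (l * Num.sqrt a + (1 - l) * Num.sqrt b) ^+ 2 + e.
  move=> a0 b0 na nb /andP[l0 l1].
  have [ne|en] := leP (n - e) 0; first by have := sqr_ge0 (l * Num.sqrt a + (1 - l) * Num.sqrt b); lra.
  rewrite -lerBlDr -[n - e]sqr_sqrtr ?(ltW en)//.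
  have h1 : Num.sqrt (n - e) <= Num.sqrt a by apply: ler_wsqrtr; lra.
  have h2 : Num.sqrt (n - e) <= Num.sqrt b by apply: ler_wsqrtr; lra.
  have l1' : 0 <= 1 - l by rewrite subr_ge0.
  have h3 := ler_wpM2l l0 h1; have h4 := ler_wpM2l l1' h2.
  rewrite ler_sqr ?nnegrE ?sqrtr_ge0//; first by lra.
  by rewrite addr_ge0// mulr_ge0// sqrtr_ge0.
have [hi|nhi] := pselect (hi_set t0 h); last first.
  have [r' r'0 hr'] := hi_set_stable nhi.
  exists (Num.min r r'); first by rewrite lt_min r0.
  move=> t s l ta sa; rewrite !lt_min => /andP[t1 t2] /andP[s1 s2] l01.
  have lo q : alpha <= q <= beta -> `|q - t0| < r' ->
      signed_slice q h = - Num.sqrt (slice_defect q h).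
    move=> qa q2; apply: signed_slice_lo => //.
    by have [/(hr' _ q2)|] := hi_lo_cover q h.
  rewrite (lo t ta t2) (lo s sa s2) !mulrN -opprD sqrrN.
  by apply: comb => //; [exact: slice_defect_ge0|exact: slice_defect_ge0|exact: hr|exact: hr].
have nlo : ~ lo_set t0 h.
  by move=> lo; move: Np; rewrite (slice_defect_eq0 tab hi lo) ltxx.
have [r' r'0 hr'] := lo_set_stable nlo.
exists (Num.min r r'); first by rewrite lt_min r0.
move=> t s l ta sa; rewrite !lt_min => /andP[t1 t2] /andP[s1 s2] l01.
have up q : `|q - t0| < r' -> signed_slice q h = Num.sqrt (slice_defect q h).
  move=> q2; apply: signed_slice_hi.
  by have [|/(hr' _ q2)] := hi_lo_cover q h.
rewrite (up t t2) (up s s2).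
by apply: comb => //; [exact: slice_defect_ge0|exact: slice_defect_ge0|exact: hr|exact: hr].
Qed.

Lemma gro_slice_defect t : alpha <= t <= beta -> gro 2 (slice_defect t).
Proof.
move=> tab; apply: groB; last by apply: (@groX _ _ 1 2); exact: lip_gro (slice_pos_lip tab).
apply: (@groX _ _ 1 2); apply: (@lip_gro _ _ 1) => g h; rewrite mul1r.
by rewrite (le_trans (l2norm_lip _ _))// pcone_nonexpansive.
Qed.

(* The signed root of the defect has nonnegative mean at alpha and nonpositive
   mean at beta; at a change of sign, convex combinations with mean zero have
   variance at most 1. *)
Lemma slice_balance : exists2 t, alpha <= t <= beta & Ex (slice_defect t) <= 1.
Proof.
have aab : alpha <= alpha <= beta by rewrite lexx alpha_le_beta.
have bab : alpha <= beta <= beta by rewrite lexx alpha_le_beta.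
have ea : 0 <= Ex (signed_slice alpha).
  apply: Ex_ge0 => h; rewrite signed_slice_hi ?sqrtr_ge0//.
  have [u Du [s s0 e]] := pcone_in h; exists u; last by exists s.
  by split => //=; case/andP: (Dab Du).
have eb : Ex (signed_slice beta) <= 0.
  rewrite -(@Ex_cst R d 0); apply: le_Ex; last 1 first.
  - move=> h; rewrite signed_slice_lo ?oppr_le0 ?sqrtr_ge0//.
    have [u Du [s s0 e]] := pcone_in h; exists u; last by exists s.
    by split => //=; case/andP: (Dab Du).
  - exact: groW (lip_gro (signed_slice_lip bab)).
  - exact: gro_cst.
(* Only semicontinuity in [t] is at hand, so [t0] is a parameter with both signs arbitrarily near
   rather than a zero of the mean. *)
have [t0 tab0 H] := @sign_change R (fun t => Ex (signed_slice t)) _ _ alpha_le_beta ea eb.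
exists t0 => //.
have kp (k : nat) : 0 < (k.+1)%:R^-1 :> R by rewrite invr_gt0.
have step (k : nat) : exists F : V -> R, [/\ lip 1 F, Ex F = 0 & exists t s (l : R),
    [/\ alpha <= t <= beta, alpha <= s <= beta, `|t - t0| < k.+1%:R^-1, `|s - t0| < k.+1%:R^-1 &
     0 <= l <= 1 /\ F = fun h => l * signed_slice t h + (1 - l) * signed_slice s h]].
  have [[t ta [t1 et]] [s sa [s1 es]]] := H _ (kp k).
  have [l l01 el] : exists2 l : R, 0 <= l <= 1 &
      l * Ex (signed_slice t) + (1 - l) * Ex (signed_slice s) = 0.
    move: (Ex (signed_slice t)) (Ex (signed_slice s)) et es => a b a0 b0.
    have [a1|an] := eqVneq a 0; first by exists 1; rewrite ?ler01 ?lexx// a1 mulr0 subrr mul0r addr0.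
    have ap : 0 < a by rewrite lt_neqAle eq_sym an.
    have ab : 0 < a - b by rewrite subr_gt0 (le_lt_trans b0).
    exists (- b / (a - b)); last by field; rewrite gt_eqF.
    rewrite divr_ge0 ?oppr_ge0 ?(ltW ab)//= ler_pdivrMr// mul1r; lra.
  have lt_ := signed_slice_lip ta; have ls_ := signed_slice_lip sa.
  have [l0 l1] := andP l01; have l1' : 0 <= 1 - l by rewrite subr_ge0.
  have gt_ : gro 4 (signed_slice t) by exact: groW (lip_gro lt_).
  have gs_ : gro 4 (signed_slice s) by exact: groW (lip_gro ls_).
  exists (fun h => l * signed_slice t h + (1 - l) * signed_slice s h); split.
  - move=> g h; have h1 := lt_ g h; have h2 := ls_ g h; rewrite !mul1r in h1 h2 *.
    rewrite (_ : _ - _ = l * (signed_slice t g - signed_slice t h) +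
       (1 - l) * (signed_slice s g - signed_slice s h)); last by ring.
    apply: (le_trans (ler_normD _ _)); rewrite !normrM (ger0_norm l0) (ger0_norm l1').
    apply: (le_trans (lerD (ler_wpM2l l0 h1) (ler_wpM2l l1' h2))).
    by rewrite -mulrDl addrC subrK mul1r.
  - by rewrite ExD; [rewrite !ExZ|exact: groZ|exact: groZ].
  - by exists t, s, l.
have /choice[F HF] := step.
have gF k : gro 1 (F k) by case: (HF k) => + _ _; exact: lip_gro.
apply: (@fatou_Ex _ _ (fun k h => F k h ^+ 2)).
- by move=> k; apply: (@groW _ _ 2) => //; exact: (groX 2 (gF k)).
- by move=> k h; exact: sqr_ge0.
- by apply: (@groW _ _ 2) => //; exact: gro_slice_defect.
- exact: slice_defect_ge0.
- move=> h e e0; have [r r0 hr] := signed_slice_stable h tab0 e0.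
  exists (Num.truncn (r^-1)) => k kN.
  have kr : k.+1%:R^-1 <= r.
    rewrite -[r]invrK lef_pV2 ?posrE ?invr_gt0//.
    by apply: (le_trans (ltW (truncnS_gt _))); rewrite ler_nat.
  have [_ _ [t [s [l [ta sa t1 s1 [l01 ->]]]]]] := HF k.
  by apply: hr => //; [exact: lt_le_trans t1 kr|exact: lt_le_trans s1 kr].
- by move=> k; have [l1 z _] := HF k; exact: lip_sqr_le.
Qed.

Hypothesis d0 : (0 < d)%N.

Lemma slice_sup_variance t : alpha <= t <= beta -> 0 <= Ex (slice_sup t) /\
  Ex (fun h => slice_sup t h ^+ 2) <=
    Ex (slice_sup t) ^+ 2 + 1 - Ex (slice_sup t) ^+ 2 / (2 * d%:R).
Proof.
move=> tab; apply: width_variance => //; first exact: slice_sup_lip.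
move=> h; have [[y Ky yh] _] := slice_supP tab h.
by exists y; [case: Ky|split => // g; exact: (slice_supP tab g).2].
Qed.

Lemma polar_sup_variance : 0 <= Ex X /\
  Ex (fun h => X h ^+ 2) <= Ex X ^+ 2 + 1 - Ex X ^+ 2 / (2 * d%:R).
Proof.
apply: width_variance => //; first exact: (polar_sup_lip cD vD D0 D_origin).
move=> h; have [[z [pz z1] zh] _] := polar_supP cD vD D0 D_origin h.
by exists z => //; split => // g; exact: (polar_supP cD vD D0 D_origin g).2.
Qed.

Let gX : gro 1 X. Proof. exact: lip_gro (polar_sup_lip cD vD D0 D_origin). Qed.
Let gXp : gro 1 Xp. Proof. exact: lip_gro (polar_sup_pos_lip cD vD D0 D_origin). Qed.
Let gXp2 : gro 4 (fun h => Xp h ^+ 2).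
Proof. by apply: (@groW _ _ 2) => //; exact: (groX 2 gXp). Qed.
Let gn2 : gro 4 (fun h : V => l2norm h ^+ 2 : R).
Proof. by apply: (@groW _ _ 2) => //; exact: (groX 2 (@gro_l2norm R d)). Qed.

(** Take means in [|h|^2 <= Xp^2 + |pcone h|^2]. The balanced slice contributes 1 and each of the
    two variances at most 1, whence the 3; the factor is the Hermite gain in the variances. *)
Lemma slice_lower_bound : exists2 t, alpha <= t <= beta &
  0 <= Ex (slice_sup t) /\
  d%:R <= (Ex X ^+ 2 + Ex (slice_sup t) ^+ 2) * (1 - 1 / (2 * d%:R)) + 3.
Proof.
have [t tab Nt] := slice_balance; exists t => //.
have [W0 VW] := slice_sup_variance tab; split => //.
have [_ VX] := polar_sup_variance.
have gWp : gro 1 (slice_pos t) by exact: lip_gro (slice_pos_lip tab).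
have gWp2 : gro 4 (fun h => slice_pos t h ^+ 2) by apply: (@groW _ _ 2) => //; exact: (groX 2 gWp).
have gW2 : gro 4 (fun h => slice_sup t h ^+ 2).
  by apply: (@groW _ _ 2) => //; exact: (groX 2 (lip_gro (slice_sup_lip tab))).
have gN : gro 4 (slice_defect t) by apply: (@groW _ _ 2) => //; exact: gro_slice_defect.
have E1 : d%:R <= Ex (fun h => Xp h ^+ 2) + (Ex (slice_defect t) + Ex (fun h => slice_pos t h ^+ 2)).
  rewrite -Ex_sqr_l2norm -!ExD//; last exact: groD.
  apply: le_Ex => //; first by apply: groD => //; exact: groD.
  by move=> h; have := sqr_norm_le h; rewrite /slice_defect subrK.
have E2 : Ex (fun h => slice_pos t h ^+ 2) <= Ex (fun h => slice_sup t h ^+ 2).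
  apply: le_Ex => // h; rewrite /slice_pos; case: (leP 0 (slice_sup t h)) => // _.
  by rewrite expr0n sqr_ge0.
have E3 := Ex_polar_sup_pos_sqr cD vD D0 D_origin.
have -> : (Ex X ^+ 2 + Ex (slice_sup t) ^+ 2) * (1 - 1 / (2 * d%:R)) =
  Ex X ^+ 2 - Ex X ^+ 2 / (2 * d%:R) + (Ex (slice_sup t) ^+ 2 - Ex (slice_sup t) ^+ 2 / (2 * d%:R)).
  by ring.
move: Nt VW VX E1 E2 E3.
move: (Ex X ^+ 2) (Ex (slice_sup t) ^+ 2) (Ex X ^+ 2 / _) (Ex (slice_sup t) ^+ 2 / _)
 (Ex (fun h => X h ^+ 2)) (Ex (fun h => Xp h ^+ 2)) (Ex (fun h => slice_pos t h ^+ 2))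
 (Ex (fun h => slice_sup t h ^+ 2)) (Ex (slice_defect t)) => *; lra.
Qed.

(** The supremum over the polar is at most [|h - pcone h|] and the one over the slice at most
    [|pcone h|]; the squares of these norms add up to [|h|^2]. *)
Lemma polar_slice_sqr_le t : alpha <= t <= beta -> 
  Ex X ^+ 2 + Ex (slice_sup t) ^+ 2 <= d%:R.
Proof.
move=> tab; have gWp : gro 1 (slice_pos t) by exact: lip_gro (slice_pos_lip tab).
have gWp2 : gro 4 (fun h => slice_pos t h ^+ 2) by apply: (@groW _ _ 2) => //; exact: (groX 2 gWp).
have [W0 _] := slice_sup_variance tab; have [X0 _] := polar_sup_variance.
have h1 : Ex X ^+ 2 <= Ex (fun h => Xp h ^+ 2).
  apply: le_trans (Ex_sqr_le gXp); rewrite ler_sqr ?nnegrE//.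
    by apply: le_Ex; [exact: groW gX|exact: groW gXp|exact: polar_sup_le_pos].
  by apply: Ex_ge0 => h; exact: polar_sup_pos_ge0.
have h2 : Ex (slice_sup t) ^+ 2 <= Ex (fun h => slice_pos t h ^+ 2).
  apply: le_trans (Ex_sqr_le gWp); rewrite ler_sqr ?nnegrE//.
    apply: le_Ex; [exact: groW (lip_gro (slice_sup_lip tab))|exact: groW gWp|exact: slice_sup_le_pos].
  by apply: Ex_ge0 => h; exact: slice_pos_ge0.
apply: (le_trans (lerD h1 h2)); rewrite -ExD// -Ex_sqr_l2norm.
apply: le_Ex => //; first exact: groD.
move=> h; rewrite sqr_norm_split; apply: lerD; rewrite ler_sqr ?nnegrE ?l2norm_ge0 ?polar_sup_pos_ge0 ?slice_pos_ge0//.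
  rewrite /polar_sup_pos ge_max l2norm_ge0/=.
  have [[z [pz z1] <-] _] := polar_supP cD vD D0 D_origin h.
  have := cauchy_schwarz z (h - pcone h); rewrite z1 mul1r dotvBr.
  by have := polar_cone pz (pcone_in h); move: (dotv z _) (dotv z _) (l2norm _) => *; lra.
exact: slice_pos_le.
Qed.

End slices.

(** * Widths and distances of the statement as real expectations *)

Section links.
Context {R : realType} {d : nat}.
Local Notation RR := (measurableTypeR R).
Local Notation V := 'rV[R]_d.
Local Notation G := (@std_gaussian R d).
Local Notation vec := (@vec_of_tuple R d).
Implicit Types (D K : set V) (g h u y : V).

Lemma gaussian_width_sup K : compact K -> K !=set0 -> K `<=` l2sphere ->
  gaussian_width K = (Ex (sup_dot K))%:E.
Proof.
move=> cK K0 KS; rewrite /gaussian_width -Ex_EFin; last first.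
  by apply: groW (lip_gro (sup_dot_lip cK K0 KS)).
by apply: eq_integral => w _; exact: ereal_sup_dot.
Qed.

Lemma dist_to_attained h K y : K y -> (forall z, K z -> l2norm (h - y) <= l2norm (h - z)) ->
  dist_to h K = (l2norm (h - y))%:E.
Proof.
move=> Ky ym; apply/eqP; rewrite eq_le; apply/andP; split.
  by apply: ereal_inf_lbound; exists y.
by apply: le_ereal_inf_tmp => _ [z Kz <-]; rewrite lee_fin; exact: ym.
Qed.

Lemma dist_to_scale_set D c g : closed D -> cvx D -> D !=set0 -> 0 < c ->
  dist_to g (scale_set c D) = (sdist D c g)%:E.
Proof.
move=> cD vD D0 c0; apply: dist_to_attained.
  by have [u Du ->] := sproj_in cD vD D0 c g; exists u.
by move=> _ [u Du <-]; exact: (sdist_min cD vD D0 c0).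
Qed.

Lemma gaussian_dist_scale_set D c : closed D -> cvx D -> D !=set0 -> 0 < c ->
  gaussian_dist (scale_set c D) = (Ex (sdist D c))%:E.
Proof.
move=> cD vD D0 c0; rewrite /gaussian_dist -Ex_EFin; last first.
  exact: groW (gro_sdist cD vD D0 c0).
by apply: eq_integral => w _; exact: dist_to_scale_set.
Qed.

Lemma scale_set_sphere D t : 0 < t -> scale_set t^-1 D `&` l2sphere = slice D t.
Proof.
move=> t0; apply/seteqP; split => y.
  by move=> [[u Du <-] n1]; split => //; rewrite scalerA divff ?gt_eqF// scale1r.
move=> [n1 Dy]; split => //; exists (t *: y) => //.
by rewrite scalerA mulVf ?gt_eqF// scale1r.
Qed.

(** On unit vectors the squared distance to [h] is affine in [dotv z h], so the nearest point is the
    maximizer of the support function. *)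
Lemma gaussian_sqdist_sup K : compact K -> K !=set0 -> K `<=` l2sphere ->
  gaussian_sqdist K = (d%:R + 1 - 2 * Ex (sup_dot K))%:E.
Proof.
move=> cK K0 KS.
have gs : gro 4 (sup_dot K) by apply: groW (lip_gro (sup_dot_lip cK K0 KS)).
have gn : gro 4 (fun h : V => l2norm h ^+ 2 : R).
  by apply: (@groW _ _ 2) => //; exact: (groX 2 (@gro_l2norm R d)).
have E : Ex (fun h => l2norm h ^+ 2 + 1 - 2 * sup_dot K h) = d%:R + 1 - 2 * Ex (sup_dot K).
  rewrite ExB; [|by apply: groD => //; exact: gro_cst|exact: groZ].
  rewrite ExD//; last exact: gro_cst.
  by rewrite ExZ// Ex_cst Ex_sqr_l2norm.
rewrite -E /gaussian_sqdist -Ex_EFin; last first.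
  by apply: groB; [apply: groD => //; exact: gro_cst|exact: groZ].
apply: eq_integral => w _; set h := vec w.
have [[y Ky yh] ym] := sup_dotP h cK K0.
have ny z : K z -> l2norm (h - z) ^+ 2 = l2norm h ^+ 2 + 1 - 2 * dotv z h.
  by move=> /KS z1; rewrite sqr_l2normB z1 dotvC expr1n mulr2n; ring.
rewrite (@dist_to_attained h K y) => //; first by rewrite -EFin_expe ny// yh.
move=> z Kz; rewrite -ler_sqr ?nnegrE ?l2norm_ge0// !ny//.
by have := ym z Kz; rewrite yh; move: (dotv z h) (sup_dot K h) => *; lra.
Qed.

End links.

(** * Existence of an optimal tradeoff parameter *)

Section real_extrema.
Context {R : realType}.
Implicit Types (a b e r s t : R).

(** [f] need not be continuous. [E e] collects the [e]-maximizers; its supremum decreases with [e],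
    and the infimum [t0] of these suprema has [e]-maximizers arbitrarily near for every [e]. *)
Lemma near_sup (f : R -> R) a b (M : R) : a <= b -> (forall s, a <= s <= b -> f s <= M) ->
  exists2 t0, a <= t0 <= b & forall r e, 0 < r -> 0 < e ->
    exists2 t, a <= t <= b & `|t - t0| < r /\ forall s, a <= s <= b -> f s <= f t + e.
Proof.
move=> ab fM; pose E e := [set t | a <= t <= b /\ forall s, a <= s <= b -> f s <= f t + e].
have aab : a <= a <= b by rewrite lexx.
have hv : has_sup [set f s | s in [set s | a <= s <= b]].
  split; first by exists (f a), a.
  by exists M => _ [s sab <-]; exact: fM.
have E0 e : 0 < e -> E e !=set0.
  move=> e0; have [_ [t tab <-] ft] := sup_adherent e0 hv.
  exists t; split => // s sab.
  have : f s <= sup [set f s | s in [set s | a <= s <= b]].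
    by apply: ub_le_sup; [case: hv|exists s].
  by move: ft; lra.
have Es e : 0 < e -> has_sup (E e).
  by move=> e0; split; [exact: E0|exists b => s [/andP[]]].
have mab e : 0 < e -> a <= sup (E e) <= b.
  move=> e0; have [t Et] := E0 e e0; apply/andP; split.
    apply: (@le_trans _ _ t); first by case: Et => /andP[].
    by apply: ub_le_sup => //; case: (Es e e0).
  by apply: ge_sup; [exists t|move=> s [/andP[]]].
pose T := [set sup (E e) | e in [set e | 0 < e]].
have hT : has_inf T.
  split; first by exists (sup (E 1)), 1 => //=.
  by exists a => _ [e e0 <-]; case/andP: (mab e e0).
pose t0 := inf T.
have t0a : a <= t0.
  by apply: lb_le_inf; [case: hT|move=> _ [e e0 <-]; case/andP: (mab e e0)].
have t0b : t0 <= b.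
  apply: (@le_trans _ _ (sup (E 1))); last by case/andP: (mab 1 ltr01).
  by apply: ge_inf; [case: hT|exists 1 => //=].
exists t0; first by rewrite t0a.
move=> r e r0 e0; have [_ [e' e'0 <-] lt1] := inf_adherent r0 hT.
pose c := Num.min e e'; have c0 : 0 < c by rewrite lt_min e0.
have mono : sup (E c) <= sup (E e').
  apply: ge_sup; first exact: E0.
  move=> t [tab tf]; apply: ub_le_sup; first by case: (Es e' e'0).
  split => // s sab.
  by apply: (le_trans (tf s sab)); rewrite lerD2l ge_min lexx orbT.
have t0c : t0 <= sup (E c) by apply: ge_inf; [case: hT|exists c].
have [t [tab tf] tt] := sup_adherent r0 (Es c c0).
exists t => //; split; last first.
  by move=> s sab; apply: (le_trans (tf s sab)); rewrite lerD2l ge_min lexx.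
have : t <= sup (E c) by apply: ub_le_sup; [case: (Es c c0)|split].
rewrite ltr_norml; move: lt1; rewrite -/t0 => lt1 h; apply/andP; split; lra.
Qed.

Lemma lip_min_attained (F : R -> R) a b (L : R) : a <= b -> 0 <= L ->
  (forall s t, a <= s <= b -> a <= t <= b -> `|F s - F t| <= L * `|s - t|) ->
  exists2 c, a <= c <= b & forall s, a <= s <= b -> F c <= F s.
Proof.
move=> ab L0 FL; pose k s := Num.min b (Num.max a s).
have kab s : a <= k s <= b by rewrite /k le_min ab le_max lexx ge_min lexx.
have klip s t : `|k s - k t| <= `|s - t|.
  have one p q : k p - k q <= `|p - q|.
    have := ler_norm (p - q); have := normr_ge0 (p - q).
    rewrite /k; move: `|_| ab => w; clear => ab w0 xy.
    by case: (leP a p) => ?; case: (leP a q) => ?; case: (leP b p) => ?;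
      case: (leP b q) => ?; case: (leP b a) => ?; lra.
  by rewrite ler_norml one andbT lerNl opprB distrC one.
have kid s : a <= s <= b -> k s = s.
  by move=> /andP[as_ sb]; rewrite /k (max_idPr as_); apply/min_idPr.
have cF : continuous (F \o k).
  apply: unif_continuousR => e e0; have L1 : 0 < L + 1 by rewrite ltr_wpDl.
  exists (e / (L + 1)); first exact: divr_gt0.
  move=> s t; rewrite ltr_pdivlMr// => st; apply: (le_trans (FL _ _ (kab s) (kab t))).
  apply: le_trans (ltW st); rewrite mulrC; apply: ler_pM => //.
  by rewrite lerDl.
have [c + cm] := EVT_min ab (continuous_subspaceT cF).
rewrite in_itv/= => cab; exists c => // s sab.
by have := cm s; rewrite in_itv/= sab => /(_ isT); rewrite !kid.
Qed.

End real_extrema.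

Section small_scale.
Context {R : realType} {d : nat}.
Local Notation RR := (measurableTypeR R).
Local Notation V := 'rV[R]_d.
Local Notation N01 := (normal_prob (0 : R) 1).
Implicit Types (g h u v w x y : V).

Lemma measurable_indic0 : measurable_fun setT (fun t : RR => (\1_[set 0] t : R)%:E).
Proof. by apply/measurable_EFinP; apply: measurable_indic; exact: measurable_set1. Qed.

Lemma normal_indic0 : (\int[N01]_t (\1_([set 0] : set RR) t : R)%:E = 0)%E.
Proof.
have /null_content_dominatesP h := @normal_prob_dominates R 0 1.
have e := @integral_indic _ RR R N01 setT measurableT [set 0] (measurable_set1 0).
by rewrite e setIT; exact: (h [set 0] (measurable_set1 0) (lebesgue_measure_set1 0)).
Qed.

Lemma gro_indic_dotv w : gro 0 (fun x : V => \1_([set 0] : set R) (dotv w x) : R).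
Proof.
split.
  have [m _] := @gro_dotv R d w.
  have mi : measurable_fun setT (\1_([set 0] : set RR) : RR -> RR).
    by apply: measurable_indic; exact: measurable_set1.
  exact: (measurableT_comp mi m).
exists 1 => // x; rewrite expr0 mulr1 indicE.
by case: (_ \in _); rewrite ?normr1// normr0.
Qed.

Lemma Ex_indic_dotv w : w != 0 -> Ex (fun x : V => \1_([set 0] : set R) (dotv w x) : R) = 0.
Proof.
move=> w0; have nw := l2norm_gt0 w0.
have p0 (t : RR) : (0 <= (\1_([set 0] : set R) t : R)%:E)%E by rewrite lee_fin indicE.
have g4 := groW (isT : (0 <= 4)%N) (gro_indic_dotv w).
apply: EFin_inj; rewrite -Ex_EFin//.
rewrite (integral_gauss_dotv w measurable_indic0 p0) -[RHS]normal_indic0.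
apply: eq_integral => t _; congr (_%:E); rewrite !indicE; congr (_%:R); congr nat_of_bool.
apply/idP/idP; rewrite !inE /=; last by move=> ->; rewrite mulr0.
by move/eqP; rewrite mulf_eq0 gt_eqF//= => /eqP.
Qed.

(** This is [2 |x| |x + y| <= |x + y|^2 + |x|^2], which gives a second-order expansion of the norm
    from above. *)
Lemma l2norm_amgm x y : x != 0 -> l2norm (x + y) <= l2norm x + dotv x y / l2norm x +
  l2norm y ^+ 2 / (2 * l2norm x).
Proof.
move=> /l2norm_gt0 nx; have e := sqr_l2normD x y.
have := sqr_ge0 (l2norm (x + y) - l2norm x).
have -> : l2norm x + dotv x y / l2norm x + l2norm y ^+ 2 / (2 * l2norm x) =
   (l2norm (x + y) ^+ 2 + l2norm x ^+ 2) / (2 * l2norm x).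
  by rewrite e mulr2n; field; rewrite gt_eqF.
rewrite ler_pdivlMr ?mulr_gt0// sqrrB mulr2n; move: (l2norm (x + y)) (l2norm x) => a b; lra.
Qed.

Variable D : set V.
Hypotheses (cD : closed D) (vD : cvx D) (D_origin : ~ D 0).
Variables (u v : V).
Hypotheses (Du : D u) (Dv : D v) (uv : u != v).

Let D0 : D !=set0. Proof. by exists u. Qed.
Local Notation J := (sdist D).

(** The point [u] serves one of [x] and [- x], and [v] the other, in the order for which
    [<u - v, x>] lowers the sum. *)
Lemma sdist_symmetrized c x : 0 < c -> x != 0 ->
  J c x + J c (- x) <= 2 * l2norm x - c * (`|dotv (u - v) x| / l2norm x) +
    c ^+ 2 * ((l2norm u ^+ 2 + l2norm v ^+ 2) / (2 * l2norm x)).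
Proof.
move=> c0 x0; have nx := l2norm_gt0 x0.
have b p : D p -> J c x <= l2norm x - c * (dotv p x / l2norm x) + c ^+ 2 * (l2norm p ^+ 2 / (2 * l2norm x)).
  move=> Dp; apply: (le_trans (sdist_min cD vD D0 c0 x Dp)).
  apply: (le_trans (l2norm_amgm _ x0)); rewrite le_eqVlt; apply/orP; left; apply/eqP.
  by rewrite dotvNr dotvZr l2normN l2normZ exprMn real_normK ?num_real// (dotvC x p); field; rewrite gt_eqF.
have b' p : D p -> J c (- x) <= l2norm x + c * (dotv p x / l2norm x) + c ^+ 2 * (l2norm p ^+ 2 / (2 * l2norm x)).
  move=> Dp; apply: (le_trans (sdist_min cD vD D0 c0 (- x) Dp)).
  rewrite -opprD l2normN.
  apply: (le_trans (l2norm_amgm _ x0)); rewrite le_eqVlt; apply/orP; left; apply/eqP.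
  by rewrite dotvZr l2normZ exprMn real_normK ?num_real// (dotvC x p); field; rewrite gt_eqF.
rewrite dotvBl (mulrDl (l2norm u ^+ 2)) mulrDr.
have := b u Du; have := b v Dv; have := b' u Du; have := b' v Dv.
have -> (a : R) : c * (`|a| / l2norm x) = `|c * (a / l2norm x)|.
  by rewrite normrM normrM normfV (gtr0_norm c0) (gtr0_norm nx).
rewrite mulrBl mulrBr.
move: (l2norm x) (J c (- x)) (J c x) (c * (dotv v x / _)) (c * (dotv u x / _))
  (c ^+ 2 * (l2norm v ^+ 2 / _)) (c ^+ 2 * (l2norm u ^+ 2 / _)).
move=> n j' j t s p q h1 h2 h3 h4.
have [st|st] := leP 0 (s - t); [rewrite (ger0_norm st)|rewrite (ltr0_norm st)]; lra.
Qed.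

(** To first order in [c] the sum of the distances at [x] and [- x] drops by at least
    [c |<w, x>| / |x|], with [w = u - v]. Fatou is applied to the difference quotients [G_], made
    nonnegative by adding [M]; if no [c] worked, their means would be at most [M], against [EF]. *)
Lemma mean_sdist_lt : exists2 c, 0 < c & Ex (J c) < Ex (fun x : V => l2norm x).
Proof.
have gJ c : 0 < c -> gro 4 (J c) by move=> c0; exact: groW (gro_sdist cD vD D0 c0).
have gn : gro 4 (fun x : V => l2norm x : R) by exact: groW (@gro_l2norm R d).
apply: contrapT => no.
have FE c : 0 < c -> Ex (fun x : V => l2norm x) <= Ex (J c).
  by move=> c0; rewrite leNgt; apply/negP => h; apply: no; exists c.
pose w := u - v; have w0 : w != 0 by rewrite subr_eq0.
have nw := l2norm_gt0 w0.
pose M := l2norm u + l2norm v; have M0 : 0 <= M by rewrite addr_ge0 ?l2norm_ge0.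
pose G_ (k : nat) x := M - k.+1%:R * (J k.+1%:R^-1 x + J k.+1%:R^-1 (- x) - 2 * l2norm x).
have kp (k : nat) : 0 < k.+1%:R^-1 :> R by rewrite invr_gt0.
have gd : gro 1 (dotv w) := @gro_dotv R d w.
pose Q := Ex (fun x => dotv w x ^+ 2 * l2norm x ^+ 2).
have Q0 : 0 <= Q by apply: Ex_ge0 => x; rewrite mulr_ge0 ?sqr_ge0.
(* Large enough for the mean of the minorant [k] to be positive: up to the factor [1 / |w|] it is
   [(Q + 2) / rho^2]. *)
pose rho := (Q + 1) / l2norm w ^+ 2.
have w2 : 0 < l2norm w ^+ 2 by exact: exprn_gt0.
have rp : 0 < rho by rewrite divr_gt0// ltr_wpDl.
(* A polynomial minorant of [|<w, x>| / |x|]. By Cauchy-Schwarz the quotient is at least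
   [<w, x>^2 / (|w| |x|^2)], and [1 / |x|^2] lies above its tangent [2 / rho - |x|^2 / rho^2] in the
   variable [|x|^2]. *)
pose k x := (l2norm w)^-1 * (2 / rho * dotv w x ^+ 2 - 1 / rho ^+ 2 * (dotv w x ^+ 2 * l2norm x ^+ 2)).
have ga2 : gro 4 (fun x => dotv w x ^+ 2) by apply: (@groW _ _ 2) => //; exact: (groX 2 gd).
have gan : gro 4 (fun x => dotv w x ^+ 2 * l2norm x ^+ 2).
  by apply: (@groM _ _ 2 2); [exact: (groX 2 gd)|exact: (groX 2 (@gro_l2norm R d))].
have gk : gro 4 k by apply: groZ; apply: groB; exact: groZ.
have Ek : 0 < Ex k.
  rewrite /k ExZ; last by apply: groB; exact: groZ.
  rewrite mulr_gt0 ?invr_gt0// ExB; [|exact: groZ|exact: groZ].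
  rewrite !ExZ// Ex_dotv_sqr -/Q.
  have -> : l2norm w ^+ 2 = (Q + 1) / rho by rewrite /rho; field; rewrite !gt_eqF// ltr_wpDl.
  rewrite (_ : _ - _ = (Q + 2) / rho ^+ 2); last by field; rewrite gt_eqF.
  by rewrite divr_gt0 ?exprn_gt0// ltr_wpDl.
pose ind x : R := \1_([set 0] : set R) (dotv w x).
have gi : gro 4 ind by exact: groW (gro_indic_dotv w).
(* The indicator removes the null hyperplane [<w, x> = 0], which contains the origin; on it only
   nonnegativity of the quotients is used. *)
pose F x := Num.max 0 (M * (1 - ind x) + k x).
have gMk : gro 4 (fun x => M * (1 - ind x) + k x).
  by apply: groD => //; apply: groZ; apply: groB => //; exact: gro_cst.
have gF : gro 4 F by apply: gro_max => //; exact: gro_cst.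
have EF : M < Ex F.
  apply: (@lt_le_trans _ _ (Ex (fun x => M * (1 - ind x) + k x))).
    rewrite ExD//; last by apply: groZ; apply: groB => //; exact: gro_cst.
    rewrite ExZ; last by apply: groB => //; exact: gro_cst.
    rewrite ExB//; last exact: gro_cst.
    by rewrite Ex_cst Ex_indic_dotv// subr0 mulr1 ltrDl.
  by apply: le_Ex => // x; rewrite /F le_max lexx orbT.
have kx x : x != 0 -> k x <= `|dotv w x| / l2norm x.
  move=> /l2norm_gt0 nx; rewrite /k -[dotv w x ^+ 2]real_normK ?num_real//.
  have := cauchy_schwarz_abs w x; have := normr_ge0 (dotv w x).
  move: `|dotv w x| (l2norm w) (l2norm x) nw nx => a p n p0 n0 a0 apn.
  have h1 : 2 / rho - 1 / rho ^+ 2 * n ^+ 2 <= 1 / n ^+ 2.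
    rewrite -subr_ge0 (_ : _ - _ = (n ^-1 - n / rho) ^+ 2) ?sqr_ge0//.
    by field; rewrite !gt_eqF.
  have -> : p^-1 * (2 / rho * a ^+ 2 - 1 / rho ^+ 2 * (a ^+ 2 * n ^+ 2)) =
     (a ^+ 2 / p) * (2 / rho - 1 / rho ^+ 2 * n ^+ 2) by field; rewrite !gt_eqF.
  apply: (@le_trans _ _ (a ^+ 2 / p * (1 / n ^+ 2))).
    by apply: ler_wpM2l => //; rewrite divr_ge0 ?sqr_ge0// ltW.
  have -> : a ^+ 2 / p * (1 / n ^+ 2) = a / n * (a / (p * n)) by field; rewrite !gt_eqF.
  rewrite ler_piMr ?divr_ge0 ?(ltW n0)//.
  by rewrite ler_pdivrMr ?mulr_gt0// mul1r.
suff : Ex F <= M by rewrite leNgt EF.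
apply: (@fatou_Ex _ _ G_).
- move=> j; apply: groB; [exact: gro_cst|apply: groZ; apply: groB; last exact: groZ].
  by apply: groD; [exact: gJ|apply: gro_opp; exact: gJ].
- move=> j x; rewrite subr_ge0 -ler_pdivlMl//.
  have := sdist_min cD vD D0 (kp j) x Du; have := sdist_min cD vD D0 (kp j) (- x) Dv.
  move=> /le_trans/(_ (l2normD _ _)) h1 /le_trans/(_ (l2normD _ _)) h2.
  move: h1 h2; rewrite !l2normN !l2normZ (gtr0_norm (kp j)) /M mulrDr.
  by move: (l2norm x) (J _ x) (J _ (- x)) (_^-1 * l2norm u) (_^-1 * l2norm v) => *; lra.
- exact: gF.
- by move=> x; rewrite /F le_max lexx.
- move=> x e e0; have [a0|an] := eqVneq (dotv w x) 0.
    exists 0%N => j _; rewrite /F /ind indicE /k a0 mem_set//= subrr mulr0 !expr2 !mul0r !mulr0 subrr mulr0.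
    rewrite addr0 maxxx addr_ge0 ?(ltW e0)//.
    rewrite subr_ge0 -ler_pdivlMl//.
    have := sdist_min cD vD D0 (kp j) x Du; have := sdist_min cD vD D0 (kp j) (- x) Dv.
    move=> /le_trans/(_ (l2normD _ _)) h1 /le_trans/(_ (l2normD _ _)) h2.
    move: h1 h2; rewrite !l2normN !l2normZ (gtr0_norm (kp j)) /M mulrDr.
    by move: (l2norm x) (J _ x) (J _ (- x)) (_^-1 * l2norm u) (_^-1 * l2norm v) => *; lra.
  have x0 : x != 0 by apply/eqP => z; move: an; rewrite z dotv0 eqxx.
  have nx := l2norm_gt0 x0.
  set B := (l2norm u ^+ 2 + l2norm v ^+ 2) / (2 * l2norm x).
  have B0 : 0 <= B by rewrite divr_ge0 ?addr_ge0 ?sqr_ge0// mulr_ge0// ltW.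
  exists (Num.truncn (B / e)) => j jN.
  have jB : j.+1%:R^-1 * B <= e.
    rewrite mulrC ler_pdivrMr// -ler_pdivrMl// mulrC.
    by apply: (le_trans (ltW (truncnS_gt _))); rewrite ler_nat.
  have s := sdist_symmetrized (kp j) x0; rewrite -/w -/B in s.
  have nn : 0 <= `|dotv w x| / l2norm x by rewrite divr_ge0// ltW.
  have low : M + `|dotv w x| / l2norm x - e <= G_ j x.
    have j0 : 0 < j.+1%:R :> R by [].
    have h : j.+1%:R * (J j.+1%:R^-1 x + J j.+1%:R^-1 (- x) - 2 * l2norm x) <=
        - (`|dotv w x| / l2norm x) + j.+1%:R^-1 * B.
      rewrite -ler_pdivlMl// mulrDr mulrA -expr2 mulrN.
      by move: s; move: (l2norm x) (J _ x) (J _ (- x)) (_ ^+ 2 * B) (_^-1 * (`|_| / _)) => *; lra.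
    move: h jB; rewrite /G_.
    by move: (_^-1 * B) (`|_| / _) (_ * (_ - _)) => *; lra.
  rewrite /F ge_max; apply/andP; split.
    by move: low nn M0; move: (`|_| / _) (G_ j x) => *; lra.
  have i0 : ind x = 0.
    by rewrite /ind indicE memNset// => /eqP; rewrite (negbTE an).
  rewrite i0 subr0 mulr1; have := kx x x0; move: low.
  by move: (`|_| / _) (G_ j x) (k x) => *; lra.
move=> j; rewrite /G_ ExB; [|exact: gro_cst|]; last first.
  apply: groZ; apply: groB; last exact: groZ.
  by apply: groD; [exact: gJ|apply: gro_opp; exact: gJ].
rewrite Ex_cst ExZ; last first.
  apply: groB; last exact: groZ.
  by apply: groD; [exact: gJ|apply: gro_opp; exact: gJ].
rewrite ExB; [|by apply: groD; [exact: gJ|apply: gro_opp; exact: gJ]|exact: groZ].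
rewrite ExD; [|exact: gJ|by apply: gro_opp; exact: gJ].
rewrite ExZ// Ex_opp; last exact: gJ.
rewrite gerBl mulr_ge0//; have := FE _ (kp j).
by move: (Ex (J _)) (Ex _) => *; lra.
Qed.

End small_scale.

Section attainment.
Context {R : realType} {d : nat}.
Local Notation V := 'rV[R]_d.
Implicit Types (g h u v w x y : V).
Variable D : set V.
Hypotheses (cD : closed D) (vD : cvx D) (D_origin : ~ D 0).

Local Notation J := (sdist D).
Local Notation p0 := (cproj D 0).

(** Some scale [c1] is strictly better than the limit [Ex |x|] at scale 0. As [D] is bounded, scales
    below [lo] are too close to this limit to improve on [c1]; above [hi] the mean distance is at
    least [c |p0| - m], too large. The minimum over [[lo, hi]] is therefore global. *)
Lemma mean_sdist_attained u v (b : R) : D u -> D v -> u != v ->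
  (forall x, D x -> l2norm x <= b) ->
  exists2 c, 0 < c & forall s, 0 < s -> Ex (J c) <= Ex (J s).
Proof.
move=> Du Dv uv Db; have D0 : D !=set0 by exists u.
have gJ c : 0 < c -> gro 4 (J c) by move=> c0; exact: groW (gro_sdist cD vD D0 c0).
have gn : gro 4 (fun x : V => l2norm x : R) by exact: groW (@gro_l2norm R d).
have [c1 c10 F1] := mean_sdist_lt cD vD Du Dv uv.
set m := Ex (fun x : V => l2norm x) in F1.
have b0 : 0 <= b by apply: le_trans (Db _ Du); exact: l2norm_ge0.
have b1 : 0 < b + 1 by rewrite ltr_wpDl.
have dp := min_norm_gt0 cD vD D0 D_origin.
have nP c x : 0 < c -> l2norm (sproj D c x) <= c * b.
  move=> c0; have [w Dw ->] := sproj_in cD vD D0 c x.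
  by rewrite l2normZ (gtr0_norm c0) ler_pM2l//; exact: Db.
have low c : 0 < c -> m - c * b <= Ex (J c).
  move=> c0; have -> : m - c * b = Ex (fun x : V => l2norm x - c * b).
    rewrite -[in LHS](@Ex_cst R d (c * b)). symmetry.
    exact: (ExB gn (gro_cst 4 (c * b))).
  apply: le_Ex; [by apply: groB => //; exact: gro_cst|exact: gJ|] => x.
  have := l2normD (x - sproj D c x) (sproj D c x); rewrite subrK -/(J c x).
  by have := nP c x c0; move: (l2norm _) (l2norm x) (J c x) (c * b) => *; lra.
have high c : 0 < c -> c * l2norm p0 - m <= Ex (J c).
  move=> c0; have -> : c * l2norm p0 - m = Ex (fun x : V => c * l2norm p0 - l2norm x).
    rewrite -[in LHS](@Ex_cst R d (c * l2norm p0)); symmetry.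
    exact: (ExB (gro_cst 4 (c * l2norm p0)) gn).
  apply: le_Ex; [by apply: groB => //; exact: gro_cst|exact: gJ|] => x.
  have := l2normD (sproj D c x - x) x; rewrite subrK l2normB -/(J c x).
  have := sproj_norm_ge cD vD D0 x c0.
  by move: (l2norm (sproj D c x)) (l2norm x) (J c x) (c * l2norm p0) => *; lra.
pose lo := Num.min c1 ((m - Ex (J c1)) / (b + 1)).
pose hi := Num.max c1 ((Ex (J c1) + m) / l2norm p0).
have lo0 : 0 < lo by rewrite lt_min c10 divr_gt0// subr_gt0.
have lo1 : lo <= c1 by rewrite ge_min lexx.
have hi1 : c1 <= hi by rewrite le_max lexx.
have lohi : lo <= hi by exact: le_trans hi1.
have gs : gro 4 (fun x : V => scale_rate D lo * (1 + l2norm x)).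
  by apply: groZ; apply: groD => //; exact: gro_cst.
set L := Ex (fun x : V => scale_rate D lo * (1 + l2norm x)).
have L0 : 0 <= L.
  apply: Ex_ge0 => x; rewrite mulr_ge0 ?scale_rate_ge0//.
  by rewrite addr_ge0 ?l2norm_ge0.
have FL s t : lo <= s <= hi -> lo <= t <= hi -> `|Ex (J s) - Ex (J t)| <= L * `|s - t|.
  move=> /andP[ls _] /andP[lt_ _].
  have one c c' : lo <= c -> lo <= c' -> Ex (J c) - Ex (J c') <= L * `|c - c'|.
    move=> lc lc'; have c0 := lt_le_trans lo0 lc; have c0' := lt_le_trans lo0 lc'.
    rewrite -ExB; [|exact: gJ|exact: gJ]; rewrite mulrC -ExZ//.
    apply: le_Ex; [by apply: groB; exact: gJ|exact: groZ|] => x.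
    exact: le_trans (ler_norm _) (sdist_scale cD vD D0 x lo0 lc lc').
  by rewrite ler_norml one// andbT lerNl opprB distrC one.
have [c /andP[loc chi] cm] := lip_min_attained lohi L0 FL.
have cc1 : Ex (J c) <= Ex (J c1) by apply: cm; rewrite lo1.
exists c; first exact: lt_le_trans loc.
move=> s s0; have [sl|ls] := ltP s lo.
  apply: (le_trans cc1); apply: le_trans (low s s0).
  have h1 : s * b <= lo * (b + 1) by apply: ler_pM; rewrite ?(ltW s0) ?(ltW sl)// lerDl.
  have h2 : lo * (b + 1) <= m - Ex (J c1).
    by rewrite -ler_pdivlMr// ge_min lexx orbT.
  by rewrite lerBrDr -lerBrDl; exact: le_trans h1 h2.
have [sh|hs] := leP s hi; first by apply: cm; rewrite ls.
apply: (le_trans cc1); apply: le_trans (high s s0).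
rewrite lerBrDr -ler_pdivrMr//; apply: le_trans (ltW hs).
by rewrite le_max lexx orbT.
Qed.

Variables (alpha beta : R) (ua ub : V).
Hypotheses (Dua : D ua) (Dub : D ub) (uaE : l2norm ua = alpha) (ubE : l2norm ub = beta).
Hypothesis (Dab : forall u, D u -> alpha <= l2norm u <= beta).

(** Near-maximizers of the mean accumulate at [t0]. Pointwise upper semicontinuity and Fatou,
    applied to the nonnegative functions [|x| - slice_sup], show that the mean at [t0] is not
    smaller. *)
Lemma mean_slice_attained : exists2 t, alpha <= t <= beta &
  forall s, alpha <= s <= beta -> Ex (slice_sup D s) <= Ex (slice_sup D t).
Proof.
have ab := alpha_le_beta Dua Dab.
have gn : gro 4 (fun x : V => l2norm x : R) by exact: groW (@gro_l2norm R d).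
have gW t : alpha <= t <= beta -> gro 4 (slice_sup D t).
  by move=> tab; exact: groW (lip_gro (slice_sup_lip cD vD D_origin Dua Dub uaE ubE tab)).
have Wn t x : alpha <= t <= beta -> slice_sup D t x <= l2norm x.
  move=> tab; have [[y Ky <-] _] := slice_supP cD vD D_origin Dua Dub uaE ubE tab x.
  by apply: (le_trans (cauchy_schwarz _ _)); rewrite Ky.1 mul1r.
have bnd s : alpha <= s <= beta -> Ex (slice_sup D s) <= Ex (fun x : V => l2norm x).
  by move=> sab; apply: le_Ex => //; [exact: gW|move=> x; exact: Wn].
have [t0 tab0 H] := @near_sup R (fun t => Ex (slice_sup D t)) _ _ _ ab bnd.
exists t0 => // s sab; apply/ler_addgt0Pr => e e0.
have kp (k : nat) : 0 < (k.+1)%:R^-1 :> R by rewrite invr_gt0.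
have /choice[t tP] (k : nat) : exists t, [/\ alpha <= t <= beta, `|t - t0| < k.+1%:R^-1 &
    Ex (slice_sup D s) <= Ex (slice_sup D t) + e].
  by have [t tab [tt0 tm]] := H _ _ (kp k) e0; exists t; split => //; exact: tm.
have tab k : alpha <= t k <= beta by case: (tP k).
have h : Ex (fun x : V => l2norm x - slice_sup D t0 x) <=
    Ex (fun x : V => l2norm x) - Ex (slice_sup D s) + e.
  apply: (@fatou_Ex _ _ (fun k x => l2norm x - slice_sup D (t k) x)).
  - by move=> k; apply: groB => //; exact: gW.
  - by move=> k x; rewrite subr_ge0; exact: Wn.
  - by apply: groB => //; exact: gW.
  - by move=> x; rewrite subr_ge0; exact: Wn.
  - move=> x e' e'0.
    have [r r0 hr] := slice_sup_usc cD vD D_origin Dua Dub uaE ubE Dab x tab0 e'0.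
    exists (Num.truncn (r^-1)) => k kN.
    have kr : k.+1%:R^-1 <= r.
      rewrite -[r]invrK lef_pV2 ?posrE ?invr_gt0//.
      by apply: (le_trans (ltW (truncnS_gt _))); rewrite ler_nat.
    have [tk tt _] := tP k; have := hr _ tk (lt_le_trans tt kr).
    by move: (slice_sup D _ x) (slice_sup D t0 x) (l2norm x) => *; lra.
  - move=> k; rewrite ExB//; last exact: gW.
    have [_ _] := tP k; move: (Ex _) (Ex (slice_sup D (t k))) (Ex (slice_sup D s)) => *; lra.
rewrite ExB// in h; last exact: gW.
by move: h; move: (Ex (fun _ => _)) (Ex (slice_sup D t0)) (Ex (slice_sup D s)) => *; lra.
Qed.

End attainment.

(** * Numerical conclusions *)

Section final_bounds.
Context {R : realType}.
Implicit Types (w wg B F m : R).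

(** If [F > B + 5/2], then [F^2 >= B^2 + 25/4], whereas the hypotheses give [B^2 >= w^2 - 3] and
    [F^2 <= w^2 + 3]; and [25/4 > 6]. *)
Lemma gap_le w wg B F m : 0 <= B -> w ^+ 2 + wg ^+ 2 <= m -> 1 <= m ->
  m <= (wg ^+ 2 + B ^+ 2) * (1 - 1 / (2 * m)) + 3 -> F ^+ 2 <= w ^+ 2 + 2 + 1 ->
  F - B <= 5 / 2.
Proof.
move=> B0 wm m1 mB Fw; rewrite leNgt; apply/negP => lt1.
have i0 : 0 <= 1 / (2 * m) by rewrite divr_ge0// mulr_ge0//; lra.
have : 0 <= (wg ^+ 2 + B ^+ 2) * (1 / (2 * m)) by rewrite mulr_ge0// addr_ge0 ?sqr_ge0.
have : (B + 5 / 2) ^+ 2 <= F ^+ 2 by rewrite ler_sqr ?nnegrE; lra.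
by move: mB; rewrite mulrBr mulr1; move: (_ * (1 / _)) => q; lra.
Qed.

(** Otherwise [B < w - 0.337], so [w^2 - B^2] is at least [0.674 w - 0.337^2]. Since
    [m (1 - i) = m - 1/2], the 3 shrinks to 5/2. For [w >= 4] and [i <= 1/32] the former times
    [1 - i] is at least about 2.502: the Hermite gain is what closes the argument. *)
Lemma sharp_gap_le w wg B F m : 0 <= B -> 4 <= w -> w ^+ 2 + wg ^+ 2 <= m ->
  m <= (wg ^+ 2 + B ^+ 2) * (1 - 1 / (2 * m)) + 3 -> F <= w + 163 / 1000 ->
  F - B <= 1 / 2.
Proof.
move=> B0 w4 wm mB Fw; rewrite leNgt; apply/negP => lt1.
have w16 : 16 <= w ^+ 2 by nra.
have m16 : 16 <= m by have := sqr_ge0 wg; lra.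
pose i := 1 / (2 * m).
have im : i * m = 1 / 2 by rewrite /i; field; rewrite gt_eqF//; lra.
have i0 : 0 <= i by rewrite divr_ge0// mulr_ge0//; lra.
have i1 : i <= 1 / 32 by nra.
have Bw : B ^+ 2 <= (w - 337 / 1000) ^+ 2 by rewrite ler_sqr ?nnegrE; lra.
have h1 : wg ^+ 2 * (1 - i) <= (m - w ^+ 2) * (1 - i) by rewrite ler_wpM2r; lra.
have h2 : B ^+ 2 * (1 - i) <= (w - 337 / 1000) ^+ 2 * (1 - i) by rewrite ler_wpM2r; lra.
have h3 : (337 / 500 * w - (337 / 1000) ^+ 2) * (31 / 32) <=
    (337 / 500 * w - (337 / 1000) ^+ 2) * (1 - i) by apply: ler_wpM2l; lra.
move: mB; rewrite -/i mulrDl; move: h1 h2 h3 im w4; move: (wg ^+ 2 * _) (B ^+ 2 * _) => p q.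
lra.
Qed.

(** The slack [e] is for a parameter [t] that is only nearly optimal. The hypotheses give
    [w <= B + e / 2] and [B <= m], so the error [B e] in the square is at most 1/2, within the 1
    that is allowed. *)
Lemma penalty_gap w wg B F m e : 0 <= w -> 0 <= B -> 1 <= m -> e = 1 / (2 * (m + 1)) ->
  w <= F -> 2 * F + m - 2 * B <= m + e -> wg ^+ 2 + B ^+ 2 <= m -> w ^+ 2 + wg ^+ 2 <= m + 1.
Proof.
move=> w0 B0 m1 ee wF Fe wB.
have em : e * (m + 1) = 1 / 2 by rewrite ee; field; rewrite gt_eqF//; lra.
have e0 : 0 <= e by rewrite ee divr_ge0// mulr_ge0//; lra.
have e1 : e <= 1 / 4 by nra.
have Bm : B <= m.
  rewrite -ler_sqr ?nnegrE//; last by lra.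
  by have := sqr_ge0 wg; nra.
have wBe : w ^+ 2 <= (B + e / 2) ^+ 2 by rewrite ler_sqr ?nnegrE; lra.
have : B * e <= 1 / 2 by nra.
nra.
Qed.

End final_bounds.

(** * The thresholds of the statement in terms of real means *)

Section thresholds_values.
Context {R : realType} {n m : nat}.
Variables (f : 'rV[R]_n -> \bar R) (g : 'rV[R]_m -> \bar R).
Variables (x : 'rV[R]_n) (v : 'rV[R]_m) (alpha beta : R).
Hypotheses (f_proper : proper_fun f) (f_convex : convex_efun f).
Hypotheses (g_proper : proper_fun g) (g_convex : convex_efun g).
Hypotheses (Tf_closed : closed (tangent_cone f x)) (Tg_closed : closed (tangent_cone g v)).
Hypothesis (df_neq0 : subdiff f x !=set0).
Hypotheses (df_origin : ~ subdiff f x 0) (dg_origin : ~ subdiff g v 0).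
Variables (ua ub : 'rV[R]_m).
Hypotheses (Dua : subdiff g v ua) (Dub : subdiff g v ub).
Hypotheses (uaE : l2norm ua = alpha) (ubE : l2norm ub = beta).
Hypothesis (Dab : forall u, subdiff g v u -> alpha <= l2norm u <= beta).

Local Notation Df := (subdiff f x).
Local Notation Dg := (subdiff g v).
Let cDf : closed Df := @subdiff_closed R n f x.
Let vDf : cvx Df := @subdiff_cvx R n f x.
Let cDg : closed Dg := @subdiff_closed R m g v.
Let vDg : cvx Dg := @subdiff_cvx R m g v.
Let Dg0 : Dg !=set0. Proof. by exists ua. Qed.

Local Notation w := (Ex (polar_sup Df)).
Local Notation wg := (Ex (polar_sup Dg)).
Local Notation F c := (Ex (sdist Df c)).
Local Notation B t := (Ex (slice_sup Dg t)).
Local Notation pen lambda := (Cp_pen f g x v alpha beta lambda).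

Lemma dim_gt0 : (0 < m)%N.
Proof.
have a0 := alpha_gt0 dg_origin Dua uaE; rewrite lt0n; apply/eqP => m0.
move: a0; rewrite -uaE; suff -> : l2norm ua = 0 by rewrite ltxx.
by rewrite /l2norm /dotv big1 ?sqrtr0// => i; move: (ltn_ord i); rewrite {2}m0.
Qed.

Let m1 : 1 <= m%:R :> R. Proof. by rewrite ler1n dim_gt0. Qed.

Lemma tangent_width d (h : 'rV[R]_d -> \bar R) (y : 'rV[R]_d) :
  proper_fun h -> convex_efun h -> closed (tangent_cone h y) -> subdiff h y !=set0 ->
  ~ subdiff h y 0 ->
  gaussian_width (tangent_cone h y `&` l2sphere) = (Ex (polar_sup (subdiff h y)))%:E.
Proof.
move=> hp hc hcl h0 ho; rewrite (tangent_coneE hp hc h0 hcl ho).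
apply: gaussian_width_sup; first exact: polar_sphere_compact.
  exact: polar_sphere_neq0 (@subdiff_closed _ _ h y) (@subdiff_cvx _ _ h y) h0 ho.
by move=> z [].
Qed.

Lemma CpE : Cp f g x v = (w ^+ 2 + wg ^+ 2)%:E.
Proof. by rewrite /Cp !tangent_width// -!EFin_expe -EFinD. Qed.

(** The 1 coming from the unit norm of the points of the slice cancels the [- 1] of the
    objective. *)
Lemma Cp_objectiveE lambda t : 0 < lambda -> alpha <= t <= beta ->
  Cp_objective f g x v lambda t =
  (2 * F (Num.sqrt m%:R / (lambda * t)) + m%:R - 2 * B t)%:E.
Proof.
move=> l0 tab; have t0 : 0 < t by case/andP: tab => /(lt_le_trans (alpha_gt0 dg_origin Dua uaE)).
have c0 : 0 < Num.sqrt m%:R / (lambda * t).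
  by rewrite divr_gt0 ?mulr_gt0// sqrtr_gt0 ltr0n dim_gt0.
rewrite /Cp_objective (gaussian_dist_scale_set cDf vDf df_neq0 c0) (scale_set_sphere Dg t0).
rewrite gaussian_sqdist_sup; last first.
- by move=> y [].
- exact: slice_neq0 vDg dg_origin Dua Dub uaE ubE _ tab.
- exact: slice_compact cDg _.
rewrite -[RHS]/(_%:E); congr (_%:E); rewrite /slice_sup.
by move: (sup_dot _) => W; ring.
Qed.

Lemma pen_le c t : 0 < c -> alpha <= t <= beta -> exists2 lambda, 0 < lambda &
  (pen lambda <= (2 * F c + m%:R - 2 * B t)%:E)%E.
Proof.
move=> c0 tab; have t0 : 0 < t by case/andP: tab => /(lt_le_trans (alpha_gt0 dg_origin Dua uaE)).
have s0 : 0 < Num.sqrt m%:R :> R by rewrite sqrtr_gt0 ltr0n dim_gt0.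
have l0 : 0 < Num.sqrt m%:R / (c * t) by rewrite divr_gt0// mulr_gt0.
exists (Num.sqrt m%:R / (c * t)) => //.
have cE : Num.sqrt m%:R / (Num.sqrt m%:R / (c * t) * t) = c by field; rewrite !gt_eqF.
have := Cp_objectiveE l0 tab; rewrite cE => <-.
by apply: ereal_inf_lbound; exists t => //=; rewrite in_itv.
Qed.

Lemma le_pen lambda (r : R) : 0 < lambda ->
  (forall c t, 0 < c -> alpha <= t <= beta -> r <= 2 * F c + m%:R - 2 * B t) ->
  (r%:E <= pen lambda)%E.
Proof.
move=> l0 h; apply: le_ereal_inf_tmp => _ [t /= tab <-].
rewrite in_itv/= in tab.
have t0 : 0 < t by case/andP: tab => /(lt_le_trans (alpha_gt0 dg_origin Dua uaE)).
rewrite (Cp_objectiveE l0 tab) lee_fin; apply: h => //.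
by rewrite divr_gt0 ?mulr_gt0// sqrtr_gt0 ltr0n dim_gt0.
Qed.

Lemma penalty_bound lambda : 0 < lambda -> (pen lambda <= m%:R%:E)%E ->
  (Cp f g x v - 1 <= m%:R%:E)%E.
Proof.
move=> l0 pm; rewrite CpE -EFinB lee_fin lerBlDr.
have [w0 _] := polar_sup_variance cDg vDg dg_origin Dua dim_gt0.
(* The penalty is an infimum over [t], so the hypothesis provides only values up to a slack; this
   one is small against [1 / m]. *)
pose e : R := 1 / (2 * (m%:R + 1)).
have e0 : 0 < e by rewrite divr_gt0// mulr_gt0// ltr_wpDl.
have [c [t [c0 tab ct]]] : exists c t, [/\ 0 < c, alpha <= t <= beta &
    2 * F c + m%:R - 2 * B t <= m%:R + e].
  apply: contrapT => no.
  have : ((m%:R + e)%:E <= pen lambda)%E.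
    apply: le_pen => // c t c0 tab; rewrite leNgt; apply/negP => h; apply: no.
    by exists c, t; split => //; exact: ltW.
  by move=> /le_trans/(_ pm); rewrite lee_fin gerDl leNgt e0.
have [B0 _] := slice_sup_variance cDg vDg dg_origin Dua Dub uaE ubE dim_gt0 tab.
apply: (@penalty_gap R _ _ (B t) (F c) _ e) => //.
- have [y [py y1] _] := (polar_supP cDf vDf df_neq0 df_origin 0).1.
  rewrite -(Ex_dotv y); apply: le_Ex; [exact: groW (gro_dotv y)| |].
    exact: groW (lip_gro (polar_sup_lip cDf vDf df_neq0 df_origin)).
  by move=> z; exact: (polar_supP cDf vDf df_neq0 df_origin z).2.
- exact: mean_polar_sup_le_sdist cDf vDf df_neq0 df_origin _ c0.
- exact: polar_slice_sqr_le cDg vDg dg_origin Dua Dub uaE ubE Dab dim_gt0 _ tab.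
Qed.

Lemma penalty_choice : (Cp f g x v <= m%:R%:E)%E ->
  (exists2 lambda, 0 < lambda & (pen lambda <= (m%:R + 5)%:E)%E) /\
  (4 <= w -> exists2 lambda, 0 < lambda & (pen lambda <= (m%:R + 1)%:E)%E).
Proof.
rewrite CpE lee_fin => wm.
have [t tab [B0 mB]] := slice_lower_bound cDg vDg dg_origin Dua Dub uaE ubE Dab dim_gt0.
split.
  have [c c0 Fc] := mean_sdist_le cDf vDf df_neq0 df_origin (@ltr01 R).
  have [l l0 hl] := pen_le c0 tab; exists l => //; apply: (le_trans hl).
  rewrite lee_fin; have := gap_le B0 wm m1 mB Fc; move: (F c) (B t) => *; lra.
move=> w4; have [c c0 Fc] := mean_sdist_sharp cDf vDf df_neq0 df_origin w4.
have [l l0 hl] := pen_le c0 tab; exists l => //; apply: (le_trans hl).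
rewrite lee_fin; have := sharp_gap_le B0 w4 wm mB Fc; move: (F c) (B t) => *; lra.
Qed.

(** A minimizer [c] of the mean distance over all scales and a maximizer [t] of the mean slice
    supremum are realized by one [lambda], whose penalty is then below every value of the
    objective. *)
Lemma penalty_argmin : compact Df -> ~ is_subset1 Df ->
  exists lambda, is_argmin [set lambda | 0 < lambda] (fun lambda => pen lambda) lambda.
Proof.
move=> cpt n1.
have [p [q [Dp Dq pq]]] : exists p q, [/\ Df p, Df q & p != q].
  apply: contrapT => no; apply: n1 => p q Dp Dq; apply/eqP/negPn/negP => pq.
  by apply: no; exists p, q.
have [b _ bm] := compact_max_attained cpt df_neq0 (@l2norm_continuous R n).
have [c c0 cm] := mean_sdist_attained cDf vDf df_origin Dp Dq pq bm.
have [t tab tm] := mean_slice_attained cDg vDg dg_origin Dua Dub uaE ubE Dab.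
have [l l0 hl] := pen_le c0 tab.
exists l; split; first exact: l0.
move=> k k0.
apply: (le_trans hl).
apply: (le_pen k0) => c' t' c'0 tab'.
have h1 := cm c' c'0.
have h2 := tm t' tab'.
apply: lerB; last by rewrite ler_pM2l.
by rewrite lerD2r ler_pM2l.
Qed.

Lemma penalty_conclusion (e : R) (E : \bar R) lambda : (E <= pen lambda)%E ->
  (pen lambda <= (m%:R + e)%:E)%E -> (E - e%:E <= m%:R%:E)%E.
Proof. by move=> h1 h2; rewrite leeBlDr// -EFinD; exact: le_trans h1 h2. Qed.

End thresholds_values.

Local Open Scope ereal_scope.

(** Attainment is separated from the bounds because it can fail: for a subdifferential of [f]
    reduced to a point [u], the mean of [|h - c u|] is even and strictly convex in [c], so its
    infimum over [c > 0] is approached only as [c] tends to 0, that is as [lambda] tends to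
    infinity. *)
Theorem theorem3 (R : realType) (n m : nat)
    (f : 'rV[R]_n -> \bar R) (g : 'rV[R]_m -> \bar R)
    (x : 'rV[R]_n) (v : 'rV[R]_m) (alpha beta : R)
    (f_proper : proper_fun f) (f_convex : convex_efun f)
    (g_proper : proper_fun g) (g_convex : convex_efun g)
    (Tf_neq0 : tangent_cone f x !=set0) (Tf_closed : closed (tangent_cone f x))
    (Tg_neq0 : tangent_cone g v !=set0) (Tg_closed : closed (tangent_cone g v))
    (df_neq0 : subdiff f x !=set0)
    (df_origin : ~ subdiff f x 0%R) (dg_origin : ~ subdiff g v 0%R)
    (alphaE : is_minimum [set l2norm b | b in subdiff g v] alpha)
    (betaE : is_maximum [set l2norm b | b in subdiff g v] beta) :
  (forall lambda : R, (0 < lambda)%R ->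
     Cp_pen f g x v alpha beta lambda <= m%:R%:E ->
     Cp f g x v - 1 <= m%:R%:E)
  /\
  (Cp f g x v <= m%:R%:E ->
   [/\ (* every minimizer satisfies the bounds *)
       forall lambda_star : R,
         is_argmin [set lambda | (0 < lambda)%R]
           (Cp_pen f g x v alpha beta) lambda_star ->
         Cp_pen f g x v alpha beta lambda_star - 5%:E <= m%:R%:E
         /\ (4%:E <= gaussian_width (tangent_cone f x `&` l2sphere) ->
             Cp_pen f g x v alpha beta lambda_star - 1 <= m%:R%:E),
       (* a minimizer exists unless the subdifferential of f is degenerate *)
       compact (subdiff f x) -> ~ is_subset1 (subdiff f x) ->
         exists lambda_star : R,
           is_argmin [set lambda | (0 < lambda)%R]
             (Cp_pen f g x v alpha beta) lambda_star
     & (* the bounds hold for the infimum, attained or not *)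
       let inf_Cp_pen :=
         ereal_inf [set Cp_pen f g x v alpha beta lambda
                   | lambda in [set lambda | (0 < lambda)%R]] in
       inf_Cp_pen - 5%:E <= m%:R%:E
       /\ (4%:E <= gaussian_width (tangent_cone f x `&` l2sphere) ->
           inf_Cp_pen - 1 <= m%:R%:E)]).
Proof.
have [[ua Dua uaE] amin] := alphaE; have [[ub Dub ubE] bmax] := betaE.
have Dab u : subdiff g v u -> (alpha <= l2norm u <= beta)%R.
  by move=> Du; apply/andP; split; [apply: amin|apply: bmax]; exists u.
split; first by move=> lambda; exact: (penalty_bound f_proper f_convex g_proper g_convex
  Tf_closed Tg_closed df_neq0 df_origin dg_origin Dua Dub uaE ubE Dab).
move=> Cpm.
have [[l5 l50 h5] h1] := penalty_choice f_proper f_convex g_proper g_convex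
  Tf_closed Tg_closed df_neq0 df_origin dg_origin Dua Dub uaE ubE Dab Cpm.
have wE := tangent_width f_proper f_convex Tf_closed df_neq0 df_origin.
split.
- move=> l [l0 lmin]; split; first exact: penalty_conclusion (lmin _ l50) h5.
  by rewrite wE lee_fin => /h1[k k0 hk]; exact: penalty_conclusion (lmin _ k0) hk.
- exact: (penalty_argmin df_neq0 df_origin dg_origin Dua Dub uaE ubE Dab).
- move=> E; have Emin l : (0 < l)%R -> (E <= Cp_pen f g x v alpha beta l)%E.
    by move=> l0; apply: ereal_inf_lbound; exists l.
  split; first exact: penalty_conclusion (Emin _ l50) h5.
  by rewrite wE lee_fin => /h1[k k0 hk]; exact: penalty_conclusion (Emin _ k0) hk.
Qed.
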